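(* Let $\Sigma$ be a super Riemann surface over a Grassmann algebra $S$. There are bijections between the following three sets: (i) the set of superprojective structures on $\Sigma$; (ii) the set of superprojective connections on $\Sigma$; (iii) the set of $SPL_2$-superopers on $\Sigma$ (up to isomorphism).
   Context: Super Riemann surface: a supercurve $\Sigma$ of dimension $1|1$ over $S$ with a rank $0|1$ subbundle $\mathcal{D}\subset T\Sigma$ such that for every local nonvanishing section $D$ of $\mathcal D$, $D^2$ is nowhere proportional to $\mathcal D$. Locally there are superconformal coordinates $(z,\theta)$ in which $\mathcal D$ is generated by $D_\theta=\partial_\theta+\theta\partial_z$, $D_\theta^2=\partial_z$. A change $(z,\theta)\mapsto(z',\theta')$ between superconformal coordinates satisfies $D_\theta z'=\theta' D_\theta\theta'$, equivalently $D_\theta=(D_\theta\theta')D_{\theta'}$. A section of $\mathcal D^n$ (''superconformal field of dimension $-n/2$'') is locally a function $\varphi$ transforming as $\varphi(z,\theta)=\varphi'(z',\theta')(D_\theta\theta')^{-n}$. $SPL_2$ is the supergroup of transformations $$z\mapsto \frac{az+b}{cz+d}+\theta\frac{\gamma z+\delta}{(cz+d)^2},\qquad \theta\mapsto\frac{\gamma z+\delta}{cz+d}+\theta\,\frac{1+\frac12\delta\gamma}{cz+d},$$ with $a,b,c,d$ even, $ad-bc=1$, and $\gamma,\delta$ odd. Its Lie superalgebra is the orthosymplectic superalgebra with defining representation of dimension $2|1$ (written $osp(2|1)$ or $osp(1|2)$). A superprojective structure on $\Sigma$ is an equivalence class of coverings of $\Sigma$ by superconformal coordinate charts whose transition functions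 are elements of $SPL_2$. Two such coverings are equivalent if their union has the same property. A superprojective connection on $\Sigma$ is a differential operator $L:\mathcal D\to\mathcal D^{-2}$, defined globally on $\Sigma$, which in every superconformal chart has the form $D_\theta^3-\omega(z,\theta)$ with $\omega$ an odd function. (So $L$ maps fields of dimension $-1/2$ to fields of dimension $1$.) Flat superholomorphic connections on a bundle over $\Sigma$ are determined locally by an odd operator $\nabla=D_\theta+A_\theta(z,\theta)$ (a ''long superderivative''). Under a change of trivialization $g$ it transforms by $A_\theta\mapsto gA_\theta g^{-1}-(D_\theta g)g^{-1}$, and under a change of superconformal coordinates $\nabla$ scales in the same way as $D_\theta$. Let $G=SPL_2$ act on $\mathbb C^{2|1}=\mathrm{span}(e_1,\xi,e_2)$ ($\xi$ odd), and let $B$ be the Borel subgroup of upper triangular matrices in this ordered basis, with Lie superalgebra $\mathfrak b$. Let $f$ be the generator of the odd negative simple root space, i.e. the matrix with entries $-1$ in position $(2,1)$, $1$ in position $(3,2)$, and $0$ elsewhere. An $SPL_2$-superoper on $\Sigma$ is a triple $(\mathcal F,\mathcal F_B,\nabla)$, where $\mathcal F$ is a principal $G$-bundle on $\Sigma$, $\mathcal F_B$ is a reduction of $\mathcal F$ to $B$, and $\nabla$ is a flat connection on $\mathcal F$ given by a long superderivative, such that in local superconformal coordinates and in any local trivialization of $\mathcal F_B$ one has $\nabla=D_\theta+a(z,\theta)f+\mu(z,\theta)$ with $a$ an even invertible function and $\mu$ an odd $\mathfrak b$-valued function. *)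

(* Defs.v *)
From HB Require Import structures.
From mathcomp Require Import all_boot all_order all_algebra.

Set Implicit Arguments.
Unset Strict Implicit.
Unset Printing Implicit Defensive.

Import Order.TTheory GRing.Theory Num.Theory.

Local Open Scope ring_scope.

(* The Grassmann algebra on n odd generators over K: f A is the coefficient of
   the product, in increasing order, of the generators with index in A. *)
Definition grass (K : comNzRingType) (n : nat) : Type := {ffun {set 'I_n} -> K^o}.

Section GrassRing.
Variables (K : comNzRingType) (n : nat).
Implicit Types (A B E F D : {set 'I_n}) (f g h : grass K n).

HB.instance Definition _ := GRing.Lmodule.on (grass K n).

Definition invs B E : nat := (\sum_(i in B) \sum_(j in E) (j < i))%N.

(* Coefficient of the monomial A in the product of the monomials B and E. *)
Definition gcoef B E A : K :=
  if [disjoint B & E] && (B :|: E == A) then (-1) ^+ invs B E else 0.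

Definition gmul f g : grass K n :=
  [ffun A => \sum_(B : {set 'I_n}) \sum_(E : {set 'I_n}) gcoef B E A * (f B * g E)].

Definition gone : grass K n := [ffun A => (A == set0)%:R].

Lemma sum_setU B E (F : 'I_n -> nat) : [disjoint B & E] ->
  (\sum_(i in B :|: E) F i = \sum_(i in B) F i + \sum_(i in E) F i)%N.
Proof.
by move=> d; rewrite -bigU //; apply: eq_bigl => i; rewrite !inE.
Qed.

Lemma invsU1 B E F : [disjoint B & E] -> invs (B :|: E) F = (invs B F + invs E F)%N.
Proof. by move=> dBE; rewrite /invs sum_setU. Qed.

Lemma invsU2 B E F : [disjoint E & F] -> invs B (E :|: F) = (invs B E + invs B F)%N.
Proof.
by move=> d; rewrite /invs -big_split /=; apply: eq_bigr => i _; rewrite sum_setU.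
Qed.

Lemma gcoef_sumL B E F A :
  \sum_D gcoef B E D * gcoef D F A =
  if [disjoint B & E] then (-1) ^+ invs B E * gcoef (B :|: E) F A else 0.
Proof.
rewrite (bigD1 (B :|: E)) //= big1 ?addr0; last first.
  by move=> D nD; rewrite /gcoef eq_sym (negbTE nD) andbF mul0r.
by rewrite {1}/gcoef eqxx andbT; case: ifP => // _; rewrite mul0r.
Qed.

Lemma gcoef_sumR B E F A :
  \sum_D gcoef E F D * gcoef B D A =
  if [disjoint E & F] then (-1) ^+ invs E F * gcoef B (E :|: F) A else 0.
Proof.
rewrite (bigD1 (E :|: F)) //= big1 ?addr0; last first.
  by move=> D nD; rewrite /gcoef eq_sym (negbTE nD) andbF mul0r.
by rewrite {1}/gcoef eqxx andbT; case: ifP => // _; rewrite mul0r.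
Qed.

Lemma gcoefA B E F A :
  \sum_D gcoef E F D * gcoef B D A = \sum_D gcoef B E D * gcoef D F A.
Proof.
rewrite gcoef_sumL gcoef_sumR /gcoef -!setI_eq0 setIUl setIUr !setU_eq0 setUA.
rewrite !setI_eq0.
case dBE: [disjoint B & E]; case dEF: [disjoint E & F]; rewrite ?andbF ?mulr0 //=.
rewrite andbT; case dBF: [disjoint B & F]; rewrite ?mulr0 //=.
case: ifP => _; rewrite ?mulr0 // -!exprD invsU1 // invsU2 //.
by congr (_ ^+ _); rewrite addnC -addnA.
Qed.

Lemma gmulA : associative gmul.
Proof.
move=> f g h; apply/ffunP => A; rewrite !ffunE.
transitivity (\sum_B \sum_E \sum_F
   (\sum_D gcoef E F D * gcoef B D A) * (f B * (g E * h F))).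
  apply: eq_bigr => B _.
  under eq_bigr => D _ do rewrite ffunE !mulr_sumr.
  rewrite exchange_big /=; apply: eq_bigr => E _.
  under eq_bigr => D _ do rewrite !mulr_sumr.
  rewrite exchange_big /=; apply: eq_bigr => F _.
  rewrite mulr_suml; apply: eq_bigr => D _.
  by rewrite [f B * _]mulrCA [LHS]mulrCA; exact: mulrA.
symmetry.
under eq_bigr => D _.
  under eq_bigr => F _ do
    (rewrite ffunE mulr_suml mulr_sumr;
     under eq_bigr => B _ do rewrite mulr_suml mulr_sumr).
  rewrite exchange_big /=; under eq_bigr => B _ do rewrite exchange_big /=.
over.
rewrite exchange_big /=; apply: eq_bigr => B _.
rewrite exchange_big /=; apply: eq_bigr => E _.
rewrite exchange_big /=; apply: eq_bigr => F _.
rewrite gcoefA mulr_suml; apply: eq_bigr => D _.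
by rewrite -[_ * h F]mulrA [LHS]mulrCA -[f B * g E * h F]mulrA; exact: mulrA.
Qed.

Lemma gcoef0l E A : gcoef set0 E A = (E == A)%:R.
Proof.
rewrite /gcoef set0U -setI_eq0 set0I eqxx /= /invs big_set0 expr0.
by case: (E == A).
Qed.

Lemma gcoef0r E A : gcoef E set0 A = (E == A)%:R.
Proof.
rewrite /gcoef setU0 -setI_eq0 setI0 eqxx /= /invs big1; last by move=> i _; rewrite big_set0.
by case: (E == A).
Qed.

Lemma gmul1l : left_id gone gmul.
Proof.
move=> f; apply/ffunP => A; rewrite ffunE (bigD1 set0) //= [X in _ + X]big1 ?addr0.
  rewrite (bigD1 A) //= big1 ?addr0 => [|E nE]; rewrite gcoef0l.
    by rewrite ffunE !eqxx !mul1r.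
  by rewrite (negbTE nE) mul0r.
by move=> B nB; apply: big1 => E _; rewrite ffunE (negbTE nB) mul0r mulr0.
Qed.

Lemma gmul1r : right_id gone gmul.
Proof.
move=> f; apply/ffunP => A; rewrite ffunE (bigD1 A) //= [X in _ + X]big1 ?addr0.
  rewrite (bigD1 set0) //= big1 ?addr0 => [|E nE]; rewrite ?gcoef0r ffunE.
    by rewrite !eqxx mul1r mulr1.
  by rewrite (negbTE nE) !mulr0.
move=> B nB; apply: big1 => E _; rewrite ffunE.
by have [->|_] := eqVneq E set0; rewrite ?gcoef0r ?(negbTE nB) ?mul0r ?mulr0.
Qed.

Lemma gmulDl : left_distributive gmul +%R.
Proof.
move=> f g h; apply/ffunP => A; rewrite !ffunE -big_split; apply: eq_bigr => B _ /=.
by rewrite -big_split; apply: eq_bigr => E _ /=; rewrite ffunE mulrDl mulrDr.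
Qed.

Lemma gmulDr : right_distributive gmul +%R.
Proof.
move=> f g h; apply/ffunP => A; rewrite !ffunE -big_split; apply: eq_bigr => B _ /=.
by rewrite -big_split; apply: eq_bigr => E _ /=; rewrite ffunE !mulrDr.
Qed.

Lemma gone_neq0 : gone != 0.
Proof. by apply/eqP => /ffunP/(_ set0)/eqP; rewrite !ffunE eqxx oner_eq0. Qed.

HB.instance Definition _ := GRing.Zmodule_isNzRing.Build (grass K n)
  gmulA gmul1l gmul1r gmulDl gmulDr gone_neq0.

Lemma gscalerAl (a : K) (f g : grass K n) : a *: (f * g) = (a *: f) * g.
Proof.
apply/ffunP => A; rewrite !ffunE scaler_sumr; apply: eq_bigr => B _.
rewrite scaler_sumr; apply: eq_bigr => E _; rewrite ffunE.
by rewrite -[RHS]/(gcoef B E A * (a * f B * g E)) -[LHS]/(a * _) [LHS]mulrCA; congr (_ * _); exact: mulrA.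
Qed.

Lemma gscalerAr (a : K) (f g : grass K n) : a *: (f * g) = f * (a *: g).
Proof.
apply/ffunP => A; rewrite !ffunE scaler_sumr; apply: eq_bigr => B _.
rewrite scaler_sumr; apply: eq_bigr => E _; rewrite ffunE.
by rewrite -[RHS]/(gcoef B E A * (f B * (a * g E))) -[LHS]/(a * _) [LHS]mulrCA; congr (_ * _); exact: mulrCA.
Qed.

HB.instance Definition _ :=
  GRing.Lmodule_isLalgebra.Build K (grass K n) gscalerAl.
HB.instance Definition _ :=
  GRing.Lalgebra_isAlgebra.Build K (grass K n) gscalerAr.

End GrassRing.

From mathcomp Require Import all_classical all_reals all_analysis.
From mathcomp Require Import complex.
Import numFieldNormedType.Exports.

Local Open Scope classical_set_scope.

Section GrassUnitRing.
Variables (K : comNzRingType) (n : nat).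

Definition ginvertible : pred (grass K n) :=
  fun x => `[< exists y : grass K n, y * x = 1 /\ x * y = 1 >].

Definition ginv (x : grass K n) : grass K n :=
  match pselect (exists y : grass K n, y * x = 1 /\ x * y = 1) with
  | left ex => projT1 (cid ex)
  | right _ => x
  end.

Lemma ginvP x : ginvertible x -> ginv x * x = 1 /\ x * ginv x = 1.
Proof.
move=> /asboolP ex; rewrite /ginv; case: pselect => // ex'.
by case: (cid ex').
Qed.

Fact gmulVr : {in ginvertible, left_inverse 1 ginv *%R}.
Proof. by move=> x /ginvP[]. Qed.

Fact gmulrV : {in ginvertible, right_inverse 1 ginv *%R}.
Proof. by move=> x /ginvP[]. Qed.

Fact gunitP (x y : grass K n) : y * x = 1 /\ x * y = 1 -> ginvertible x.
Proof. by move=> xy; apply/asboolP; exists y. Qed.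

Fact ginv_out : {in [predC ginvertible], ginv =1 id}.
Proof. by move=> x /asboolPn nx; rewrite /ginv; case: pselect. Qed.

HB.instance Definition _ := GRing.NzRing_hasMulInverse.Build (grass K n)
  gmulVr gmulrV gunitP ginv_out.

End GrassUnitRing.

Section Parity.
Variables (K : comNzRingType) (n : nat).

Definition gbody (x : grass K n) : K := x finset.set0.

Definition ghom (b : bool) (x : grass K n) : Prop :=
  forall A : {set 'I_n}, x A != 0 -> odd #|A| = b.

Definition ggen (i : 'I_n) : grass K n := [ffun A => (A == [set i]%SET)%:R].

End Parity.

Notation geven := (ghom false).
Notation godd := (ghom true).

(* R[i], repackaged so that the normed topology of an abstract
   numClosedFieldType applies to it. *)
Definition Cx (R : realType) : numClosedFieldType := R[i].

(* The base is S = grass (Cx R) N.  Values of superfunctions of (z, theta) lie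
   in S[theta] = grass (Cx R) N.+1, where theta is the generator of index 0 and
   the i-th generator of S has index lift ord0 i. *)
Notation gS R N := (grass (Cx R) N).
Notation gL R N := (grass (Cx R) N.+1).

Section Superfunctions.
Variables (R : realType) (N : nat).
Local Notation C := (Cx R).
Local Notation L := (gL R N).

Definition glift (s : gS R N) : L :=
  [ffun A : {set 'I_N.+1} => if ord0 \in A then 0
     else s [set i | lift ord0 i \in A]%SET].

Definition gtheta : L := ggen _ ord0.

(* x = gcoef0 x + theta * gcoef1 x with gcoef0 x, gcoef1 x in S. *)
Definition gcoef0 (x : L) : L := [ffun A : {set 'I_N.+1} => if ord0 \in A then 0 else x A].
Definition gcoef1 (x : L) : L :=
  [ffun A : {set 'I_N.+1} => if ord0 \in A then 0 else x (ord0 |: A)%SET].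

(* Holomorphic functions are the functions locally given by power series. *)
Definition holo_at (f : C -> C) (p : C) : Prop :=
  exists a : nat -> C,
    \forall q \near p, series (fun k => a k * (q - p) ^+ k) @ \oo --> f q.

(* f : C -> L stands for f(z, theta) = f_0(z) + theta f_1(z); only its values
   on a given open set of C matter. *)
Definition sholo (V : set C) (f : C -> L) : Prop :=
  forall p A, V p -> holo_at (fun q => f q A) p.

Definition dzn (k : nat) (f : C -> L) : C -> L :=
  fun p => [ffun A : {set 'I_N.+1} => derive1n k (fun q => f q A : C^o) p].

Definition dz : (C -> L) -> C -> L := dzn 1.
Definition dth (f : C -> L) : C -> L := fun p => gcoef1 (f p).

Definition Dth (f : C -> L) : C -> L := fun p => dth f p + gtheta * dz f p.

(* A map between domains of C^{1|1}, given by the pullbacks of z and theta. *)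
Record smap := SMap { smz : C -> L; smth : C -> L }.

Definition smap_ok (V : set C) (T : smap) : Prop :=
  sholo V (smz T) /\ sholo V (smth T) /\
  forall p, V p -> geven (smz T p) /\ godd (smth T p).

Definition smap_id : smap := SMap (fun p => p%:A) (fun=> gtheta).

(* Pullback f(z', theta') = f_0(z') + theta' f_1(z') by T = (z', theta'): Taylor
   expansion of f_0, f_1 around the body of z'; the powers of the nilpotent part
   of z' of exponent > N + 1 vanish. *)
Definition spull (T : smap) (f : C -> L) : C -> L := fun p =>
  let z0 := gbody (smz T p) in
  \sum_(k < N.+2) (k`!%:R : C)^-1 *:
     ((smz T p - z0%:A) ^+ k *
      (gcoef0 (dzn k f z0) + smth T p * gcoef1 (dzn k f z0))).

Definition scomp (T' T : smap) : smap :=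
  SMap (spull T (smz T')) (spull T (smth T')).

Definition smap_eq_at (p : C) (T T' : smap) : Prop :=
  smz T p = smz T' p /\ smth T p = smth T' p.

(* The vector field vfth d/dtheta + vfz d/dz. *)
Record svf := SVF { vfth : C -> L; vfz : C -> L }.

Definition vfapp (E : svf) (f : C -> L) : C -> L :=
  fun p => vfth E p * dth f p + vfz E p * dz f p.

Definition vfscale (h : C -> L) (E : svf) : svf :=
  SVF (fun p => h p * vfth E p) (fun p => h p * vfz E p).

Definition vf_odd (V : set C) (E : svf) : Prop :=
  sholo V (vfth E) /\ sholo V (vfz E) /\
  forall p, V p -> geven (vfth E p) /\ godd (vfz E p).

(* The square of an odd vector field E is the even vector field with
   components E(vfth E), E(vfz E). *)
Definition vfsq (E : svf) : svf := SVF (vfapp E (vfth E)) (vfapp E (vfz E)).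

Definition vf_nonzero_at (p : C) (E : svf) : Prop :=
  gbody (vfth E p) != 0 \/ gbody (vfz E p) != 0.

Definition vf_prop_at (p : C) (E' E : svf) : Prop :=
  exists c : C, gbody (vfth E' p) = c * gbody (vfth E p) /\
                gbody (vfz E' p) = c * gbody (vfz E p).

Definition seven_unit (V : set C) (h : C -> L) : Prop :=
  sholo V h /\ forall p, V p -> geven (h p) /\ h p \is a GRing.unit.

(* On V, the isomorphism T carries the line spanned by E to that spanned by E':
   E = h T^*E', tested on the target coordinates z', theta'. *)
Definition vf_same_line (V : set C) (T : smap) (E E' : svf) : Prop :=
  exists h : C -> L, seven_unit V h /\
    forall p, V p -> vfapp E (smz T) p = h p * spull T (vfz E') p /\
                     vfapp E (smth T) p = h p * spull T (vfth E') p.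

Definition vfD : svf := SVF (fun=> 1) (fun=> gtheta).

End Superfunctions.

(* Homeomorphism of the open set U onto an open subset of C. *)
Definition chart_homeo (R : realType) (X : topologicalType)
    (U : set X) (f : X -> Cx R) : Prop :=
  [/\ open U, set_inj U f, (forall x, U x -> {for x, continuous f})
    & forall O : set X, open O -> O `<=` U -> open (f @` O)].

(* A complex supermanifold of dimension 1|1 over S, by gluing: sc_tr i j is the
   expression of the j-th coordinates (z_j, theta_j) in the i-th ones. *)
Record supercurve (R : realType) (N : nat) := Supercurve {
  sc_space : topologicalType;
  sc_idx : Type;
  sc_dom : sc_idx -> set sc_space;
  sc_crd : sc_idx -> sc_space -> Cx R;
  sc_tr : sc_idx -> sc_idx -> smap R N;
  sc_hausdorff : hausdorff_space sc_space;
  sc_countable : @second_countable sc_space;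
  sc_cover : forall x, exists i, sc_dom i x;
  sc_homeo : forall i, chart_homeo (sc_dom i) (sc_crd i);
  sc_tr_ok : forall i j,
    smap_ok (sc_crd i @` (sc_dom i `&` sc_dom j)) (sc_tr i j);
  sc_tr_body : forall i j x, sc_dom i x -> sc_dom j x ->
    gbody (smz (sc_tr i j) (sc_crd i x)) = sc_crd j x;
  sc_tr_id : forall i x, sc_dom i x ->
    smap_eq_at (sc_crd i x) (sc_tr i i) (smap_id R N);
  sc_tr_comp : forall i j k x, sc_dom i x -> sc_dom j x -> sc_dom k x ->
    smap_eq_at (sc_crd i x) (scomp (sc_tr j k) (sc_tr i j)) (sc_tr i k)
}.

(* The subbundle D is given by local generators srs_gen i; the atlas may be
   refined so that D has a generator on each of its charts. *)
Record srs (R : realType) (N : nat) := Srs {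
  srs_curve :> supercurve R N;
  srs_gen : sc_idx srs_curve -> svf R N;
  srs_gen_odd : forall i,
    vf_odd (sc_crd i @` sc_dom (s := srs_curve) i) (srs_gen i);
  srs_gen_nonzero : forall i x, sc_dom i x ->
    vf_nonzero_at (sc_crd i x) (srs_gen i);
  srs_gen_glue : forall i j,
    vf_same_line (sc_crd i @` (sc_dom i `&` sc_dom j)) (sc_tr i j)
      (srs_gen i) (srs_gen j);
  srs_nonint : forall i (V : set (Cx R)) (h : Cx R -> gL R N),
    open V -> V `<=` sc_crd i @` sc_dom (s := srs_curve) i ->
    sholo V h -> (forall p, V p -> geven (h p)) ->
    (forall p, V p -> vf_nonzero_at p (vfscale h (srs_gen i))) ->
    forall p, V p ->
      ~ vf_prop_at p (vfsq (vfscale h (srs_gen i))) (vfscale h (srs_gen i))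
}.

Section SuperRiemannSurface.
Variables (R : realType) (N : nat) (Sg : srs R N).
Local Notation C := (Cx R).
Local Notation L := (gL R N).
Local Notation X := (sc_space Sg).
Local Notation idx := (sc_idx Sg).

(* Superconformal coordinates (z, theta) on the open set ch_dom: ch_to i
   expresses them in the i-th coordinates of the atlas, ch_from i is the inverse
   change of coordinates, ch_bd is the body of z. *)
Record schart := SChart {
  ch_dom : set X;
  ch_bd : X -> C;
  ch_to : idx -> smap R N;
  ch_from : idx -> smap R N;
  ch_homeo : chart_homeo ch_dom ch_bd;
  ch_to_ok : forall i, smap_ok (sc_crd i @` (sc_dom i `&` ch_dom)) (ch_to i);
  ch_from_ok : forall i, smap_ok (ch_bd @` (sc_dom i `&` ch_dom)) (ch_from i);
  ch_to_body : forall i x, sc_dom i x -> ch_dom x ->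
    gbody (smz (ch_to i) (sc_crd i x)) = ch_bd x;
  ch_from_body : forall i x, sc_dom i x -> ch_dom x ->
    gbody (smz (ch_from i) (ch_bd x)) = sc_crd i x;
  ch_to_glue : forall i j x, sc_dom i x -> sc_dom j x -> ch_dom x ->
    smap_eq_at (sc_crd i x) (scomp (ch_to j) (sc_tr i j)) (ch_to i);
  ch_toK : forall i x, sc_dom i x -> ch_dom x ->
    smap_eq_at (sc_crd i x) (scomp (ch_from i) (ch_to i)) (smap_id R N);
  ch_fromK : forall i x, sc_dom i x -> ch_dom x ->
    smap_eq_at (ch_bd x) (scomp (ch_to i) (ch_from i)) (smap_id R N);
  ch_superconformal : forall i,
    vf_same_line (sc_crd i @` (sc_dom i `&` ch_dom)) (ch_to i)
      (srs_gen i) (vfD R N)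
}.

(* The change of coordinates (z, theta) |-> (z', theta') from c to c', on the
   part of the overlap covered by the i-th chart of the atlas; on the overlap of
   two such parts the expressions agree. *)
Definition ch_tr (c c' : schart) (i : idx) : smap R N :=
  scomp (ch_to c' i) (ch_from c i).

(* A field on an open subset of Sigma is a family, indexed by the superconformal
   charts, of functions of the coordinates of the chart. *)
Definition sfield := schart -> C -> L.

(* Sections of D^n on W: phi(z, theta) = phi'(z', theta') (D_theta theta')^(-n). *)
Definition Dsection (n : int) (W : set X) (phi : sfield) : Prop :=
  (forall c, sholo (ch_bd c @` (W `&` ch_dom c)) (phi c)) /\
  (forall c c' i x, W x -> ch_dom c x -> ch_dom c' x -> sc_dom i x ->
     phi c (ch_bd c x) = spull (ch_tr c c' i) (phi c') (ch_bd c x)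
        * Dth (smth (ch_tr c c' i)) (ch_bd c x) ^ (- n)).

Definition sfield_eq (W : set X) (phi psi : sfield) : Prop :=
  forall c x, W x -> ch_dom c x -> phi c (ch_bd c x) = psi c (ch_bd c x).

(* The set of classes of an equivalence relation r. *)
Definition classes (T : Type) (r : T -> T -> Prop) : Type :=
  {P : T -> Prop | exists t, P = r t}.

(* An S-point of SPL_2. *)
Record spl := Spl {
  spa : gS R N; spb : gS R N; spc : gS R N; spd : gS R N;
  spgam : gS R N; spdel : gS R N;
  spl_even : [/\ geven spa, geven spb, geven spc & geven spd];
  spl_odd : godd spgam /\ godd spdel;
  spl_det : spa * spd - spb * spc = 1
}.

Definition spl_den (g : spl) : C -> L :=
  fun p => glift (spc g) * p%:A + glift (spd g).

Definition spl_smap (g : spl) : smap R N :=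
  let num p := glift (spa g) * p%:A + glift (spb g) in
  let onum p := glift (spgam g) * p%:A + glift (spdel g) in
  SMap (fun p => num p / spl_den g p
                 + gtheta R N * (onum p / spl_den g p ^+ 2))
       (fun p => onum p / spl_den g p
                 + gtheta R N * ((1 + glift (2^-1 *: (spdel g * spgam g)))
                                 / spl_den g p)).

(* The change of coordinates from c to c' belongs to SPL_2 on a neighbourhood of
   every point of the overlap, i.e. on each of its connected components. *)
Definition spl_related (c c' : schart) : Prop :=
  forall x, ch_dom c x -> ch_dom c' x -> exists g : spl,
    \forall y \near x, ch_dom c y -> ch_dom c' y ->
      spl_den g (ch_bd c y) \is a GRing.unit /\
      forall i, sc_dom i y ->
        smap_eq_at (ch_bd c y) (ch_tr c c' i) (spl_smap g).

Definition spl_covering (A : set schart) : Prop :=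
  (forall x, exists2 c, A c & ch_dom c x) /\
  (forall c c', A c -> A c' -> spl_related c c').

Record spatlas := SPAtlas {
  spa_charts : set schart;
  spa_ok : spl_covering spa_charts
}.

Definition spatlas_equiv (A A' : spatlas) : Prop :=
  spl_covering (spa_charts A `|` spa_charts A').

Definition superprojective_structure : Type := classes spatlas_equiv.

Record spconn := SPConn {
  spc_op : set X -> sfield -> sfield;
  spc_section : forall W phi, open W ->
    Dsection 1 W phi -> Dsection (- 2) W (spc_op W phi);
  spc_form : forall c, exists om : C -> L,
    [/\ sholo (ch_bd c @` ch_dom c) om,
        forall x, ch_dom c x -> godd (om (ch_bd c x))
      & forall W phi, open W -> Dsection 1 W phi ->
          forall x, W x -> ch_dom c x ->
          spc_op W phi c (ch_bd c x) =
            Dth (Dth (Dth (phi c))) (ch_bd c x)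
            - om (ch_bd c x) * phi c (ch_bd c x)]
}.

Definition spconn_equiv (P Q : spconn) : Prop :=
  forall W phi, open W -> Dsection 1 W phi ->
    sfield_eq W (spc_op P W phi) (spc_op Q W phi).

Definition superprojective_connection : Type := classes spconn_equiv.

Definition mx3 (s : seq (seq L)) : 'M[L]_3 :=
  \matrix_(i < 3, j < 3) nth 0 (nth [::] s i) j.

(* Matrices act on C^{2|1} = span(e_1, xi, e_2) by multiplication of the column of
   right coordinates, v = e_1 x_1 + xi zeta + e_2 x_2.  spl_mx is the matrix
   inducing on z = x_1 / x_2, theta = zeta / x_2 the transformation of SPL_2 with
   parameters a, b, c, d, gam, del, normalized to preserve the orthosymplectic
   form x_1 y_2 - x_2 y_1 - zeta eta. *)
Definition spl_mx (a b c d gam del : L) : 'M[L]_3 :=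
  let l := 1 - 2^-1 *: (del * gam) in
  mx3 [:: [:: l * a; gam * b - del * a;  l * b];
          [:: gam;   1 + del * gam;      del  ];
          [:: l * c; gam * d - del * c;  l * d]].

Definition in_G (g : 'M[L]_3) : Prop :=
  exists a b c d gam del : L,
    [/\ [/\ geven a, geven b, geven c & geven d], godd gam /\ godd del,
        a * d - b * c = 1 & g = spl_mx a b c d gam del].

Definition in_B (g : 'M[L]_3) : Prop :=
  in_G g /\ forall i j : 'I_3, (j < i)%N -> g i j = 0.

Definition f_mx : 'M[L]_3 :=
  mx3 [:: [:: 0; 0; 0]; [:: -1; 0; 0]; [:: 0; 1; 0]].

(* The Lie superalgebra b of B is spanned by H = diag(1, 0, -1), e_13 (even) and
   e_12 + e_23 (odd); this is an odd element of its extension of scalars. *)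
Definition in_b_odd (m : 'M[L]_3) : Prop :=
  exists h c d : L, [/\ godd h, geven c, godd d
    & m = mx3 [:: [:: h; c; d]; [:: 0; 0; c]; [:: 0; 0; - h]]].

Definition mfield := schart -> C -> 'M[L]_3.

Definition mDsection (n : int) (W : set X) (M : mfield) : Prop :=
  forall i j, Dsection n W (fun c p => M c p i j).

Definition on_open (W : set X) (P : schart -> C -> Prop) : Prop :=
  forall c x, W x -> ch_dom c x -> P c (ch_bd c x).

Definition Gfun (W : set X) (g : mfield) : Prop :=
  mDsection 0 W g /\ on_open W (fun c p => in_G (g c p)).

Definition Bfun (W : set X) (g : mfield) : Prop :=
  mDsection 0 W g /\ on_open W (fun c p => in_B (g c p)).

(* The odd derivation D_theta of matrix-valued functions: in right coordinates,
   D_theta moves past xi, whence the sign on the middle row.  With it,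
   D(g h) = (D g) h + g (D h) for even g. *)
Definition mDth (M : C -> 'M[L]_3) : C -> 'M[L]_3 := fun p =>
  \matrix_(i < 3, j < 3) ((-1) ^+ (i == 1%N :> nat) * Dth (fun q => M q i j) p).

(* A = g A' g^-1 - (D g) g^-1, multiplied by g on the right. *)
Definition gauge (W : set X) (g : mfield) (A A' : mfield) : Prop :=
  on_open W (fun c p => A c p *m g c p = g c p *m A' c p - mDth (g c) p).

(* F is given by G-valued transition functions, x_k = op_g k l x_l on fibre
   coordinates.  F_B is given by its local sections: op_h k is the change from
   the k-th trivialization of F to one of F_B.  The connection is
   D_theta + op_A k in the k-th trivialization of F; since it scales
   like D_theta, op_A k is a section of D^(-1).  Flatness is no extra condition:
   a flat superholomorphic connection is the same as its long superderivative. *)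
Record superoper := Superoper {
  op_idx : Type;
  op_dom : op_idx -> set X;
  op_g : op_idx -> op_idx -> mfield;
  op_h : op_idx -> mfield;
  op_A : op_idx -> mfield;
  op_open : forall k, open (op_dom k);
  op_cover : forall x, exists k, op_dom k x;
  op_gG : forall k l, Gfun (op_dom k `&` op_dom l) (op_g k l);
  op_cocycle : forall k l m,
    on_open (op_dom k `&` op_dom l `&` op_dom m)
      (fun c p => op_g k l c p *m op_g l m c p = op_g k m c p);
  op_hG : forall k, Gfun (op_dom k) (op_h k);
  op_reduction : forall k l, exists2 b : mfield,
    Bfun (op_dom k `&` op_dom l) b
    & on_open (op_dom k `&` op_dom l)
        (fun c p => op_h k c p *m op_g k l c p = b c p *m op_h l c p);
  op_Asection : forall k, mDsection (- 1) (op_dom k) (op_A k);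
  op_conn : forall k l,
    gauge (op_dom k `&` op_dom l) (op_g k l) (op_A k) (op_A l);
  (* For varying b, b *m op_h k ranges over the local trivializations of F_B *)
  op_oper : forall k (W : set X) (b : mfield),
    open W -> W `<=` op_dom k -> Bfun W b ->
    exists A : mfield,
      gauge W (fun c p => b c p *m op_h k c p) A (op_A k) /\
      on_open W (fun c p => exists (a : L) (mu : 'M[L]_3),
        [/\ geven a, a \is a GRing.unit, in_b_odd mu
          & A c p = a *: f_mx + mu])
}.

(* An isomorphism O' -> O is given in trivializations by x_k = phi k k' x'_k'. *)
Definition oper_iso (O O' : superoper) : Prop :=
  exists phi : op_idx O -> op_idx O' -> mfield,
    [/\ forall k k', Gfun (op_dom k `&` op_dom k') (phi k k'),
        forall k k' l l',
          on_open (op_dom k `&` op_dom k' `&` (op_dom l `&` op_dom l'))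
            (fun c p => op_g k l c p *m phi l l' c p =
                        phi k k' c p *m op_g k' l' c p),
        forall k k', exists2 b : mfield, Bfun (op_dom k `&` op_dom k') b
          & on_open (op_dom k `&` op_dom k')
              (fun c p => op_h k c p *m phi k k' c p = b c p *m op_h k' c p)
      & forall k k',
          gauge (op_dom k `&` op_dom k') (phi k k') (op_A k) (op_A k')].

Definition superoper_class : Type := classes oper_iso.

End SuperRiemannSurface.

(* Main.v *)
(* The proof closes a cycle of injections between the three sets of classes,
   superprojective structures -> superopers -> superprojective connections ->
   superprojective structures, and applies the Cantor-Bernstein theorem.
   A superprojective structure gives the superoper with trivial transition
   functions between its charts and connection D + f in each of them.  A superoper
   has in each superconformal chart a unique normal form D + f - omega e_13, and
   its omega's are those of a superprojective connection: they satisfy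
   omega u = J^2 T^*omega' + D^3 u, where J = D theta' and u = 1 / J.  This law is
   the transformation rule of D^3 - omega tested on the section of D which is 1 in
   one chart.  Finally, a superprojective connection is sent to the charts in which
   omega = 0: they cover Sigma because D^3 u = omega u has local solutions with
   invertible body that are D theta' of superconformal coordinates, and their
   transitions lie in SPL_2 because D^3 (1 / D theta') = 0 characterizes SPL_2.
   Each of the three maps reflects equivalence. *)

Require Import Defs.
From HB Require Import structures.
From mathcomp Require Import all_boot all_order all_algebra.
From mathcomp Require Import ring lra zify.

Set Implicit Arguments.
Unset Strict Implicit.
Unset Printing Implicit Defensive.

Import Order.TTheory GRing.Theory Num.Theory.

Local Open Scope ring_scope.

(** * Supercommutative algebra *)

(** Superfunctions are total functions of which only germs count, so nearly every identity is stated
    for all points near a given one. The pullback is a Taylor polynomial in a nilpotent increment.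
    Its multiplicativity is checked on the terms; the chain rule and the composition of pullbacks
    follow by uniqueness: two operations obeying the same rules and agreeing on constants and
    coordinates are equal, because repeated use of F = F(z0) + (z - z0) G leaves a power of the
    nilpotent increment as a factor of the difference.

    Holomorphic means given by power series. Composition, inverse functions and linear differential
    equations are therefore obtained from majorants in the norm sum |a_k| r^k, without integration;
    [holoCalc] collects what the super calculus takes from them.

    Equivalence is detected by invariants: the potential omega in every chart for connections and
    superopers, the equation D^3 u = 0 for pairs of charts. The link is the rigidity [bJ_unique]: a
    B-valued gauge transformation between two normal forms is determined by the change of
    coordinates and forces the law for omega. Hence each map reflects equivalence, and no round trip
    between two of the sets has to be computed. *)

Section Grassmann.
Variables (K : numClosedFieldType) (n : nat).
Local Notation G := (grass K n).
Implicit Types (x y z : G) (A B E : {set 'I_n}) (b c : bool) (a : K).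

Lemma gmulE x y A : (x * y) A = \sum_B \sum_E gcoef K B E A * (x B * y E).
Proof. by rewrite ffunE. Qed.
Lemma gaddE x y A : (x + y) A = x A + y A. Proof. by rewrite ffunE. Qed.
Lemma goppE x A : (- x) A = - x A. Proof. by rewrite ffunE. Qed.
Lemma gzeroE A : (0 : G) A = 0. Proof. by rewrite ffunE. Qed.
Lemma gscaleE a x A : (a *: x) A = a * x A. Proof. by rewrite ffunE. Qed.
Lemma goneE A : (1 : G) A = (A == set0)%:R. Proof. by rewrite ffunE. Qed.
Lemma gsumE I (s : seq I) (P : pred I) (F : I -> G) A :
  (\sum_(i <- s | P i) F i) A = \sum_(i <- s | P i) F i A.
Proof.
apply: (big_morph (fun x : G => x A)); first by move=> x y; rewrite gaddE.
exact: gzeroE.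
Qed.

Lemma gcoef_neq0 B E A : gcoef K B E A != 0 -> [disjoint B & E] /\ B :|: E = A.
Proof. by rewrite /gcoef; case: ifP => [/andP[d /eqP]|]; rewrite ?eqxx. Qed.

Lemma card_disjointU B E : [disjoint B & E] -> #|B :|: E| = (#|B| + #|E|)%N.
Proof. by move=> d; rewrite cardsU disjoint_setI0 // cards0 subn0. Qed.

(* The parity involution: its fixed points are the even elements, and it is -1
   on the odd ones. *)
Definition gsig x : G := [ffun A : {set 'I_n} => (-1) ^+ #|A| * x A].

Lemma gsigE x A : gsig x A = (-1) ^+ #|A| * x A. Proof. by rewrite ffunE. Qed.

Lemma gsig_is_zmod_morphism : zmod_morphism gsig.
Proof. by move=> x y; apply/ffunP => A; rewrite !(gsigE, gaddE, goppE) mulrBr. Qed.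

Lemma gsig_is_monoid_morphism : monoid_morphism gsig.
Proof.
split.
  apply/ffunP => A; rewrite gsigE goneE.
  by case: eqVneq => [->|_]; rewrite ?cards0 ?expr0 ?mul1r // mulr0.
move=> x y; apply/ffunP => A; rewrite gsigE !gmulE mulr_sumr.
apply: eq_bigr => B _; rewrite mulr_sumr; apply: eq_bigr => E _.
rewrite !gsigE; have [->|/gcoef_neq0[d <-]] := eqVneq (gcoef K B E A) 0.
  by rewrite !mul0r mulr0.
by rewrite card_disjointU // exprD [LHS]mulrCA; congr (_ * _); rewrite mulrACA.
Qed.

HB.instance Definition _ := GRing.isZmodMorphism.Build G G gsig gsig_is_zmod_morphism.
HB.instance Definition _ := GRing.isMonoidMorphism.Build G G gsig gsig_is_monoid_morphism.

Lemma gsigD x y : gsig (x + y) = gsig x + gsig y. Proof. exact: rmorphD. Qed.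
Lemma gsigN x : gsig (- x) = - gsig x. Proof. exact: rmorphN. Qed.
Lemma gsigM x y : gsig (x * y) = gsig x * gsig y. Proof. exact: rmorphM. Qed.
Lemma gsig0 : gsig 0 = 0. Proof. exact: rmorph0. Qed.
Lemma gsig1 : gsig 1 = 1. Proof. exact: rmorph1. Qed.
Lemma gsigX x k : gsig (x ^+ k) = gsig x ^+ k. Proof. exact: rmorphXn. Qed.

Lemma gsigK : involutive gsig.
Proof.
by move=> x; apply/ffunP => A; rewrite !gsigE mulrA -expr2 sqrr_sign mul1r.
Qed.

Lemma gsigZ a x : gsig (a *: x) = a *: gsig x.
Proof. by apply/ffunP => A; rewrite !(gsigE, gscaleE) mulrCA. Qed.

Lemma signr_odd_eq (m : nat) (k : K) b : (k != 0 -> odd m = b) -> (-1) ^+ m * k = (-1) ^+ b * k.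
Proof.
have [->|k0 /(_ isT) <-] := eqVneq k 0; first by rewrite !mulr0.
by rewrite signr_odd.
Qed.

(** Where a coefficient is non-zero, comparison with [gsig] gives [(-1) ^+ #|A| = (-1) ^+ b], and 1
    and -1 differ in characteristic 0. Parity becomes an equation to which the morphism laws of
    [gsig] apply. *)
Lemma ghomE b x : ghom b x <-> gsig x = (-1) ^+ b *: x.
Proof.
split=> [h|h A].
  by apply/ffunP => A; rewrite gsigE gscaleE; exact: signr_odd_eq (h A).
move=> xA; have := congr1 (fun z : G => z A) h.
rewrite gsigE gscaleE => /(mulIf xA); rewrite -signr_odd.
have m1 : (-1 : K) != 1 by rewrite eq_sym -subr_eq0 opprK (_ : 1 + 1 = 2%:R) ?pnatr_eq0.
case: (odd _) b {h} => -[] //=; rewrite expr0 expr1 => /eqP.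
  by rewrite (negbTE m1).
by rewrite eq_sym (negbTE m1).
Qed.

Lemma gevenE x : geven x <-> gsig x = x.
Proof. by rewrite ghomE scale1r. Qed.
Lemma goddE x : godd x <-> gsig x = - x.
Proof. by rewrite ghomE expr1 scaleN1r. Qed.

(** For disjoint sets each pair of an element of B and one of E is inverted in exactly one of the
    two orders. *)
Lemma invs_swap B E : [disjoint B & E] -> (invs B E + invs E B = #|B| * #|E|)%N.
Proof.
move=> d; rewrite /invs [X in (_ + X)%N]exchange_big -big_split /=.
rewrite -sum_nat_const; apply: eq_bigr => i iB.
rewrite -big_split -sum1_card /=; apply: eq_bigr => j jE.
have ij : i != j :> nat.
  by apply/eqP => /val_inj ij; move: (disjointFr d iB); rewrite ij jE.
by case: ltngtP ij.
Qed.

Lemma gcoefC B E A : gcoef K B E A = (-1) ^+ (#|B| * #|E|) * gcoef K E B A.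
Proof.
rewrite /gcoef disjoint_sym setUC; case: ifP => [/andP[d _]|]; last by rewrite mulr0.
rewrite disjoint_sym in d; rewrite -(invs_swap d) exprD -mulrA -expr2 sqrr_sign mulr1 //.
Qed.

Lemma ghomC b c x y : ghom b x -> ghom c y -> x * y = (-1) ^+ (b && c) *: (y * x).
Proof.
move=> hx hy; apply/ffunP => A; rewrite gscaleE !gmulE exchange_big mulr_sumr /=.
apply: eq_bigr => E _; rewrite mulr_sumr; apply: eq_bigr => B _.
rewrite gcoefC [x B * _]mulrC.
have [->|xB] := eqVneq (x B) 0; first by rewrite !mulr0.
have [->|yE] := eqVneq (y E) 0; first by rewrite !(mul0r, mulr0).
by rewrite -signr_odd oddM (hx _ xB) (hy _ yE) -mulrA.
Qed.

Definition gpart b x : G := [ffun A : {set 'I_n} => if odd #|A| == b then x A else 0].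
Lemma gpart_hom b x : ghom b (gpart b x).
Proof. by move=> A; rewrite ffunE; case: (eqVneq (odd #|A|) b) => [<-|_] //; rewrite eqxx. Qed.
Arguments gpart_hom b x : clear implicits.
Lemma gpartD x : x = gpart false x + gpart true x.
Proof.
by apply/ffunP => A; rewrite gaddE !ffunE; case: odd; rewrite /= ?addr0 ?add0r.
Qed.

Lemma geven_comm x y : geven x -> x * y = y * x.
Proof.
move=> hx; rewrite [y]gpartD mulrDl mulrDr.
by rewrite !(ghomC hx (gpart_hom _ _)) !scale1r.
Qed.

(** By splitting [x] into even and odd parts. This sign rule asks nothing of [x], so it moves
    [theta] and the odd components of vector fields past arbitrary values. *)
Lemma godd_sig x y : godd y -> x * y = y * gsig x.
Proof.
move=> hy.
have -> : gsig x = gpart false x - gpart true x.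
  have /gevenE {1}<- := gpart_hom false x; have /goddE <- := gpart_hom true x.
  by rewrite -gsigD -gpartD.
rewrite {1}[x]gpartD mulrDl mulrBr.
by rewrite !(ghomC (gpart_hom _ _) hy) scale1r expr1 scaleN1r.
Qed.

Lemma godd_anti x y : godd x -> godd y -> x * y = - (y * x).
Proof. by move=> /goddE hx /(godd_sig x) ->; rewrite hx mulrN. Qed.

Lemma godd_sq x : godd x -> x * x = 0.
Proof.
move=> hx; have := godd_anti hx hx => /eqP; rewrite -subr_eq0 opprK.
rewrite -mulr2n -scaler_nat => /eqP/(congr1 (fun z => 2%:R^-1 *: z)).
by rewrite scalerA mulVf ?pnatr_eq0 // scale1r scaler0.
Qed.

Lemma ghomD b x y : ghom b x -> ghom b y -> ghom b (x + y).
Proof. by rewrite !ghomE gsigD scalerDr => -> ->. Qed.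
Lemma ghomN b x : ghom b x -> ghom b (- x).
Proof. by rewrite !ghomE gsigN scalerN => ->. Qed.
Lemma ghomB b x y : ghom b x -> ghom b y -> ghom b (x - y).
Proof. by move=> hx /ghomN; exact: ghomD. Qed.
Lemma ghomZ b a x : ghom b x -> ghom b (a *: x).
Proof. by rewrite !ghomE gsigZ => ->; rewrite !scalerA mulrC. Qed.
Lemma ghom0 b : ghom b (0 : G).
Proof. by rewrite ghomE gsig0 scaler0. Qed.
Lemma ghom_sum b I (s : seq I) (P : pred I) (F : I -> G) :
  (forall i, ghom b (F i)) -> ghom b (\sum_(i <- s | P i) F i).
Proof. by move=> h; elim/big_rec: _ => [|i x _]; [exact: ghom0|exact: ghomD]. Qed.
Lemma ghomM b c x y : ghom b x -> ghom c y -> ghom (b (+) c) (x * y).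
Proof.
rewrite !ghomE gsigM => -> ->.
by rewrite -scalerAl -scalerAr scalerA signr_addb.
Qed.
Lemma geven1 : geven (1 : G). Proof. by rewrite gevenE gsig1. Qed.
Lemma geven_alg a : geven (a%:A : G). Proof. exact/ghomZ/geven1. Qed.
Lemma gevenM x y : geven x -> geven y -> geven (x * y). Proof. exact: ghomM. Qed.
Lemma gevenX x k : geven x -> geven (x ^+ k).
Proof. by rewrite !gevenE gsigX => ->. Qed.
Lemma godd_evenM x y : godd x -> geven y -> godd (x * y). Proof. exact: ghomM. Qed.
Lemma geven_oddM x y : geven x -> godd y -> godd (x * y). Proof. exact: ghomM. Qed.
Lemma goddM x y : godd x -> godd y -> geven (x * y). Proof. exact: ghomM. Qed.

Lemma gbodyM x y : gbody (x * y) = gbody x * gbody y.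
Proof.
rewrite /gbody gmulE (bigD1 set0) //= (bigD1 set0) //= gcoef0l eqxx mul1r.
rewrite !big1 ?addr0 // => [B nB|E nE].
  apply: big1 => E _; rewrite /gcoef setU_eq0 (negbTE nB) andbF mul0r //.
by rewrite gcoef0l (negbTE nE) mul0r.
Qed.
Lemma gbodyD x y : gbody (x + y) = gbody x + gbody y. Proof. exact: gaddE. Qed.
Lemma gbodyB x y : gbody (x - y) = gbody x - gbody y.
Proof. by rewrite /gbody gaddE goppE. Qed.
Lemma gbodyZ a x : gbody (a *: x) = a * gbody x. Proof. exact: gscaleE. Qed.
Lemma gbody1 : gbody (1 : G) = 1. Proof. by rewrite /gbody goneE eqxx. Qed.
Lemma gbodyX x k : gbody (x ^+ k) = gbody x ^+ k.
Proof. by elim: k => [|k IH]; rewrite ?gbody1 // !exprS gbodyM IH. Qed.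
Lemma gbody_alg a : gbody (a%:A : G) = a. Proof. by rewrite gbodyZ gbody1 mulr1. Qed.
Lemma gbody_sum I (s : seq I) (P : pred I) (F : I -> G) :
  gbody (\sum_(i <- s | P i) F i) = \sum_(i <- s | P i) gbody (F i).
Proof. exact: gsumE. Qed.
Lemma gbody_odd x : godd x -> gbody x = 0.
Proof.
by move=> h; apply/eqP; apply: contraT => /h; rewrite cards0.
Qed.

(* x has order at least m in the generators of index in W. *)
Definition gfilt (W : {set 'I_n}) m x := forall A, (#|A :&: W| < m)%N -> x A = 0.

Lemma gfilt0 W x : gfilt W 0 x. Proof. by []. Qed.
Lemma gfiltD W m x y : gfilt W m x -> gfilt W m y -> gfilt W m (x + y).
Proof. by move=> hx hy A Am; rewrite gaddE hx ?hy ?addr0. Qed.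
Lemma gfiltN W m x : gfilt W m x -> gfilt W m (- x).
Proof. by move=> hx A Am; rewrite goppE hx ?oppr0. Qed.
Lemma gfiltZ W m a x : gfilt W m x -> gfilt W m (a *: x).
Proof. by move=> hx A Am; rewrite gscaleE hx ?mulr0. Qed.
Lemma gfilt_sum W m I (s : seq I) (P : pred I) (F : I -> G) :
  (forall i, P i -> gfilt W m (F i)) -> gfilt W m (\sum_(i <- s | P i) F i).
Proof. by move=> h A Am; rewrite gsumE big1 // => i Pi; apply: h. Qed.
Lemma gfiltM W m m' x y : gfilt W m x -> gfilt W m' y -> gfilt W (m + m') (x * y).
Proof.
move=> hx hy A Am; rewrite gmulE; apply: big1 => B _; apply: big1 => E _.
have [->|/gcoef_neq0[d BE]] := eqVneq (gcoef K B E A) 0; first by rewrite mul0r.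
have [Bm|mB] := ltnP #|B :&: W| m; first by rewrite hx // mul0r mulr0.
have [Em|mE] := ltnP #|E :&: W| m'; first by rewrite hy // !mulr0.
move: Am; rewrite -BE setIUl card_disjointU; first by lia.
by apply: disjointWl (subsetIl _ _) _; apply: disjointWr (subsetIl _ _) d.
Qed.
Lemma gfiltX W m x k : gfilt W m x -> gfilt W (k * m) (x ^+ k).
Proof.
by move=> h; elim: k => [|k IH] //; rewrite exprS mulSn; apply: gfiltM.
Qed.
Lemma gfilt_top W x : gfilt W #|W|.+1 x -> x = 0.
Proof.
move=> h; apply/ffunP => A; rewrite gzeroE; apply: h.
by rewrite ltnS subset_leq_card // subsetIr.
Qed.
Lemma gfilt_body x : gbody x = 0 -> gfilt setT 1 x.
Proof.
by move=> h A; rewrite setIT ltnS leqn0 cards_eq0 => /eqP ->.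
Qed.

(** Vanishing body means order at least 1; orders add up in products, and no monomial in [n]
    generators has order [n.+1]. *)
Lemma gnilp x : gbody x = 0 -> x ^+ n.+1 = 0.
Proof.
move=> /gfilt_body/(@gfiltX _ _ _ n.+1); rewrite muln1 => h.
by apply: (@gfilt_top setT); rewrite cardsT card_ord.
Qed.

(** With an invertible body, [x] is its body times [1 - z] with [z] nilpotent, and the geometric
    series inverts [1 - z]. *)
Lemma gunitE x : (x \is a GRing.unit) = (gbody x != 0).
Proof.
apply/idP/idP => [xU|x0].
  apply/eqP => h; have := gbodyM x x^-1; rewrite divrr // gbody1 h mul0r => /eqP.
  by rewrite oner_eq0.
pose c := gbody x; pose z := 1 - c^-1 *: x.
have z0 : z ^+ n.+1 = 0.
  by apply: gnilp; rewrite gbodyB gbody1 gbodyZ mulVf // subrr.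
have h1 : c^-1 *: x = 1 - z by rewrite /z subKr.
pose y := \sum_(i < n.+1) z ^+ i.
have e1 : (1 - z) * y = 1.
  by rewrite -[LHS]opprK -mulNr opprB -subrX1 z0 sub0r opprK.
have e2 : y * (1 - z) = 1.
  have h : GRing.comm (1 - z) y; last by rewrite -h.
  apply: commr_sum => i _; apply: commrX.
  by apply/commr_sym/commrB; [exact: commr1|exact: commr_refl].
apply/unitrP; exists (c^-1 *: y).
have -> : x = c *: (1 - z) by rewrite -h1 scalerA divff ?scale1r.
by rewrite -!scalerAl -!scalerAr !scalerA e1 e2 mulVf ?divff // scale1r.
Qed.

(** This explicit form shows later that the inverse of a holomorphic superfunction is
    holomorphic. *)
Lemma ginv_series x : gbody x != 0 ->
  x^-1 = (gbody x)^-1 *: \sum_(i < n.+1) (1 - (gbody x)^-1 *: x) ^+ i.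
Proof.
move=> x0; set c := gbody x; set z := 1 - c^-1 *: x.
have xU : x \is a GRing.unit by rewrite gunitE.
have z0 : z ^+ n.+1 = 0.
  by apply: gnilp; rewrite gbodyB gbody1 gbodyZ mulVf // subrr.
have h1 : x = c *: (1 - z) by rewrite /z subKr scalerA divff ?scale1r.
apply: (mulrI xU); rewrite divrr // {1}h1 -scalerAl -scalerAr scalerA divff // scale1r.
by rewrite -[RHS]opprK -mulNr opprB -subrX1 z0 sub0r opprK.
Qed.

Lemma gbodyV x : gbody x != 0 -> gbody x^-1 = (gbody x)^-1.
Proof.
move=> x0; apply: (mulfI x0); rewrite -gbodyM divrr ?gunitE //.
by rewrite gbody1 divff.
Qed.

Lemma gsigV x : gsig x^-1 = (gsig x)^-1.
Proof.
have [xU|xU] := boolP (x \is a GRing.unit); first by rewrite rmorphV.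
by rewrite !invr_out // gunitE /gbody gsigE cards0 mul1r -gunitE.
Qed.

Lemma gevenV x : geven x -> geven x^-1.
Proof. by rewrite !gevenE gsigV => ->. Qed.

End Grassmann.

(** * A decision procedure for identities in supercommutative rings *)

Section SuperRing.
Variables (K : numClosedFieldType) (n : nat).
Local Notation G := (grass K n).

Inductive sexp := SVar of nat | SNat of nat | SAdd of sexp & sexp | SOpp of sexp
  | SMul of sexp & sexp | SExp of sexp & nat | SMuln of sexp & nat.

Fixpoint seval (vs : seq G) e : G := match e with
  | SVar i => nth 0 vs i
  | SNat k => k%:R
  | SAdd e1 e2 => seval vs e1 + seval vs e2
  | SOpp e1 => - seval vs e1
  | SMul e1 e2 => seval vs e1 * seval vs e2
  | SExp e1 k => seval vs e1 ^+ k
  | SMuln e1 k => seval vs e1 *+ k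
  end.

(* A monomial is a sorted list of variables; inserting i on the left of m gives
   a sign and a monomial, or None when an odd variable is repeated. *)
Fixpoint sins (ps : seq bool) i (m : seq nat) : option (bool * seq nat) :=
  if m isn't j :: m' then Some (false, [:: i]) else
  if (i < j)%N then Some (false, i :: m) else
  if i == j then (if nth false ps i then None else Some (false, i :: m)) else
  if sins ps i m' is Some (s, r)
  then Some (s (+) (nth false ps i && nth false ps j), j :: r) else None.

Definition spoly := seq (int * seq nat).

Fixpoint smono_lt (m m' : seq nat) : bool := match m, m' with
  | [::], [::] => false
  | [::], _ => true
  | _, [::] => false
  | i :: r, j :: r' => (i < j)%N || ((i == j) && smono_lt r r')
  end.

Fixpoint saddm (c : int) (m : seq nat) (p : spoly) : spoly :=
  if p isn't (c', m') :: p' then [:: (c, m)] else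
  if m == m' then (if c + c' == 0 then p' else (c + c', m) :: p') else
  if smono_lt m m' then (c, m) :: p else (c', m') :: saddm c m p'.

Definition sadd (p q : spoly) : spoly := foldr (fun cm r => saddm cm.1 cm.2 r) q p.
Definition sopp (p : spoly) : spoly := [seq (- cm.1, cm.2) | cm <- p].

Definition smulv ps i (p : spoly) : spoly :=
  foldr (fun cm r => if sins ps i cm.2 is Some (s, m)
                     then saddm (if s then - cm.1 else cm.1) m r else r) [::] p.
Definition smulm ps (c : int) (m : seq nat) (p : spoly) : spoly :=
  [seq (c * cm.1, cm.2) | cm <- foldr (smulv ps) p m].
Definition smul ps (p q : spoly) : spoly :=
  foldr (fun cm r => sadd (smulm ps cm.1 cm.2 q) r) [::] p.

Fixpoint snorm ps e : spoly := match e with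
  | SVar i => [:: (1, [:: i])]
  | SNat k => if k is 0%N then [::] else [:: (k%:Z, [::])]
  | SAdd e1 e2 => sadd (snorm ps e1) (snorm ps e2)
  | SOpp e1 => sopp (snorm ps e1)
  | SMul e1 e2 => smul ps (snorm ps e1) (snorm ps e2)
  | SExp e1 k => iter k (smul ps (snorm ps e1)) [:: (1, [::])]
  | SMuln e1 k => smul ps (if k is 0%N then [::] else [:: (k%:Z, [::])]) (snorm ps e1)
  end.

Section Correct.
Variables (ps : seq bool) (vs : seq G).
Hypothesis hps : forall i, ghom (nth false ps i) (nth 0 vs i).

Definition mval m : G := \prod_(i <- m) nth 0 vs i.
Definition pval (p : spoly) : G := \sum_(cm <- p) mval cm.2 *~ cm.1.

Lemma sins_correct i m :
  nth 0 vs i * mval m = if sins ps i m is Some (s, r) then (-1) ^+ s *: mval r else 0.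
Proof.
elim: m => [|j m IH] /=; first by rewrite scale1r /mval big_seq1 big_nil mulr1.
case: ifP => _; first by rewrite scale1r [mval (i :: _)]big_cons.
case: eqVneq => [->|ij].
  case: ifP => hj; last by rewrite scale1r [mval (j :: j :: _)]big_cons.
  have oj : godd (nth 0 vs j) by rewrite -hj; exact: hps.
  by rewrite /mval big_cons mulrA (godd_sq oj) mul0r.
rewrite {1}/mval big_cons mulrA (ghomC (@hps i) (@hps j)) -scalerAl -mulrA -/(mval m) IH.
case: (sins ps i m) => [[s r]|]; last by rewrite mulr0 scaler0.
rewrite -scalerAr scalerA [mval (j :: r)]big_cons -/(mval r).
by rewrite signr_addb mulrC.
Qed.

Lemma saddm_correct c m p : pval (saddm c m p) = mval m *~ c + pval p.
Proof.
rewrite /pval; elim: p => [|[c' m'] p IH] /=; first by rewrite big_seq1 big_nil addr0.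
case: eqVneq => [<-|_].
  case: eqVneq => [h|_]; rewrite !big_cons /= addrA -mulrzDr //.
  by rewrite h mulr0z add0r.
by case: ifP => _; rewrite !big_cons //= IH addrCA.
Qed.

Lemma sadd_correct p q : pval (sadd p q) = pval p + pval q.
Proof.
elim: p => [|[c m] p IH] /=; first by rewrite /pval big_nil add0r.
by rewrite saddm_correct IH [pval (_ :: p)]big_cons addrA.
Qed.

Lemma sopp_correct p : pval (sopp p) = - pval p.
Proof.
rewrite /pval /sopp big_map -sumrN; apply: eq_bigr => cm _ /=.
by rewrite mulrNz.
Qed.

Lemma smulv_correct i p : pval (smulv ps i p) = nth 0 vs i * pval p.
Proof.
elim: p => [|[c m] p IH] /=; first by rewrite /pval big_nil mulr0.
rewrite [pval (_ :: p)]big_cons mulrDr /= mulrzAr sins_correct -/(pval p) -IH.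
case: (sins ps i m) => [[s r]|]; last by rewrite mul0rz add0r.
rewrite saddm_correct; congr (_ + _); case: s.
  by rewrite expr1 scaleN1r mulrNz mulNrz.
by rewrite scale1r.
Qed.

Lemma smulm_correct c m p : pval (smulm ps c m p) = (mval m *~ c) * pval p.
Proof.
have e q : pval [seq (c * cm.1, cm.2) | cm <- q] = pval q *~ c.
  by rewrite /pval big_map mulrz_suml; apply: eq_bigr => cm _; rewrite -mulrzA mulrC.
rewrite /smulm e mulrzAl; congr (_ *~ _).
elim: m => [|i m IH] /=; first by rewrite /mval big_nil mul1r.
by rewrite smulv_correct IH [mval (_ :: _)]big_cons mulrA.
Qed.

Lemma smul_correct p q : pval (smul ps p q) = pval p * pval q.
Proof.
elim: p => [|[c m] p IH] /=; first by rewrite /pval big_nil mul0r.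
by rewrite sadd_correct smulm_correct IH [pval (_ :: p)]big_cons mulrDl.
Qed.

Lemma snorm_correct e : seval vs e = pval (snorm ps e).
Proof.
have v1 : pval [:: (1, [::])] = 1 by rewrite /pval big_seq1 /= /mval big_nil.
elim: e => [i|k|e1 IH1 e2 IH2|e1 IH1|e1 IH1 e2 IH2|e1 IH1 k|e1 IH1 k] /=; rewrite ?IH1 ?IH2.
- by rewrite /pval big_seq1 /= /mval big_seq1.
- by case: k => [|k]; rewrite /pval ?big_nil // big_seq1 /= /mval big_nil.
- by rewrite sadd_correct.
- by rewrite sopp_correct.
- by rewrite smul_correct.
- by elim: k => [|k IH]; rewrite ?v1 // exprS IH /= smul_correct.
- rewrite smul_correct; case: k => [|k]; first by rewrite /pval big_nil mul0r mulr0n.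
  have -> : pval [:: (k.+1%:Z, [::])] = k.+1%:R by rewrite /pval big_seq1 /= /mval big_nil.
  by rewrite mulr_natl.
Qed.

End Correct.

Fixpoint spar (ps : seq bool) (vs : seq G) : Prop := match ps, vs with
  | p :: ps', v :: vs' => ghom p v /\ spar ps' vs'
  | [::], [::] => True
  | _, _ => False
  end.

Lemma sparP ps vs : spar ps vs -> forall i, ghom (nth false ps i) (nth 0 vs i).
Proof.
elim: ps vs => [|p ps IH] [|v vs] //= h i; first by rewrite !nth_nil; exact: ghom0.
by case: h => hv /IH h; case: i.
Qed.

(** Only soundness is proved: an empty normal form of the difference implies equality. Coefficients
    are integers, so a scaled term such as [2^-1 *: (del * gam)] enters as an atom with a parity of
    its own. *)
Lemma sring_correct ps vs e1 e2 : spar ps vs ->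
  snorm ps (SAdd e1 (SOpp e2)) = [::] -> seval vs e1 = seval vs e2.
Proof.
move=> /sparP h hn; apply/eqP; rewrite -subr_eq0.
have -> : seval vs e1 - seval vs e2 = seval vs (SAdd e1 (SOpp e2)) by [].
by rewrite (snorm_correct h) hn /pval big_nil.
Qed.

End SuperRing.

Ltac sring_index x vs k := lazymatch vs with
  | nil => constr:(@None nat)
  | ?y :: ?vs' => match goal with
    | _ => let _ := match goal with _ => constr_eq x y end in constr:(Some k)
    | _ => sring_index x vs' (S k)
    end
  end.

Ltac sring_reify e vs :=
  let bin C a b :=
    let r1 := sring_reify a vs in
    match r1 with (?ea, ?vs1) =>
      let r2 := sring_reify b vs1 in
      match r2 with (?eb, ?vs2) => constr:((C ea eb, vs2)) end
    end in
  lazymatch e with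
  | (?a + ?b)%R => bin SAdd a b
  | (?a * ?b)%R => bin SMul a b
  | (- ?a)%R => let r := sring_reify a vs in
      match r with (?ea, ?vs1) => constr:((SOpp ea, vs1)) end
  | (?a ^+ ?k)%R => let r := sring_reify a vs in
      match r with (?ea, ?vs1) => constr:((SExp ea k, vs1)) end
  | 0%R => constr:((SNat 0, vs))
  | 1%R => constr:((SNat 1, vs))
  | (1 *+ ?k)%R => constr:((SNat k, vs))
  | (?a *+ ?k)%R => let r := sring_reify a vs in
      match r with (?ea, ?vs1) => constr:((SMuln ea k, vs1)) end
  | ?a => let k := sring_index a vs 0%N in
      lazymatch k with
      | Some ?i => constr:((SVar i, vs))
      | None => let i := eval lazy beta iota delta [size] in (size vs) in
          let vs' := eval lazy beta iota delta [rcons] in (rcons vs a) in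
          constr:((SVar i, vs'))
      end
  end.

Ltac sring_parities vs := lazymatch vs with
  | nil => constr:(@nil bool)
  | ?v :: ?vs' =>
    let ps := sring_parities vs' in
    match goal with
    | _ : ghom ?b ?w |- _ => let _ := match goal with _ => constr_eq w v end in
                             constr:(b :: ps)
    | _ => fail 100 "sring: no parity for" v
    end
  end.

Ltac sring_hyps := lazymatch goal with
  | |- True => exact I
  | |- ghom ?b ?v /\ _ =>
    split; [match goal with H : ghom b ?w |- _ => constr_eq w v; exact H end | sring_hyps]
  end.

(* Decides identities in a supercommutative ring; the parity of every atom must
   be among the hypotheses. *)
Ltac sring := lazymatch goal with
  | |- @eq ?T ?a ?b =>
    let r1 := sring_reify a (@nil T) in
    lazymatch r1 with (?ea, ?vs1) =>
      let r2 := sring_reify b vs1 in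
      lazymatch r2 with (?eb, ?vs) =>
        let ps := sring_parities vs in
        refine (@sring_correct _ _ ps vs ea eb _ _);
        [cbn [spar]; sring_hyps | vm_compute; reflexivity]
      end
    end
  end.

(** * The decomposition x = x_0 + theta x_1 over the base *)

Section ThetaFree.
Variables (K : numClosedFieldType) (N : nat).
Local Notation L := (grass K N.+1).
Local Notation th := (ggen K (ord0 : 'I_N.+1)).
Implicit Types (x y u v : L).

Definition thfree x := forall A : {set 'I_N.+1}, ord0 \in A -> x A = 0.

Lemma thfree0 : thfree 0. Proof. by move=> A _; rewrite gzeroE. Qed.
Lemma thfreeD x y : thfree x -> thfree y -> thfree (x + y).
Proof. by move=> hx hy A h; rewrite gaddE hx ?hy ?addr0. Qed.
Lemma thfreeN x : thfree x -> thfree (- x).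
Proof. by move=> hx A h; rewrite goppE hx ?oppr0. Qed.
Lemma thfreeB x y : thfree x -> thfree y -> thfree (x - y).
Proof. by move=> hx /thfreeN; exact: thfreeD. Qed.
Lemma thfreeZ (a : K) x : thfree x -> thfree (a *: x).
Proof. by move=> hx A h; rewrite gscaleE hx ?mulr0. Qed.
Lemma thfreeM x y : thfree x -> thfree y -> thfree (x * y).
Proof.
move=> hx hy A h; rewrite gmulE; apply: big1 => B _; apply: big1 => E _.
have [->|/gcoef_neq0[_ BE]] := eqVneq (gcoef K B E A) 0; first by rewrite mul0r.
by move: h; rewrite -BE inE => /orP[/hx|/hy] ->; rewrite ?mul0r !mulr0.
Qed.
Lemma thfree1 : thfree 1.
Proof. by move=> A h; rewrite goneE; case: eqVneq h => // ->; rewrite inE. Qed.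
Lemma thfree_alg (a : K) : thfree (a%:A). Proof. exact/thfreeZ/thfree1. Qed.
Lemma thfree_sig x : thfree x -> thfree (gsig x).
Proof. by move=> hx A h; rewrite gsigE hx ?mulr0. Qed.

Lemma gtheta_odd : godd th.
Proof.
by move=> A; rewrite ffunE; case: (eqVneq A) => [->|_]; rewrite ?cards1 ?eqxx.
Qed.

(** As [theta] is the generator of smallest index, putting it in front of a monomial creates no
    inversion and hence no sign. *)
Lemma gthetaM v A : thfree v ->
  (th * v) A = if ord0 \in A then v (A :\ ord0) else 0.
Proof.
move=> hv; rewrite gmulE (bigD1 [set ord0]) //= [X in _ + X]big1 ?addr0; last first.
  by move=> B nB; apply: big1 => E _; rewrite ffunE (negbTE nB) mul0r mulr0.
case: ifP => h.
  rewrite (bigD1 (A :\ ord0)) //= big1 ?addr0.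
    rewrite ffunE eqxx mul1r /gcoef disjoints1 !inE eqxx /= setD1K // eqxx.
    have -> : invs [set ord0] (A :\ ord0) = 0%N.
      by rewrite /invs big_set1 big1.
    by rewrite expr0 mul1r.
  move=> E nE; have [->|/gcoef_neq0[d e]] := eqVneq (gcoef K [set ord0] E A) 0; first by rewrite mul0r.
  case/eqP: nE; rewrite -e; move: d; rewrite disjoints1 => d.
  by rewrite setU1K.
apply: big1 => E _; have [->|/gcoef_neq0[_ e]] := eqVneq (gcoef K [set ord0] E A) 0; first by rewrite mul0r.
by move: h; rewrite -e !inE eqxx.
Qed.

End ThetaFree.

Section Theta.
Variables (K : numClosedFieldType) (N : nat).
Local Notation L := (grass K N.+1).
Local Notation S := (grass K N).
Local Notation th := (ggen K (ord0 : 'I_N.+1)).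
Implicit Types (x y u v : L) (s t : S) (b : bool).

(* gcoef0, gcoef1 and glift over an arbitrary field. *)
Definition thp0 x : L := [ffun A : {set 'I_N.+1} => if ord0 \in A then 0 else x A].
Definition thp1 x : L :=
  [ffun A : {set 'I_N.+1} => if ord0 \in A then 0 else x (ord0 |: A)].
Definition thlift s : L := [ffun A : {set 'I_N.+1} => if ord0 \in A then 0
   else s [set i | lift ord0 i \in A]].

Lemma th_odd : godd th. Proof. exact: gtheta_odd. Qed.
Arguments th_odd : clear implicits.

Lemma thp0E x (A : {set 'I_N.+1}) : thp0 x A = if ord0 \in A then 0 else x A.
Proof. by rewrite ffunE. Qed.
Lemma thp1E x (A : {set 'I_N.+1}) :
  thp1 x A = if ord0 \in A then 0 else x (ord0 |: A).
Proof. by rewrite ffunE. Qed.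
Lemma thliftE s (A : {set 'I_N.+1}) :
  thlift s A = if ord0 \in A then 0 else s [set i | lift ord0 i \in A].
Proof. by rewrite ffunE. Qed.

Lemma thp0_free x : thfree (thp0 x).
Proof. by move=> A h; rewrite thp0E h. Qed.
Lemma thp1_free x : thfree (thp1 x).
Proof. by move=> A h; rewrite thp1E h. Qed.

Lemma thp_unique u v : thfree u -> thfree v ->
  thp0 (u + th * v) = u /\ thp1 (u + th * v) = v.
Proof.
move=> hu hv; split; apply/ffunP => A; rewrite (thp0E, thp1E); case: ifP => h.
- by rewrite hu.
- by rewrite gaddE gthetaM // h addr0.
- by rewrite hv.
- by rewrite gaddE hu ?setU11 // add0r gthetaM // setU11 setU1K // h.
Qed.

Lemma thpD x : x = thp0 x + th * thp1 x.
Proof.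
apply/ffunP => A; rewrite gaddE (gthetaM _ (@thp1_free x)) thp0E thp1E.
by case: ifP => h; rewrite ?addr0 // !inE eqxx /= add0r setD1K.
Qed.

Lemma thp_add x y : thp0 (x + y) = thp0 x + thp0 y /\
  thp1 (x + y) = thp1 x + thp1 y.
Proof.
by split; apply/ffunP => A; rewrite gaddE !(thp0E, thp1E) gaddE; case: ifP; rewrite ?addr0.
Qed.
Lemma thp0D x y : thp0 (x + y) = thp0 x + thp0 y.
Proof. exact: (thp_add x y).1. Qed.
Lemma thp1D x y : thp1 (x + y) = thp1 x + thp1 y.
Proof. exact: (thp_add x y).2. Qed.
Lemma thp0Z (a : K) x : thp0 (a *: x) = a *: thp0 x.
Proof. by apply/ffunP => A; rewrite gscaleE !thp0E gscaleE; case: ifP; rewrite ?mulr0. Qed.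
Lemma thp1Z (a : K) x : thp1 (a *: x) = a *: thp1 x.
Proof. by apply/ffunP => A; rewrite gscaleE !thp1E gscaleE; case: ifP; rewrite ?mulr0. Qed.
Lemma thp0N x : thp0 (- x) = - thp0 x.
Proof. by rewrite -scaleN1r thp0Z scaleN1r. Qed.
Lemma thp1N x : thp1 (- x) = - thp1 x.
Proof. by rewrite -scaleN1r thp1Z scaleN1r. Qed.

Lemma thp_free x : thfree x -> thp0 x = x /\ thp1 x = 0.
Proof.
move=> hx; have := thp_unique hx (@thfree0 _ _); rewrite mulr0 addr0; exact.
Qed.
Lemma thfreeP x : thfree x <-> thp1 x = 0.
Proof.
split=> [/thp_free[]//|h]; rewrite [x]thpD h mulr0 addr0.
exact: thp0_free.
Qed.

Lemma gsig_theta v : gsig (th * v) = - (th * gsig v).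
Proof. by rewrite gsigM; have /goddE -> := th_odd; rewrite mulNr. Qed.

(** [thp1] is the left derivative in [theta], an odd derivation: passing [theta] through [x]
    produces [gsig x], and the product of the two [theta] terms vanishes. *)
Lemma thpM x y : thp0 (x * y) = thp0 x * thp0 y /\
  thp1 (x * y) = thp1 x * y + gsig x * thp1 y.
Proof.
have e : x * y = thp0 x * thp0 y +
    th * (thp1 x * thp0 y + gsig (thp0 x) * thp1 y).
  rewrite {1}[x]thpD {1}[y]thpD mulrDl !mulrDr addrA.
  rewrite [thp0 x * (th * _)]mulrA (godd_sig (thp0 x) th_odd).
  rewrite [th * thp1 x * (th * _)]mulrA -[th * thp1 x * th]mulrA.
  rewrite (godd_sig (thp1 x) th_odd) [th * (th * _)]mulrA (godd_sq th_odd).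
  by rewrite !mul0r addr0 -!mulrA -addrA; congr (_ + _); rewrite addrC.
have f1 := thfreeM (@thp0_free x) (@thp0_free y).
have f2 := thfreeD (thfreeM (@thp1_free x) (@thp0_free y))
  (thfreeM (thfree_sig (@thp0_free x)) (@thp1_free y)).
have [h0 h1] := thp_unique f1 f2; rewrite -e in h0 h1; split=> //.
rewrite h1 {3}[y]thpD [in gsig x](thpD x) mulrDr gsigD mulrDl gsig_theta.
rewrite mulrA (godd_sig (thp1 x) th_odd) -mulrA mulNr -mulrA.
by rewrite addrACA subrr addr0.
Qed.
Lemma thp0M x y : thp0 (x * y) = thp0 x * thp0 y.
Proof. exact: (thpM x y).1. Qed.
Lemma thp1M x y : thp1 (x * y) = thp1 x * y + gsig x * thp1 y.
Proof. exact: (thpM x y).2. Qed.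

Lemma thp_theta : thp0 th = 0 /\ thp1 th = 1.
Proof. by have := thp_unique (@thfree0 _ _) (@thfree1 _ _); rewrite mulr1 add0r. Qed.

Lemma thp0_hom b x : ghom b x -> ghom b (thp0 x).
Proof. by move=> h A; rewrite thp0E; case: ifP; rewrite ?eqxx // => _; exact: h. Qed.
Lemma thp1_hom b x : ghom b x -> ghom (~~ b) (thp1 x).
Proof.
move=> h A; rewrite thp1E; case: ifP => [_|h0 /h]; first by rewrite eqxx.
by rewrite cardsU1 h0 /= => <-; rewrite negbK.
Qed.
Lemma thp1_sig x : thp1 (gsig x) = - gsig (thp1 x).
Proof.
apply/ffunP => A; rewrite goppE gsigE !thp1E gsigE; case: ifP => h.
  by rewrite mulr0 oppr0.
by rewrite cardsU1 h exprS mulN1r mulNr.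
Qed.

Lemma gbody_thp0 x : gbody (thp0 x) = gbody x.
Proof. by rewrite /gbody thp0E inE. Qed.

Let up (A : {set 'I_N}) : {set 'I_N.+1} := [set lift ord0 i | i in A].
Let down (A : {set 'I_N.+1}) : {set 'I_N} := [set i | lift ord0 i \in A].

Lemma up0 (A : {set 'I_N}) : ord0 \notin up A.
Proof. by apply/imsetP => -[i _ /eqP]; rewrite (negbTE (neq_lift _ _)). Qed.
Lemma upK : cancel up down.
Proof.
move=> A; apply/setP => i; rewrite inE mem_imset //; exact: lift_inj.
Qed.
Lemma downK (A : {set 'I_N.+1}) : ord0 \notin A -> up (down A) = A.
Proof.
move=> A0; apply/setP => i; apply/imsetP/idP => [[j]|iA].
  by rewrite inE => jA ->.
case: (unliftP ord0 i) iA => [j ->|->]; last by rewrite (negbTE A0).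
by move=> jA; exists j; rewrite ?inE.
Qed.

Lemma thlift_free s : thfree (thlift s).
Proof. by move=> A h; rewrite thliftE h. Qed.

Lemma thlift_up s A : thlift s (up A) = s A.
Proof. by rewrite thliftE (negbTE (up0 A)) -/(down _) upK. Qed.

Lemma thlift_surj x : thfree x -> exists s, thlift s = x.
Proof.
move=> hx; exists [ffun A : {set 'I_N} => x (up A)]; apply/ffunP => A.
rewrite thliftE; case: ifP => h; first by rewrite hx.
by rewrite ffunE -/(down A) downK ?h.
Qed.

Lemma thlift_inj : injective (thlift).
Proof. by move=> s t h; apply/ffunP => A; rewrite -!thlift_up h. Qed.

Lemma thliftD s t : thlift (s + t) = thlift s + thlift t.
Proof. by apply/ffunP => A; rewrite gaddE !thliftE gaddE; case: ifP; rewrite ?addr0. Qed.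
Lemma thliftZ (a : K) s : thlift (a *: s) = a *: thlift s.
Proof. by apply/ffunP => A; rewrite gscaleE !thliftE gscaleE; case: ifP; rewrite ?mulr0. Qed.

(** [lift ord0] is increasing, so the inversions between two sets of generators are preserved. This
    is why [thlift] is multiplicative. *)
Lemma gcoef_up B E A : gcoef K (up B) (up E) (up A) = gcoef K B E A.
Proof.
have inj : injective (lift (ord0 : 'I_N.+1)) by exact: lift_inj.
rewrite /gcoef; congr (if _ then _ ^+ _ else _).
  congr (_ && _); last by rewrite /up -imsetU (inj_eq (imset_inj inj)).
  by rewrite -!setI_eq0 /up -imsetI; [rewrite imset_eq0|move=> ? ? _ _; exact: inj].
rewrite /invs big_imset /=; last by move=> ? ? _ _; exact: inj.
apply: eq_bigr => i _; rewrite big_imset /=; last by move=> ? ? _ _; exact: inj.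
by apply: eq_bigr => j _; rewrite /bump /= !add1n ltnS.
Qed.

Lemma sum_up (F : {set 'I_N.+1} -> K) : (forall B : {set 'I_N.+1}, ord0 \in B -> F B = 0) ->
  \sum_B F B = \sum_(B : {set 'I_N}) F (up B).
Proof.
move=> h; rewrite (bigID (fun B : {set 'I_N.+1} => ord0 \in B)) /= big1 ?add0r //.
rewrite (reindex_onto up down) /=; last by move=> B; exact: downK.
by apply: eq_bigl => B; rewrite up0 upK eqxx.
Qed.

Lemma thliftM s t : thlift (s * t) = thlift s * thlift t.
Proof.
apply/ffunP => A; have [A0|A0] := boolP (ord0 \in A).
  by rewrite thlift_free // (thfreeM (@thlift_free s) (@thlift_free t)).
rewrite -(downK A0) thlift_up !gmulE sum_up; last first.
  by move=> B B0; apply: big1 => E _; rewrite thlift_free // mul0r mulr0.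
apply: eq_bigr => B _; rewrite sum_up; last first.
  by move=> E E0; rewrite [thlift t E]thlift_free // !mulr0.
by apply: eq_bigr => E _; rewrite gcoef_up !thlift_up.
Qed.

Lemma thlift1 : thlift (1 : S) = 1.
Proof.
apply/ffunP => A; have [A0|A0] := boolP (ord0 \in A).
  by rewrite thlift_free // thfree1.
by rewrite -(downK A0) thlift_up !goneE /up imset_eq0.
Qed.

Lemma thlift_hom b s : ghom b (thlift s) <-> ghom b s.
Proof.
have cu A : #|up A| = #|A| by rewrite card_imset //; exact: lift_inj.
split=> h A; first by move=> sA; rewrite -cu; apply: h; rewrite thlift_up.
have [A0|A0] := boolP (ord0 \in A); first by rewrite thlift_free ?eqxx.
by rewrite -(downK A0) thlift_up cu; exact: h.
Qed.

End Theta.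

(** * Matrices of SPL_2 *)

Section Matrices.
Variables (K : numClosedFieldType) (n : nat).
Local Notation L := (grass K n).
Implicit Types (a b c d h t u x y gam del beta : L) (g : 'M[L]_3).

(** The matrix notions of the statement over an abstract field; over [Cx R] they unfold to the same
    terms. *)
Definition kmx3 (s : seq (seq L)) : 'M[L]_3 :=
  \matrix_(i < 3, j < 3) nth 0 (nth [::] s i) j.

Definition kspl_mx a b c d gam del : 'M[L]_3 :=
  let l := 1 - 2^-1 *: (del * gam) in
  kmx3 [:: [:: l * a; gam * b - del * a;  l * b];
          [:: gam;   1 + del * gam;      del  ];
          [:: l * c; gam * d - del * c;  l * d]].

Definition kin_G (g : 'M[L]_3) : Prop :=
  exists a b c d gam del : L,
    [/\ [/\ geven a, geven b, geven c & geven d], godd gam /\ godd del,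
        a * d - b * c = 1 & g = kspl_mx a b c d gam del].

Definition kin_B (g : 'M[L]_3) : Prop :=
  kin_G g /\ forall i j : 'I_3, (j < i)%N -> g i j = 0.

Definition kf_mx : 'M[L]_3 :=
  kmx3 [:: [:: 0; 0; 0]; [:: -1; 0; 0]; [:: 0; 1; 0]].

Definition kin_b_odd (m : 'M[L]_3) : Prop :=
  exists h c d : L, [/\ godd h, geven c, godd d
    & m = kmx3 [:: [:: h; c; d]; [:: 0; 0; c]; [:: 0; 0; - h]]].

Definition o0 : 'I_3 := @Ordinal 3 0 isT.
Definition o1 : 'I_3 := @Ordinal 3 1 isT.
Definition o2 : 'I_3 := @Ordinal 3 2 isT.

Lemma ord3P (P : 'I_3 -> Prop) : P o0 -> P o1 -> P o2 -> forall i, P i.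
Proof.
move=> h0 h1 h2 [[|[|[|i]]] hi] //.
- by rewrite (_ : Ordinal hi = o0) //; exact: val_inj.
- by rewrite (_ : Ordinal hi = o1) //; exact: val_inj.
- by rewrite (_ : Ordinal hi = o2) //; exact: val_inj.
Qed.

Lemma mx3P (A B : 'M[L]_3) :
  A o0 o0 = B o0 o0 -> A o0 o1 = B o0 o1 -> A o0 o2 = B o0 o2 ->
  A o1 o0 = B o1 o0 -> A o1 o1 = B o1 o1 -> A o1 o2 = B o1 o2 ->
  A o2 o0 = B o2 o0 -> A o2 o1 = B o2 o1 -> A o2 o2 = B o2 o2 -> A = B.
Proof.
move=> *; apply/matrixP; elim/ord3P; elim/ord3P; assumption.
Qed.

Lemma mul3E (A B : 'M[L]_3) i j :
  (A *m B) i j = A i o0 * B o0 j + A i o1 * B o1 j + A i o2 * B o2 j.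
Proof.
rewrite mxE !big_ord_recl big_ord0 addr0 addrA.
have -> : ord0 = o0 by exact: val_inj.
have -> : lift o0 (ord0 : 'I_2) = o1 by exact: val_inj.
by have -> : lift o0 (lift (ord0 : 'I_2) ord0) = o2 by exact: val_inj.
Qed.

Lemma kmx3E s i j : kmx3 s i j = nth 0 (nth [::] s i) j.
Proof. by rewrite mxE. Qed.

(** The even subgroup SL_2, acting trivially on the odd line. Every element of G is some [Sm] times
    an element [Um] with odd parameters only. *)
Definition Sm a b c d := kmx3 [:: [:: a; 0; b]; [:: 0; 1; 0]; [:: c; 0; d]].
Definition Um gam del := kspl_mx 1 0 0 1 gam del.

Ltac mx3tac := apply: mx3P; rewrite ?mul3E ?kmx3E /=.

Lemma kmx3M (x00 x01 x02 x10 x11 x12 x20 x21 x22 y00 y01 y02 y10 y11 y12 y20 y21 y22 z00 z01 z02 z10 z11 z12 z20 z21 z22 : L) :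
  x00 * y00 + x01 * y10 + x02 * y20 = z00 ->
  x00 * y01 + x01 * y11 + x02 * y21 = z01 ->
  x00 * y02 + x01 * y12 + x02 * y22 = z02 ->
  x10 * y00 + x11 * y10 + x12 * y20 = z10 ->
  x10 * y01 + x11 * y11 + x12 * y21 = z11 ->
  x10 * y02 + x11 * y12 + x12 * y22 = z12 ->
  x20 * y00 + x21 * y10 + x22 * y20 = z20 ->
  x20 * y01 + x21 * y11 + x22 * y21 = z21 ->
  x20 * y02 + x21 * y12 + x22 * y22 = z22 ->
  kmx3 [:: [:: x00; x01; x02]; [:: x10; x11; x12]; [:: x20; x21; x22]] *m kmx3 [:: [:: y00; y01; y02]; [:: y10; y11; y12]; [:: y20; y21; y22]] =
  kmx3 [:: [:: z00; z01; z02]; [:: z10; z11; z12]; [:: z20; z21; z22]].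
Proof. by move=> *; apply: mx3P; rewrite mul3E !kmx3E. Qed.

Lemma SmM a b c d a' b' c' d' : Sm a b c d *m Sm a' b' c' d' =
  Sm (a * a' + b * c') (a * b' + b * d') (c * a' + d * c') (c * b' + d * d').
Proof. by mx3tac; rewrite ?mul0r ?mulr0 ?addr0 ?add0r ?mulr1. Qed.

Lemma Sm1 : Sm 1 0 0 1 = 1%:M.
Proof. by mx3tac; rewrite mxE. Qed.

Lemma SmUm a b c d gam del : [/\ geven a, geven b, geven c & geven d] ->
  godd gam -> godd del -> kspl_mx a b c d gam del = Sm a b c d *m Um gam del.
Proof.
move=> [ae be ce de] go dlo; pose h := 2^-1 *: (del * gam).
have he : geven h by apply/ghomZ/goddM.
by mx3tac; rewrite -/h; sring.
Qed.

(** The odd parameters form a doublet of SL_2 whose product is multiplied by the determinant. So the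
    factor [1 - 2^-1 *: (del * gam)] of [kspl_mx] survives moving an [Sm] to the other side. *)
Lemma half_det gam del a b c d : [/\ geven a, geven b, geven c & geven d] ->
  godd gam -> godd del -> a * d - b * c = 1 ->
  (gam * b + del * d) * (gam * a + del * c) = del * gam.
Proof.
move=> [ae be ce de] go dlo D.
transitivity (del * gam * (a * d - b * c)); last by rewrite D mulr1.
by sring.
Qed.

Lemma UmSm a b c d gam del : [/\ geven a, geven b, geven c & geven d] ->
  godd gam -> godd del -> a * d - b * c = 1 ->
  Um gam del *m Sm a b c d = kspl_mx a b c d (gam * a + del * c) (gam * b + del * d).
Proof.
move=> e go dlo D; rewrite /kspl_mx (half_det e go dlo D).
pose h := 2^-1 *: (del * gam); case: e => ae be ce de.
have he : geven h by apply/ghomZ/goddM.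
have e1 : gam * d - del * c = (gam * d - del * c) by [].
mx3tac; rewrite -/h; try by sring.
- transitivity (- del * (a * d - b * c)); first by rewrite D; sring.
  by sring.
- transitivity (gam * (a * d - b * c)); first by rewrite D; sring.
  by sring.
Qed.

Lemma half2 x y : 2^-1 *: ((x + x) * y) = x * y.
Proof.
rewrite mulrDl -mulr2n -scaler_nat scalerA mulVf ?scale1r //.
by rewrite pnatr_eq0.
Qed.

(** Writing [del] as [x + x] turns [2^-1 *: (del * gam)] into [x * gam]: the identities for
    [kspl_mx] get integer coefficients, as [sring] requires. *)
Lemma half_odd del : godd del -> exists2 x, godd x & del = x + x.
Proof.
move=> h; exists (2^-1 *: del); first exact: ghomZ.
rewrite -scalerDl (_ : 2^-1 + 2^-1 = 1 :> K) ?scale1r //.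
by rewrite -mulr2n -[_ *+ 2]mulr_natr mulVf // pnatr_eq0.
Qed.

Lemma UmM gam del gam' del' : godd gam -> godd del -> godd gam' -> godd del' ->
  kin_G (Um gam del *m Um gam' del').
Proof.
move=> go /half_odd[x xo ->] go' /half_odd[y yo ->].
pose l := 1 - x * gam; pose l' := 1 - y * gam'.
(* [g2] and [d2] are the outer entries of the middle row of the product. The corner entries of a
   matrix in G carry the factor [1 - x2 * g2]; multiplying those of the product by its inverse [e2]
   gives the even parameters. *)
pose g2 := gam * l' + (1 + (x + x) * gam) * gam'.
pose x2 := (1 + (x + x) * gam) * y + x * l'.
pose d2 := x2 + x2.
pose e2 := 1 + x2 * g2.
have xe : geven (x * gam) by exact: goddM.
have le : geven l by apply: ghomB; [exact: geven1|exact: goddM].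
have le' : geven l' by apply: ghomB; [exact: geven1|exact: goddM].
have se : geven (1 + (x + x) * gam).
  by apply: ghomD; [exact: geven1|apply: goddM => //; exact: ghomD].
have g2o : godd g2 by apply: ghomD; [exact: godd_evenM|exact: geven_oddM].
have x2o : godd x2 by apply: ghomD; [exact: geven_oddM|exact: godd_evenM].
have d2o : godd d2 by exact: ghomD.
have e2e : geven e2 by apply: ghomD; [exact: geven1|exact: goddM].
exists (e2 * (l * l' - (x + x) * gam')), (- (e2 * ((x + x) * (y + y)))),
  (e2 * (gam * gam')), (e2 * (gam * (y + y) + l * l')), g2, d2.
have xxo : godd (x + x) by exact: ghomD.
have yyo : godd (y + y) by exact: ghomD.
split.
- split; [|apply: ghomN| |]; apply: gevenM => //; try exact: goddM.
    by apply: ghomB; [exact: gevenM|exact: goddM].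
  by apply: ghomD; [exact: goddM|exact: gevenM].
- by [].
- by rewrite /e2 /x2 /g2 /l /l'; sring.
rewrite /kspl_mx /Um /kspl_mx /d2 !half2.
have E1 : e2 = 1 + x2 * g2 by [].
have E2 : x2 = (1 + (x + x) * gam) * y + x * l' by [].
have E3 : g2 = gam * l' + (1 + (x + x) * gam) * gam' by [].
have E4 : l = 1 - x * gam by [].
have E5 : l' = 1 - y * gam' by [].
clearbody e2 d2 x2 g2 l l'.
apply: kmx3M; rewrite ?E1 ?E2 ?E3 ?E4 ?E5; sring.
Qed.

Definition kSL a b c d := [/\ geven a, geven b, geven c & geven d] /\ a * d - b * c = 1.

Lemma kSLM a b c d a' b' c' d' : kSL a b c d -> kSL a' b' c' d' ->
  kSL (a * a' + b * c') (a * b' + b * d') (c * a' + d * c') (c * b' + d * d').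
Proof.
move=> [[ae be ce de] D] [[ae' be' ce' de'] D'].
split; first by split; apply: ghomD; exact: gevenM.
transitivity ((a * d - b * c) * (a' * d' - b' * c')); last by rewrite D D' mulr1.
by sring.
Qed.

(** With [g = S U] and [g' = S' U'], the factor [U] is moved across, [U S' = S' U'']; then [U'' U']
    is again some [S U] by [UmM], and the SL_2 factors multiply. *)
Lemma kin_GM g g' : kin_G g -> kin_G g' -> kin_G (g *m g').
Proof.
move=> [a [b [c [d [gam [del [e [go dlo] D ->]]]]]]] [a' [b' [c' [d' [gam' [del' [e' [go' dlo'] D' ->]]]]]]].
rewrite (SmUm e go dlo) (SmUm e' go' dlo') -!mulmxA [Um _ _ *m (Sm _ _ _ _ *m _)]mulmxA UmSm //.
case: (e') => ae be ce de.
have o1' : godd (gam * a' + del * c') by apply: ghomD; exact: godd_evenM.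
have o2' : godd (gam * b' + del * d') by apply: ghomD; exact: godd_evenM.
rewrite SmUm // -!mulmxA.
have [a2 [b2 [c2 [d2 [g2 [dl2 [e2 [go2 dlo2] D2 ->]]]]]]] := UmM o1' o2' go' dlo'.
rewrite (SmUm e2 go2 dlo2) !mulmxA SmM SmM.
have [e3 D3] := kSLM (kSLM (conj e D) (conj e' D')) (conj e2 D2).
rewrite -SmUm //.
by do 6!eexists; split; [exact: e3| |exact: D3|reflexivity].
Qed.

(** The adjoint for the orthosymplectic form, which inverts the elements of G. Its entries are those
    of [g] up to sign and position, so holomorphy and pullback pass to the inverse entry by
    entry. *)
Definition ginv3 g : 'M[L]_3 := kmx3
  [:: [:: g o2 o2; g o1 o2; - g o0 o2]; [:: - g o2 o1; g o1 o1; g o0 o1];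
      [:: - g o2 o0; - g o1 o0; g o0 o0]].

Lemma UmK gam del : godd gam -> godd del -> Um (- gam) (- del) *m Um gam del = 1%:M.
Proof.
move=> go /half_odd[x xo ->]; rewrite /Um /kspl_mx opprD half2.
rewrite half2 -Sm1.
by apply: kmx3M; sring.
Qed.

Lemma ginv3E a b c d gam del : [/\ geven a, geven b, geven c & geven d] ->
  godd gam -> godd del -> a * d - b * c = 1 ->
  ginv3 (kspl_mx a b c d gam del) = Um (- gam) (- del) *m Sm d (- b) (- c) a.
Proof.
move=> e go dlo D; case: (e) => ae be ce de.
have e' : [/\ geven d, geven (- b), geven (- c) & geven a] by split => //; exact: ghomN.
have D' : d * a - - b * - c = 1 by rewrite mulrNN (geven_comm a de).
rewrite UmSm //; try exact: ghomN.
have hh : (- gam * - b + - del * a) * (- gam * d + - del * - c) = del * gam.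
  by rewrite (half_det e' (ghomN go) (ghomN dlo) D') mulrNN.
pose h := 2^-1 *: (del * gam).
have he : geven h by apply/ghomZ/goddM.
mx3tac; rewrite ?hh -/h; try by sring.
- transitivity (del * (a * d - b * c)); first by rewrite D; sring.
  by sring.
- transitivity (- gam * (a * d - b * c)); first by rewrite D; sring.
  by sring.
Qed.

Lemma mulmx4 (A B C D : 'M[L]_3) : B *m C = 1%:M -> A *m D = 1%:M ->
  A *m B *m (C *m D) = 1%:M.
Proof. by move=> h1 h2; rewrite mulmxA -(mulmxA A B C) h1 mulmx1. Qed.

Lemma ginv3P g : kin_G g -> [/\ kin_G (ginv3 g), ginv3 g *m g = 1%:M & g *m ginv3 g = 1%:M].
Proof.
move=> [a [b [c [d [gam [del [e [go dlo] D ->]]]]]]].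
rewrite (ginv3E e go dlo D); case: (e) => ae be ce de.
have e' : [/\ geven d, geven (- b), geven (- c) & geven a] by split => //; exact: ghomN.
have D' : d * a - - b * - c = 1 by rewrite mulrNN (geven_comm a de).
have SS : Sm d (- b) (- c) a *m Sm a b c d = 1%:M.
  rewrite SmM -Sm1; congr Sm; rewrite -?D; sring.
have SS' : Sm a b c d *m Sm d (- b) (- c) a = 1%:M.
  rewrite SmM -Sm1; congr Sm; rewrite -?D; sring.
split.
- rewrite UmSm //; try exact: ghomN.
  do 6!eexists; split; [exact: e'| |exact: D'|reflexivity].
  split; apply: ghomD; apply: godd_evenM => //; exact: ghomN.
- by rewrite (SmUm e go dlo); apply: mulmx4 => //; exact: UmK.
- have h := UmK (ghomN go) (ghomN dlo); rewrite (opprK gam) (opprK del) in h.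
  by rewrite (SmUm e go dlo); exact: mulmx4.
Qed.

Definition mxpar (i j : 'I_3) : bool := (i == 1%N :> nat) (+) (j == 1%N :> nat).

Lemma kin_G_hom g : kin_G g -> forall i j, ghom (mxpar i j) (g i j).
Proof.
move=> [a [b [c [d [gam [del [[ae be ce de] [go dlo] D ->]]]]]]].
have le : geven (1 - 2^-1 *: (del * gam)) by apply: ghomB; [exact: geven1|apply/ghomZ/goddM].
have e1 : geven (1 + del * gam) by apply: ghomD; [exact: geven1|exact: goddM].
have o1' : godd (gam * b - del * a) by apply: ghomB; exact: godd_evenM.
have o2' : godd (gam * d - del * c) by apply: ghomB; exact: godd_evenM.
by elim/ord3P; elim/ord3P; rewrite kmx3E /=; first [assumption | exact: gevenM].
Qed.

Lemma kin_G1 : kin_G 1%:M.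
Proof.
exists 1, 0, 0, 1, 0, 0; split.
- by split; try exact: geven1; exact: ghom0.
- by split; exact: ghom0.
- by rewrite mulr1 mulr0 subr0.
by apply: mx3P; rewrite mxE kmx3E /= ?mulr0 ?mul0r ?scaler0 ?subr0 ?addr0 ?mulr1.
Qed.

(** General element of B. [u] stands for the inverse of [t]; the entry [- (del * t)] is the one
    prescribed by [kspl_mx] with [gam = 0] and [c = 0]. *)
Definition Bm t del beta u : 'M[L]_3 :=
  kmx3 [:: [:: t; - (del * t); beta]; [:: 0; 1; del]; [:: 0; 0; u]].

Lemma Bm_in t del beta u : [/\ geven t, godd del, geven beta & geven u] -> t * u = 1 ->
  kin_B (Bm t del beta u).
Proof.
move=> [te dlo be ue] tu; split; last first.
  by elim/ord3P; elim/ord3P => //; rewrite kmx3E.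
exists t, beta, 0, u, 0, del; split.
- by split => //; exact: ghom0.
- by split => //; exact: ghom0.
- by rewrite mulr0 subr0.
by mx3tac; rewrite ?mulr0 ?mul0r ?scaler0 ?subr0 ?addr0 ?mul1r ?sub0r.
Qed.

Lemma kin_BP g : kin_B g -> exists t del beta u,
  [/\ [/\ geven t, godd del, geven beta & geven u], t * u = 1 & g = Bm t del beta u].
Proof.
move=> [[a [b [c [d [gam [del [[ae be ce de] [go dlo] D gE]]]]]]]] low.
have g0 : gam = 0 by have := low o1 o0 isT; rewrite gE kmx3E /=.
have c0 : c = 0.
  by have := low o2 o0 isT; rewrite gE kmx3E /= g0 mulr0 scaler0 subr0 mul1r.
exists a, del, b, d; split => //; first by move: D; rewrite c0 mulr0 subr0.
rewrite gE g0 c0.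
by mx3tac; rewrite ?mulr0 ?mul0r ?scaler0 ?subr0 ?addr0 ?mul1r ?sub0r.
Qed.

Lemma BmM t del beta u t' del' beta' u' :
  [/\ geven t, godd del, geven beta & geven u] ->
  [/\ geven t', godd del', geven beta' & geven u'] -> t' * u' = 1 ->
  Bm t del beta u *m Bm t' del' beta' u' =
  Bm (t * t') (del' + del * u') (t * beta' - del * t * del' + beta * u') (u * u').
Proof.
move=> [te dlo be ue] [te' dlo' be' ue'] tu'.
apply: kmx3M; rewrite ?mulr0 ?mul0r ?addr0 ?add0r ?mul1r ?mulr1 ?mulNr //.
transitivity (- (del' * t * t') - del * t * (t' * u')); last by sring.
by rewrite tu' mulr1; sring.
Qed.

Lemma kin_BM g g' : kin_B g -> kin_B g' -> kin_B (g *m g').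
Proof.
move=> [hg lg] [hg' lg']; split; first exact: kin_GM.
elim/ord3P; elim/ord3P => // _; rewrite mul3E ?(lg o1 o0) ?(lg o2 o0) ?(lg o2 o1) ?(lg' o1 o0) ?(lg' o2 o0) ?(lg' o2 o1) //;
  by rewrite ?mulr0 ?mul0r ?addr0.
Qed.
Lemma kin_BV g : kin_B g -> kin_B (ginv3 g).
Proof.
move=> [hg lg]; split; first by have [] := ginv3P hg.
by elim/ord3P; elim/ord3P => // _; rewrite kmx3E /= ?(lg o1 o0) ?(lg o2 o0) ?(lg o2 o1) ?oppr0.
Qed.

Definition Om a h c d : 'M[L]_3 :=
  kmx3 [:: [:: h; c; d]; [:: - a; 0; c]; [:: 0; a; - h]].

Lemma OmE a m : kin_b_odd m -> exists h c d, [/\ godd h, geven c, godd d & a *: kf_mx + m = Om a h c d].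
Proof.
move=> [h [c [d [ho ce do_ ->]]]]; exists h, c, d; split => //.
by mx3tac; rewrite !mxE /= ?mulr0 ?mulr1 ?mulrN1 ?add0r ?addr0.
Qed.
Lemma Om_form a h c d : godd h -> geven c -> godd d ->
  exists2 m, kin_b_odd m & Om a h c d = a *: kf_mx + m.
Proof.
move=> ho ce do_; exists (kmx3 [:: [:: h; c; d]; [:: 0; 0; c]; [:: 0; 0; - h]]); first by exists h, c, d.
by mx3tac; rewrite !mxE /= ?mulr0 ?mulr1 ?mulrN1 ?add0r ?addr0.
Qed.

Lemma mx3BE (A B : 'M[L]_3) i j : (A - B) i j = A i j - B i j.
Proof. by rewrite !mxE. Qed.

(** The gauge equation for an upper triangular matrix, with plain variables in place of the
    derivatives. The minus sign in the middle row of [D] is that of the odd basis vector; position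
    (3,1) is trivially satisfied, which leaves eight equations. *)
Lemma gauge_entries (t del beta u dt ddt db dd du a h c d a' h' c' d' : L) :
  let D := kmx3 [:: [:: dt; - ddt; db]; [:: 0; 0; - dd]; [:: 0; 0; du]] in
  Om a h c d *m Bm t del beta u = Bm t del beta u *m Om a' h' c' d' - D <->
  [/\ [/\ h * t = t * h' + del * t * a' - dt,
      - (h * (del * t)) + c = t * c' + beta * a' + ddt &
      h * beta + c * del + d * u = t * d' - del * t * c' - beta * h' - db],
      [/\ a * t = a', a * (del * t) = del * a' & - (a * beta) + c * u = c' - del * h' + dd] &
      a = u * a' /\ a * del - h * u = - (u * h') - du].
Proof.
split.
  move=> E.
  have F i j := congr1 (fun M : 'M[L]_3 => M i j) E.
  split.
  - split.
    + have := F o0 o0; rewrite mul3E mx3BE mul3E !kmx3E /=.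
      by rewrite !mulr0 !addr0 mulrN mulNr opprK.
    + have := F o0 o1; rewrite mul3E mx3BE mul3E !kmx3E /=.
      by rewrite !mulr0 !addr0 mulr1 opprK mulrN.
    + have := F o0 o2; rewrite mul3E mx3BE mul3E !kmx3E /=.
      by rewrite mulNr mulrN.
  - split.
    + have := F o1 o0; rewrite mul3E mx3BE mul3E !kmx3E /=.
      by rewrite !mulr0 !mul0r !addr0 oppr0 add0r addr0 mul1r mulNr => /oppr_inj.
    + have := F o1 o1; rewrite mul3E mx3BE mul3E !kmx3E /=.
      by rewrite !mulr0 !mul0r !addr0 oppr0 add0r addr0 mulrN mulNr opprK.
    + have := F o1 o2; rewrite mul3E mx3BE mul3E !kmx3E /=.
      by rewrite !mul0r !addr0 add0r mul1r opprK mulNr mulrN.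
  - split.
    + have := F o2 o1; rewrite mul3E mx3BE mul3E !kmx3E /=.
      by rewrite !mulr0 !mul0r !addr0 !add0r oppr0 addr0 mulr1.
    + have := F o2 o2; rewrite mul3E mx3BE mul3E !kmx3E /=.
      by rewrite !mul0r !add0r mulNr mulrN.
move=> [[e1 e2 e3] [e4 e5 e6] [e7 e8]]; apply: mx3P; rewrite mul3E mx3BE mul3E !kmx3E /=.
- by rewrite !mulr0 !addr0 mulrN mulNr opprK.
- by rewrite !mulr0 !addr0 mulr1 opprK mulrN.
- by rewrite mulNr mulrN.
- by rewrite !mulr0 !mul0r !addr0 oppr0 add0r addr0 mul1r mulNr e4.
- by rewrite !mulr0 !mul0r !addr0 oppr0 add0r addr0 mulrN mulNr opprK.
- by rewrite !mul0r !addr0 add0r mul1r opprK mulNr mulrN.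
- by rewrite !mulr0 !mul0r oppr0 !addr0.
- by rewrite !mulr0 !mul0r !addr0 !add0r oppr0 addr0 mulr1.
- by rewrite !mul0r !add0r mulNr mulrN.
Qed.

End Matrices.

From mathcomp Require Import all_classical all_reals all_analysis.
From mathcomp Require complex.
Import numFieldNormedType.Exports.

Local Open Scope classical_set_scope.
Local Open Scope ring_scope.

(** * Power series and linear differential equations in one complex variable *)

Module ComplexAnalysis.
Import complex.

Section ComplexNorm.
Variable R : realType.
Local Notation C := (Cx R).
Implicit Types (x y z p q : C) (e r : R).

(** The modulus as an element of [R]: the norm of [Cx R] has values in [Cx R], whereas estimates
    need a totally ordered field with suprema. *)
Definition nc (z : C) : R := Normc.normc z.
Arguments nc : simpl never.

Lemma nc0 : nc 0 = 0. Proof. exact: Normc.normc0. Qed.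
Lemma nc1 : nc 1 = 1. Proof. exact: Normc.normc1. Qed.
Lemma nc_eq0 z : (nc z == 0) = (z == 0).
Proof.
by apply/eqP/eqP => [/Normc.eq0_normc|->]; [|exact: nc0].
Qed.
Lemma ncM x y : nc (x * y) = nc x * nc y. Proof. exact: Normc.normcM. Qed.
Lemma ncD x y : nc (x + y) <= nc x + nc y. Proof. exact: le_normcD. Qed.
Lemma ncN x : nc (- x) = nc x. Proof. exact: normcN. Qed.
Lemma nc_ge0 x : 0 <= nc x.
Proof. by case: x => a b; exact: sqrtr_ge0. Qed.
Lemma ncV x : nc x^-1 = (nc x)^-1. Proof. exact: Normc.normcV. Qed.
Lemma ncX x k : nc (x ^+ k) = nc x ^+ k.
Proof. by elim: k => [|k IH]; rewrite ?expr0 ?nc1 // !exprS ncM IH. Qed.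
Lemma ncB x y : nc (x - y) = nc (y - x).
Proof. by rewrite -ncN opprB. Qed.
Lemma nc_sum I (s : seq I) (P : pred I) (F : I -> C) :
  nc (\sum_(i <- s | P i) F i) <= \sum_(i <- s | P i) nc (F i).
Proof.
apply: (big_rec2 (fun a b => nc a <= b)); first by rewrite nc0.
by move=> i y1 y2 _ h; apply: le_trans (ncD _ _) _; rewrite lerD2l.
Qed.
Lemma nc_nat n : nc n%:R = n%:R.
Proof.
elim: n => [|n IH]; first exact: nc0.
have h : forall a : R, 0 <= a -> nc (real_complex R a) = a.
  by move=> a a0; rewrite /nc /= expr0n /= addr0 sqrtr_sqr ger0_norm.
by rewrite -(h n.+1%:R) ?ler0n // rmorph_nat.
Qed.
Lemma nc_real r : 0 <= r -> nc (real_complex R r : C) = r.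
Proof. by move=> a0; rewrite /nc /= expr0n /= addr0 sqrtr_sqr ger0_norm. Qed.
Lemma nc_gt0 x : (0 < nc x) = (x != 0).
Proof. by rewrite lt_neqAle nc_ge0 eq_sym nc_eq0 andbT. Qed.
Lemma nc_Re x : `|complex.Re x| <= nc x.
Proof.
case: x => a b /=; rewrite -[`|a|]sqrtr_sqr ler_sqrt ?lerDl ?sqr_ge0 //.
by rewrite addr_ge0 ?sqr_ge0.
Qed.
Lemma nc_Im x : `|complex.Im x| <= nc x.
Proof.
case: x => a b /=; rewrite -[`|b|]sqrtr_sqr ler_sqrt ?lerDr ?sqr_ge0 //.
by rewrite addr_ge0 ?sqr_ge0.
Qed.
Lemma nc_le_ReIm (a b : R) : nc (Complex a b) <= `|a| + `|b|.
Proof.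
rewrite -[X in _ <= X]ger0_norm ?addr_ge0 // -[X in _ <= X]sqrtr_sqr.
rewrite ler_sqrt ?sqr_ge0 // sqrrD !real_normK ?num_real //.
by rewrite lerD2r lerDl mulrn_wge0 // mulr_ge0.
Qed.
Lemma ncE z : `|z| = real_complex R (nc z).
Proof. by rewrite normc_def; case: z. Qed.

Lemma norm_lt z r : (`|z| < real_complex R r) = (nc z < r).
Proof. by rewrite ncE ltcR. Qed.

Lemma Cpos_real (e : C) : 0 < e -> exists2 r : R, 0 < r & e = real_complex R r.
Proof.
case: e => a b; rewrite ltcE /= => /andP[/eqP-> a0].
by exists a.
Qed.

Lemma nbhs_nc p (P : C -> Prop) :
  (\forall q \near p, P q) <->
  exists2 e : R, 0 < e & forall x, nc x < e -> P (p + x).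
Proof.
split=> [/nbhs_ballP[e /= e0 h]|[e e0 h]].
  have [r r0 er] := Cpos_real e0; exists r => // x xr; apply: h.
  by rewrite /ball /= opprD addNKr normrN er norm_lt.
apply/nbhs_ballP; exists (real_complex R e) => /=; first by rewrite ltcR.
move=> q; rewrite /ball /= distrC norm_lt => /h.
by rewrite addrC subrK.
Qed.

Definition has_sum (u : nat -> C) (l : C) :=
  forall e, 0 < e -> exists n0, forall n, (n0 <= n)%N ->
    nc (\sum_(k < n) u k - l) < e.

Lemma has_sumE u l : has_sum u l <-> series u @ \oo --> l.
Proof.
split=> h.
  apply/cvgrPdist_lt => e /Cpos_real[r r0 ->].
  have [n0 hn] := h _ r0; exists n0 => // n /= /hn.
  by rewrite norm_lt ncB /series /= big_mkord.
move=> e e0; have /cvgrPdist_lt/(_ (real_complex R e)) := h.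
rewrite ltcR => /(_ e0)[n0 _ hn]; exists n0 => n /hn /=.
by rewrite norm_lt ncB /series /= big_mkord.
Qed.

End ComplexNorm.
Arguments nc {R} z : simpl never.

Section Sums.
Variable R : realType.
Local Notation C := (Cx R).
Implicit Types (u v : nat -> C) (a b : nat -> R) (e r M : R) (l x y : C).

Lemma has_sum_le u l (x : C) e m0 : has_sum u l ->
  (forall m, (m0 <= m)%N -> nc (\sum_(k < m) u k - x) <= e) -> nc (l - x) <= e.
Proof.
move=> hu hm; apply/ler_addgt0Pr => d d0; have [n0 hn] := hu _ d0.
have h1 := hn (maxn n0 m0) (leq_maxl _ _).
have h2 := hm (maxn n0 m0) (leq_maxr _ _).
rewrite ncB in h1.
rewrite -[l](subrK (\sum_(k < maxn n0 m0) u k)) -addrA.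
by apply: le_trans (ncD _ _) _; lra.
Qed.

Lemma has_sum_uniq u l l' : has_sum u l -> has_sum u l' -> l = l'.
Proof.
move=> h h'; apply/eqP; rewrite -subr_eq0 -nc_eq0 eq_le nc_ge0 andbT.
have -> : nc (l - l') <= 0 => //.
  apply/ler_addgt0Pr => d d0; have [m0 hm] := h' _ d0; rewrite add0r.
  by apply: (has_sum_le h (m0 := m0)) => m /hm/ltW.
Qed.

Lemma has_sum_ext u v l : u =1 v -> has_sum u l -> has_sum v l.
Proof.
move=> uv h e /h[n0 hn]; exists n0 => n /hn.
by under eq_bigr do rewrite uv.
Qed.

Lemma has_sum_fin u n : (forall k, (n <= k)%N -> u k = 0) ->
  has_sum u (\sum_(k < n) u k).
Proof.
move=> u0 e e0; exists n => m nm.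
rewrite -!(big_mkord xpredT u) (@big_cat_nat _ _ _ n) //= addrAC subrr add0r.
by rewrite big_nat_cond big1 ?nc0 // => i /andP[/andP[/u0]].
Qed.

Lemma has_sumD u v l l' : has_sum u l -> has_sum v l' ->
  has_sum (fun k => u k + v k) (l + l').
Proof.
move=> h h' e e0; have e2 : 0 < e / 2 by lra.
have [n0 hn] := h _ e2; have [n0' hn'] := h' _ e2; exists (maxn n0 n0') => n.
rewrite geq_max => /andP[/hn H1 /hn' H2]; rewrite big_split /= opprD addrACA.
by apply: le_lt_trans (ncD _ _) _; lra.
Qed.

Lemma has_sumZ u l x : has_sum u l -> has_sum (fun k => x * u k) (x * l).
Proof.
move=> h e e0; have c0 : 0 < nc x + 1 by have := nc_ge0 x; lra.
have [n0 hn] := h _ (divr_gt0 e0 c0); exists n0 => n /hn.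
rewrite -mulr_sumr -mulrBr ncM ltr_pdivlMr // mulrC; apply: le_lt_trans.
by rewrite ler_wpM2r ?nc_ge0 //; lra.
Qed.

Lemma has_sum0 : has_sum (fun=> 0 : C) 0.
Proof. by move=> e e0; exists 0%N => n _; rewrite big1 // subrr nc0. Qed.

Lemma has_sum_sum I (s : seq I) (u : I -> nat -> C) (l : I -> C) :
  (forall i, has_sum (u i) (l i)) ->
  has_sum (fun k => \sum_(i <- s) u i k) (\sum_(i <- s) l i).
Proof.
move=> h; elim: s => [|i s IH].
  by rewrite big_nil; apply: has_sum_ext has_sum0 => k; rewrite big_nil.
rewrite big_cons; apply: has_sum_ext (has_sumD (h i) IH) => k.
by rewrite big_cons.
Qed.

Lemma has_sumS_inv u l : has_sum u l -> has_sum (fun k => u k.+1) (l - u 0%N).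
Proof.
move=> h e /h[n0 hn]; exists n0 => n nn; have := hn n.+1 (leqW nn).
rewrite big_ord_recl /=; set w := \sum_(i < n) _.
by have -> : u 0%N + w - l = w - (l - u 0%N) by ring.
Qed.

(** Summability of nonnegative terms as a bound on finite sums. Keeping the bound explicit is what
    allows norms of products and composites to be estimated. *)
Definition sbdd (a : nat -> R) (M : R) := forall n, \sum_(k < n) a k <= M.

Lemma sbdd_le a b M : (forall k, a k <= b k) -> sbdd b M -> sbdd a M.
Proof. by move=> h H n; apply: le_trans (H n); apply: ler_sum. Qed.

Lemma sbdd_ge0 a M : sbdd a M -> 0 <= M.
Proof. by move=> /(_ 0%N); rewrite big_ord0. Qed.

(** [K] is an index at which the partial sum is within [e] of the supremum of all partial sums. *)
Lemma sbdd_tail a M e : (forall k, 0 <= a k) -> sbdd a M -> 0 < e ->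
  exists K, forall m, \sum_(K <= k < m) a k <= e.
Proof.
move=> a0 aM e0; pose S : set R := [set \sum_(k < n) a k | n in setT].
have S0 : has_sup S.
  split; first by exists 0, 0%N => //; rewrite big_ord0.
  by exists M => _ [n _ <-].
have [_ [K _ <-] hK] := sup_adherent e0 S0; exists K => m.
have [mK|Km] := leqP m K; first by rewrite big_geq // ltW.
have : \sum_(k < m) a k <= sup S by apply: ub_le_sup; [exact: S0.2|exists m].
rewrite -(big_mkord xpredT a) (@big_cat_nat _ _ _ K) //= 1?ltnW // big_mkord.
by move: hK; set s1 := \sum_(k < K) _; lra.
Qed.

Lemma sbdd_abs u M : sbdd (fun k => nc (u k)) M -> exists l, has_sum u l.
Proof.
move=> uM.
have real_part (w : nat -> R) : (forall k, `|w k| <= nc (u k)) ->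
    cvgn (series w).
  move=> wu; apply: normed_cvg.
  apply: nondecreasing_is_cvgn.
    by apply/nondecreasing_seqP => n; rewrite /= !seriesEnat /= big_nat_recr //= lerDl.
  exists M => _ [n _ <-]; rewrite /normed_series_of /series /= big_mkord.
  by apply: le_trans (uM n); exact: ler_sum.
have /cvg_ex[/= lr hr] := real_part _ (fun k => nc_Re (u k)).
have /cvg_ex[/= li hi] := real_part _ (fun k => nc_Im (u k)).
exists (Complex lr li : C) => e e0; have e2 : 0 < e / 2 by lra.
have /cvgrPdist_lt/(_ _ e2)[n1 _ h1] := hr.
have /cvgrPdist_lt/(_ _ e2)[n2 _ h2] := hi.
exists (maxn n1 n2) => n; rewrite geq_max => /andP[/h1 /= H1 /h2 /= H2].
rewrite ncB.
have -> : (Complex lr li : C) - \sum_(k < n) u k =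
   Complex (lr - series (fun k => complex.Re (u k)) n)
           (li - series (fun k => complex.Im (u k)) n).
  rewrite /series /= !big_mkord.
  have -> : \sum_(k < n) u k =
    Complex (\sum_(k < n) complex.Re (u k)) (\sum_(k < n) complex.Im (u k)) :> C.
    elim/big_rec3 : _ => //= i y1 y2 z _ ->.
    by case: (u i).
  by [].
by apply: le_lt_trans (nc_le_ReIm _ _) _; lra.
Qed.

Lemma has_sum_norm u l M : has_sum u l -> sbdd (fun k => nc (u k)) M -> nc l <= M.
Proof.
move=> h hM; rewrite -[l]subr0; apply: (has_sum_le (m0 := 0%N) h) => m _.
by rewrite subr0; apply: le_trans (nc_sum _ _ _) _.
Qed.

(** Rows beyond [K] contribute at most [e / 4] to [S], and also to every partial sum of the columns,
    uniformly in its length; the finitely many remaining rows converge one by one. *)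
Lemma has_sum_double (u : nat -> nat -> C) (V : nat -> R) M
    (s c : nat -> C) S :
  (forall k, sbdd (fun j => nc (u k j)) (V k)) -> sbdd V M ->
  (forall k, has_sum (u k) (s k)) -> (forall j, has_sum (u^~ j) (c j)) ->
  has_sum s S -> has_sum c S.
Proof.
move=> uV VM us uc sS e e0; have e4 : 0 < e / 4 by lra.
have V0 k : 0 <= V k by exact: sbdd_ge0 (uV k).
have [K hK] := sbdd_tail V0 VM e4.
have h1 : nc (S - \sum_(k < K) s k) <= e / 4.
  apply: (has_sum_le (m0 := K) sS) => m Km.
  rewrite -!(big_mkord xpredT s) (@big_cat_nat _ _ _ K) //= addrAC subrr add0r.
  apply: le_trans (nc_sum _ _ _) _; apply: le_trans (hK m).
  by apply: ler_sum => k _; exact: has_sum_norm (uV k).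
have h2 J : nc (\sum_(j < J) c j - \sum_(k < K) \sum_(j < J) u k j) <= e / 4.
  have hc : has_sum (fun k => \sum_(j < J) u k j) (\sum_(j < J) c j).
    by apply: has_sum_sum => j; exact: uc.
  apply: (has_sum_le (m0 := K) hc) => m Km.
  rewrite -!(big_mkord xpredT (fun k => \sum_(j < J) u k j)).
  rewrite (@big_cat_nat _ _ _ K) //= addrAC subrr add0r.
  apply: le_trans (nc_sum _ _ _) _; apply: le_trans (hK m).
  apply: ler_sum => k _; apply: le_trans (nc_sum _ _ _) _; exact: uV.
have [J0 h3] : exists J0, forall J, (J0 <= J)%N ->
    nc (\sum_(k < K) \sum_(j < J) u k j - \sum_(k < K) s k) < e / 4.
  elim: (K) (e / 4) e4 => [|n IH] d d0.
    by exists 0%N => J _; rewrite !big_ord0 subrr nc0.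
  have d2 : 0 < d / 2 by lra.
  have [J1 H1] := IH _ d2; have [J2 H2] := us n _ d2; exists (maxn J1 J2) => J.
  rewrite geq_max => /andP[/H1 A1 /H2 A2]; rewrite !big_ord_recr /= opprD addrACA.
  by apply: le_lt_trans (ncD _ _) _; lra.
exists J0 => J /h3 H3; have H2 := h2 J; rewrite ncB in h1.
have -> : \sum_(j < J) c j - S = (\sum_(j < J) c j - \sum_(k < K) \sum_(j < J) u k j)
   + ((\sum_(k < K) \sum_(j < J) u k j - \sum_(k < K) s k) + (\sum_(k < K) s k - S)).
  move: (\sum_(j < J) c j) (\sum_(k < K) \sum_(j < J) u k j) (\sum_(k < K) s k) => x y z.
  by ring.
apply: le_lt_trans (ncD _ _) _.
have : nc (\sum_(k < K) \sum_(j < J) u k j - \sum_(k < K) s k + (\sum_(k < K) s k - S)) <= e/4+e/4.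
  by apply: le_trans (ncD _ _) _; lra.
by lra.
Qed.

(** Unit factors [g j] make the column sums real and nonnegative. The sum of their moduli is then
    the modulus of one sum, which is estimated row by row. *)
Lemma sbdd_double (u : nat -> nat -> C) (V : nat -> R) M (c : nat -> C) :
  (forall k, sbdd (fun j => nc (u k j)) (V k)) -> sbdd V M ->
  (forall j, has_sum (u^~ j) (c j)) -> sbdd (fun j => nc (c j)) M.
Proof.
move=> uV VM uc J.
have [g hg] : exists g : nat -> C, forall j, nc (g j) = 1 /\ nc (c j) = nc (g j * c j) /\
   exists r : R, 0 <= r /\ g j * c j = real_complex R r.
  have: forall j, exists g, nc g = 1 /\ nc (c j) = nc (g * c j) /\
     exists r : R, 0 <= r /\ g * c j = real_complex R r.
    move=> j; have [c0|c0] := eqVneq (c j) 0.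
      exists 1; rewrite nc1 mul1r; split=> //; split=> //; exists 0; split=> //.
    exists ((real_complex R (nc (c j)) : C) / c j).
    rewrite ncM ncV nc_real ?nc_ge0 // divff ?nc_eq0 //; split=> //.
    rewrite divfK // nc_real ?nc_ge0 //; split=> //.
    by exists (nc (c j)); split => //; exact: nc_ge0.
  by move=> /choice[g hg]; exists g.
have -> : \sum_(j < J) nc (c j) = nc (\sum_(j < J) g j * c j).
  have /choice[r hr] : forall j, exists r : R, 0 <= r /\ g j * c j = real_complex R r.
    by move=> j; have [_ []] := hg j.
  under [in RHS]eq_bigr do rewrite (hr _).2.
  rewrite -(rmorph_sum (real_complex R)) nc_real; last by apply: sumr_ge0 => i _; have [] := hr i.
  apply: eq_bigr => k _; have [_ [-> _]] := hg k; have [r0 ->] := hr k; by rewrite nc_real.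
have hs : has_sum (fun k => \sum_(j < J) g j * u k j) (\sum_(j < J) g j * c j).
  by apply: has_sum_sum => j; apply: has_sumZ.
apply: (has_sum_norm hs) => n; apply: le_trans (VM n); apply: ler_sum => k _.
apply: le_trans (nc_sum _ _ _) _; apply: le_trans (uV k J).
by apply: ler_sum => j _; rewrite ncM; have [-> _] := hg j; rewrite mul1r.
Qed.

End Sums.

(** * Power series: products and substitution *)

Section PowerSeries.
Variable R : realType.
Local Notation C := (Cx R).
Implicit Types (a b c : nat -> C) (e r s M : R) (l x y p q : C) (f g : C -> C).

(** A bound for the weighted norm sum |a_k| r^k, which is submultiplicative for the Cauchy product
    and implies convergence on the closed disc of radius [r]. *)
Definition pw a r M := sbdd (fun k => nc (a k) * r ^+ k) M.
Definition ev a x l := has_sum (fun k => a k * x ^+ k) l.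
Definition cauchy_prod a b n : C := \sum_(i < n.+1) a i * b (n - i)%N.
Definition delta0 n : C := if n is 0%N then 1 else 0.
Definition convpow a k := iter k (cauchy_prod a) delta0.
Lemma convpowS a k : convpow a k.+1 = cauchy_prod a (convpow a k). Proof. by []. Qed.

Lemma sum_shift (V : zmodType) (u : nat -> V) i n :
  \sum_(m < n) (if (i <= m)%N then u (m - i)%N else 0) = \sum_(m < n - i) u m.
Proof.
elim: n => [|n IH]; first by rewrite !big_ord0.
rewrite big_ord_recr /= {}IH; case: leqP => h; first by rewrite subSn // big_ord_recr.
by rewrite addr0; have -> : (n - i = 0)%N; [lia|have -> : (n.+1 - i = 0)%N by lia].
Qed.

Lemma sum_le_widen (A : nat -> R) n m : (forall k, 0 <= A k) -> (n <= m)%N ->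
  \sum_(k < n) A k <= \sum_(k < m) A k.
Proof.
move=> A0 nm; rewrite -!(big_mkord xpredT A) [X in _ <= X](@big_cat_nat _ _ _ n) //=.
by rewrite lerDl sumr_ge0.
Qed.

(** Stated over any ring, because it serves for norms of power series and again for Taylor
    polynomials with values in the Grassmann algebra. *)
Lemma sum_triangle (V : pzRingType) (A B : nat -> V) n :
  \sum_(m < n) \sum_(i < m.+1) A i * B (m - i)%N =
  \sum_(i < n) A i * \sum_(m < n - i) B m.
Proof.
under eq_bigr => m _ do rewrite (big_ord_widen n (fun i => A i * B (m - i)%N) (ltn_ord m)).
rewrite (exchange_big_dep xpredT) //=; apply: eq_bigr => i _.
by rewrite -mulr_sumr -sum_shift big_mkcond; congr (_ * _); apply: eq_bigr => m _; rewrite ltnS.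
Qed.

Lemma triangle_le (A B : nat -> R) n :
  (forall k, 0 <= A k) -> (forall k, 0 <= B k) ->
  \sum_(m < n) \sum_(i < m.+1) A i * B (m - i)%N <=
  (\sum_(i < n) A i) * (\sum_(i < n) B i).
Proof.
move=> A0 B0; rewrite sum_triangle mulr_suml; apply: ler_sum => i _.
by rewrite ler_wpM2l // sum_le_widen // leq_subr.
Qed.

Lemma tnorm_conv a b r n : 0 <= r ->
  \sum_(k < n) nc (cauchy_prod a b k) * r ^+ k <=
  (\sum_(k < n) nc (a k) * r ^+ k) * (\sum_(k < n) nc (b k) * r ^+ k).
Proof.
move=> r0.
apply: le_trans (triangle_le (A := fun k => nc (a k) * r ^+ k)
  (B := fun k => nc (b k) * r ^+ k) _ _ _); last 2 first.
- by move=> k; rewrite mulr_ge0 ?nc_ge0 ?exprn_ge0.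
- by move=> k; rewrite mulr_ge0 ?nc_ge0 ?exprn_ge0.
apply: ler_sum => m _; apply: le_trans (ler_wpM2r _ (nc_sum _ _ _)) _.
  by rewrite exprn_ge0.
rewrite mulr_suml; apply: ler_sum => i _; rewrite ncM.
have im : (i <= m)%N by rewrite -ltnS.
have -> : r ^+ m = r ^+ i * r ^+ (m - i) by rewrite -exprD subnKC.
by rewrite mulrACA.
Qed.

Lemma pw_ge0 a r k : 0 <= r -> 0 <= nc (a k) * r ^+ k.
Proof. by move=> r0; rewrite mulr_ge0 ?nc_ge0 ?exprn_ge0. Qed.

Lemma pw_conv a b r M M' : 0 <= r -> pw a r M -> pw b r M' -> pw (cauchy_prod a b) r (M * M').
Proof.
move=> r0 ha hb n; apply: le_trans (tnorm_conv _ _ _ r0) _.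
by apply: ler_pM => //; apply: sumr_ge0 => k _; exact: pw_ge0.
Qed.

Lemma pw_ev_bdd a r M x : 0 <= r -> pw a r M -> nc x <= r ->
  sbdd (fun k => nc (a k * x ^+ k)) M.
Proof.
move=> r0 ha xr; apply: sbdd_le ha => k; rewrite ncM ncX.
by rewrite ler_wpM2l ?nc_ge0 // lerXn2r ?nnegrE ?nc_ge0.
Qed.

Lemma pw_ev a r M x : 0 <= r -> pw a r M -> nc x <= r -> exists l, ev a x l.
Proof. by move=> r0 ha xr; apply: sbdd_abs (pw_ev_bdd r0 ha xr). Qed.

Lemma pw_le a r r' M : 0 <= r' <= r -> pw a r M -> pw a r' M.
Proof.
move=> /andP[r0 rr]; apply: sbdd_le => k; rewrite ler_wpM2l ?nc_ge0 //.
by rewrite lerXn2r ?nnegrE // (le_trans r0).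
Qed.

Lemma has_sum_shift (u : nat -> C) l i : has_sum u l ->
  has_sum (fun m => if (i <= m)%N then u (m - i)%N else 0) l.
Proof.
move=> h e /h[n0 hn]; exists (n0 + i)%N => n nn.
by rewrite sum_shift; apply: hn; lia.
Qed.

(** The terms of the product series are the column sums of the triangular array [u], whose rows sum
    to [a k * x ^+ k * l']; the summations may be exchanged. *)
Lemma ev_conv a b r M M' x l l' : 0 <= r -> pw a r M -> pw b r M' -> nc x <= r ->
  ev a x l -> ev b x l' -> ev (cauchy_prod a b) x (l * l').
Proof.
move=> r0 ha hb xr hl hl'.
pose u k j := if (k <= j)%N then a k * x ^+ k * (b (j - k)%N * x ^+ (j - k)) else 0.
have ax := pw_ev_bdd r0 ha xr; have bx := pw_ev_bdd r0 hb xr.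
apply: (has_sum_double (u := u) (V := fun k => nc (a k * x ^+ k) * M') (M := M * M')
   (s := fun k => a k * x ^+ k * l')).
- move=> k n; apply: le_trans (_ : nc (a k * x ^+ k) * \sum_(j < n - k) nc (b j * x ^+ j) <= _).
    rewrite -(sum_shift (fun j => nc (b j * x ^+ j))) mulr_sumr; apply: ler_sum => j _; rewrite /u.
    by case: ifP => _; rewrite ?nc0 ?mulr0 // ncM.
  by rewrite ler_wpM2l ?nc_ge0.
- move=> n; rewrite -mulr_suml ler_wpM2r ?(sbdd_ge0 hb) //.
- move=> k; have := has_sum_shift k (has_sumZ (a k * x ^+ k) hl').
  by apply: has_sum_ext => j; rewrite /u; case: ifP.
- move=> j; have -> : cauchy_prod a b j * x ^+ j = \sum_(k < j.+1) u k j.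
    rewrite /cauchy_prod mulr_suml; apply: eq_bigr => k _.
    have kj : (k <= j)%N by rewrite -ltnS.
    have -> : x ^+ j = x ^+ k * x ^+ (j - k) by rewrite -exprD subnKC.
    rewrite /u kj.
    by rewrite mulrACA.
  by apply: has_sum_fin => k jk; rewrite /u leqNgt jk.
- have := has_sumZ l' hl; rewrite mulrC; apply: has_sum_ext => k.
  by rewrite mulrC.
Qed.

Lemma pw_delta r : pw delta0 r 1.
Proof.
move=> [|n]; first by rewrite big_ord0.
rewrite big_ord_recl big1 => [|i _]; last first.
  by rewrite nc0 mul0r.
by rewrite addr0 nc1 mul1r.
Qed.

Lemma ev_delta x : ev delta0 x 1.
Proof.
have := @has_sum_fin _ (fun k => delta0 k * x ^+ k) 1 _.
rewrite big_ord1 /delta0 /= expr0 mulr1; apply=> -[//|k] _.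
by rewrite mul0r.
Qed.

Lemma pw_convpow a r M k : 0 <= r -> pw a r M -> pw (convpow a k) r (M ^+ k).
Proof.
move=> r0 ha; elim: k => [|k IH]; first exact: pw_delta.
by rewrite exprS; apply: pw_conv.
Qed.

Lemma ev_convpow a r M x l k : 0 <= r -> pw a r M -> nc x <= r -> ev a x l ->
  ev (convpow a k) x (l ^+ k).
Proof.
move=> r0 ha xr al; elim: k => [|k IH]; first exact: ev_delta.
by rewrite exprS; apply: (ev_conv r0 ha (pw_convpow k r0 ha)).
Qed.

(** The array to be summed has as rows the multiples [b k] of the powers of the series [a], with
    norms at most [nc (b k) * s ^+ k]. The constant term of [a] is arbitrary, so that recentring a
    series is also a case of substitution. *)
Lemma pw_comp a b r s M M' : 0 < r -> pw a r M -> pw b s M' -> M <= s ->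
  exists c, [/\ forall j, has_sum (fun k => b k * convpow a k j) (c j),
    pw c r M' & forall x l l', nc x <= r -> ev a x l -> ev b l l' -> ev c x l'].
Proof.
move=> r0 ha hb Ms; have M0 := sbdd_ge0 ha.
have rk k : nc (real_complex R (r ^+ k)) = r ^+ k by rewrite nc_real ?exprn_ge0 ?ltW.
have hV k : sbdd (fun j => nc (b k) * (nc (convpow a k j) * r ^+ j)) (nc (b k) * s ^+ k).
  move=> n; rewrite -mulr_sumr ler_wpM2l ?nc_ge0 //.
  apply: le_trans (pw_convpow k (ltW r0) ha n) _.
  by rewrite lerXn2r ?nnegrE // (le_trans M0).
have /choice[c hc] : forall j, exists l, has_sum (fun k => b k * convpow a k j) l.
  move=> j; apply: (@sbdd_abs _ _ (M' / r ^+ j)) => n.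
  rewrite ler_pdivlMr ?exprn_gt0 // mulr_suml; apply: le_trans (hb n).
  apply: ler_sum => k _; rewrite ncM -mulrA; apply: le_trans (hV k j.+1).
  by rewrite big_ord_recr /= lerDr sumr_ge0 // => i _; rewrite mulr_ge0 ?nc_ge0 ?pw_ge0 // ltW.
exists c; split=> //.
- have := @sbdd_double _ (fun k j => b k * convpow a k j * real_complex R (r ^+ j))
     (fun k => nc (b k) * s ^+ k) M' (fun j => c j * real_complex R (r ^+ j)).
  move=> /(_ _ hb _)H n; apply: le_trans (H _ _ n).
  + by apply: ler_sum => k _; rewrite ncM rk.
  + by move=> k; apply: sbdd_le (hV k) => j; rewrite !ncM rk mulrA.
  + move=> j; have := has_sumZ (real_complex R (r ^+ j)) (hc j).
    by rewrite mulrC; apply: has_sum_ext => k; rewrite mulrC.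
- move=> x l l' xr al bl.
  apply: (has_sum_double (u := fun k j => b k * convpow a k j * x ^+ j)
     (V := fun k => nc (b k) * s ^+ k) (M := M') (s := fun k => b k * l ^+ k)) => //.
  + move=> k; apply: sbdd_le (hV k) => j; rewrite !ncM ncX -mulrA.
    by rewrite !ler_wpM2l ?nc_ge0 // lerXn2r ?nnegrE ?nc_ge0 // ltW.
  + move=> k; have := has_sumZ (b k) (ev_convpow k (ltW r0) ha xr al).
    by apply: has_sum_ext => j; rewrite mulrA.
  + move=> j; have := has_sumZ (x ^+ j) (hc j).
    by rewrite mulrC; apply: has_sum_ext => k; rewrite mulrC.
Qed.

End PowerSeries.

(** * Functions represented by power series, and their derivatives *)

Section Analytic.
Variable R : realType.
Local Notation C := (Cx R).
Implicit Types (a b c : nat -> C) (e r s M : R) (l x y p q : C) (f g : C -> C).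

Definition rep f p a := exists r M, [/\ 0 < r, pw a r M &
  forall x, nc x <= r -> ev a x (f (p + x))].

Lemma geom_half n : \sum_(k < n) (2^-1) ^+ k <= 2 :> R.
Proof.
have -> : \sum_(k < n) (2^-1) ^+ k = 2 - 2 * (2^-1) ^+ n :> R.
  elim: n => [|n IH]; first by rewrite big_ord0 expr0 mulr1 subrr.
  by rewrite big_ord_recr /= IH exprS; field.
have : 0 <= (2^-1 : R) ^+ n by rewrite exprn_ge0.
by lra.
Qed.

Lemma has_sum_term_bdd (u : nat -> C) l : has_sum u l -> exists B, forall k, nc (u k) <= B.
Proof.
move=> /(_ 1 ltr01)[n0 h]; exists (2 + \sum_(k < n0) nc (u k)) => k.
have s0 : 0 <= \sum_(k < n0) nc (u k) by apply: sumr_ge0 => i _; exact: nc_ge0.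
have [kn|nk] := ltnP k n0.
  rewrite (bigD1 (Ordinal kn)) //= addrCA lerDl addr_ge0 // sumr_ge0 // => i _.
  exact: nc_ge0.
have h1 := h _ nk; have h2 := h k.+1 (leqW nk).
rewrite big_ord_recr /= in h2.
have -> : u k = (\sum_(i < k) u i + u k - l) - (\sum_(i < k) u i - l) by ring.
by apply: le_trans (ncD _ _) _; rewrite ncN; lra.
Qed.

(** Convergence at radius [e / 2] bounds the terms of the series there; at half that radius they
    have a geometric majorant. Pointwise convergence is thus turned into a bound [pw]. *)
Lemma holoP f p : holo_at f p <-> exists a, rep f p a.
Proof.
split=> [[a]|[a [r [M [r0 ha he]]]]].
  move=> /nbhs_nc[e e0 h]; exists a.
  have {}h x : nc x < e -> ev a x (f (p + x)).
    by move=> /h/has_sumE; apply: has_sum_ext => k; rewrite addrAC subrr add0r.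
  have r2 : nc (real_complex R (e / 2) : C) = e / 2 by rewrite nc_real // ltW ?divr_gt0.
  have [|B hB] := has_sum_term_bdd (h (real_complex R (e / 2)) _); first by rewrite r2; lra.
  exists (e / 2 * 2^-1), (B * 2); split; first by lra.
    have B0 : 0 <= B by apply: le_trans (hB 0%N); exact: nc_ge0.
    move=> n; apply: le_trans (_ : \sum_(k < n) B * (2^-1) ^+ k <= _).
      apply: ler_sum => k _; rewrite exprMn mulrA ler_wpM2r ?exprn_ge0 //.
      by have := hB k; rewrite ncM ncX r2.
    by rewrite -mulr_sumr ler_wpM2l // geom_half.
  by move=> x xr; apply: h; lra.
exists a; apply/nbhs_nc; exists r => // x /ltW/he h; apply/has_sumE.
by apply: has_sum_ext h => k; rewrite addrAC subrr add0r.
Qed.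

Lemma rep0 f p a : rep f p a -> a 0%N = f p.
Proof.
move=> [r [M [r0 _ h]]]; have := h 0; rewrite nc0 addr0 => /(_ (ltW r0)) h1.
apply: has_sum_uniq h1; have := @has_sum_fin _ (fun k => a k * 0 ^+ k) 1.
rewrite big_ord1 expr0 mulr1; apply=> -[//|k] _.
by rewrite expr0n mulr0.
Qed.

Lemma ev_tail a x l : x != 0 -> ev a x l -> ev (fun k => a k.+1) x ((l - a 0%N) / x).
Proof.
move=> x0 h; rewrite mulrC.
have := has_sumZ x^-1 (has_sumS_inv h); rewrite expr0 mulr1.
by apply: has_sum_ext => k; rewrite exprS mulrCA mulKf.
Qed.

Lemma pw_tail a r M : 0 < r -> pw a r M -> pw (fun k => a k.+1) r (M / r).
Proof.
move=> r0 ha n; rewrite ler_pdivlMr //; have := ha n.+1.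
rewrite big_ord_recl /=; apply: le_trans; rewrite mulr_suml.
apply: le_trans (_ : \sum_(i < n) nc (a (lift ord0 i)) * r ^+ lift ord0 i <= _).
  by apply: ler_sum => k _; rewrite /= /bump /= add1n exprSr mulrA.
by rewrite lerDr pw_ge0 // ltW.
Qed.

(** Without a constant term each term contains a positive power of the radius, and
    [t ^+ k.+1 <= t]. *)
Lemma pw_small a r M t : 0 <= t <= 1 -> 0 < r -> a 0%N = 0 -> pw a r M -> pw a (t * r) (t * M).
Proof.
move=> /andP[t0 t1] r0 a0 ha [|n].
  by rewrite big_ord0 mulr_ge0 // (sbdd_ge0 ha).
rewrite big_ord_recl a0 nc0 mul0r add0r.
apply: le_trans (ler_wpM2l t0 (ha n.+1)); rewrite big_ord_recl a0 nc0 mul0r add0r.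
rewrite mulr_sumr; apply: ler_sum => k _; rewrite mulrCA ler_wpM2l ?nc_ge0 //.
rewrite lift0 exprMn ler_wpM2r ?exprn_ge0 ?(ltW r0) // exprS ler_piMr //.
exact: exprn_ile1.
Qed.

Lemma rep_comp f g p a b : rep g p a -> rep f (g p) b -> exists c, rep (f \o g) p c.
Proof.
move=> hg [s [Mb [s0 hb fb]]]; have a0 := rep0 hg.
case: hg => [r [M [r0 ha ga]]].
pose a' k := if k is 0%N then 0 else a k.
have ha' : pw a' r M.
  by apply: sbdd_le ha => -[|k] //; rewrite /a' nc0 mul0r pw_ge0 // ltW.
have M1 : 0 < M + 1 by have := sbdd_ge0 ha; lra.
(* Chosen so that [t * M <= s]: on the disc of radius [t * r] the inner series without its constant
   term stays within the radius of the outer one. The 1 added to [M] avoids a division by 0. *)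
pose t := Num.min 1 (s / (M + 1)).
have t0 : 0 < t by rewrite lt_min ltr01 divr_gt0.
have t1 : t <= 1 by rewrite ge_min lexx.
have ts : t * M <= s.
  apply: le_trans (_ : s / (M + 1) * M <= _).
    by rewrite ler_wpM2r ?(sbdd_ge0 ha) // ge_min lexx orbT.
  by rewrite mulrAC ler_pdivrMr // ler_wpM2l ?ltW //; lra.
have ht : 0 <= t <= 1 by rewrite ltW.
have tr : 0 < t * r by rewrite mulr_gt0.
have [c [hc1 hc2 hc3]] := pw_comp tr (pw_small ht r0 (erefl : a' 0%N = 0) ha') hb ts.
exists c, (t * r), Mb; split=> // x xt.
have a'x : ev a' x (g (p + x) - g p).
  have g1 : ev a x (g (p + x)).
    by apply: ga; apply: le_trans xt _; rewrite ler_piMl // ltW.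
  have g2 : has_sum (fun k => if k is 0%N then - g p else 0) (- g p).
    have := @has_sum_fin _ (fun k => if k is 0%N then - g p else 0) 1%N.
    by rewrite big_ord1; apply=> -[].
  apply: has_sum_ext (has_sumD g1 g2) => -[|k]; rewrite /a' ?addr0 //.
  by rewrite expr0 !mulr1 a0 subrr.
apply: (hc3 _ _ _ xt a'x).
have := fb (g (p + x) - g p); rewrite [g p + _]addrC subrK; apply.
by apply: le_trans ts; apply: (has_sum_norm a'x); apply: pw_ev_bdd (ltW tr) (pw_small ht r0 (erefl : a' 0%N = 0) ha') xt.
Qed.

(** The new series is obtained by substituting [h + x], whose norm at radius [r - nc h] is [r]. Its
    linear coefficient is the termwise derivative at [h]; comparing the two gives [rep_der]. *)
Lemma rep_recenter f p a : rep f p a -> exists2 r, 0 < r & forall h, nc h < r ->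
  exists2 c, rep f (p + h) c & ev (fun k => k.+1%:R * a k.+1) h (c 1%N).
Proof.
move=> [r [M [r0 ha fa]]]; exists r => // h hr.
pose b k : C := if k is 0%N then h else if k is 1%N then 1 else 0.
have rho0 : 0 < r - nc h by rewrite subr_gt0.
have hb : pw b (r - nc h) r.
  move=> n; apply: le_trans (_ : \sum_(k < n.+2) nc (b k) * (r - nc h) ^+ k <= _).
    apply: (@sum_le_widen _ (fun k => nc (b k) * (r - nc h) ^+ k)); last by lia.
    by move=> k; apply: pw_ge0; exact: ltW.
  rewrite big_ord_recl big_ord_recl big1 => [|i _]; last by rewrite nc0 mul0r.
  rewrite /b /= /bump /= nc1 expr0 expr1; lra.
have [c [hc1 hc2 hc3]] := pw_comp rho0 hb ha (lexx r).
exists c.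
  exists (r - nc h), M; split=> // x xr.
  apply: (hc3 x (h + x)) => //.
    have := @has_sum_fin _ (fun k => b k * x ^+ k) 2.
    rewrite big_ord_recl big_ord1 /b /= expr0 mulr1 mul1r; apply=> -[|[|k]] //.
    by rewrite mul0r.
  by rewrite -addrA; apply: fa; apply: le_trans (ncD _ _) _; lra.
have c0 k : convpow b k 0%N = h ^+ k.
  elim: k => [|k IH]; first by rewrite expr0.
  by rewrite convpowS /cauchy_prod big_ord1 IH exprS.
have c1 k : convpow b k.+1 1%N = k.+1%:R * h ^+ k.
  elim: k => [|k IH].
    by rewrite [LHS]big_ord_recl big_ord1 /= ?mulr0 ?add0r ?mulr1 ?expr0 ?mulr1.
  rewrite convpowS /cauchy_prod big_ord_recl big_ord1 subn0 lift0 subnn IH c0 /= mul1r.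
  by rewrite -[k.+2]addn1 natrD mulrDl mul1r exprS mulrCA.
have := has_sumS_inv (hc1 1%N).
have -> : convpow b 0 1%N = 0 by [].
rewrite mulr0 subr0; apply: has_sum_ext => k.
by rewrite c1 mulrCA mulrA.
Qed.

(** After removing the leading term twice, the difference quotient minus [a 1] is [h] times a series
    of modulus at most [M / r / r]. *)
Lemma rep_is_derive f p a : rep f p a -> is_derive p 1 (f : C -> C^o) (a 1%N).
Proof.
move=> hf; have a0 := rep0 hf; case: hf => [r [M [r0 ha fa]]].
have H : (fun h : C => h^-1 *: ((f (h *: 1 + p) : C^o) - f p)) @ 0^' --> (a 1%N : C^o).
  apply/cvgrPdist_lt => e /Cpos_real[d d0 ->].
  pose K := M / r / r + 1.
  have K0 : 0 < K by rewrite ltr_wpDl // !divr_ge0 ?(sbdd_ge0 ha) // ltW.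
  near=> h; have h0 : h != 0 by near: h; exact: nbhs_dnbhs_neq.
  rewrite distrC norm_lt.
  have hr : nc h <= r by near: h; apply: nbhs_dnbhs; apply/nbhs_nc;
    exists r => // x xr; rewrite add0r ltW.
  have hd : nc h < d / K by near: h; apply: nbhs_dnbhs; apply/nbhs_nc;
    exists (d / K); rewrite ?divr_gt0 // => x xr; rewrite add0r.
  have e1 := ev_tail h0 (fa h hr); have e2 := ev_tail h0 e1.
  have hb := has_sum_norm e2 (pw_ev_bdd (ltW r0) (pw_tail r0 (pw_tail r0 ha)) hr).
  rewrite -[h *: 1]/(h * 1) mulr1 [h + p]addrC -[_ *: _]/(_ * _) -a0 mulrC.
  move: hb; set w := (f (p + h) - a 0%N) / h - a 1%N; rewrite ncM ncV.
  rewrite ler_pdivrMr ?nc_gt0 // => hb; apply: le_lt_trans hb _.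
  apply: le_lt_trans (_ : K * nc h < _); last by rewrite mulrC -ltr_pdivlMr.
  by rewrite ler_wpM2r ?nc_ge0 // /K lerDl.
have -> : a 1%N = 'D_1 (f : C -> C^o) p by symmetry; apply: cvg_lim.
apply: derivableP; apply/cvg_ex; exists (a 1%N : C^o); exact: H.
Unshelve. all: by end_near.
Qed.

(** The lock keeps conversion from unfolding derivatives. *)
Fact der_key : unit. Proof. by []. Qed.
Definition der f : C -> C := locked_with der_key (derive1 (f : C -> C^o)).
Lemma derE f : der f = derive1 (f : C -> C^o). Proof. exact: locked_withE. Qed.

Lemma rep_der1 f p a : rep f p a -> der f p = a 1%N.
Proof. by move=> /rep_is_derive h; rewrite derE derive1E; apply: derive_val. Qed.

Lemma natr_le_exp2 n : n.+1%:R * (2^-1) ^+ n <= 2 :> R.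
Proof.
rewrite -(ler_pM2r (_ : 0 < 2 ^+ n)) ?exprn_gt0 // -mulrA -exprMn mulVf // expr1n mulr1.
by rewrite -exprS -natrX ler_nat ltnW // ltn_expl.
Qed.

(** Halving the radius absorbs the factors [k.+1], by [natr_le_exp2]; that the series sums to the
    derivative is read off from the recentred series. *)
Lemma rep_der f p a : rep f p a -> rep (der f) p (fun k => k.+1%:R * a k.+1).
Proof.
move=> hf; have [r1 r10 hr1] := rep_recenter hf; case: hf => [r [M [r0 ha fa]]].
pose s := Num.min (r / 2) (r1 / 2).
have s0 : 0 < s by rewrite lt_min !divr_gt0.
have sr : s <= r * 2^-1 by rewrite ge_min lexx.
have sr1 : s <= r1 / 2 by rewrite ge_min lexx orbT.
exists s, (M / r * 2); split=> //.
  apply: (@pw_le _ _ (r * 2^-1)); first by rewrite sr ltW.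
  move=> n; rewrite [M / r * 2]mulrC.
  apply: le_trans (_ : 2 * \sum_(k < n) nc (a k.+1) * r ^+ k <= _); last first.
    by rewrite ler_wpM2l // (pw_tail r0 ha n).
  rewrite mulr_sumr; apply: ler_sum => k _; rewrite ncM nc_nat exprMn.
  have := natr_le_exp2 k; have := nc_ge0 (a k.+1); have : 0 <= r ^+ k by rewrite exprn_ge0 // ltW.
  move: (nc _) (r ^+ k) ((2^-1) ^+ k) (k.+1%:R) => A B D E B0 A0 DE.
  suff -> : E * A * (B * D) = E * D * (A * B) by rewrite ler_wpM2r // mulr_ge0.
  by ring.
move=> h hs; have [|c rc ec] := hr1 h; first by lra.
by rewrite (rep_der1 rc).
Qed.

Lemma near_rep f g p a : (\forall q \near p, f q = g q) -> rep f p a -> rep g p a.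
Proof.
move=> /nbhs_nc[e e0 h] [r [M [r0 ha fa]]].
pose s := Num.min r (e / 2).
have s0 : 0 < s by rewrite lt_min r0 divr_gt0.
have sr : s <= r by rewrite ge_min lexx.
have se : s <= e / 2 by rewrite ge_min lexx orbT.
exists s, M; split=> //; first by apply: pw_le ha; rewrite sr ltW.
by move=> x xs; rewrite -h; [apply: fa|]; lra.
Qed.

End Analytic.

(** * Algebra, chain rule and primitives of holomorphic functions *)

Section HoloCalculus.
Variable R : realType.
Local Notation C := (Cx R).
Implicit Types (a b c : nat -> C) (e r s M : R) (l x y p q : C) (f g : C -> C).

Lemma holo_ext f g p : (\forall q \near p, f q = g q) -> holo_at f p -> holo_at g p.
Proof. by move=> h /holoP[a /(near_rep h) ra]; apply/holoP; exists a. Qed.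

Lemma rep_min f p a r M s : 0 < s <= r -> pw a r M ->
  (forall x, nc x <= r -> ev a x (f (p + x))) ->
  pw a s M /\ (forall x, nc x <= s -> ev a x (f (p + x))).
Proof.
move=> /andP[s0 sr] ha fa; split; first by apply: pw_le ha; rewrite ltW.
by move=> x xs; apply: fa; lra.
Qed.

Lemma rep_cst (k : C) p : rep (fun=> k) p (fun n => if n is 0%N then k else 0).
Proof.
exists 1, (nc k); split=> //.
  move=> [|n]; first by rewrite big_ord0 nc_ge0.
  by rewrite big_ord_recl big1 => [|i _]; rewrite ?nc0 ?mul0r // expr0 mulr1 addr0.
move=> x _; have := @has_sum_fin _ (fun n => (if n is 0%N then k else 0) * x ^+ n) 1.
by rewrite big_ord1 expr0 mulr1; apply=> -[//|n] _; rewrite mul0r.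
Qed.

Lemma rep_id p : rep id p (fun n => if n is 0%N then p else if n is 1%N then 1 else 0).
Proof.
exists 1, (nc p + 1); split=> //.
  move=> n; apply: le_trans (@sum_le_widen _ (fun k => nc (if k is 0%N then p else if k is 1%N then 1 else 0) * 1 ^+ k) n n.+2 _ _) _.
  - by move=> k; rewrite mulr_ge0 ?nc_ge0 ?exprn_ge0.
  - by lia.
  rewrite big_ord_recl big_ord_recl big1 => [|i _]; last by rewrite nc0 mul0r.
  by rewrite nc1 addr0 !expr1n !mulr1.
move=> x _; have := @has_sum_fin _ (fun n => (if n is 0%N then p else if n is 1%N then 1 else 0) * x ^+ n) 2.
rewrite big_ord_recl big_ord1 expr0 mulr1 mul1r expr1.
by apply=> -[|[|n]] // _; rewrite mul0r.
Qed.

Lemma rep_add f g p a b : rep f p a -> rep g p b ->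
  rep (fun q => f q + g q) p (fun k => a k + b k).
Proof.
move=> [r [M [r0 ha fa]]] [r' [M' [r0' hb gb]]].
pose s := Num.min r r'.
have s0 : 0 < s by rewrite lt_min r0 r0'.
have hs : 0 < s <= r by rewrite s0 ge_min lexx.
have hs' : 0 < s <= r' by rewrite s0 ge_min lexx orbT.
have [ha' fa'] := rep_min hs ha fa.
have [hb' gb'] := rep_min hs' hb gb.
exists s, (M + M'); split=> //.
  move=> n; apply: le_trans (lerD (ha' n) (hb' n)); rewrite -big_split /=.
  by apply: ler_sum => k _; rewrite -mulrDl ler_wpM2r ?exprn_ge0 ?(ltW s0) ?ncD.
move=> x xs; apply: has_sum_ext (has_sumD (fa' x xs) (gb' x xs)) => k.
by rewrite mulrDl.
Qed.

Lemma rep_mul f g p a b : rep f p a -> rep g p b ->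
  rep (fun q => f q * g q) p (cauchy_prod a b).
Proof.
move=> [r [M [r0 ha fa]]] [r' [M' [r0' hb gb]]].
pose s := Num.min r r'.
have s0 : 0 < s by rewrite lt_min r0 r0'.
have hs : 0 < s <= r by rewrite s0 ge_min lexx.
have hs' : 0 < s <= r' by rewrite s0 ge_min lexx orbT.
have [ha' fa'] := rep_min hs ha fa.
have [hb' gb'] := rep_min hs' hb gb.
exists s, (M * M'); split=> //; first by apply: pw_conv => //; apply: ltW.
by move=> x xs; apply: (ev_conv (ltW s0) ha' hb' xs); [apply: fa'|apply: gb'].
Qed.

Lemma holo_cst (k : C) p : holo_at (fun=> k) p.
Proof. by apply/holoP; eexists; exact: rep_cst. Qed.

Lemma holo_id p : holo_at (fun q : C => q) p.
Proof. by apply/holoP; eexists; exact: rep_id. Qed.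

Lemma holoD f g p : holo_at f p -> holo_at g p -> holo_at (fun q => f q + g q) p.
Proof.
by move=> /holoP[a ha] /holoP[b hb]; apply/holoP; eexists; apply: rep_add ha hb.
Qed.

Lemma holoM f g p : holo_at f p -> holo_at g p -> holo_at (fun q => f q * g q) p.
Proof.
by move=> /holoP[a ha] /holoP[b hb]; apply/holoP; eexists; apply: rep_mul ha hb.
Qed.

Lemma holo_comp f g p : holo_at g p -> holo_at f (g p) -> holo_at (f \o g) p.
Proof.
by move=> /holoP[a ha] /holoP[b hb]; apply/holoP; apply: rep_comp ha hb.
Qed.

Lemma holo_near f p : holo_at f p -> \forall q \near p, holo_at f q.
Proof.
move=> /holoP[a /rep_recenter[r r0 h]]; apply/nbhs_nc; exists r => // x /h[c rc _].
by apply/holoP; exists c.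
Qed.

(** A geometric series: removing its first term multiplies the sum by [- (x / p)], and this equation
    determines the sum. *)
Lemma rep_inv p : p != 0 -> rep (fun q => q^-1) p (fun k => (-1) ^+ k / p ^+ k.+1).
Proof.
move=> p0; pose b k : C := (-1) ^+ k / p ^+ k.+1; change (rep (fun q : C => q^-1) p b).
have np : 0 < nc p by rewrite nc_gt0.
have hb : pw b (nc p / 2) (2 / nc p).
  move=> n; apply: le_trans (_ : \sum_(k < n) (nc p)^-1 * (2^-1) ^+ k <= _).
    apply: ler_sum => k _; rewrite /b ncM ncV !ncX ncN nc1 expr1n mul1r exprS.
    by rewrite exprMn invfM mulrA mulfVK // expf_neq0 // gt_eqF.
  by rewrite -mulr_sumr mulrC ler_wpM2r ?invr_ge0 ?(ltW np) // geom_half.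
have r0 : 0 < nc p / 2 by rewrite divr_gt0.
exists (nc p / 2), (2 / nc p); split=> // x xr.
have [l hl] := pw_ev (ltW r0) hb xr.
have e1 : l - b 0%N * x ^+ 0 = - (x / p) * l.
  apply: has_sum_uniq (has_sumS_inv hl) _.
  apply: has_sum_ext (has_sumZ (- (x / p)) hl) => k.
  rewrite /b [_ ^+ k.+2]exprS [x ^+ k.+1]exprS [(-1) ^+ k.+1]exprS.
  field; apply/andP; split=> //; exact: expf_neq0.
have px : p + x != 0.
  apply/eqP => h; have xp : x = - p by rewrite -(addKr p x) h addr0.
  by move: xr; rewrite xp ncN; lra.
suff -> : (p + x)^-1 = l by [].
apply: (mulfI px); rewrite divff //.
move: e1; rewrite /b expr0 mulr1 div1r expr1 => /(congr1 (fun z => p * z)).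
rewrite mulrBr divff // => h.
have : p * (- (x / p) * l) = - (x * l) by field.
move=> h2; rewrite h2 in h; rewrite mulrDl; apply/eqP.
by rewrite eq_sym addrC -[x * l]opprK -h opprB subrK.
Qed.

Lemma holoV f p : holo_at f p -> f p != 0 -> holo_at (fun q => (f q)^-1) p.
Proof.
move=> hf f0; apply: (holo_comp (f := fun q => q^-1) hf).
by apply/holoP; eexists; exact: rep_inv.
Qed.

Lemma holo_is_derive f p : holo_at f p -> is_derive p 1 (f : C -> C^o) (der f p).
Proof.
by move=> /holoP[a ha]; rewrite (rep_der1 ha); exact: rep_is_derive.
Qed.

Lemma holo_der f p : holo_at f p -> holo_at (der f) p.
Proof. by move=> /holoP[a /rep_der ha]; apply/holoP; eexists; exact: ha. Qed.

Lemma holo_cts f p : holo_at f p -> {for p, continuous f}.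
Proof.
move=> /holo_is_derive[h _]; apply: differentiable_continuous.
by apply/derivable1_diffP.
Qed.

Lemma near_der f g p : (\forall q \near p, f q = g q) -> der f p = der g p.
Proof. by move=> h; rewrite !derE !derive1E; apply: near_eq_derive. Qed.

Lemma near_near (P : C -> Prop) p : (\forall q \near p, P q) ->
  \forall q \near p, \forall q' \near q, P q'.
Proof. by move=> h; apply: nbhs_interior. Qed.

Lemma derD f g p : holo_at f p -> holo_at g p ->
  der (fun q => f q + g q) p = der f p + der g p.
Proof.
move=> /holoP[a ha] /holoP[b hb].
by rewrite (rep_der1 ha) (rep_der1 hb) (rep_der1 (rep_add ha hb)).
Qed.

Lemma derM f g p : holo_at f p -> holo_at g p ->
  der (fun q => f q * g q) p = der f p * g p + f p * der g p.
Proof.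
move=> /holoP[a ha] /holoP[b hb].
rewrite (rep_der1 ha) (rep_der1 hb) (rep_der1 (rep_mul ha hb)) -(rep0 ha) -(rep0 hb).
by rewrite /cauchy_prod big_ord_recl big_ord1 addrC.
Qed.

Lemma der_cst (k : C) p : der (fun=> k) p = 0.
Proof. by rewrite (rep_der1 (rep_cst k p)). Qed.

Lemma der_id p : der (fun q : C => q) p = 1.
Proof. by rewrite (rep_der1 (rep_id p)). Qed.

(** The quotient has the shifted coefficients. Besides the chain rule, this factorization drives the
    uniqueness arguments for pullbacks of superfunctions. *)
Lemma holo_factor f p : holo_at f p ->
  exists g, holo_at g p /\ forall q, f q = f p + (q - p) * g q.
Proof.
move=> /holoP[a fa]; have a0 := rep0 fa; case: (fa) => [r [M [r0 ha fe]]].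
pose g q := if q == p then a 1%N else (f q - f p) / (q - p).
exists g; split; last first.
  move=> q; rewrite /g; case: eqVneq => [->|qp]; first by rewrite subrr mul0r addr0.
  by rewrite mulrC divfK ?subr_eq0 // addrC subrK.
apply/holoP; exists (fun k => a k.+1), r, (M / r); split=> //; first exact: pw_tail.
move=> x xr; rewrite /g; case: eqVneq => [h|h].
  have -> : x = 0 by rewrite -(addKr p x) h addrC subrr.
  have := @has_sum_fin _ (fun k => a k.+1 * 0 ^+ k) 1.
  by rewrite big_ord1 expr0 mulr1; apply=> -[//|k] _; rewrite expr0n mulr0.
have x0 : x != 0 by apply: contra h => /eqP ->; rewrite addr0.
by rewrite -a0 [p + x - p]addrAC subrr add0r; apply: ev_tail => //; apply: fe.
Qed.

(** Caratheodory's argument: composing [f q = f (g p) + (q - g p) * h q] with [g] reduces the chain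
    rule to the product rule. *)
Lemma der_comp f g p : holo_at g p -> holo_at f (g p) ->
  der (f \o g) p = der f (g p) * der g p.
Proof.
move=> hg hf; have [h [hh e]] := holo_factor hf.
have hgh := holo_comp hg hh.
have hB : holo_at (fun q => g q - g p) p by exact: holoD hg (holo_cst _ _).
have hM : holo_at (fun q => (g q - g p) * h (g q)) p by exact: holoM hB hgh.
have -> : der f (g p) = h (g p).
  have h1 : holo_at (fun q => q - g p) (g p) by exact: holoD (holo_id _) (holo_cst _ _).
  transitivity (der (fun q => f (g p) + (q - g p) * h q) (g p)).
    by apply: near_der; near=> q; exact: e.
  rewrite (derD (holo_cst _ _) (holoM h1 hh)) (derM h1 hh).
  rewrite (derD (holo_id _) (holo_cst _ _)) !der_cst der_id subrr.
  by rewrite mul0r !addr0 add0r mul1r.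
transitivity (der (fun q => f (g p) + (g q - g p) * h (g q)) p).
  by apply: near_der; near=> q; exact: e.
rewrite (derD (holo_cst _ _) hM) (derM hB hgh) (derD hg (holo_cst _ _)).
by rewrite !der_cst subrr mul0r !addr0 add0r mulrC.
Unshelve. all: by end_near. Qed.

(** A germ that vanishes near [p] has a derivative that vanishes near [p], and the coefficients of
    the latter are those of [f] shifted by one, up to non-zero integers. *)
Lemma rep_zero f p a : (\forall q \near p, f q = 0) -> rep f p a -> forall k, a k = 0.
Proof.
move=> f0 fa k; elim: k f a f0 fa => [|k IH] f a f0 fa.
  by rewrite (rep0 fa); exact: nbhs_singleton f0.
have := IH _ _ _ (rep_der fa) => /(_ _)/eqP.
rewrite mulf_eq0 pnatr_eq0 /= => h; apply/eqP/h.
move: (near_near f0); apply: filterS => q hq.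
by rewrite -(der_cst 0 q); apply: near_der.
Qed.

Lemma holo_const f p : holo_at f p -> (\forall q \near p, der f q = 0) ->
  \forall q \near p, f q = f p.
Proof.
move=> /holoP[a fa] d0; have ak := rep_zero d0 (rep_der fa).
have a0 := rep0 fa; case: fa => [r [M [r0 ha fa]]].
apply/nbhs_nc; exists r => // x /ltW/fa h; rewrite -a0.
apply: has_sum_uniq h _.
have := @has_sum_fin _ (fun k => a k * x ^+ k) 1.
rewrite big_ord1 expr0 mulr1; apply=> -[//|k] _.
have := ak k => /eqP; rewrite mulf_eq0 pnatr_eq0 /= => /eqP ->.
by rewrite mul0r.
Qed.

Lemma holo_primitive f p : holo_at f p ->
  exists F, holo_at F p /\ \forall q \near p, der F q = f q.
Proof.
move=> /holoP[a fa]; case: (fa) => [r [M [r0 ha fe]]].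
pose b k := if k is n.+1 then a n / n.+1%:R else 0.
have hb : pw b r (r * M).
  move=> [|n]; first by rewrite big_ord0 mulr_ge0 ?(ltW r0) ?(sbdd_ge0 ha).
  rewrite big_ord_recl nc0 mul0r add0r.
  apply: le_trans (ler_wpM2l (ltW r0) (ha n)); rewrite mulr_sumr.
  apply: ler_sum => k _; rewrite lift0 /b ncM ncV nc_nat exprS [_ * (r * _)]mulrCA.
  rewrite ler_wpM2l ?(ltW r0) // ler_wpM2r ?exprn_ge0 ?(ltW r0) //.
  by rewrite ler_piMr ?nc_ge0 // invf_le1 ?ltr0n // ler1n.
have /choice[G hG] : forall x, exists l, nc x <= r -> ev b x l.
  move=> x; have [xr|_] := leP (nc x) r; last by exists 0.
  by have [l hl] := pw_ev (ltW r0) hb xr; exists l.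
have GF : rep (fun q => G (q - p)) p b.
  by exists r, (r * M); split=> // x xr; rewrite addrAC subrr add0r; apply: hG.
exists (fun q => G (q - p)); split; first by apply/holoP; exists b.
have [r1 [M1 [r10 _ h1]]] := rep_der GF.
pose s := Num.min r r1; have s0 : 0 < s by rewrite lt_min r0.
have sr : s <= r by rewrite ge_min lexx.
have sr1 : s <= r1 by rewrite ge_min lexx orbT.
apply/nbhs_nc; exists s => // x xs.
apply: (has_sum_uniq (h1 x _)); first by lra.
have := fe x; rewrite -/(ev _ _ _) => /(_ _) h; apply: has_sum_ext (h _) => [k|]; last by lra.
by rewrite /b [_ * (a k / _)]mulrC divfK ?pnatr_eq0.
Qed.

End HoloCalculus.

(** Course-of-values recursion: the value at [n] is stationary from the iterate [n.+1] on, since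
    [Phi u n] looks at [u] below [n] only. *)
Lemma causal_fixpoint (T : Type) (t0 : T) (Phi : (nat -> T) -> nat -> T) :
  (forall u v n, (forall m, (m < n)%N -> u m = v m) -> Phi u n = Phi v n) ->
  exists u, forall n, u n = Phi u n.
Proof.
move=> hPhi; pose w k := iter k Phi (fun=> t0).
have hw n : forall k, (n < k)%N -> w k n = w n.+1 n.
  elim/ltn_ind: n => n IH [//|k] nk; apply: hPhi => m mn.
  change (w k m = w n m); rewrite (IH m mn k) ?(IH m mn n) //; lia.
exists (fun n => w n.+1 n) => n; apply: hPhi => m mn.
by change (w n m = w m.+1 m); rewrite hw.
Qed.

(** * Inverse functions by power series *)

Section InverseODE.
Variable R : realType.
Local Notation C := (Cx R).
Implicit Types (a b c u v : nat -> C) (e r s M : R) (l x y p q : C) (f g : C -> C).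

Lemma convpow_low u k n : u 0%N = 0 -> (n < k)%N -> convpow u k n = 0.
Proof.
move=> u0; elim: k n => [//|k IH] n nk; rewrite convpowS /cauchy_prod.
apply: big1 => -[i /= ni] _; case: i ni => [|i] ni; first by rewrite u0 mul0r.
by rewrite IH ?mulr0 //; lia.
Qed.

Lemma convpow_agree_low u v k n : (forall m, (m < n)%N -> u m = v m) ->
  forall m, (m < n)%N -> convpow u k m = convpow v k m.
Proof.
move=> uv; elim: k => [//|k IH] m mn; rewrite !convpowS /cauchy_prod.
by apply: eq_bigr => -[i /= mi] _; rewrite uv ?IH //; lia.
Qed.

(** In a product of at least two series without constant term, no factor can contribute its
    coefficient of the full degree [n]. *)
Lemma convpow_agree u v k n : u 0%N = 0 -> v 0%N = 0 ->
  (forall m, (m < n)%N -> u m = v m) -> convpow u k.+2 n = convpow v k.+2 n.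
Proof.
move=> u0 v0 uv; rewrite !(convpowS _ k.+1) /cauchy_prod.
apply: eq_bigr => -[i /= mi] _; case: i mi => [|i] mi; first by rewrite u0 v0 !mul0r.
have [->|ni] := eqVneq n i.+1.
  by rewrite subnn -!convpowS !convpow_low // !mulr0.
by rewrite -!convpowS uv ?(@convpow_agree_low u v k.+1 n) //; lia.
Qed.

Lemma convpow1 u n : convpow u 1 n = u n.
Proof.
rewrite convpowS /cauchy_prod big_ord_recr /= subnn mulr1 big1 ?add0r // => -[i /= ni] _.
by rewrite (_ : (n - i)%N = (n - i).-1.+1) ?mulr0 //; lia.
Qed.

(** As [a 1 = 1], the equation in degree [n] gives [u n] as minus the sum over [k >= 2] of [a k]
    times the [n]-th coefficient of the [k]-th power of [u], which involves lower coefficients only.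
    Convergence is a majorant estimate for this recursion. *)
Lemma compositional_inverse a r M : 0 < r -> pw a r M -> a 0%N = 0 -> a 1%N = 1 ->
  exists u s, [/\ 0 < s, pw u s (2 * s), u 0%N = 0, 2 * s <= r &
   forall n, \sum_(k < n.+1) a k * convpow u k n = (n == 1%N)%:R].
Proof.
move=> r0 ha a0 a1.
(* Cutting [u] off at [n] makes the recursion causal by construction; [convpow_agree] removes the
   cut afterwards. *)
pose tr n u m := if (0 < m < n)%N then u m else 0 : C.
pose Phi u n : C := if n is m.+2 then - \sum_(2 <= k < n.+1) a k * convpow (tr n u) k n
                    else n%:R.
have [u hu] : exists u, forall n, u n = Phi u n.
  apply: (causal_fixpoint 0) => u v [|[|n]] // uv; rewrite /Phi; congr (- _).
  apply: eq_bigr => k _; congr (_ * convpow _ _ _); apply/funext => m.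
  by rewrite /tr; case: ifP => // /andP[_ /uv].
have u0 : u 0%N = 0 by rewrite hu.
have u1 : u 1%N = 1 by rewrite hu.
have hu2 n : (1 < n)%N -> u n = - \sum_(2 <= k < n.+1) a k * convpow u k n.
  case: n => [|[|n]] // _; rewrite hu /Phi; congr (- _).
  rewrite big_nat_cond [RHS]big_nat_cond; apply: eq_bigr => -[|[|k]] // _.
  congr (_ * _); apply: convpow_agree => // m mn.
  by rewrite /tr; case: m mn => [|m] ->.
exists u.
(* [s] has to make the terms of exponent at least 2 contribute at most [s] in [hsum]: they are
   bounded by [(2 * s / r) ^+ 2 * M], which is [s * (s * (K - 1))]. *)
pose K := 4 * M / (r * r) + 1.
have M0 := sbdd_ge0 ha.
have K0 : 0 < K by rewrite ltr_wpDl // divr_ge0 ?mulr_ge0 // ltW.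
pose s := Num.min (r / 2) K^-1.
have s0 : 0 < s by rewrite lt_min divr_gt0 // invr_gt0.
have sr : s <= r / 2 by rewrite ge_min lexx.
have sK : s * K <= 1.
  by rewrite -ler_pdivlMr // div1r ge_min lexx orbT.
have hsum n : \sum_(2 <= k < n.+1) nc (a k) * (2 * s) ^+ k <= s.
  apply: le_trans (_ : \sum_(2 <= k < n.+1) (2 * s / r) ^+ 2 * (nc (a k) * r ^+ k) <= _).
    rewrite big_nat_cond [X in _ <= X]big_nat_cond; apply: ler_sum => k /andP[/andP[k2 _] _].
    rewrite mulrCA ler_wpM2l ?nc_ge0 //.
    have -> : (2 * s) ^+ k = (2 * s / r) ^+ k * r ^+ k by rewrite -exprMn divfK ?gt_eqF.
    rewrite ler_wpM2r ?exprn_ge0 ?(ltW r0) // -(subnK k2) exprD ler_piMl ?exprn_ge0 //.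
      by rewrite divr_ge0 ?mulr_ge0 ?(ltW s0) ?(ltW r0).
    rewrite exprn_ile1 // ?divr_ge0 ?mulr_ge0 ?(ltW s0) ?(ltW r0) //.
    by rewrite ler_pdivrMr // mul1r; lra.
  rewrite -mulr_sumr; apply: le_trans (_ : (2 * s / r) ^+ 2 * M <= _).
    rewrite ler_wpM2l ?sqr_ge0 //; apply: le_trans (ha n.+1).
    case: n => [|n]; first by rewrite big_geq // sumr_ge0 // => i _; rewrite pw_ge0 // ltW.
    rewrite -(big_mkord xpredT (fun k => nc (a k) * r ^+ k)).
    rewrite [X in _ <= X](@big_cat_nat _ _ _ 2) //= lerDr sumr_ge0 // => i _.
    by rewrite pw_ge0 // ltW.
  have -> : (2 * s / r) ^+ 2 * M = s * (s * (K - 1)).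
    by rewrite /K addrK; field; rewrite gt_eqF.
  by rewrite ler_piMr ?(ltW s0) // mulrBr mulr1; lra.
(* By induction the truncation [v] has norm at most [2 * s], so its [k]-th power has norm at most
   [(2 * s) ^+ k]. The linear term contributes [s], and all higher terms together at most [s] by
   [hsum]. *)
have hbd n : \sum_(k < n) nc (u k) * s ^+ k <= 2 * s.
  elim: n => [|n IH]; first by rewrite big_ord0 mulr_ge0 // ltW.
  case: n IH => [|[|n]] IH.
  - by rewrite big_ord1 u0 nc0 mul0r mulr_ge0 // ltW.
  - by rewrite big_ord_recl big_ord1 u0 nc0 mul0r add0r lift0 u1 nc1 mul1r expr1; lra.
  set m := n.+2 in IH *.
  pose v k := if (k < m)%N then u k else 0.
  have hv k : \sum_(i < m.+1) nc (convpow v k i) * s ^+ i <= (2 * s) ^+ k.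
    apply: (@pw_convpow _ v s (2 * s)); first exact: ltW.
    move=> j; apply: le_trans IH; rewrite /v.
    have -> : \sum_(k < m) nc (u k) * s ^+ k = \sum_(k < m) nc (v k) * s ^+ k.
      by apply: eq_bigr => i _; rewrite /v ltn_ord.
    have vz i : (m <= i)%N -> nc (v i) * s ^+ i = 0.
      by move=> mi; rewrite /v ltnNge mi nc0 mul0r.
    have [jm|mj] := leqP j m.
      by apply: (@sum_le_widen _ (fun k => nc (v k) * s ^+ k)) => // i; rewrite mulr_ge0 ?nc_ge0 ?exprn_ge0 ?ltW.
    rewrite -!(big_mkord xpredT (fun k => nc (v k) * s ^+ k)).
    have z0 : \sum_(m <= i < j) nc (v i) * s ^+ i = 0.
      by rewrite big_nat_cond big1 // => i /andP[/andP[/vz]].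
    by rewrite (@big_cat_nat _ _ _ m) //= ?(ltnW mj) // z0 addr0.
  rewrite big_ord_recl u0 nc0 mul0r add0r big_ord_recl lift0 u1 nc1 mul1r expr1.
  suff : \sum_(i < n.+1) nc (u i.+2) * s ^+ i.+2 <= s by lra.
  apply: le_trans (hsum m).
  apply: le_trans (_ : \sum_(i < n.+1) (\sum_(2 <= k < m.+1) nc (a k) * nc (convpow v k i.+2)) * s ^+ i.+2 <= _).
    apply: ler_sum => i _; rewrite ler_wpM2r ?exprn_ge0 ?(ltW s0) // hu2 // ncN.
    apply: le_trans (nc_sum _ _ _) _.
    rewrite [X in _ <= X](@big_cat_nat _ _ _ i.+3) //=; last by rewrite /m !ltnS; case: i => i /=; lia.
    rewrite -[X in X <= _]addr0 lerD //.
      rewrite big_nat_cond [X in _ <= X]big_nat_cond; apply: ler_sum => -[|[|k]] // _.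
      rewrite ncM (@convpow_agree u v) // => j ji; rewrite /v.
      by have -> : (j < m)%N by rewrite /m; case: i ji => i /=; lia.
    by apply: sumr_ge0 => k _; rewrite mulr_ge0 ?nc_ge0.
  under eq_bigr => i _ do rewrite mulr_suml.
  rewrite exchange_big /=; apply: ler_sum => k _.
  apply: le_trans (ler_wpM2l (nc_ge0 (a k)) (hv k)); rewrite mulr_sumr.
  rewrite [X in _ <= X]big_ord_recl [X in _ <= _ + X]big_ord_recl.
  rewrite -[X in X <= _]add0r lerD ?mulr_ge0 ?nc_ge0 ?exprn_ge0 ?(ltW s0) //.
  rewrite -[X in X <= _]add0r lerD ?mulr_ge0 ?nc_ge0 ?exprn_ge0 ?(ltW s0) //.
  by apply: ler_sum => i _; rewrite !lift0 -mulrA lexx.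
exists s; split=> //; first by lra.
move=> [|[|n]].
- by rewrite big_ord1 a0 mul0r.
- by rewrite big_ord_recl big_ord1 a0 mul0r add0r a1 mul1r convpow1 u1.
rewrite -(big_mkord xpredT (fun k => a k * convpow u k n.+2)).
rewrite big_ltn // a0 mul0r add0r big_ltn // a1 mul1r convpow1 hu2 //.
by rewrite addNr.
Qed.

(** After subtracting the value and dividing by the derivative [c], the series starts with [x], and
    [compositional_inverse] applies. *)
Lemma holo_right_inverse f p : holo_at f p -> der f p != 0 ->
  exists g, [/\ holo_at g (f p), g (f p) = p & \forall w \near f p, f (g w) = w].
Proof.
move=> /holoP[a fa] d0; rewrite (rep_der1 fa) in d0.
have a0 := rep0 fa; case: fa => [r [M [r0 ha fe]]].
pose c := a 1%N.
pose b k := if k is 0%N then 0 else a k / c.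
have hb : pw b r (M / nc c).
  move=> n; rewrite mulrC -[M]/(M); apply: le_trans (ler_wpM2l _ (ha n)); last by rewrite invr_ge0 nc_ge0.
  rewrite mulr_sumr; apply: ler_sum => -[[|k] /= kn] _.
    by rewrite nc0 mul0r mulr_ge0 ?invr_ge0 ?nc_ge0 // mulr_ge0 ?nc_ge0.
  by rewrite ncM ncV mulrAC mulrC lexx.
have [||u [s [s0 hu u0 sr huc]]] := compositional_inverse r0 hb; [by []|by rewrite /b divff|].
have [d [hd1 hd2 hd3]] := pw_comp s0 hu hb sr.
have hd n : d n = (n == 1%N)%:R.
  rewrite -huc; apply: has_sum_uniq (hd1 n) _; apply: has_sum_fin => k nk.
  by rewrite convpow_low ?mulr0.
have /choice[G hG] : forall x, exists l, nc x <= s -> ev u x l.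
  move=> x; have [xr|_] := leP (nc x) s; last by exists 0.
  by have [l hl] := pw_ev (ltW s0) hu xr; exists l.
have G0 : G 0 = 0.
  have h : rep G 0 u by exists s, (2 * s); split=> // x xs; rewrite add0r; exact: hG.
  by rewrite -(rep0 h).
have GF y : nc y <= s -> f (p + G y) = f p + c * y.
  move=> ys; have Gy := hG y ys.
  have Gr : nc (G y) <= r by apply: le_trans sr; apply: (has_sum_norm Gy); exact: pw_ev_bdd (ltW s0) hu ys.
  have e1 : ev b (G y) ((f (p + G y) - f p) / c).
    have g2 : has_sum (fun k => if k is 0%N then - f p / c else 0) (- f p / c).
      have := @has_sum_fin _ (fun k => if k is 0%N then - f p / c else 0) 1%N.
      by rewrite big_ord1; apply=> -[].
    have g1 := has_sumZ c^-1 (fe _ Gr).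
    rewrite mulrDl [_ / c]mulrC; apply: has_sum_ext (has_sumD g1 g2) => -[|k].
      by rewrite expr0 !mulr1 /b a0 mulrC mulNr subrr.
    by rewrite addr0 /b mulrA [c^-1 * _]mulrC.
  have e2 := hd3 _ _ _ ys Gy e1.
  have e3 : ev d y y.
    have := @has_sum_fin _ (fun k => d k * y ^+ k) 2.
    rewrite big_ord_recl big_ord1 !hd /= mul0r add0r mul1r expr1.
    by apply=> -[|[|k]] // _; rewrite hd mul0r.
  rewrite -[X in c * X](has_sum_uniq e2 e3).
  by rewrite [c * _]mulrC divfK // [f p + _]addrC subrK.
exists (fun w => p + G ((w - f p) / c)); split.
- apply: holoD (holo_cst _ _) _.
  apply: (holo_comp (f := G) (g := fun w => (w - f p) / c)).
    by apply: holoM (holo_cst _ _); exact: holoD (holo_id _) (holo_cst _ _).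
  rewrite subrr mul0r; apply/holoP; exists u, s, (2 * s); split=> // x xs.
  by rewrite add0r; exact: hG.
- by rewrite subrr mul0r G0 addr0.
- apply/nbhs_nc; exists (s * nc c); first by rewrite mulr_gt0 // nc_gt0.
  move=> x xs; rewrite addrAC subrr add0r GF; last by rewrite ncM ncV ler_pdivrMr ?nc_gt0 // ltW.
  by rewrite [x / c]mulrC mulVKf.
Qed.

Lemma nbhs_pull f p (P : C -> Prop) : {for p, continuous f} ->
  (\forall w \near f p, P w) -> \forall q \near p, P (f q).
Proof. by move=> h; apply: h. Qed.

(** The right inverse [g] has a right inverse [h] in turn; [f (g (h q))] equals both [f q] and
    [h q], so [f] and [h] agree near [p] and [g] is a left inverse as well. *)
Lemma holo_inverse f p : holo_at f p -> der f p != 0 ->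
  exists g, [/\ holo_at g (f p), g (f p) = p, \forall q \near p, g (f q) = q &
    \forall w \near f p, f (g w) = w].
Proof.
move=> hf df; have [g [hg gp fg]] := holo_right_inverse hf df.
have dg : der g (f p) != 0.
  have hf' : holo_at f (g (f p)) by rewrite gp.
  have : der (f \o g) (f p) = 1.
    rewrite -(der_id (f p)); apply: near_der; exact: fg.
  rewrite (der_comp hg hf') => h; apply/eqP => h0; move: h.
  by rewrite h0 mulr0 => /eqP; rewrite eq_sym oner_eq0.
have [h [hh hp gh]] := holo_right_inverse hg dg.
rewrite gp in hh hp gh.
exists g; split=> //.
have hc := holo_cts hh.
have fgh : \forall q \near p, f (g (h q)) = h q.
  have h1 : \forall w \near h p, f (g w) = w by rewrite hp.
  exact: (nbhs_pull (P := fun w => f (g w) = w) hc h1).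
near=> q.
have gq : g (h q) = q by near: q.
have : f (g (h q)) = h q by near: q.
by rewrite gq => ->.
Unshelve. all: by end_near. Qed.

End InverseODE.

(** * Linear differential equations *)

Section LinearODE.
Variable R : realType.
Local Notation C := (Cx R).
Implicit Types (e r s M : R) (p q x : C).

Lemma common_radius (I : finType) (P : I -> R -> Prop) :
  (forall i, exists2 r, 0 < r & forall s, 0 < s <= r -> P i s) ->
  exists2 r, 0 < r & forall i s, 0 < s <= r -> P i s.
Proof.
move=> h.
suff [r r0 hr] : exists2 r, 0 < r & forall i, i \in enum I -> forall s, 0 < s <= r -> P i s.
  by exists r => // i; apply: hr; rewrite mem_enum.
elim: (enum I) => [|i l [r r0 hr]]; first by exists 1.
have [r' r0' hr'] := h i; exists (Num.min r r'); first by rewrite lt_min r0.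
move=> j; rewrite inE => /orP[/eqP ->|jl] s /andP[s0]; rewrite le_min => /andP[sr sr'].
  by apply: hr'; rewrite s0.
by apply: hr => //; rewrite s0.
Qed.

(** The coefficients are determined recursively by comparing powers. With [s] small, the norm of the
    solution summed over all components is at most twice that of the initial values, since one
    integration multiplies it by at most one half. *)
Lemma linear_ode (I : finType) (A : I -> I -> C -> C) (y0 : I -> C) p :
  (forall i j, holo_at (A i j) p) ->
  exists y : I -> C -> C, [/\ forall i, holo_at (y i) p, forall i, y i p = y0 i &
    \forall q \near p, forall i, der (y i) q = \sum_j A i j q * y j q].
Proof.
move=> hA.
have /choice[a ha] : forall ij : I * I, exists a, rep (A ij.1 ij.2) p a.
  by move=> ij; apply/holoP; exact: hA.
pose good (ij : I * I) r := 0 < r /\ (exists M, pw (a ij) r M) /\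
  forall x, nc x <= r -> ev (a ij) x (A ij.1 ij.2 (p + x)).
have [r r0 hr] : exists2 r, 0 < r & forall i s, 0 < s <= r -> good i s.
  apply: common_radius => ij; have [r [M [r0 h1 h2]]] := ha ij; exists r => // s hs.
  have [h3 h4] := rep_min hs h1 h2; split; first by case/andP: hs.
  by split=> //; exists M.
have gd ij : (exists M, pw (a ij) r M) /\ forall x, nc x <= r -> ev (a ij) x (A ij.1 ij.2 (p + x)).
  by have [|_] := hr ij r; first by rewrite r0 lexx.
have /choice[Mf hM] : forall ij, exists M, pw (a ij) r M by move=> ij; exact: (gd ij).1.
have gev ij x : nc x <= r -> ev (a ij) x (A ij.1 ij.2 (p + x)) by exact: (gd ij).2.
pose M := \sum_ij Mf ij.
have Mf0 ij : 0 <= Mf ij by exact: sbdd_ge0 (hM ij).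
have M0 : 0 <= M by exact: sumr_ge0.
have MfM ij : Mf ij <= M by rewrite /M (bigD1 ij) //= lerDl sumr_ge0.
pose Phi (Y : nat -> I -> C) n i : C := if n is m.+1 then
  (\sum_j \sum_(k < m.+1) a (i, j) k * Y (m - k)%N j) / m.+1%:R else y0 i.
have [Y hY] : exists Y, forall n, Y n = Phi Y n.
  apply: (causal_fixpoint (fun=> 0)) => u v [|n] // uv; apply/funext => i.
  rewrite /Phi; congr (_ / _); apply: eq_bigr => j _; apply: eq_bigr => k _.
  by rewrite uv // ltnS leq_subr.
(* Small enough for [s * (#|I|%:R * M) <= 2^-1], the factor gained in each step of the majorant
   estimate [bd]. *)
pose s := Num.min r ((2 * #|I|%:R * M + 1)^-1).
have D0 : 0 < 2 * #|I|%:R * M + 1 by rewrite ltr_wpDl // !mulr_ge0.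
have s0 : 0 < s by rewrite lt_min r0 invr_gt0.
have sr : s <= r by rewrite ge_min lexx.
have sD : s * (#|I|%:R * M) <= 2^-1.
  apply: le_trans (_ : (2 * #|I|%:R * M + 1)^-1 * (#|I|%:R * M) <= _).
    by rewrite ler_wpM2r ?mulr_ge0 // ge_min lexx orbT.
  by rewrite mulrC ler_pdivrMr //; lra.
pose S0 := \sum_i nc (y0 i).
have S00 : 0 <= S0 by apply: sumr_ge0 => i _; exact: nc_ge0.
have bd n : \sum_i \sum_(k < n) nc (Y k i) * s ^+ k <= 2 * S0.
  elim: n => [|n IH].
    by rewrite big1 ?mulr_ge0 // => i _; rewrite big_ord0.
  under eq_bigr => i _ do rewrite big_ord_recl expr0 mulr1 hY /=.
  rewrite big_split /= -/S0.
  suff : \sum_i \sum_(k < n) nc (Y (lift ord0 k) i) * s ^+ lift ord0 k <= S0 by lra.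
  apply: le_trans (_ : \sum_i \sum_j s * (M * (\sum_(k < n) nc (Y k j) * s ^+ k)) <= _).
    apply: ler_sum => i _.
    apply: le_trans (_ : \sum_j \sum_(k < n) s * (nc (cauchy_prod (a (i, j)) (Y^~ j) k) * s ^+ k) <= _).
      rewrite exchange_big /=; apply: ler_sum => k _.
      rewrite -!mulr_sumr -mulr_suml /bump leq0n !add1n hY /Phi ncM ncV nc_nat exprS.
      rewrite [X in X <= _]mulrCA ler_wpM2l ?(ltW s0) // ler_wpM2r ?exprn_ge0 ?(ltW s0) //.
      apply: le_trans (nc_sum _ _ _); rewrite ler_piMr ?nc_ge0 // invf_le1 ?ltr0n // ler1n //.
    apply: ler_sum => j _; rewrite -mulr_sumr ler_wpM2l ?(ltW s0) //.
    apply: le_trans (tnorm_conv _ _ _ (ltW s0)) _; rewrite ler_wpM2r //.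
      by apply: sumr_ge0 => k _; rewrite mulr_ge0 ?nc_ge0 ?exprn_ge0 ?(ltW s0).
    apply: le_trans (MfM (i, j)); apply: (@pw_le _ _ r) => //.
    by rewrite sr ltW.
  rewrite sumr_const -!mulr_sumr -mulr_natl; move: IH; set T := \sum_i _ => IH.
  have T0 : 0 <= T.
    apply: sumr_ge0 => i _; apply: sumr_ge0 => k _.
    by rewrite mulr_ge0 ?nc_ge0 ?exprn_ge0 ?(ltW s0).
  have -> : #|I|%:R * (s * (M * T)) = s * (#|I|%:R * M) * T by ring.
  have := ler_wpM2r T0 sD; lra.
have hYp i : pw (Y^~ i) s (2 * S0).
  move=> n; apply: le_trans (bd n); rewrite (bigD1 i) //= lerDl sumr_ge0 // => j _.
  by apply: sumr_ge0 => k _; rewrite mulr_ge0 ?nc_ge0 ?exprn_ge0 ?(ltW s0).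
have /choice[G hG] : forall ix : I * C, exists l, nc ix.2 <= s -> ev (Y^~ ix.1) ix.2 l.
  move=> [i x] /=; have [xs|_] := leP (nc x) s; last by exists 0.
  by have [l hl] := pw_ev (ltW s0) (hYp i) xs; exists l.
pose y i q := G (i, q - p).
have ry i : rep (y i) p (Y^~ i).
  exists s, (2 * S0); split=> // x xs; rewrite /y addrAC subrr add0r.
  exact: (hG (i, x) xs).
exists y; split=> [i|i|].
- by apply/holoP; eexists; exact: ry.
- by rewrite -(rep0 (ry i)) hY.
have [r1 r10 hr1] : exists2 r, 0 < r & forall i t, 0 < t <= r -> forall x, nc x <= t ->
    ev (fun k => k.+1%:R * Y k.+1 i) x (der (y i) (p + x)).
  apply: common_radius => i; have [r1 [M1 [r10 _ h1]]] := rep_der (ry i).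
  by exists r1 => // t /andP[_ tr] x xt; apply: h1; apply: le_trans tr.
pose t := Num.min s r1; have t0 : 0 < t by rewrite lt_min s0.
have ts : t <= s by rewrite ge_min lexx.
have tr1 : 0 < t <= r1 by rewrite t0 ge_min lexx orbT.
apply/nbhs_nc; exists t => // x /ltW xt i.
apply: has_sum_uniq (hr1 i _ tr1 _ xt) _.
have H j : has_sum (fun k => cauchy_prod (a (i, j)) (Y^~ j) k * x ^+ k)
    (A i j (p + x) * y j (p + x)).
  have sM : pw (a (i, j)) s (Mf (i, j)) by apply: (@pw_le _ _ r) => //; rewrite sr ltW.
  apply: (ev_conv (ltW s0) sM (hYp j)); first by lra.
    by apply: (gev (i, j)); lra.
  by rewrite /y addrAC subrr add0r; apply: (hG (j, x)); rewrite /=; lra.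
apply: has_sum_ext (has_sum_sum (index_enum I) H) => k.
by rewrite -mulr_suml hY /Phi [_ * (_ / _)]mulrC divfK ?pnatr_eq0.
Qed.

End LinearODE.

End ComplexAnalysis.
Export ComplexAnalysis.

(** * Superfunctions and superconformal maps *)

Module SuperDerivation.

(* The properties of the one-variable analytic functions over a field K that the
   calculus of superfunctions depends on. *)
Record holoCalc (K : numClosedFieldType) := HoloCalc {
  holo : (K -> K) -> K -> Prop;
  hder : (K -> K) -> K -> K;
  hc_ext : forall f g p, (\forall q \near p, f q = g q) -> holo f p -> holo g p;
  hc_cst : forall k p, holo (fun=> k) p;
  hc_id : forall p, holo (fun q => q) p;
  hc_add : forall f g p, holo f p -> holo g p -> holo (fun q => f q + g q) p;
  hc_mul : forall f g p, holo f p -> holo g p -> holo (fun q => f q * g q) p;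
  hc_inv : forall f p, holo f p -> f p != 0 -> holo (fun q => (f q)^-1) p;
  hc_comp : forall f g p, holo g p -> holo f (g p) -> holo (f \o g) p;
  hc_near : forall f p, holo f p -> \forall q \near p, holo f q;
  hc_cts : forall f p, holo f p -> {for p, continuous f};
  hc_der : forall f p, holo f p -> holo (hder f) p;
  hc_near_der : forall f g p, (\forall q \near p, f q = g q) -> hder f p = hder g p;
  hc_derD : forall f g p, holo f p -> holo g p ->
    hder (fun q => f q + g q) p = hder f p + hder g p;
  hc_derM : forall f g p, holo f p -> holo g p ->
    hder (fun q => f q * g q) p = hder f p * g p + f p * hder g p;
  hc_der_cst : forall k p, hder (fun=> k) p = 0;
  hc_der_id : forall p, hder (fun q => q) p = 1;
  hc_der_comp : forall f g p, holo g p -> holo f (g p) ->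
    hder (f \o g) p = hder f (g p) * hder g p;
  hc_const : forall f p, holo f p -> (\forall q \near p, hder f q = 0) ->
    \forall q \near p, f q = f p;
  hc_primitive : forall f p, holo f p ->
    exists F, holo F p /\ \forall q \near p, hder F q = f q;
  hc_factor : forall f p, holo f p ->
    exists g, holo g p /\ forall q, f q = f p + (q - p) * g q;
  hc_inverse : forall f p, holo f p -> hder f p != 0 ->
    exists g, [/\ holo g (f p), g (f p) = p, \forall q \near p, g (f q) = q &
      \forall w \near f p, f (g w) = w];
  hc_ode : forall (I : finType) (A : I -> I -> K -> K) (y0 : I -> K) p,
    (forall i j, holo (A i j) p) ->
    exists y : I -> K -> K, [/\ forall i, holo (y i) p, forall i, y i p = y0 i &
      \forall q \near p, forall i, hder (y i) q = \sum_j A i j q * y j q]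
}.

Section SuperCalculus.
Variables (K : numClosedFieldType) (H : holoCalc K) (N : nat).
Local Notation L := (grass K N.+1).
Local Notation th := (ggen K (ord0 : 'I_N.+1)).
Local Notation holo := (holo H).
Local Notation der := (hder H).
Implicit Types (p q : K) (F G : K -> L).

Lemma near_near (P : K -> Prop) p : (\forall q \near p, P q) ->
  \forall q \near p, \forall q' \near q, P q'.
Proof. by move=> h; apply: nbhs_interior. Qed.

Lemma hc_sum I (s : seq I) (P : pred I) (f : I -> K -> K) p :
  (forall i, holo (f i) p) -> holo (fun q => \sum_(i <- s | P i) f i q) p.
Proof.
move=> h; elim: s => [|i s IH].
  by apply: hc_ext (hc_cst H 0 p); near=> q; rewrite big_nil.
case Pi: (P i).
  by apply: hc_ext (hc_add (h i) IH); near=> q; rewrite big_cons Pi.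
by apply: hc_ext IH; near=> q; rewrite big_cons Pi.
Unshelve. all: by end_near. Qed.

Lemma hc_der_sum I (s : seq I) (P : pred I) (f : I -> K -> K) p :
  (forall i, holo (f i) p) ->
  der (fun q => \sum_(i <- s | P i) f i q) p = \sum_(i <- s | P i) der (f i) p.
Proof.
move=> h; elim: s => [|i s IH].
  rewrite big_nil -[RHS](hc_der_cst H 0 p); apply: hc_near_der.
  by near=> q; rewrite big_nil.
rewrite big_cons -IH; case Pi: (P i).
  rewrite -(hc_derD (h i) (hc_sum _ _ h)).
  by apply: hc_near_der; near=> q; rewrite big_cons Pi.
by apply: hc_near_der; near=> q; rewrite big_cons Pi.
Unshelve. all: by end_near. Qed.

Definition sh F p := forall A, holo (fun q => F q A) p.
Definition sdzn k F : K -> L := fun p =>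
  [ffun A : {set 'I_N.+1} => iter k (hder H) (fun q => F q A) p].
Definition sdz := sdzn 1.
Definition SD F : K -> L := fun p => thp1 (F p) + th * sdz F p.

Lemma sdzE F p A : sdz F p A = der (fun q => F q A) p.
Proof. by rewrite ffunE. Qed.

Lemma sdzn0 F p : sdzn 0 F p = F p.
Proof. by apply/ffunP => A; rewrite ffunE. Qed.
Lemma sdznS k F p : sdzn k.+1 F p = sdz (sdzn k F) p.
Proof.
apply/ffunP => A; rewrite sdzE ffunE /=; congr (der _ p).
by apply/funext => q; rewrite ffunE.
Qed.

Lemma sh_ext F G p : (\forall q \near p, F q = G q) -> sh F p -> sh G p.
Proof.
move=> h hF A; apply: hc_ext (hF A).
by move: h; apply: filterS => q ->.
Qed.

Lemma near_sdz F G p : (\forall q \near p, F q = G q) -> sdz F p = sdz G p.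
Proof.
move=> h; apply/ffunP => A; rewrite !sdzE; apply: hc_near_der.
by move: h; apply: filterS => q ->.
Qed.

Lemma near_SD F G p : (\forall q \near p, F q = G q) -> SD F p = SD G p.
Proof. by move=> h; rewrite /SD (near_sdz h) (nbhs_singleton h). Qed.

Lemma near_SD' F G p : (\forall q \near p, F q = G q) -> \forall q \near p, SD F q = SD G q.
Proof. by move=> /near_near; apply: filterS => q; exact: near_SD. Qed.

Lemma near_sdz' F G p : (\forall q \near p, F q = G q) -> \forall q \near p, sdz F q = sdz G q.
Proof. by move=> /near_near; apply: filterS => q; exact: near_sdz. Qed.

Lemma sh_cst x p : sh (fun=> x) p.
Proof. by move=> A; exact: hc_cst. Qed.
Lemma sdz_cst x p : sdz (fun=> x) p = 0.
Proof. by apply/ffunP => A; rewrite sdzE hc_der_cst gzeroE. Qed.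

Lemma sh_body (f : K -> K) p : holo f p -> sh (fun q => (f q)%:A) p.
Proof.
move=> hf A; apply: hc_ext (hc_mul hf (hc_cst H ((1 : L) A) p)).
by near=> q; rewrite gscaleE.
Unshelve. all: by end_near. Qed.
Lemma sdz_body (f : K -> K) p : holo f p -> sdz (fun q => (f q)%:A) p = (der f p)%:A.
Proof.
move=> hf; apply/ffunP => A; rewrite sdzE gscaleE.
transitivity (der (fun q => f q * (1 : L) A) p).
  by apply: hc_near_der; near=> q; rewrite gscaleE.
by rewrite (hc_derM hf (hc_cst H _ p)) hc_der_cst mulr0 addr0.
Unshelve. all: by end_near. Qed.

Lemma sh_id p : sh (fun q => q%:A) p.
Proof. exact/sh_body/hc_id. Qed.
Lemma sdz_id p : sdz (fun q => q%:A) p = 1.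
Proof. by rewrite (sdz_body (hc_id H p)) hc_der_id scale1r. Qed.

Lemma holo_body F p : sh F p -> holo (fun q => gbody (F q)) p.
Proof. by move=> h; exact: h. Qed.
Lemma gbody_sdz F p : gbody (sdz F p) = der (fun q => gbody (F q)) p.
Proof. exact: sdzE. Qed.

Lemma shD F G p : sh F p -> sh G p -> sh (fun q => F q + G q) p.
Proof.
move=> hF hG A; apply: hc_ext (hc_add (hF A) (hG A)).
by near=> q; rewrite gaddE.
Unshelve. all: by end_near. Qed.
Lemma sdzD F G p : sh F p -> sh G p ->
  sdz (fun q => F q + G q) p = sdz F p + sdz G p.
Proof.
move=> hF hG; apply/ffunP => A; rewrite gaddE !sdzE -(hc_derD (hF A) (hG A)).
by apply: hc_near_der; near=> q; rewrite gaddE.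
Unshelve. all: by end_near. Qed.

Lemma shM F G p : sh F p -> sh G p -> sh (fun q => F q * G q) p.
Proof.
move=> hF hG A.
have h B E : holo (fun q => gcoef K B E A * (F q B * G q E)) p.
  by apply: hc_mul (hc_cst H _ p) _; apply: hc_mul.
apply: hc_ext (hc_sum (index_enum _) xpredT (fun B => hc_sum (index_enum _) xpredT (h B))).
by near=> q; rewrite gmulE.
Unshelve. all: by end_near. Qed.
Lemma sdzM F G p : sh F p -> sh G p ->
  sdz (fun q => F q * G q) p = sdz F p * G p + F p * sdz G p.
Proof.
move=> hF hG; apply/ffunP => A; rewrite gaddE !gmulE sdzE.
have h0 B E := hc_mul (hF B) (hG E).
have h B E : holo (fun q => gcoef K B E A * (F q B * G q E)) p.
  by apply: hc_mul (hc_cst H _ p) _.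
have hB B := hc_sum (index_enum _) xpredT (h B).
rewrite -big_split /=.
transitivity (der (fun q => \sum_B \sum_E gcoef K B E A * (F q B * G q E)) p).
  by apply: hc_near_der; near=> q; rewrite gmulE.
rewrite (hc_der_sum _ _ hB); apply: eq_bigr => B _.
rewrite (hc_der_sum _ _ (h B)) -big_split /=; apply: eq_bigr => E _.
rewrite (hc_derM (hc_cst H _ p) (h0 B E)) hc_der_cst mul0r add0r -mulrDr !sdzE.
by rewrite (hc_derM (hF B) (hG E)).
Unshelve. all: by end_near. Qed.

Lemma shZ (a : K) F p : sh F p -> sh (fun q => a *: F q) p.
Proof.
move=> hF A; apply: hc_ext (hc_mul (hc_cst H a p) (hF A)).
by near=> q; rewrite gscaleE.
Unshelve. all: by end_near. Qed.
Lemma sdzZ (a : K) F p : sh F p -> sdz (fun q => a *: F q) p = a *: sdz F p.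
Proof.
move=> hF; transitivity (sdz (fun q => a%:A * F q) p).
  by apply: near_sdz; near=> q; rewrite -scalerAl mul1r.
by rewrite (sdzM (sh_cst _ _) hF) sdz_cst mul0r add0r -scalerAl mul1r.
Unshelve. all: by end_near. Qed.
Lemma shN F p : sh F p -> sh (fun q => - F q) p.
Proof.
by move=> hF; apply: sh_ext (shZ (-1) hF); near=> q; rewrite scaleN1r.
Unshelve. all: by end_near. Qed.
Lemma sdzN F p : sh F p -> sdz (fun q => - F q) p = - sdz F p.
Proof.
move=> hF; rewrite -scaleN1r -(sdzZ _ hF).
by apply: near_sdz; near=> q; rewrite scaleN1r.
Unshelve. all: by end_near. Qed.
Lemma shB F G p : sh F p -> sh G p -> sh (fun q => F q - G q) p.
Proof. by move=> hF /shN; exact: shD. Qed.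
Lemma sdzB F G p : sh F p -> sh G p ->
  sdz (fun q => F q - G q) p = sdz F p - sdz G p.
Proof. by move=> hF hG; rewrite (sdzD hF (shN hG)) (sdzN hG). Qed.

Lemma sh_sum I (s : seq I) (P : pred I) (F : I -> K -> L) p :
  (forall i, sh (F i) p) -> sh (fun q => \sum_(i <- s | P i) F i q) p.
Proof.
move=> h A; apply: hc_ext (hc_sum s P (fun i => h i A)).
by near=> q; rewrite gsumE.
Unshelve. all: by end_near. Qed.
Lemma sdz_sum I (s : seq I) (P : pred I) (F : I -> K -> L) p :
  (forall i, sh (F i) p) ->
  sdz (fun q => \sum_(i <- s | P i) F i q) p = \sum_(i <- s | P i) sdz (F i) p.
Proof.
move=> h; apply/ffunP => A; rewrite sdzE gsumE.
under [RHS]eq_bigr do rewrite sdzE.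
rewrite -(hc_der_sum s P (fun i => h i A)).
by apply: hc_near_der; near=> q; rewrite gsumE.
Unshelve. all: by end_near. Qed.

Lemma shX F k p : sh F p -> sh (fun q => F q ^+ k) p.
Proof.
move=> hF; elim: k => [|k IH].
  by apply: sh_ext (sh_cst 1 p); near=> q; rewrite expr0.
by apply: sh_ext (shM hF IH); near=> q; rewrite exprS.
Unshelve. all: by end_near. Qed.

Lemma sh_near F p : sh F p -> \forall q \near p, sh F q.
Proof.
move=> h; have h' A : \forall q \near p, holo (fun q => F q A) q by exact: hc_near.
exact: (@filter_forall _ _ (fun A q => holo (fun q => F q A) q) (nbhs p) _ h').
Qed.

Lemma sh_sdz F p : sh F p -> sh (sdz F) p.
Proof.
by move=> h A; apply: hc_ext (hc_der (h A)); near=> q; rewrite sdzE.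
Unshelve. all: by end_near. Qed.
Lemma sh_sdzn F k p : sh F p -> sh (sdzn k F) p.
Proof.
move=> h; elim: k => [|k IH].
  by apply: sh_ext h; near=> q; rewrite sdzn0.
by apply: sh_ext (sh_sdz IH); near=> q; rewrite sdznS.
Unshelve. all: by end_near. Qed.

Lemma sh_thp0 F p : sh F p -> sh (fun q => thp0 (F q)) p.
Proof.
move=> h A; have [A0|A0] := boolP (ord0 \in A).
  by apply: hc_ext (hc_cst H 0 p); near=> q; rewrite thp0E A0.
by apply: hc_ext (h A); near=> q; rewrite thp0E (negbTE A0).
Unshelve. all: by end_near. Qed.
Lemma sh_thp1 F p : sh F p -> sh (fun q => thp1 (F q)) p.
Proof.
move=> h A; have [A0|A0] := boolP (ord0 \in A).
  by apply: hc_ext (hc_cst H 0 p); near=> q; rewrite thp1E A0.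
by apply: hc_ext (h (ord0 |: A)%SET); near=> q; rewrite thp1E (negbTE A0).
Unshelve. all: by end_near. Qed.
Lemma sdz_thp0 F p : sdz (fun q => thp0 (F q)) p = thp0 (sdz F p).
Proof.
apply/ffunP => A; rewrite sdzE thp0E; case: ifP => A0.
  by rewrite -(hc_der_cst H 0 p); apply: hc_near_der; near=> q; rewrite thp0E A0.
by rewrite sdzE; apply: hc_near_der; near=> q; rewrite thp0E A0.
Unshelve. all: by end_near. Qed.
Lemma sdz_thp1 F p : sdz (fun q => thp1 (F q)) p = thp1 (sdz F p).
Proof.
apply/ffunP => A; rewrite sdzE thp1E; case: ifP => A0.
  by rewrite -(hc_der_cst H 0 p); apply: hc_near_der; near=> q; rewrite thp1E A0.
by rewrite sdzE; apply: hc_near_der; near=> q; rewrite thp1E A0.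
Unshelve. all: by end_near. Qed.
Lemma sh_sig F p : sh F p -> sh (fun q => gsig (F q)) p.
Proof.
move=> h A; apply: hc_ext (hc_mul (hc_cst H ((-1) ^+ #|A|) p) (h A)).
by near=> q; rewrite gsigE.
Unshelve. all: by end_near. Qed.
Lemma sdz_sig F p : sh F p -> sdz (fun q => gsig (F q)) p = gsig (sdz F p).
Proof.
move=> h; apply/ffunP => A; rewrite sdzE gsigE sdzE.
transitivity (der (fun q => (-1) ^+ #|A| * F q A) p).
  by apply: hc_near_der; near=> q; rewrite gsigE.
by rewrite (hc_derM (hc_cst H _ p) (h A)) hc_der_cst mul0r add0r.
Unshelve. all: by end_near. Qed.

Lemma near_body_neq0 F p : sh F p -> gbody (F p) != 0 -> \forall q \near p, gbody (F q) != 0.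
Proof.
move=> h F0; have c := hc_cts (holo_body h).
exact: cvgr_neq0 c F0.
Qed.

(** Near [p] the inverse is a polynomial in [F] and the inverse of its body, so inversion is needed
    for an ordinary holomorphic function only. *)
Lemma sh_inv F p : sh F p -> F p \is a GRing.unit -> sh (fun q => (F q)^-1) p.
Proof.
move=> h; rewrite gunitE => F0.
have hc := hc_inv (holo_body h) F0.
have hs : sh (fun q => (gbody (F q))^-1%:A * \sum_(i < N.+2) (1 - (gbody (F q))^-1%:A * F q) ^+ i) p.
  apply: shM (sh_body hc) _; apply: sh_sum => i; apply: shX.
  by apply: shB (sh_cst 1 p) _; apply: shM (sh_body hc) h.
apply: sh_ext hs; move: (near_body_neq0 h F0); apply: filterS => q q0.
by rewrite (ginv_series q0) -!scalerAl !mul1r.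
Qed.
Lemma sdz_inv F p : sh F p -> F p \is a GRing.unit -> geven (F p) ->
  sdz (fun q => (F q)^-1) p = - (F p)^-1 * sdz F p * (F p)^-1.
Proof.
move=> h FU Fe; have hV := sh_inv h FU.
have e : sdz (fun q => F q * (F q)^-1) p = 0.
  rewrite -(sdz_cst 1 p); apply: near_sdz.
  move: (near_body_neq0 h); rewrite -gunitE FU => /(_ isT); apply: filterS => q q0.
  by rewrite divrr // gunitE.
have := sdzM h hV; rewrite e => /eqP; rewrite eq_sym addrC addr_eq0 => /eqP h1.
apply: (mulrI FU); rewrite h1 mulrA mulrA mulrN divrr // mulN1r mulNr //.
Qed.

Lemma sh_SD F p : sh F p -> sh (SD F) p.
Proof.
move=> h; apply: shD; first exact: sh_thp1.
by apply: shM (sh_cst _ _) _; exact: sh_sdz.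
Qed.
Lemma SD_cst x p : thfree x -> SD (fun=> x) p = 0.
Proof. by move=> /thfreeP h; rewrite /SD sdz_cst mulr0 addr0. Qed.
Lemma SDD F G p : sh F p -> sh G p ->
  SD (fun q => F q + G q) p = SD F p + SD G p.
Proof. by move=> hF hG; rewrite /SD (sdzD hF hG) thp1D mulrDr addrACA. Qed.
Lemma SDZ a F p : sh F p -> SD (fun q => a *: F q) p = a *: SD F p.
Proof. by move=> hF; rewrite /SD (sdzZ _ hF) thp1Z -scalerAr scalerDr. Qed.
Lemma SDN F p : sh F p -> SD (fun q => - F q) p = - SD F p.
Proof. by move=> hF; rewrite /SD (sdzN hF) thp1N mulrN opprD. Qed.
Lemma SDB F G p : sh F p -> sh G p ->
  SD (fun q => F q - G q) p = SD F p - SD G p.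
Proof. by move=> hF hG; rewrite (SDD hF (shN hG)) (SDN hG). Qed.
(** The sign of the odd derivation D is carried by [gsig], so that no parity of [F] is involved. *)
Lemma SDM F G p : sh F p -> sh G p ->
  SD (fun q => F q * G q) p = SD F p * G p + gsig (F p) * SD G p.
Proof.
move=> hF hG; rewrite /SD (sdzM hF hG) thp1M mulrDl !mulrDr -!addrA.
congr (_ + _); rewrite [LHS]addrCA mulrA; congr (_ + (_ + _)).
by rewrite !mulrA [gsig _ * th](godd_sig _ (@th_odd _ _)) gsigK.
Qed.
Lemma SD_th p : SD (fun=> th) p = 1.
Proof. by rewrite /SD sdz_cst mulr0 addr0 (thp_theta _ _).2. Qed.
Lemma SD_sum I (s : seq I) (P : pred I) (F : I -> K -> L) p :
  (forall i, sh (F i) p) ->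
  SD (fun q => \sum_(i <- s | P i) F i q) p = \sum_(i <- s | P i) SD (F i) p.
Proof.
move=> h; rewrite /SD (sdz_sum _ _ h) mulr_sumr big_split /=; congr (_ + _).
elim/big_rec2: _ => [|i y1 y2 _ <-]; last by rewrite thp1D.
by have /thfreeP := @thfree0 K N.
Qed.

Lemma SD_sq F p : sh F p -> SD (SD F) p = sdz F p.
Proof.
move=> h; rewrite {1}/SD.
have h1 := sh_thp1 h; have h2 := sh_sdz h.
have -> : sdz (SD F) p = thp1 (sdz F p) + th * sdz (sdz F) p.
  rewrite (sdzD h1 (shM (sh_cst th p) h2)) sdz_thp1 (sdzM (sh_cst th p) h2).
  by rewrite sdz_cst mul0r add0r.
rewrite /SD thp1D thp1M (thp_theta _ _).2 mul1r.
have /thfreeP -> := @thp1_free K N (F p).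
have /goddE -> := @th_odd K N.
by rewrite mulrDr mulrA (godd_sq (@th_odd K N)) mul0r addr0 add0r mulNr addrNK.
Qed.

Lemma sdz_hom b F p : (\forall q \near p, ghom b (F q)) -> ghom b (sdz F p).
Proof.
move=> h A; rewrite sdzE => d; apply/eqP; apply: contraNT d => nb.
rewrite -(hc_der_cst H 0 p); apply/eqP; apply: hc_near_der.
move: h; apply: filterS => q hq; apply/eqP; apply: contraNT nb => /hq ->.
exact: eqxx.
Qed.
Lemma SD_hom b F p : (\forall q \near p, ghom b (F q)) -> ghom (~~ b) (SD F p).
Proof.
move=> h; apply: ghomD; first exact: thp1_hom (nbhs_singleton h).
have := ghomM (@th_odd K N) (sdz_hom h).
by [].
Qed.
Lemma near_SD_hom b F p : (\forall q \near p, ghom b (F q)) ->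
  \forall q \near p, ghom (~~ b) (SD F q).
Proof. by move=> /near_near; apply: filterS => q; exact: SD_hom. Qed.
Lemma near_sdz_hom b F p : (\forall q \near p, ghom b (F q)) ->
  \forall q \near p, ghom b (sdz F q).
Proof. by move=> /near_near; apply: filterS => q; exact: sdz_hom. Qed.

End SuperCalculus.

End SuperDerivation.
Export SuperDerivation.

Module Pullbacks.

(** * Pullback of superfunctions and the chain rule *)

Section Pullback.
Variables (K : numClosedFieldType) (H : holoCalc K) (N : nat).
Local Notation L := (grass K N.+1).
Local Notation th := (ggen K (ord0 : 'I_N.+1)).
Local Notation sh := (sh H).
Local Notation sdz := (sdz H).
Local Notation sdzn := (sdzn H).
Local Notation SD := (SD H).
Implicit Types (p q : K) (F G : K -> L) (x y z t : L).

Lemma near_at (P : K -> Prop) p : (\forall q \near p, P q) -> P p.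
Proof. exact: nbhs_singleton. Qed.

Definition tay k F p : L := (k`!%:R : K)^-1 *: sdzn k F p.

Lemma tayS k F p : sh F p -> sdz (tay k F) p = k.+1%:R *: tay k.+1 F p.
Proof.
move=> hF; rewrite /tay (sdzZ _ (sh_sdzn k hF)) -sdznS scalerA factS natrM invfM.
by rewrite mulrA divff ?mul1r // pnatr_eq0.
Qed.

Lemma near_tay k F G p : (\forall q \near p, F q = G q) -> \forall q \near p, tay k F q = tay k G q.
Proof.
move=> h; have {}h : \forall q \near p, sdzn k F q = sdzn k G q.
  elim: k => [|k IH]; first by move: h; apply: filterS => q; rewrite !sdzn0.
  by move: (near_sdz' H IH); apply: filterS => q; rewrite !sdznS.
by move: h; apply: filterS => q; rewrite /tay => ->.
Qed.

Lemma sh_tay k F p : sh F p -> sh (tay k F) p.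
Proof. by move=> hF; apply/shZ/sh_sdzn. Qed.

Lemma tay0 F p : tay 0 F p = F p.
Proof. by rewrite /tay sdzn0 fact0 invr1 scale1r. Qed.

Lemma tayD k F G p : sh F p -> sh G p ->
  tay k (fun q => F q + G q) p = tay k F p + tay k G p.
Proof.
move=> hF hG; rewrite /tay -scalerDr; congr (_ *: _).
suff : \forall q \near p, sdzn k (fun q => F q + G q) q = sdzn k F q + sdzn k G q.
  by move=> near0; exact: (near_at near0).
elim: k => [|k IH]; first by near=> q; rewrite !sdzn0.
have := near_sdz' H IH.
apply: filterS2 (filterI (sh_near hF) (sh_near hG)) => q [hF' hG'].
by rewrite !sdznS => ->; rewrite (sdzD (sh_sdzn k hF') (sh_sdzn k hG')).
Unshelve. all: by end_near. Qed.

(** Differentiating the rule for [k] gives [k.+1] times the rule for [k.+1]: the two resulting sums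
    have weights [i] and [k.+1 - i]. *)
Lemma leibniz k F G p : sh F p -> sh G p ->
  \forall q \near p, tay k (fun q => F q * G q) q = \sum_(i < k.+1) tay i F q * tay (k - i) G q.
Proof.
move=> hF hG; elim: k => [|k IH].
  by near=> q; rewrite big_ord1 !tay0.
have := near_sdz' H IH.
apply: filterS2 (filterI (sh_near hF) (sh_near hG)) => q [hFq hGq].
rewrite (tayS k (shM hFq hGq)) => e; have k0 : k.+1%:R != 0 :> K by rewrite pnatr_eq0.
apply: (scalerI k0); rewrite e sdz_sum; last by move=> i; apply: shM; exact: sh_tay.
under eq_bigr => i _ do
  rewrite (sdzM (sh_tay i hFq) (sh_tay (k - i) hGq)) (tayS i hFq) (tayS (k - i) hGq)
    -(scalerAl i.+1%:R) -(scalerAr (k - i).+1%:R).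
rewrite big_split /=.
have -> : \sum_(i < k.+1) i.+1%:R *: (tay i.+1 F q * tay (k - i) G q) =
  \sum_(i < k.+2) i%:R *: (tay i F q * tay (k.+1 - i) G q).
  by rewrite [RHS]big_ord_recl scale0r add0r; apply: eq_bigr => i _; rewrite lift0 subSS.
have -> : \sum_(i < k.+1) (k - i).+1%:R *: (tay i F q * tay (k - i).+1 G q) =
  \sum_(i < k.+2) (k.+1 - i)%:R *: (tay i F q * tay (k.+1 - i) G q).
  rewrite [RHS]big_ord_recr /= subnn scale0r addr0; apply: eq_bigr => i _.
  by rewrite subSn // -ltnS.
rewrite -big_split scaler_sumr /=; apply: eq_bigr => i _.
by rewrite -scalerDl -natrD subnKC // -ltnS.
Unshelve. all: by end_near. Qed.

Lemma sh_factor F p : sh F p -> exists2 G, sh G p & forall q, F q = F p + (q - p)%:A * G q.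
Proof.
move=> hF.
have /choice[g hg] : forall A, exists g, holo H g p /\ forall q, F q A = F p A + (q - p) * g q.
  by move=> A; exact: hc_factor (hF A).
exists (fun q => [ffun A => g A q]).
  by move=> A; apply: hc_ext (hg A).1; near=> q; rewrite ffunE.
move=> q; apply/ffunP => A; rewrite gaddE -scalerAl mul1r gscaleE ffunE.
exact: (hg A).2.
Unshelve. all: by end_near. Qed.

(** Substitution of [t] for [theta] in a value, a ring morphism when [t] is odd. *)
Definition chi t x : L := thp0 x + t * thp1 x.

Lemma chiD t x y : chi t (x + y) = chi t x + chi t y.
Proof. by rewrite /chi thp0D thp1D mulrDr addrACA. Qed.
Lemma chiZ t a x : chi t (a *: x) = a *: chi t x.
Proof. by rewrite /chi thp0Z thp1Z -scalerAr scalerDr. Qed.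
Lemma chi_free t x : thfree x -> chi t x = x.
Proof. by move=> /thp_free[h0 h1]; rewrite /chi h0 h1 mulr0 addr0. Qed.
Lemma chi_th t : chi t th = t.
Proof. by rewrite /chi (thp_theta _ _).1 (thp_theta _ _).2 mulr1 add0r. Qed.
Lemma chi_id x : chi th x = x.
Proof. by rewrite /chi -thpD. Qed.
Lemma thp1M' x y : thp1 (x * y) = thp1 x * thp0 y + gsig (thp0 x) * thp1 y.
Proof.
have f2 := thfreeD (thfreeM (@thp1_free _ _ x) (@thp0_free _ _ y))
  (thfreeM (thfree_sig (@thp0_free _ _ x)) (@thp1_free _ _ y)).
have [_ <-] := thp_unique (thfreeM (@thp0_free _ _ x) (@thp0_free _ _ y)) f2.
congr (thp1 _); rewrite {1}[x]thpD {1}[y]thpD mulrDl !mulrDr -!addrA; congr (_ + _).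
rewrite [thp0 x * (th * _)]mulrA (godd_sig (thp0 x) (@th_odd K N)).
rewrite [th * thp1 x * (th * _)]mulrA -[th * thp1 x * th]mulrA.
rewrite (godd_sig (thp1 x) (@th_odd K N)) [th * (th * _)]mulrA (godd_sq (@th_odd K N)).
by rewrite !mul0r addr0 !mulrA addrC.
Qed.
Lemma chiM t x y : godd t -> chi t (x * y) = chi t x * chi t y.
Proof.
move=> ht; rewrite /chi thp0M thp1M' mulrDl !mulrDr -!addrA; congr (_ + _).
rewrite [thp0 x * (t * _)]mulrA (godd_sig (thp0 x) ht).
rewrite [t * thp1 x * (t * _)]mulrA -[t * thp1 x * t]mulrA.
rewrite (godd_sig (thp1 x) ht) [t * (t * _)]mulrA (godd_sq ht).
by rewrite !mul0r addr0 !mulrA addrC.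
Qed.
Lemma chi_hom b t x : godd t -> ghom b x -> ghom b (chi t x).
Proof.
move=> ht hx; apply: ghomD; first exact: thp0_hom.
by have := ghomM ht (thp1_hom hx); rewrite addTb negbK.
Qed.
Lemma chi_sig t x : godd t -> chi t (gsig x) = gsig (chi t x).
Proof.
move=> ht; rewrite /chi gsigD gsigM thp1_sig; have /goddE -> := ht.
rewrite mulrN mulNr; congr (_ - _); apply/ffunP => A.
by rewrite thp0E !gsigE thp0E; case: ifP; rewrite ?mulr0.
Qed.
Lemma gbody_chi t x : godd t -> gbody (chi t x) = gbody x.
Proof.
by move=> ht; rewrite /chi gbodyD gbodyM (gbody_odd ht) mul0r addr0 gbody_thp0.
Qed.

(* The value at a point of the pullback of F by a map with z' = z and theta' = t
   at this point. *)
Definition sev z t F : L := let z0 := gbody z in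
  \sum_(k < N.+2) (k`!%:R : K)^-1 *: ((z - z0%:A) ^+ k *
     (thp0 (sdzn k F z0) + t * thp1 (sdzn k F z0))).

Lemma sevE z t F : sev z t F =
  \sum_(k < N.+2) (z - (gbody z)%:A) ^+ k * chi t (tay k F (gbody z)).
Proof. by apply: eq_bigr => k _; rewrite /tay chiZ -scalerAr. Qed.

Section Point.
Variables (z t : L).
Hypotheses (z_even : geven z) (t_odd : godd t).
Let z0 := gbody z.
Let nu := z - z0%:A.

Lemma nu_even : geven nu. Proof. by apply: ghomB => //; exact: geven_alg. Qed.
Lemma nuX_even k : geven (nu ^+ k). Proof. exact/gevenX/nu_even. Qed.
Lemma nuX_comm k y : nu ^+ k * y = y * nu ^+ k.
Proof. exact/geven_comm/nuX_even. Qed.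
Lemma nu_nilp : nu ^+ N.+2 = 0.
Proof. by apply: gnilp; rewrite gbodyB gbody_alg subrr. Qed.
Lemma nu_nilp_ge k : (N.+2 <= k)%N -> nu ^+ k = 0.
Proof. by move=> /subnKC <-; rewrite exprD nu_nilp mul0r. Qed.

Lemma sev_near F G : (\forall q \near z0, F q = G q) -> sev z t F = sev z t G.
Proof.
move=> h; rewrite !sevE; apply: eq_bigr => k _.
by rewrite (nbhs_singleton (near_tay k h)).
Qed.

Lemma sevD F G : sh F z0 -> sh G z0 -> sev z t (fun q => F q + G q) = sev z t F + sev z t G.
Proof.
move=> hF hG; rewrite !sevE -big_split /=; apply: eq_bigr => k _.
by rewrite (tayD k hF hG) chiD mulrDr.
Qed.

(** The Leibniz rule yields the part of the product of the two Taylor sums with [i + j < N.+2]; the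
    other terms contain a power of [nu] that vanishes. *)
Lemma sevM F G : sh F z0 -> sh G z0 -> sev z t (fun q => F q * G q) = sev z t F * sev z t G.
Proof.
move=> hF hG; rewrite !sevE.
pose A k := nu ^+ k * chi t (tay k F z0); pose B k := nu ^+ k * chi t (tay k G z0).
have e k : chi t (tay k (fun q => F q * G q) z0) =
    \sum_(i < k.+1) chi t (tay i F z0) * chi t (tay (k - i) G z0).
  rewrite (nbhs_singleton (leibniz k hF hG)).
  elim/big_rec2: _ => [|i y1 y2 _ <-]; last by rewrite chiD chiM.
  by rewrite (chi_free _ (@thfree0 K N)).
transitivity (\sum_(k < N.+2) \sum_(i < k.+1) A i * B (k - i)%N).
  apply: eq_bigr => k _; rewrite e mulr_sumr; apply: eq_bigr => i _.
  have ik : (i <= k)%N by rewrite -ltnS.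
  have -> : (z - (gbody z)%:A) ^+ k = nu ^+ i * nu ^+ (k - i) by rewrite -exprD subnKC.
  rewrite /A /B -!mulrA; congr (_ * _).
  by rewrite !mulrA nuX_comm.
rewrite sum_triangle mulr_suml; apply: eq_bigr => i _.
rewrite -/(A i); have AB j : (N.+2 <= i + j)%N -> A i * B j = 0.
  move=> ij; rewrite /A /B -mulrA [chi t _ * (_ * _)]mulrA.
  rewrite -nuX_comm !mulrA -exprD nu_nilp_ge //.
  by rewrite !mul0r.
rewrite !mulr_sumr -!(big_mkord xpredT (fun j => A i * B j)).
have tail0 : \sum_(N.+2 - i <= j < N.+2) A i * B j = 0.
  rewrite big_nat_cond; apply: big1 => j /andP[/andP[h _] _].
  by apply: AB; lia.
by rewrite [RHS](@big_cat_nat _ _ _ (N.+2 - i)) ?leq_subr //= tail0 addr0.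
Qed.

Lemma sev_cst x : sev z t (fun=> x) = chi t x.
Proof.
rewrite sevE big_ord_recl expr0 mul1r tay0 big1 ?addr0 // => i _.
rewrite lift0 /tay; suff -> : sdzn i.+1 (fun=> x) (gbody z) = 0.
  by rewrite scaler0 (chi_free _ (@thfree0 K N)) mulr0.
suff : \forall q \near (gbody z), sdzn i.+1 (fun=> x) q = 0 by move=> near0; exact: (near_at near0).
elim: (nat_of_ord i) => [|j IH].
  by near=> q; rewrite sdznS -(sdz_cst H x q); apply: near_sdz; near=> q'; rewrite sdzn0.
move: (near_sdz' H IH); apply: filterS => q; rewrite sdznS => ->.
exact: sdz_cst.
Unshelve. all: by end_near. Qed.

Lemma sev_id : sev z t (fun q => q%:A) = z.
Proof.
rewrite sevE big_ord_recl expr0 mul1r tay0 big_ord_recl.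
have t1 q : tay 1 (fun q => q%:A : L) q = 1.
  rewrite /tay sdznS invr1 scale1r -[RHS](sdz_id H N q).
  by apply: near_sdz; near=> q'; rewrite sdzn0.
rewrite !lift0 expr1 t1 (chi_free _ (@thfree1 K N)) (chi_free _ (@thfree_alg K N _)) mulr1.
rewrite big1 ?addr0; first by rewrite addrC subrK.
move=> i _; rewrite !lift0; suff -> : tay i.+2 (fun q => q%:A : L) (gbody z) = 0.
  by rewrite (chi_free _ (@thfree0 K N)) mulr0.
rewrite /tay; suff -> : sdzn i.+2 (fun q : K => q%:A : L) (gbody z) = 0 by rewrite scaler0.
suff : \forall q \near (gbody z), sdzn i.+2 (fun q : K => q%:A : L) q = 0 by move=> near0; exact: (near_at near0).
elim: (nat_of_ord i) => [|j IH].
  near=> q; rewrite sdznS -(sdz_cst H 1 q); apply: near_sdz; near=> q'.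
  by have := t1 q'; rewrite /tay invr1 scale1r.
move: (near_sdz' H IH); apply: filterS => q; rewrite sdznS => ->.
exact: sdz_cst.
Unshelve. all: by end_near. Qed.

Lemma sev_body F : gbody (sev z t F) = gbody (F z0).
Proof.
rewrite sevE big_ord_recl expr0 mul1r gbodyD tay0 gbody_chi //.
rewrite gbody_sum big1 ?addr0 // => i _.
by rewrite gbodyM gbodyX gbodyB gbody_alg subrr expr0n mul0r.
Qed.

Lemma sev_hom b F : (\forall q \near z0, ghom b (F q)) -> ghom b (sev z t F).
Proof.
move=> h; rewrite sevE; apply: ghom_sum => k.
suff hk : ghom b (tay k F z0) by have := ghomM (@nuX_even k) (chi_hom t_odd hk).
apply: ghomZ; suff : \forall q \near z0, ghom b (sdzn k F q) by move=> near0; exact: (near_at near0).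
elim: (nat_of_ord k) => [|j IH].
  by move: h; apply: filterS => q hq; rewrite sdzn0.
by move: (near_sdz_hom H IH); apply: filterS => q hq; rewrite sdznS.
Qed.

Lemma sev_sig F : sh F z0 -> sev z t (fun q => gsig (F q)) = gsig (sev z t F).
Proof.
move=> hF; rewrite !sevE.
have -> (s : seq 'I_N.+2) (E : 'I_N.+2 -> L) : gsig (\sum_(k <- s) E k) = \sum_(k <- s) gsig (E k).
  by elim/big_rec2: _ => [|i y1 y2 _ <-]; rewrite ?gsig0 // gsigD.
apply: eq_bigr => k _; rewrite gsigM gsigX.
have /gevenE -> := nu_even; congr (_ * _); rewrite -chi_sig //; congr (chi t _).
suff : \forall q \near z0, tay k (fun q => gsig (F q)) q = gsig (tay k F q).
  by move=> near0; exact: (near_at near0).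
suff : \forall q \near z0, sdzn k (fun q => gsig (F q)) q = gsig (sdzn k F q).
  by apply: filterS => q e; rewrite /tay e gsigZ.
elim: (nat_of_ord k) => [|j IH]; first by near=> q; rewrite !sdzn0.
apply: filterS2 (near_sdz' H IH) (sh_near hF) => q e hq.
by rewrite !sdznS e (sdz_sig (sh_sdzn j hq)).
Unshelve. all: by end_near. Qed.

(* An evaluation is determined by the images of z and theta: expanding F to
   order N + 2 at z0, the remainder is killed by nilpotency. *)
Lemma sev_unique (phi : (K -> L) -> L) :
  (forall F G, sh F z0 -> sh G z0 -> phi (fun q => F q + G q) = phi F + phi G) ->
  (forall F G, sh F z0 -> sh G z0 -> phi (fun q => F q * G q) = phi F * phi G) ->
  (forall x, phi (fun=> x) = chi t x) -> phi (fun q => q%:A) = z ->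
  forall F, sh F z0 -> phi F = sev z t F.
Proof.
move=> pD pM pc pid F hF; apply/eqP; rewrite -subr_eq0.
have step G : sh G z0 -> exists2 G', sh G' z0 & phi G - sev z t G = nu * (phi G' - sev z t G').
  move=> hG; have [G' hG' e] := sh_factor hG; exists G' => //.
  have hB : sh (fun q => q%:A - z0%:A : L) z0 by apply: (shB (F := fun q => q%:A) (G := fun=> z0%:A)); [exact: sh_id|exact: sh_cst].
  have -> : G = fun q => G z0 + (q%:A - z0%:A) * G' q.
    by apply/funext => q; rewrite e -scalerBl.
  have hm : sh (fun q => (q%:A - z0%:A) * G' q) z0 by exact: shM.
  rewrite (pD _ _ (sh_cst H _ _) hm) (sevD (sh_cst H _ _) hm) (pM _ _ hB hG') (sevM hB hG').
  rewrite pc sev_cst.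
  have h1 := pD _ _ (@sh_id _ H N z0) (sh_cst H (- z0%:A) z0).
  have h2 := sevD (@sh_id _ H N z0) (sh_cst H (- z0%:A) z0).
  rewrite h1 h2 pid sev_id pc sev_cst (@chi_free t (- z0%:A)); last exact/thfreeN/thfree_alg.
  by rewrite opprD addrACA subrr add0r -mulrBr.
have iter_step k : exists2 G', sh G' z0 & phi F - sev z t F = nu ^+ k * (phi G' - sev z t G').
  elim: k => [|k [G hG ->]]; first by exists F => //; rewrite expr0 mul1r.
  have [G' hG' ->] := step G hG; exists G' => //.
  by rewrite mulrA exprSr.
have [G _ ->] := iter_step N.+2.
by rewrite nu_nilp mul0r.
Qed.

End Point.

Lemma sev_th z t : godd t -> sev z t (fun=> th) = t.
Proof. by move=> ht; rewrite sev_cst chi_th. Qed.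

Lemma sev_refl F p : sh F p -> sev (p%:A) th F = F p.
Proof.
move=> hF; symmetry; have e : gbody (p%:A : L) = p by rewrite gbody_alg.
apply: (@sev_unique (p%:A) th (@geven_alg K _ p) (@th_odd K N) (fun F => F p)) => //.
- by move=> x; rewrite chi_id.
- by rewrite e.
Qed.

Section Maps.
Variables (Z Th : K -> L) (p : K).
Hypotheses (hZ : sh Z p) (hTh : sh Th p).
Hypotheses (Ze : \forall q \near p, geven (Z q)) (To : \forall q \near p, godd (Th q)).
Let z0 := gbody (Z p).

Lemma near_body (P : K -> Prop) : (\forall w \near z0, P w) ->
  \forall q \near p, P (gbody (Z q)).
Proof. by have c := hc_cts (holo_body hZ); move/c. Qed.

Lemma sh_pull F : sh F z0 -> sh (fun q => sev (Z q) (Th q) F) p.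
Proof.
move=> hF; apply: sh_sum => k; apply: shZ.
have hb : sh (fun q => (gbody (Z q))%:A : L) p by apply: sh_body; exact: (holo_body hZ).
have hk : sh (fun q => sdzn k F (gbody (Z q))) p.
  move=> A; apply: (hc_comp (f := fun w => sdzn k F w A) (holo_body hZ)).
  exact: (sh_sdzn k hF).
apply: shM; first by apply: shX; exact: shB.
by apply: shD; [exact: sh_thp0|apply: shM => //; exact: sh_thp1].
Qed.

Lemma near_pullM F G : sh F z0 -> sh G z0 -> \forall q \near p,
  sev (Z q) (Th q) (fun w => F w * G w) = sev (Z q) (Th q) F * sev (Z q) (Th q) G.
Proof.
move=> /sh_near/near_body hF /sh_near/near_body hG.
near=> q; apply: sevM; by near: q.
Unshelve. all: by end_near. Qed.

Lemma near_pullD F G : sh F z0 -> sh G z0 -> \forall q \near p,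
  sev (Z q) (Th q) (fun w => F w + G w) = sev (Z q) (Th q) F + sev (Z q) (Th q) G.
Proof.
move=> /sh_near/near_body hF /sh_near/near_body hG.
near=> q; apply: sevD; by near: q.
Unshelve. all: by end_near. Qed.

(* The vector field a d/dtheta + b d/dz. *)
Definition vf a b (F : K -> L) : L := a * thp1 (F p) + b * sdz F p.

Lemma vf_near a b F G : (\forall q \near p, F q = G q) -> vf a b F = vf a b G.
Proof. by move=> h; rewrite /vf (near_sdz H h) (nbhs_singleton h). Qed.

Lemma vfD a b F G : sh F p -> sh G p -> vf a b (fun q => F q + G q) = vf a b F + vf a b G.
Proof. by move=> hF hG; rewrite /vf (sdzD hF hG) thp1D !mulrDr addrACA. Qed.

Lemma vfM a b F G : geven a -> godd b -> sh F p -> sh G p ->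
  vf a b (fun q => F q * G q) = vf a b F * G p + gsig (F p) * vf a b G.
Proof.
move=> ha hb hF hG; rewrite /vf (sdzM hF hG) thp1M !mulrDl !mulrDr !mulrA -!addrA.
rewrite -(geven_comm (gsig (F p)) ha); congr (_ + _).
by rewrite [RHS]addrCA; congr (_ + (_ + _)); rewrite (godd_sig (gsig (F p)) hb) gsigK.
Qed.

Lemma vf_cst a b x : thfree x -> vf a b (fun=> x) = 0.
Proof. by move=> /thfreeP h; rewrite /vf sdz_cst h !mulr0 addr0. Qed.

Lemma vf_hom a b c F : geven a -> godd b -> (\forall q \near p, ghom c (F q)) -> ghom (~~ c) (vf a b F).
Proof.
move=> ha hb hF; apply: ghomD.
  by have := ghomM ha (thp1_hom (nbhs_singleton hF)).
by have := ghomM hb (sdz_hom (H := H) hF).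
Qed.

Lemma mulrD2 x y u v u' v' : x * (u + v) + y * (u' + v') = x * u + y * u' + (x * v + y * v').
Proof. by rewrite !mulrDr addrACA. Qed.

Lemma twisted_leibniz x y u v u' v' (f g : L) : godd x -> geven y ->
  x * (u * g + f * v) + y * (u' * g + gsig f * v') =
  (x * u + y * u') * g + gsig f * (x * v + y * v').
Proof.
move=> hx hy; rewrite !mulrDl !mulrDr !mulrA (godd_sig (gsig f) hx) gsigK.
by rewrite -(geven_comm (gsig f) hy) addrACA.
Qed.

(** As functions of [F], both sides are derivations along the pullback and agree on constants and on
    z. Writing F = F(z0) + (z - z0) G, their difference at [F] is [nu] times their difference at
    [G]; after [N.+2] steps the power of [nu] is 0. *)
Lemma chain_rule a b F : geven a -> godd b -> sh F z0 ->
  vf a b (fun q => sev (Z q) (Th q) F) =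
  vf a b Z * sev (Z p) (Th p) (sdz F) +
  vf a b Th * sev (Z p) (Th p) (fun w => thp1 (F w)).
Proof.
move=> ha hb hF.
have Zpe := nbhs_singleton Ze; have Tpo := nbhs_singleton To.
pose phi F := sev (Z p) (Th p) F.
pose de F := vf a b (fun q => sev (Z q) (Th q) F).
pose dr F := vf a b Z * phi (sdz F) + vf a b Th * phi (fun w => thp1 (F w)).
have dZo : godd (vf a b Z) by exact: (vf_hom ha hb Ze).
have dTe : geven (vf a b Th) by exact: (vf_hom ha hb To).
pose nu := Z p - z0%:A.
apply/eqP; rewrite -subr_eq0; change (de F - dr F == 0).
have deD F1 G1 : sh F1 z0 -> sh G1 z0 -> de (fun q => F1 q + G1 q) = de F1 + de G1.
  move=> h1 h2; rewrite /de -(vfD _ _ (sh_pull h1) (sh_pull h2)).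
  by apply: vf_near; exact: near_pullD.
have deM F1 G1 : sh F1 z0 -> sh G1 z0 ->
    de (fun q => F1 q * G1 q) = de F1 * phi G1 + gsig (phi F1) * de G1.
  move=> h1 h2; rewrite /de -(vfM ha hb (sh_pull h1) (sh_pull h2)).
  by apply: vf_near; exact: near_pullM.
have drD F1 G1 : sh F1 z0 -> sh G1 z0 -> dr (fun q => F1 q + G1 q) = dr F1 + dr G1.
  move=> h1 h2; rewrite /dr.
  have -> : phi (sdz (fun q => F1 q + G1 q)) = phi (sdz F1) + phi (sdz G1).
    rewrite /phi -(sevD _ (sh_sdz h1) (sh_sdz h2)).
    apply: sev_near; apply: filterS2 (sh_near h1) (sh_near h2) => q.
    exact: sdzD.
  have -> : phi (fun w => thp1 (F1 w + G1 w)) = phi (fun w => thp1 (F1 w)) + phi (fun w => thp1 (G1 w)).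
    rewrite /phi -(sevD _ (sh_thp1 h1) (sh_thp1 h2)).
    by apply: sev_near; near=> q; rewrite thp1D.
  exact: mulrD2.
have drM F1 G1 : sh F1 z0 -> sh G1 z0 ->
    dr (fun q => F1 q * G1 q) = dr F1 * phi G1 + gsig (phi F1) * dr G1.
  move=> h1 h2; rewrite /dr.
  have -> : phi (sdz (fun q => F1 q * G1 q)) = phi (sdz F1) * phi G1 + phi F1 * phi (sdz G1).
    rewrite /phi -(sevM Zpe Tpo (sh_sdz h1) h2) -(sevM Zpe Tpo h1 (sh_sdz h2)).
    rewrite -(sevD _ (shM (sh_sdz h1) h2) (shM h1 (sh_sdz h2))).
    apply: sev_near; apply: filterS2 (sh_near h1) (sh_near h2) => q.
    exact: sdzM.
  have -> : phi (fun w => thp1 (F1 w * G1 w)) =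
      phi (fun w => thp1 (F1 w)) * phi G1 + gsig (phi F1) * phi (fun w => thp1 (G1 w)).
    have hs := sh_sig h1.
    rewrite /phi -(sev_sig Zpe Tpo h1) -(sevM Zpe Tpo (sh_thp1 h1) h2).
    rewrite -(sevM Zpe Tpo hs (sh_thp1 h2)).
    rewrite -(sevD _ (shM (sh_thp1 h1) h2) (shM hs (sh_thp1 h2))).
    by apply: sev_near; near=> q; rewrite thp1M.
  exact: twisted_leibniz.
have de_cst x : de (fun=> x) = dr (fun=> x).
  rewrite /de /dr.
  have -> : vf a b (fun q => sev (Z q) (Th q) (fun=> x)) = vf a b Th * thp1 x.
    transitivity (vf a b (fun q => thp0 x + Th q * thp1 x)).
      apply: vf_near; move: Ze To; apply: filterS2 => q _ _.
      by rewrite sev_cst.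
    rewrite (vfD _ _ (sh_cst H _ _) (shM hTh (sh_cst H _ _))).
    rewrite (vf_cst _ _ (@thp0_free K N x)) add0r (vfM ha hb hTh (sh_cst H _ _)).
    by rewrite (vf_cst _ _ (@thp1_free K N x)) mulr0 addr0.
  have -> : phi (sdz (fun=> x)) = 0.
    transitivity (phi (fun=> 0)).
      by apply: sev_near; near=> q; exact: sdz_cst.
    by rewrite /phi sev_cst (chi_free _ (@thfree0 K N)).
  by rewrite mulr0 add0r /phi sev_cst (chi_free _ (@thp1_free K N x)).
have de_id : de (fun q => q%:A) = dr (fun q => q%:A).
  rewrite /de /dr.
  have -> : vf a b (fun q => sev (Z q) (Th q) (fun q => q%:A)) = vf a b Z.
    by apply: vf_near; near=> q; exact: sev_id.
  have -> : phi (sdz (fun q => q%:A : L)) = 1.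
    transitivity (phi (fun=> 1)).
      by apply: sev_near; near=> q; exact: sdz_id.
    by rewrite /phi sev_cst (chi_free _ (@thfree1 K N)).
  have -> : phi (fun w => thp1 (w%:A : L)) = 0.
    transitivity (phi (fun=> 0)).
      by apply: sev_near; near=> q; have /thfreeP := @thfree_alg K N q.
    by rewrite /phi sev_cst (chi_free _ (@thfree0 K N)).
  by rewrite mulr1 mulr0 addr0.
have nue : gsig nu = nu by apply/gevenE/ghomB => //; exact: geven_alg.
have nu0 : nu ^+ N.+2 = 0 by exact: nu_nilp.
have phi_nu : phi (fun q => q%:A + - z0%:A) = nu.
  rewrite /phi (sevD _ (@sh_id _ H N _) (sh_cst H _ _)) sev_id sev_cst.
  by rewrite (@chi_free _ (- z0%:A)) //; exact/thfreeN/thfree_alg.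
have main d d' e e' : d = d' -> d + (nu * e) - (d' + nu * e') = nu * (e - e').
  by move=> ->; rewrite opprD addrACA subrr add0r -mulrBr.
have cs : de (fun q => q%:A + - z0%:A) = dr (fun q => q%:A + - z0%:A).
  by rewrite (deD _ _ (@sh_id _ H N z0) (sh_cst H _ z0)) (drD _ _ (@sh_id _ H N z0) (sh_cst H _ z0)) de_cst de_id.
have de_cst' := de_cst.
clearbody de dr phi nu.
have step G : sh G z0 -> exists2 G', sh G' z0 & de G - dr G = nu * (de G' - dr G').
  move=> hG; have [G' hG' e] := sh_factor hG; exists G' => //.
  have hB : sh (fun q => q%:A + - z0%:A : L) z0 by apply: (shD (F := fun q => q%:A) (G := fun=> - z0%:A)); [exact: sh_id|exact: sh_cst].
  have -> : G = fun q => G z0 + (q%:A + - z0%:A) * G' q.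
    by apply/funext => q; rewrite e -scalerBl.
  have hm : sh (fun q => (q%:A + - z0%:A) * G' q) z0 by exact: shM.
  rewrite (deD _ _ (sh_cst H _ _) hm) (drD _ _ (sh_cst H _ _) hm) (deM _ _ hB hG') (drM _ _ hB hG').
  by rewrite phi_nu nue cs de_cst' !addrA; apply: main.
have iter_step k : exists2 G', sh G' z0 & de F - dr F = nu ^+ k * (de G' - dr G').
  elim: k => [|k [G hG ->]]; first by exists F => //; rewrite expr0 mul1r.
  have [G' hG' ->] := step G hG; exists G' => //.
  by rewrite mulrA exprSr.
have [G _ ->] := iter_step N.+2.
by rewrite nu0 mul0r.
Unshelve. all: by end_near. Qed.

End Maps.

(** The left side, as a function of [F], is additive and multiplicative, and sends z and theta to
    the pullbacks of [Z'] and [Th']; [sev_unique] identifies it. *)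
Lemma sev_comp (Z Th Z' Th' : K -> L) p F :
  geven (Z p) -> godd (Th p) -> sh Z' (gbody (Z p)) -> sh Th' (gbody (Z p)) ->
  (\forall q \near gbody (Z p), geven (Z' q)) ->
  (\forall q \near gbody (Z p), godd (Th' q)) ->
  sh F (gbody (Z' (gbody (Z p)))) ->
  sev (Z p) (Th p) (fun q => sev (Z' q) (Th' q) F) =
  sev (sev (Z p) (Th p) Z') (sev (Z p) (Th p) Th') F.
Proof.
move=> ze to hZ' hT' Ze' To' hF.
have z'e : geven (sev (Z p) (Th p) Z') by exact: sev_hom.
have t'o : godd (sev (Z p) (Th p) Th') by exact: sev_hom.
have eb : gbody (sev (Z p) (Th p) Z') = gbody (Z' (gbody (Z p))) by exact: sev_body.
have hu := @sev_unique _ _ z'e t'o (fun F => sev (Z p) (Th p) (fun q => sev (Z' q) (Th' q) F)).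
rewrite eb in hu; apply: hu; last exact: hF.
- move=> F1 G1 h1 h2; rewrite -(sevD _ (sh_pull hZ' hT' h1) (sh_pull hZ' hT' h2)).
  by apply: sev_near; exact: near_pullD.
- move=> F1 G1 h1 h2; rewrite -(sevM ze to (sh_pull hZ' hT' h1) (sh_pull hZ' hT' h2)).
  by apply: sev_near; exact: near_pullM.
- move=> x; transitivity (sev (Z p) (Th p) (fun q => thp0 x + Th' q * thp1 x)).
    by apply: sev_near; near=> q; rewrite sev_cst.
  rewrite (sevD _ (sh_cst H _ _) (shM hT' (sh_cst H _ _))) (sevM ze to hT' (sh_cst H _ _)).
  by rewrite !sev_cst (chi_free _ (@thp0_free K N x)) (chi_free _ (@thp1_free K N x)).
- by apply: sev_near; near=> q; exact: sev_id.
Unshelve. all: by end_near. Qed.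

End Pullback.

End Pullbacks.
Export Pullbacks.

Module SconfMaps.

(** * Superconformal germs and the transformation of D^3 *)

Section Superconformal.
Variables (K : numClosedFieldType) (H : holoCalc K) (N : nat).
Local Notation L := (grass K N.+1).
Local Notation th := (ggen K (ord0 : 'I_N.+1)).
Local Notation sh := (sh H).
Local Notation sdz := (sdz H).
Local Notation SD := (SD H).
Local Notation sev := (sev H).
Implicit Types (p q : K) (F G Z T : K -> L) (x y z t : L).

Definition pull Z T F : K -> L := fun q => sev (Z q) (T q) F.

Record scgerm Z T p : Prop := ScGerm {
  sc_shZ : sh Z p;
  sc_shT : sh T p;
  sc_Ze : \forall q \near p, geven (Z q);
  sc_To : \forall q \near p, godd (T q);
  sc_conf : \forall q \near p, SD Z q = T q * SD T q;
  sc_unit : SD T p \is a GRing.unit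
}.

Lemma near_unit F p : sh F p -> F p \is a GRing.unit -> \forall q \near p, F q \is a GRing.unit.
Proof.
move=> hF; rewrite gunitE => /(near_body_neq0 hF); apply: filterS => q.
by rewrite gunitE.
Qed.

Lemma sc_near Z T p : scgerm Z T p -> \forall q \near p, scgerm Z T q.
Proof.
move=> [h1 h2 h3 h4 h5 h6]; have h7 := near_unit (sh_SD h2) h6.
have {}h1 := sh_near h1; have {}h2 := sh_near h2.
have {}h3 := near_near h3; have {}h4 := near_near h4; have {}h5 := near_near h5.
near=> q; split; by near: q.
Unshelve. all: by end_near. Qed.

Lemma sc_ext Z T Z' T' p : (\forall q \near p, Z q = Z' q) -> (\forall q \near p, T q = T' q) ->
  scgerm Z T p -> scgerm Z' T' p.
Proof.
move=> hZ hT [h1 h2 h3 h4 h5 h6]; split.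
- exact: sh_ext hZ h1.
- exact: sh_ext hT h2.
- by apply: filterS2 hZ h3 => q ->.
- by apply: filterS2 hT h4 => q ->.
- have hZ' := near_SD' H hZ; have hT' := near_SD' H hT.
  near=> q; have <- : SD Z q = SD Z' q by near: q.
  have <- : SD T q = SD T' q by near: q.
  have <- : T q = T' q by near: q.
  by near: q.
- by rewrite -(near_SD H hT).
Unshelve. all: by end_near. Qed.

Section Germ.
Variables (Z T : K -> L) (p : K).
Hypothesis g : scgerm Z T p.
Let z0 := gbody (Z p).
Let J := SD T.
Let u q := (J q)^-1.
Let shZ := sc_shZ g.
Let shT := sc_shT g.
Let Ze := sc_Ze g.
Let To := sc_To g.

Lemma sc_body P : (\forall w \near z0, P w) -> \forall q \near p, P (gbody (Z q)).
Proof. exact: near_body. Qed.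

Lemma pull_ext F G : (\forall w \near z0, F w = G w) -> \forall q \near p, pull Z T F q = pull Z T G q.
Proof.
move=> /near_near/sc_body; apply: filterS => q h; exact: sev_near.
Qed.

Lemma sh_pullg F : sh F z0 -> sh (pull Z T F) p.
Proof. exact: sh_pull. Qed.

Lemma pull_D F G : sh F z0 -> sh G z0 -> \forall q \near p,
  pull Z T (fun w => F w + G w) q = pull Z T F q + pull Z T G q.
Proof. exact: near_pullD. Qed.
Lemma pull_M F G : sh F z0 -> sh G z0 -> \forall q \near p,
  pull Z T (fun w => F w * G w) q = pull Z T F q * pull Z T G q.
Proof. exact: near_pullM. Qed.
Lemma pull_cst x q : thfree x -> pull Z T (fun=> x) q = x.
Proof. by move=> h; rewrite /pull sev_cst chi_free. Qed.
Lemma pull_hom b F : (\forall w \near z0, ghom b (F w)) -> \forall q \near p, ghom b (pull Z T F q).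
Proof.
move=> /near_near/sc_body h; move: h Ze To; apply: filterS3 => q h ze to.
exact: sev_hom.
Qed.

Lemma pull_inv F : sh F z0 -> F z0 \is a GRing.unit ->
  \forall q \near p, pull Z T (fun w => (F w)^-1) q = (pull Z T F q)^-1.
Proof.
move=> hF F0; have hV := sh_inv hF F0.
have hu := near_unit hF F0.
have hm := pull_M hF hV; have hm' := pull_M hV hF.
have e : \forall q \near p, pull Z T (fun w => F w * (F w)^-1) q = pull Z T (fun=> 1) q.
  by apply: pull_ext; move: hu; apply: filterS => w /divrr.
have e' : \forall q \near p, pull Z T (fun w => (F w)^-1 * F w) q = pull Z T (fun=> 1) q.
  by apply: pull_ext; move: hu; apply: filterS => w /mulVr.
apply: filterS2 (filterI hm hm') (filterI e e') => q [a b] [c d].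
have c1 := pull_cst q (@thfree1 K N).
have h1 := etrans (esym a) (etrans c c1); have h2 := etrans (esym b) (etrans d c1).
have U : pull Z T F q \is a GRing.unit by apply/unitrP; exists (pull Z T (fun w => (F w)^-1) q).
by apply: (mulrI U); rewrite h1 divrr.
Qed.

Lemma sc_J_sh : sh J p. Proof. exact: sh_SD. Qed.
Lemma sc_J_even : \forall q \near p, geven (J q).
Proof. exact: near_SD_hom To. Qed.
Lemma sc_J_unit : \forall q \near p, J q \is a GRing.unit.
Proof. exact: near_unit sc_J_sh (sc_unit g). Qed.
Lemma sc_u_sh : sh u p. Proof. exact: sh_inv sc_J_sh (sc_unit g). Qed.
Lemma sc_u_even : \forall q \near p, geven (u q).
Proof. by move: sc_J_even; apply: filterS => q; exact: gevenV. Qed.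
Lemma sc_uJ : \forall q \near p, u q * J q = 1.
Proof. by move: sc_J_unit; apply: filterS => q; exact: mulVr. Qed.

Lemma SD_vf F q : SD F q = vf H q 1 th F.
Proof. by rewrite /vf mul1r. Qed.

(** The chain rule has one term with factor D z' and one with factor D theta'. As D z' = theta' D
    theta', the factor D theta' comes out and the pullback of D F remains. *)
Lemma sc_chain0 F : sh F z0 -> SD (pull Z T F) p = J p * pull Z T (SD F) p.
Proof.
move=> hF; rewrite SD_vf (chain_rule shZ shT Ze To (@geven1 _ _) (@th_odd K N) hF).
rewrite -!SD_vf (near_at (sc_conf g)) -/J /pull.
have To' := near_at To; have Je := near_at sc_J_even.
have -> : sev (Z p) (T p) (SD F) =
    sev (Z p) (T p) (fun w => thp1 (F w)) + T p * sev (Z p) (T p) (sdz F).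
  have hth := sh_cst H th z0.
  have -> : T p * sev (Z p) (T p) (sdz F) = sev (Z p) (T p) (fun w => th * sdz F w).
    by rewrite (sevM (near_at Ze) To' hth (sh_sdz hF)) (sev_th H (Z p) To').
  by rewrite -(sevD _ (sh_thp1 hF) (shM hth (sh_sdz hF))).
move: (sev (Z p) (T p) (fun w => thp1 (F w))) (sev (Z p) (T p) (sdz F)) => a b.
move: (J p) (T p) Je => j t je.
by rewrite mulrDr addrC !mulrA (geven_comm t je).
Qed.

End Germ.

Lemma sc_chain Z T p F : scgerm Z T p -> sh F (gbody (Z p)) ->
  \forall q \near p, SD (pull Z T F) q = SD T q * pull Z T (SD F) q.
Proof.
move=> g hF; have h1 := sc_near g; have h2 := sc_body g (sh_near hF).
by apply: filterS2 h1 h2 => q a b; exact: (sc_chain0 a b).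
Qed.

Lemma add6 (V : zmodType) (a b c d e f : V) :
  a + b - (c - d) + (- e + f) = f + a + (b - c) + (d - e).
Proof. by rewrite opprB !addrA [LHS](ACl (6*1*2*4*3*5)). Qed.

(** Three Leibniz rules. With [u] the inverse of [J], one has D J = - J^2 D u, and this cancels the
    coefficients of [f1] and [f2], that is, the terms of order 1 and 2. *)
Lemma third_order_law (u J f0 f1 f2 f3 : K -> L) p :
  sh u p -> sh J p -> sh f0 p -> sh f1 p -> sh f2 p ->
  (\forall q \near p, geven (u q)) -> (\forall q \near p, geven (J q)) ->
  (\forall q \near p, u q * J q = 1) ->
  (\forall q \near p, SD f0 q = J q * f1 q) ->
  (\forall q \near p, SD f1 q = J q * f2 q) ->
  (\forall q \near p, SD f2 q = J q * f3 q) ->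
  \forall q \near p, SD (SD (SD (fun q => u q * f0 q))) q =
    J q ^+ 2 * f3 q + SD (SD (SD u)) q * f0 q.
Proof.
move=> us Js s0 s1 s2 ue Je uJ d0 d1 d2.
have u1s := sh_SD us; have u2s := sh_SD u1s.
have u1o := near_SD_hom H ue; have u2e := near_SD_hom H u1o.
have u3o := near_SD_hom H u2e; have J1o := near_SD_hom H Je.
have e1 : \forall q \near p, SD (fun q => u q * f0 q) q = SD u q * f0 q + f1 q.
  apply: filterS3 (filterI (sh_near us) (sh_near s0)) (filterI ue uJ) d0 => q [h1 h2] [h3 h4] h5.
  rewrite (SDM h1 h2) h5 (_ : gsig (u q) = u q); last exact/gevenE.
  by rewrite mulrA h4 mul1r.
have e1' := near_SD' H e1.
have e2 : \forall q \near p, SD (SD (fun q => u q * f0 q)) q =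
    SD (SD u) q * f0 q - SD u q * J q * f1 q + J q * f2 q.
  have n1 := sh_near u1s; have n2 := sh_near s0; have n3 := sh_near s1.
  near=> q.
  have -> : SD (SD (fun q => u q * f0 q)) q = SD (fun q => SD u q * f0 q + f1 q) q by near: q.
  have h1 : sh (SD u) q by near: q.
  have h2 : sh f0 q by near: q.
  have h3 : sh f1 q by near: q.
  rewrite (SDD (shM h1 h2) h3) (SDM h1 h2).
  have -> : SD f0 q = J q * f1 q by near: q.
  have -> : SD f1 q = J q * f2 q by near: q.
  have /goddE -> : godd (SD u q) by near: q.
  by rewrite mulNr mulrA.
have e2' := near_SD' H e2.
have DJ : \forall q \near p, SD u q * J q + u q * SD J q = 0.
  have := near_SD' H uJ.
  apply: filterS3 (filterI (sh_near us) (sh_near Js)) ue => q [h1 h2] h3.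
  rewrite (SDM h1 h2) SD_cst; last exact: thfree1.
  by rewrite (_ : gsig (u q) = u q) //; exact/gevenE.
have n0 := sh_near s0; have n1 := sh_near s1; have n2 := sh_near s2.
have m1 := sh_near u1s; have m2 := sh_near u2s; have mJ := sh_near Js.
near=> q.
have -> : SD (SD (SD (fun q => u q * f0 q))) q =
  SD (fun q => SD (SD u) q * f0 q - SD u q * J q * f1 q + J q * f2 q) q by near: q.
have h0 : sh f0 q by near: q.
have h1 : sh f1 q by near: q.
have h2 : sh f2 q by near: q.
have k1 : sh (SD u) q by near: q.
have k2 : sh (SD (SD u)) q by near: q.
have kJ : sh J q by near: q.
have k1J := shM k1 kJ.
rewrite (SDD (shB (shM k2 h0) (shM k1J h1)) (shM kJ h2)) (SDB (shM k2 h0) (shM k1J h1)).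
rewrite (SDM k2 h0) (SDM k1J h1) (SDM kJ h2) (SDM k1 kJ).
have -> : SD f0 q = J q * f1 q by near: q.
have -> : SD f1 q = J q * f2 q by near: q.
have -> : SD f2 q = J q * f3 q by near: q.
have [[uo u2q] u3q] : (godd (SD u q) /\ geven (SD (SD u) q)) /\ godd (SD (SD (SD u)) q).
  by near: q; exact: filterI (filterI u1o u2e) u3o.
have Jq : geven (J q) by near: q.
have J1q : godd (SD J q) by near: q.
have uq : geven (u q) by near: q.
have uJq : u q * J q = 1 by near: q.
have DJq : SD u q * J q + u q * SD J q = 0 by near: q.
(* The equation D (u J) = 0 multiplied by [J]. *)
have J1E : SD J q = - (J q * J q * SD u q).
  have := congr1 (fun z => J q * z) DJq; rewrite mulr0 mulrDr !mulrA.
  rewrite (geven_comm (u q) Jq) uJq mul1r => /eqP; rewrite addrC addr_eq0 => /eqP ->.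
  by congr (- _); sring.
have -> : gsig (SD u q * J q) = - (SD u q * J q) by apply/goddE/godd_evenM.
have -> : gsig (SD (SD u) q) = SD (SD u) q by exact/gevenE.
have -> : gsig (SD u q) = - SD u q by exact/goddE.
have -> : gsig (J q) = J q by exact/gevenE.
rewrite J1E; move: (f0 q) (f1 q) (f2 q) (f3 q) => v0 v1 v2 v3.
move: (SD (SD (SD u)) q) (SD (SD u) q) (SD u q) (J q) u3q u2q uo Jq => w3 w2 w1 j w3o w2e w1o je.
(* [c1] and [c2] are the coefficients of [v1] and [v2]; the second product of the first one contains
   the square of the odd [w1]. *)
have c1 : w2 * j - (w2 * j + - w1 * - (j * j * w1)) = 0 by sring.
have c2 : w1 * j * j - j * j * w1 = 0 by sring.
transitivity (j ^+ 2 * v3 + w3 * v0 + (w2 * j - (w2 * j + - w1 * - (j * j * w1))) * v1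
   + (w1 * j * j - j * j * w1) * v2); last by rewrite c1 c2 !mul0r !addr0.
move: (w2 * j + - w1 * - (j * j * w1)) (j * j * w1) => c e.
rewrite expr2 !mulrBl !mulNr !mulrA.
move: (w3 * v0) (w2 * j * v1) (c * v1) (w1 * j * j * v2) (e * v2) (j * j * v3) => a1 a2 a3 a4 a5 a6.
exact: add6.
Unshelve. all: by end_near. Qed.

(* With phi = u T^*phi' for u = (D theta')^-1, D^3 phi is
   (D theta')^2 T^*(D^3 phi') up to a term of order zero. *)
Lemma sc_law Z T p F : scgerm Z T p -> sh F (gbody (Z p)) ->
  \forall q \near p, SD (SD (SD (fun q => (SD T q)^-1 * pull Z T F q))) q =
    SD T q ^+ 2 * pull Z T (SD (SD (SD F))) q
    + SD (SD (SD (fun q => (SD T q)^-1))) q * pull Z T F q.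
Proof.
move=> g hF; have hF1 := sh_SD hF; have hF2 := sh_SD hF1.
exact: (third_order_law (sc_u_sh g) (sc_J_sh g) (sh_pullg g hF) (sh_pullg g hF1)
  (sh_pullg g hF2) (sc_u_even g) (sc_J_even g) (sc_uJ g) (sc_chain g hF) (sc_chain g hF1)
  (sc_chain g hF2)).
Qed.

End Superconformal.

End SconfMaps.
Export SconfMaps.

Module PullbackComp.

Section Composition.
Variables (K : numClosedFieldType) (H : holoCalc K) (N : nat).
Local Notation L := (grass K N.+1).
Local Notation th := (ggen K (ord0 : 'I_N.+1)).
Local Notation sh := (sh H).
Local Notation sdz := (sdz H).
Local Notation SD := (SD H).
Local Notation sev := (sev H).
Local Notation pull := (pull H).
Local Notation scgerm := (scgerm H).
Implicit Types (p q : K) (F G Z T : K -> L).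

(** The factor 1 / D theta' by which fields of dimension -1/2 change. *)
Definition uinv T : K -> L := fun q => (SD T q)^-1.

Opaque SconfMaps.pull SuperDerivation.SD.
Section Two.
Variables (Z T Z' T' : K -> L) (p : K).
Hypotheses (g : scgerm Z T p) (g' : scgerm Z' T' (gbody (Z p))).

Lemma sc_compJ : \forall q \near p, SD (pull Z T T') q = SD T q * pull Z T (SD T') q.
Proof. exact: sc_chain g (sc_shT g'). Qed.

Lemma sc_comp : scgerm (pull Z T Z') (pull Z T T') p.
Proof.
have hJ := sc_compJ; have hZ := sc_chain g (sc_shZ g').
have hc := pull_ext g (sc_conf g').
have hm := pull_M g (sc_shT g') (sh_SD (sc_shT g')).
split.
- exact: (sh_pullg g (sc_shZ g')).
- exact: (sh_pullg g (sc_shT g')).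
- exact: (pull_hom g (sc_Ze g')).
- exact: (pull_hom g (sc_To g')).
- have Je := sc_J_even g.
  apply: filterS3 (filterI hJ hZ) (filterI hc hm) Je => q [a b] [c d] e.
  by rewrite a b c d mulrA (geven_comm _ e) -mulrA.
- rewrite (near_at hJ) gunitE gbodyM mulf_neq0 //; first by rewrite -gunitE (sc_unit g).
  Transparent SconfMaps.pull. rewrite /pull (sev_body H (Z p) (near_at (sc_To g))) -gunitE; exact: (sc_unit g').
Qed.
Opaque SconfMaps.pull.

Lemma sc_comp_u : \forall q \near p,
  uinv (pull Z T T') q = uinv T q * pull Z T (uinv T') q.
Proof.
have hi := pull_inv g (sh_SD (sc_shT g')) (sc_unit g').
have Ju := sc_J_unit g; have J'u := sc_J_unit sc_comp; have Je := sc_J_even g.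
apply: filterS3 (filterI sc_compJ hi) (filterI Ju Je) J'u => q [a b] [c d] e.
move: e; rewrite /uinv a b => e.
have e' : pull Z T (SD T') q \is a GRing.unit by rewrite -(unitrMr _ c).
by rewrite invrM // geven_comm //; apply: gevenV.
Qed.

Let u := uinv T.
Let u' := uinv T'.
Let shu : sh u p := sc_u_sh g.
Let shu' : sh u' (gbody (Z p)) := sc_u_sh g'.

Lemma sc_comp_Du : \forall q \near p,
  SD (uinv (pull Z T T')) q = SD u q * pull Z T u' q + pull Z T (SD u') q.
Proof.
have h1 := near_SD' H sc_comp_u; have h2 := sc_chain g shu'.
have hp := sh_near (sh_pullg g shu').
apply: filterS3 (filterI h1 h2) (filterI (sh_near shu) hp) (filterI (sc_u_even g) (sc_uJ g)) => q [a b] [c d] [e f].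
rewrite a (SDM c d) b (_ : gsig (u q) = u q); last exact/gevenE.
by rewrite mulrA f mul1r.
Qed.

Lemma sc_comp_D2u : \forall q \near p,
  SD (SD (uinv (pull Z T T'))) q = SD (SD u) q * pull Z T u' q
    - SD u q * SD T q * pull Z T (SD u') q + SD T q * pull Z T (SD (SD u')) q.
Proof.
have h1 := near_SD' H sc_comp_Du; have h2 := sc_chain g shu'.
have h3 := sc_chain g (sh_SD shu').
have hp := sh_near (sh_pullg g shu'); have hp' := sh_near (sh_pullg g (sh_SD shu')).
have uo := near_SD_hom H (sc_u_even g).
apply: filterS3 (filterI h1 (filterI h2 h3)) (filterI (sh_near (sh_SD shu)) uo) (filterI hp hp') => q [a [b b']] [c e] [d d'].
apply: (etrans a); apply: (etrans (SDD (shM c d) d')); apply: (etrans (congr2 +%R (SDM c d) erefl)).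
move: b b'; move: (SD (pull Z T u') q) (SD (pull Z T (SD u')) q) => x y -> ->.
have /goddE -> : godd (SD u q) by [].
by rewrite mulNr mulrA.
Qed.

(** The cocycle rule of the super Schwarzian derivative, which is minus D theta' times D^3 u: the
    third order law applied to [u']. *)
Lemma sc_comp_D3u : \forall q \near p,
  SD (SD (SD (uinv (pull Z T T')))) q =
  SD T q ^+ 2 * pull Z T (SD (SD (SD u'))) q + SD (SD (SD u)) q * pull Z T u' q.
Proof.
have h1 := near_SD' H (near_SD' H (near_SD' H sc_comp_u)).
have h2 := sc_law g shu'.
by apply: filterS2 h1 h2 => q a b; exact: (etrans a b).
Qed.

End Two.

Lemma pull_comp Z T Z' T' F p : scgerm Z T p -> scgerm Z' T' (gbody (Z p)) ->
  sh F (gbody (Z' (gbody (Z p)))) -> \forall q \near p,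
  pull Z T (pull Z' T' F) q = pull (pull Z T Z') (pull Z T T') F q.
Proof.
move=> g g' hF; have h1 := sc_near g.
have h2 := sc_body g (sc_near g').
have h3 := sc_body g (sc_body g' (sh_near hF)).
apply: filterS3 h1 h2 h3 => q a b c.
exact: (sev_comp (near_at (sc_Ze a)) (near_at (sc_To a)) (sc_shZ b) (sc_shT b) (sc_Ze b) (sc_To b) c).
Qed.

Lemma pull_id F p : sh F p -> \forall q \near p, pull (fun q => q%:A) (fun=> th) F q = F q.
Proof. by move=> /sh_near; apply: filterS => q; exact: sev_refl. Qed.
Transparent SconfMaps.pull SuperDerivation.SD.

End Composition.

End PullbackComp.
Export PullbackComp.

(** * SPL_2 as the solutions of D^3 (1 / D theta') = 0 *)

Section SPL.
Variables (K : numClosedFieldType) (H : holoCalc K) (N : nat).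
Local Notation L := (grass K N.+1).
Local Notation th := (ggen K (ord0 : 'I_N.+1)).
Local Notation sh := (sh H).
Local Notation sdz := (sdz H).
Local Notation SD := (SD H).
Local Notation scgerm := (scgerm H).
Local Notation uinv := (uinv H).
Implicit Types (p q : K) (F G Z T : K -> L) (a b c d gam del : L).

Definition lin a b : K -> L := fun q => a * q%:A + b.
Definition splZ a b c d gam del : K -> L := fun q =>
  lin a b q / lin c d q + th * (lin gam del q / lin c d q ^+ 2).
Definition splT c d gam del : K -> L := fun q =>
  lin gam del q / lin c d q + th * ((1 + 2^-1 *: (del * gam)) / lin c d q).

Lemma lin_hom e a b q : ghom e a -> ghom e b -> ghom e (lin a b q).
Proof.
move=> ha hb; apply: ghomD => //.
by have := ghomM ha (@geven_alg K _ q); rewrite addbF.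
Qed.
Lemma lin_free a b q : thfree a -> thfree b -> thfree (lin a b q).
Proof. by move=> ha hb; apply: thfreeD => //; apply: thfreeM => //; exact: thfree_alg. Qed.
Lemma sh_lin a b q : sh (lin a b) q.
Proof. exact: (shD (shM (sh_cst H a q) (@sh_id _ H N q)) (sh_cst H b q)). Qed.
Lemma sdz_lin a b q : sdz (lin a b) q = a.
Proof.
rewrite (sdzD (shM (sh_cst H a q) (@sh_id _ H N q)) (sh_cst H b q)).
by rewrite (sdzM (sh_cst H a q) (@sh_id _ H N q)) sdz_cst mul0r sdz_id mulr1 add0r sdz_cst addr0.
Qed.

Lemma sdz_const F p : sh F p -> (\forall q \near p, sdz F q = 0) -> \forall q \near p, F q = F p.
Proof.
move=> hF h.
have h' A : \forall q \near p, F q A = F p A.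
  apply: (hc_const (hF A)); apply: filterS h => q hq.
  by rewrite -sdzE hq gzeroE.
have h2 : \forall q \near p, forall A, F q A = F p A.
  exact: (@filter_forall _ _ (fun A q => F q A = F p A) (nbhs p) _ h').
by apply: filterS h2 => q hq; apply/ffunP.
Qed.

Lemma sdz_linear F w p : sh F p -> (\forall q \near p, sdz F q = w) ->
  \forall q \near p, F q = lin w (F p - w * p%:A) q.
Proof.
move=> hF h.
have hl q := sh_lin w 0 q.
have hG := shB hF (hl p).
have e : \forall q \near p, sdz (fun q => F q - lin w 0 q) q = 0.
  apply: filterS2 h (sh_near hF) => q h1 h2.
  by rewrite (sdzB h2 (hl q)) sdz_lin h1 subrr.
have := sdz_const hG e; apply: filterS => q.
rewrite /lin !addr0 => h1; apply/eqP; rewrite addrC -subr_eq; apply/eqP.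
exact: h1.
Qed.

Definition halfp del gam : L := 1 + 2^-1 *: (del * gam).

Lemma halfp_even del gam : godd del -> godd gam -> geven (halfp del gam).
Proof. by move=> hd hg; apply: ghomD; [exact: geven1|apply/ghomZ/goddM]. Qed.
Lemma halfp_free del gam : thfree del -> thfree gam -> thfree (halfp del gam).
Proof. by move=> hd hg; apply: thfreeD; [exact: thfree1|apply/thfreeZ/thfreeM]. Qed.
Lemma halfp_unit del gam : godd del -> halfp del gam \is a GRing.unit.
Proof.
by move=> hd; rewrite gunitE gbodyD gbody1 gbodyZ gbodyM (gbody_odd hd) mul0r mulr0 addr0 oner_neq0.
Qed.
Lemma halfp_gam del gam : godd del -> godd gam -> halfp del gam * gam = gam.
Proof.
move=> hd hg; rewrite /halfp mulrDl mul1r -scalerAl -mulrA.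
by rewrite (godd_sq hg) mulr0 scaler0 addr0.
Qed.
Lemma halfp_del del gam : godd del -> godd gam -> halfp del gam * del = del.
Proof.
move=> hd hg; rewrite /halfp mulrDl mul1r -scalerAl (godd_anti hd hg) mulNr -mulrA.
by rewrite (godd_sq hd) mulr0 oppr0 scaler0 addr0.
Qed.
Lemma halfp_sq del gam : godd del -> godd gam -> halfp del gam ^+ 2 = 1 + del * gam.
Proof.
move=> hd hg; rewrite expr2 {1}/halfp mulrDl mul1r -scalerAl -mulrA.
rewrite (_ : gam * _ = gam); last by rewrite -(geven_comm _ (halfp_even hd hg)) halfp_gam.
rewrite /halfp -addrA -scalerDl (_ : 2^-1 + 2^-1 = 1 :> K) ?scale1r //.
by field.
Qed.

(** For a map in SPL_2, 1 / D theta' is affine in z and its z-derivative is a constant of the base;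
    D^3 = D d_z then kills it. *)
Lemma spl_D3u T c d gam del p : [/\ geven c, geven d, godd gam & godd del] ->
  [/\ thfree c, thfree d, thfree gam & thfree del] ->
  lin c d p \is a GRing.unit -> sh T p ->
  (\forall q \near p, T q = splT c d gam del q) ->
  \forall q \near p, SD (SD (SD (uinv T))) q = 0.
Proof.
move=> [ce de go dlo] [cf df gf dlf] mu hT hTe.
pose e := halfp del gam; pose m := lin c d; pose n := lin gam del.
pose kap := gam * d - c * del.
have ee : geven e by exact: halfp_even.
have ef : thfree e by exact: halfp_free.
have eu : e \is a GRing.unit by exact: halfp_unit.
have me q : geven (m q) by exact: lin_hom.
have ko : godd kap by apply: ghomB; [exact: godd_evenM|exact: geven_oddM].
have mU : \forall q \near p, m q \is a GRing.unit by exact: (near_unit (sh_lin c d p)).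
have eVe : geven e^-1 by exact: gevenV.
have mVe q : geven (m q)^-1 by exact: gevenV.
have shm q : m q \is a GRing.unit -> sh (fun q => (m q)^-1) q by move=> ?; apply: sh_inv => //; exact: sh_lin.
have fe : thp1 e^-1 = 0.
  have : thp1 (e * e^-1) = 0 by rewrite divrr //; apply/thfreeP/thfree1.
  rewrite thp1M (_ : thp1 e = 0) ?mul0r ?add0r; last exact/thfreeP.
  have /gevenE -> := ee.
  by move=> h; apply: (mulrI eu); rewrite h mulr0.
have JE : \forall q \near p, SD T q = e / m q + th * (kap / m q ^+ 2).
  have h1 := near_SD' H hTe.
  apply: filterS2 h1 mU => q -> mq.
  have hm := shm q mq.
  have fm : thp1 (m q)^-1 = 0.
    have : thp1 (m q * (m q)^-1) = 0 by rewrite divrr //; apply/thfreeP/thfree1.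
    rewrite thp1M (_ : thp1 (m q) = 0) ?mul0r ?add0r; last exact/thfreeP/lin_free.
    have /gevenE -> := me q.
    by move=> h; apply: (mulrI mq); rewrite h mulr0.
  have hnm := shM (sh_lin gam del q) hm.
  have hem := shM (sh_cst H e q) hm.
  have e1 := SDD hnm (shM (sh_cst H th q) hem).
  apply: (etrans e1); rewrite (SDM (sh_cst H th q) hem) SD_th mul1r.
  rewrite (_ : gsig th = - th); last exact/goddE/th_odd.
  rewrite /SuperDerivation.SD (sdzM (sh_lin gam del q) hm) (sdzM (sh_cst H e q) hm).
  rewrite (sdz_inv (sh_lin c d q) mq (me q)) !sdz_lin sdz_cst mul0r add0r.
  rewrite (_ : thp1 (n q / m q) = 0); last first.
    by rewrite thp1M fm mulr0 addr0 (_ : thp1 _ = 0) ?mul0r //; exact/thfreeP/lin_free.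
  rewrite (_ : thp1 (e / m q) = 0); last first.
    by rewrite thp1M fm mulr0 addr0 (_ : thp1 _ = 0) ?mul0r //; exact/thfreeP.
  have tt (x : L) : - th * (th * x) = 0 by rewrite mulNr mulrA (godd_sq (@th_odd K N)) mul0r oppr0.
  rewrite !add0r tt addr0 addrC.
  congr (_ + th * _); rewrite expr2 (invrM mq mq) -/(m q) /kap.
  have mm := divrr mq; have xe := mVe q; rewrite -{1}(mulr1 (gam / m q)) -{1}mm; clear mm.
  have qe : geven (q%:A : L) := @geven_alg K _ q.
  move: (m q)^-1 xe => x xe; rewrite /n /m /lin.
  by move: (q%:A : L) qe => y ye; sring.
(* The inverse of [e / m + theta kap / m ^+ 2], by theta^2 = 0. *)
pose w q := m q * e^-1 - th * kap * (e^-1 * e^-1).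
have uE : \forall q \near p, uinv T q = w q.
  apply: filterS2 JE mU => q hJ mq.
  have JU : SD T q * w q = 1.
    rewrite hJ /w; have := divrr eu; have := divrr mq; have := mVe q; have := me q.
    rewrite expr2 (invrM mq mq).
    move: (m q) (m q)^-1 (e^-1) eVe (@th_odd K N) => x x' e' e'e tho xe x'e xx ee'.
    transitivity (e * e' * (x * x') + th * kap * x' * (x * x') * e'
       - th * kap * (x' * e') * (e * e')); first by sring.
    by rewrite xx ee' !mulr1 !mulrA addrK.
  have Ju : SD T q \is a GRing.unit.
    rewrite gunitE; apply: contraTneq isT => h.
    have := congr1 (@gbody _ _) JU; rewrite gbodyM h mul0r gbody1 => /eqP.
    by rewrite eq_sym oner_eq0.
  by apply: (mulrI Ju); rewrite /uinv divrr.
have hw q : sh w q.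
  exact: (shB (shM (sh_lin c d q) (sh_cst H e^-1 q)) (sh_cst H (th * kap * (e^-1 * e^-1)) q)).
have sdw q : sdz w q = c * e^-1.
  rewrite (sdzB (shM (sh_lin c d q) (sh_cst H e^-1 q)) (sh_cst H (th * kap * (e^-1 * e^-1)) q)).
  by rewrite sdz_cst subr0 (sdzM (sh_lin c d q) (sh_cst H e^-1 q)) sdz_lin sdz_cst mulr0 addr0.
have h3 := near_SD' H (near_SD' H (near_SD' H uE)).
apply: filterS h3 => q ->.
transitivity (SD (fun=> c * e^-1) q).
  by apply: near_SD; near=> q'; rewrite SD_sq ?sdw.
apply: SD_cst; apply: thfreeM => //; exact/thfreeP.
Unshelve. all: by end_near. Qed.

End SPL.

Section SPLConverse.
Variables (K : numClosedFieldType) (H : holoCalc K) (N : nat).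
Local Notation L := (grass K N.+1).
Local Notation th := (ggen K (ord0 : 'I_N.+1)).
Local Notation sh := (sh H).
Local Notation sdz := (sdz H).
Local Notation SD := (SD H).
Local Notation scgerm := (scgerm H).
Local Notation uinv := (uinv H).
Implicit Types (p q : K) (F G Z T : K -> L).

Lemma thp0_inv (x : L) : x \is a GRing.unit -> thp0 x^-1 = (thp0 x)^-1.
Proof.
move=> xu; have h1 : thp0 x * thp0 x^-1 = 1 by rewrite -thp0M divrr // (thp_free (@thfree1 K N)).1.
have xu' : thp0 x \is a GRing.unit by rewrite gunitE gbody_thp0 -gunitE.
by apply: (mulrI xu'); rewrite h1 divrr.
Qed.

Lemma thp0_SD F q : thp0 (SD F q) = thp1 (F q).
Proof. by rewrite /SuperDerivation.SD thp0D thp0M (thp_theta _ _).1 mul0r addr0 (thp_free (@thp1_free _ _ _)).1. Qed.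
Lemma thp1_SD F q : thp1 (SD F q) = sdz (fun q => thp0 (F q)) q.
Proof.
rewrite sdz_thp0 /SuperDerivation.SD thp1D thp1M' (thp_theta _ _).1 gsig0 mul0r addr0 (thp_theta _ _).2 mul1r.
by rewrite (thp_free (@thp1_free _ _ _)).2 add0r.
Qed.

(** As D^2 = d_z, the hypothesis is D (d_z F) = 0; its two components say that F_1 is constant and
    that F_0 has vanishing second derivative. *)
Lemma D3u_linear F p : sh F p -> (\forall q \near p, SD (SD (SD F)) q = 0) ->
  exists P Q R0 : L, [/\ thfree P, thfree Q, thfree R0 &
    \forall q \near p, thp0 (F q) = lin P Q q /\ thp1 (F q) = R0].
Proof.
move=> hF h.
have h2 : \forall q \near p, SD (sdz F) q = 0.
  have e : \forall q \near p, sdz F q = SD (SD F) q.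
    by apply: filterS (sh_near hF) => q hq; rewrite SD_sq.
  by apply: filterS2 h (near_SD' H e) => q a b; exact: (etrans b a).
have w1 : \forall q \near p, sdz (fun q => thp1 (F q)) q = 0.
  apply: filterS h2 => q hq; rewrite sdz_thp1 -(thp0_SD (sdz F)) hq.
  by rewrite (thp_free (@thfree0 K N)).1.
have w0 : \forall q \near p, sdz (sdz (fun q => thp0 (F q))) q = 0.
  have e : \forall q \near p, sdz (fun q => thp0 (F q)) q = thp0 (sdz F q).
    by near=> q; exact: sdz_thp0.
  have e' := near_sdz' H e.
  apply: filterS2 h2 e' => q hq ->.
  by rewrite -thp1_SD hq (thp_free (@thfree0 K N)).2.
have hF0 := sh_thp0 hF; have hF1 := sh_thp1 hF.
have c1 := sdz_const hF1 w1.
have c0 := sdz_linear hF0 (sdz_const (sh_sdz hF0) w0).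
exists (sdz (fun q => thp0 (F q)) p), (thp0 (F p) - sdz (fun q => thp0 (F q)) p * p%:A), (thp1 (F p)).
have f0 : thfree (sdz (fun q => thp0 (F q)) p) by rewrite sdz_thp0; exact: thp0_free.
split => //; last by apply: filterS2 c0 c1 => q a b; split; [exact: a|exact: b].
  by apply: thfreeB; [exact: thp0_free|apply: thfreeM => //; exact: thfree_alg].
exact: thp1_free.
Unshelve. all: by end_near. Qed.

(** Let 1 / D theta' = u_0 + theta R with u_0 = P z + Q. Then theta'_1 = 1 / u_0, and the
    derivatives of theta'_0 and z'_0 are constants over u_0^2. Hence theta'_0 u_0 and z'_0 u_0 are
    affine in z and are the numerators of a fractional transformation with denominator u_0. *)
Lemma D3u_spl Z T p : scgerm Z T p -> (\forall q \near p, SD (SD (SD (uinv T))) q = 0) ->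
  exists a b c d gam del : L,
  [/\ [/\ geven a, geven b, geven c & geven d] /\ (godd gam /\ godd del),
      [/\ thfree a, thfree b, thfree c & thfree d] /\ (thfree gam /\ thfree del),
      a * d - b * c = 1 &
      \forall q \near p, [/\ lin c d q \is a GRing.unit,
        Z q = splZ a b c d gam del q & T q = splT c d gam del q]].
Proof.
move=> g h3; have shu := sc_u_sh g.
have [P [Q [R0 [Pf Qf Rf uE]]]] := D3u_linear shu h3.
have ue := sc_u_even g; have JU := sc_J_unit g.
pose u0 := lin P Q; pose v q := (u0 q)^-1.
pose T0 q := thp0 (T q); pose Z0 q := thp0 (Z q).
have u0E : \forall q \near p, u0 q = thp0 (uinv T q) by apply: filterS uE => q [].
have u0e : \forall q \near p, geven (u0 q).
  by apply: filterS2 u0E ue => q -> ?; exact: thp0_hom.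
have u0U : \forall q \near p, u0 q \is a GRing.unit.
  by apply: filterS2 u0E JU => q -> ?; rewrite gunitE gbody_thp0 -gunitE unitrV.
have u0f q : thfree (u0 q) by exact: lin_free.
have Ro : godd R0.
  by rewrite -(near_at uE).2; exact: (thp1_hom (near_at ue)).
have shT0 := sh_thp0 (sc_shT g); have shZ0 := sh_thp0 (sc_shZ g).
have T0o : \forall q \near p, godd (T0 q).
  by apply: filterS (sc_To g) => q; exact: thp0_hom.
have Z0e : \forall q \near p, geven (Z0 q).
  by apply: filterS (sc_Ze g) => q; exact: thp0_hom.
have shu0 q : sh u0 q := sh_lin H P Q q.
have du0 q : sdz u0 q = P := sdz_lin H P Q q.
have Pe : geven P.
  by rewrite -(du0 p); exact: sdz_hom.
have ve : \forall q \near p, geven (v q) by apply: filterS u0e => q; exact: gevenV.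
have T1E : \forall q \near p, thp1 (T q) = v q.
  apply: filterS2 u0E JU => q hq hJ.
  by rewrite -thp0_SD /v hq thp0_inv ?invrK // gunitE gbody_thp0 -gunitE.
have dT0 : \forall q \near p, sdz T0 q = - R0 * (v q * v q).
  apply: filterS3 uE (filterI JU u0U) (filterI u0e T1E) => q [a b] [c d] [e f].
  have h1 : thp1 (SD T q * uinv T q) = 0 by rewrite divrr // (thp_free (@thfree1 K N)).2.
  move: h1; rewrite thp1M' a b thp0_SD f thp1_SD -/u0 -/(T0) => h1.
  have {}h1 : sdz T0 q * u0 q = - (v q * R0).
    apply/eqP; rewrite -addr_eq0; move: h1; rewrite (_ : gsig (v q) = v q); first by move=> /eqP.
    by apply/gevenE/gevenV.
  apply: (mulIr d); apply: (etrans h1).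
  rewrite (geven_comm R0 (gevenV e)) !mulNr; congr (- _).
  by rewrite -!mulrA /v mulVr // mulr1.
have sdv : \forall q \near p, sdz v q = - P * (v q * v q).
  apply: filterS2 u0U u0e => q a b; rewrite /v (sdz_inv (shu0 q) a b) du0.
  by move: (u0 q)^-1 (gevenV b) => x xe; sring.
have shv : \forall q \near p, sh v q.
  by apply: filterS u0U => q; exact: sh_inv (shu0 q).
(* The second derivative of [F u0] is [(F' u0)' + F' P], which vanishes by assumption. *)
have lin_step F c : sh F p -> (\forall q \near p, ghom c (F q)) -> (\forall q \near p, thfree (F q)) ->
    (\forall q \near p, sdz (fun q => sdz F q * u0 q) q + sdz F q * P = 0) ->
    exists A B : L, [/\ ghom c A /\ ghom c B, thfree A /\ thfree B &
      \forall q \near p, F q * u0 q = lin A B q].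
  move=> hF hc hf hs.
  have hFn := sh_near hF; have hF1 := sh_near (sh_sdz hF).
  pose A := sdz (fun q => F q * u0 q) p.
  have e1 : \forall q \near p, sdz (fun q => F q * u0 q) q = sdz F q * u0 q + F q * P.
    by apply: filterS hFn => q hq; rewrite (sdzM hq (shu0 q)) du0.
  have e2 := near_sdz' H e1.
  have e3 : \forall q \near p, sdz (sdz (fun q => F q * u0 q)) q = 0.
    apply: filterS3 e2 hs (filterI hFn hF1) => q -> b [c1 c2].
    have m1 := shM c2 (shu0 q); have m2 := shM c1 (sh_cst H P q).
    rewrite (sdzD m1 m2) (sdzM c1 (sh_cst H P q)) sdz_cst mulr0 addr0; exact: b.
  have hm := shM hF (shu0 p).
  have e4 := sdz_linear hm (sdz_const (sh_sdz hm) e3).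
  have hhom : \forall q \near p, ghom c (F q * u0 q).
    by apply: filterS2 hc u0e => q a b; have := ghomM a b; rewrite addbF.
  have Ac : ghom c A by exact: sdz_hom.
  have Af : thfree A.
    rewrite /A; apply/thfreeP; rewrite -sdz_thp1 -(sdz_cst H 0 p).
    by apply: near_sdz; apply: filterS hf => q hq; apply/thfreeP/thfreeM.
  exists A, (F p * u0 p - A * p%:A); split; [split => //|split => //|exact: e4].
    apply: ghomB (near_at hhom) _.
    by have := ghomM Ac (@geven_alg K _ p); rewrite addbF.
  apply: thfreeB; first by apply: thfreeM (near_at hf) _.
  by apply: thfreeM => //; exact: thfree_alg.
have [g0 [dl [[go dlo] [gf dlf] T0u]]] : exists A B : L, [/\ godd A /\ godd B, thfree A /\ thfree B &
      \forall q \near p, T0 q * u0 q = lin A B q].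
  apply: lin_step => //; first by near=> q; exact: thp0_free.
  have e1 : \forall q \near p, sdz T0 q * u0 q = - R0 * v q.
    apply: filterS2 dT0 u0U => q a b; rewrite a /v -!mulrA mulVr // mulr1 //.
  have e2 := near_sdz' H e1.
  apply: filterS3 e2 (filterI shv sdv) (filterI dT0 ve) => q a [b b'] [c c'].
  rewrite a (sdzM (sh_cst H (- R0) q) b) sdz_cst mul0r add0r b' c.
  by move: (v q) c' => x xe; sring.
have gR : g0 * Q - dl * P = - R0.
  have e1 := near_sdz H T0u.
  rewrite sdz_lin (sdzM shT0 (shu0 p)) du0 (near_at dT0) in e1.
  have e2 := near_at T0u; have U := near_at u0U; have ue' := near_at u0e; have ve' := near_at ve.
  have to := near_at T0o; rewrite -/(T0 p) in e1.
  have vu : v p * u0 p = 1 by rewrite /v mulVr.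
  have e3 : g0 * u0 p - lin g0 dl p * P = - R0.
    rewrite -e2 -e1 -(mulr1 (- R0)) -[in RHS]vu.
    move: (v p) (u0 p) (T0 p) ve' ue' to vu => x y t xe ye to xy.
    transitivity (- R0 * (x * y) * (x * y)); last by rewrite xy !mulr1.
    by sring.
  rewrite -e3 /u0 /lin; have qe : geven (p%:A : L) := @geven_alg K _ p.
  have Qe : geven Q.
    have -> : Q = u0 p - P * p%:A by rewrite /u0 /lin addrC addKr.
    by apply: ghomB => //; exact: gevenM.
  move: (p%:A : L) qe => x xe; sring.
have Qe : geven Q.
  have -> : Q = u0 p - P * p%:A by rewrite /u0 /lin addrC addKr.
  by apply: ghomB (near_at u0e) _; apply: gevenM => //; exact: geven_alg.
(* By [gR], [T0 R0] is minus the product of [g0 z + dl] and [g0 Q - dl P] over [u0]; as odd squares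
   vanish, that product is [dl g0 u0], and the quotient is constant. *)
have T0R : \forall q \near p, T0 q * R0 = - (dl * g0).
  apply: filterS3 T0u (filterI u0U u0e) T0o => q a [b c] to.
  have RE : R0 = - (g0 * Q - dl * P) by rewrite gR opprK.
  apply: (mulrI b); rewrite mulrA (geven_comm _ c) a RE /u0 /lin.
  have qe : geven (q%:A : L) := @geven_alg K _ q.
  by move: (q%:A : L) qe => x xe; sring.
have Z1E : \forall q \near p, thp1 (Z q) = T0 q * v q.
  apply: filterS2 (sc_conf g) T1E => q a b.
  by rewrite -thp0_SD a thp0M thp0_SD b.
have dZ0 : \forall q \near p, sdz Z0 q = (1 - dl * g0) * (v q * v q).
  apply: filterS3 (sc_conf g) (filterI T1E dT0) (filterI T0R (filterI T0o ve)) => q a [b c] [d [e f]].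
  rewrite -thp1_SD a thp1M' thp0_SD thp1_SD b -/T0 c -/(T0 q).
  have /goddE -> := e; rewrite -d.
  by move: (v q) (T0 q) e f => x y ye xe; sring.
have [at0 [bt0 [[ae be] [af bf] Z0u]]] : exists A B : L, [/\ geven A /\ geven B, thfree A /\ thfree B &
      \forall q \near p, Z0 q * u0 q = lin A B q].
  apply: lin_step => //; first by near=> q; exact: thp0_free.
  have e1 : \forall q \near p, sdz Z0 q * u0 q = (1 - dl * g0) * v q.
    apply: filterS2 dZ0 u0U => q a b; rewrite a /v -!mulrA mulVr // mulr1 //.
  have e2 := near_sdz' H e1.
  apply: filterS3 e2 (filterI shv sdv) (filterI dZ0 ve) => q a [b b'] [c c'].
  rewrite a (sdzM (sh_cst H (1 - dl * g0) q) b) sdz_cst mul0r add0r b' c.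
  by move: (v q) c' => x xe; sring.
have aQ : at0 * Q - bt0 * P = 1 - dl * g0.
  have e1 := near_sdz H Z0u.
  rewrite sdz_lin (sdzM shZ0 (shu0 p)) du0 (near_at dZ0) in e1.
  have e2 := near_at Z0u; have U := near_at u0U; have ue' := near_at u0e; have ve' := near_at ve.
  have ze := near_at Z0e; rewrite -/(Z0 p) in e1.
  have vu : v p * u0 p = 1 by rewrite /v mulVr.
  have e3 : at0 * u0 p - lin at0 bt0 p * P = 1 - dl * g0.
    rewrite -e2 -e1.
    move: (v p) (u0 p) (Z0 p) ve' ue' ze vu => x y t xe ye to xy.
    transitivity ((1 - dl * g0) * (x * y) * (x * y)); last by rewrite xy !mulr1.
    by sring.
  rewrite -e3 /u0 /lin; have qe : geven (p%:A : L) := @geven_alg K _ p.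
  by move: (p%:A : L) qe => x xe; sring.
(* By [aQ] the determinant so far is [1 - dl * g0], whose inverse [1 + dl * g0] is the square of
   [e]. Scaling the four even coefficients by [e] makes the determinant 1, and [e] fixes [g0] and
   [dl]. *)
pose e := halfp dl g0.
have ee : geven e by exact: halfp_even.
have ef : thfree e by exact: halfp_free.
have eU : e \is a GRing.unit by exact: halfp_unit.
have eg : e * g0 = g0 by exact: halfp_gam.
have ed : e * dl = dl by exact: halfp_del.
have e2 : e ^+ 2 = 1 + dl * g0 by exact: halfp_sq.
have eE : 1 + 2^-1 *: (dl * g0) = e by [].
clearbody e.
exists (e * at0), (e * bt0), (e * P), (e * Q), g0, dl; split.
- by split; split => //; exact: gevenM.
- by split; split => //; exact: thfreeM.
- transitivity (e ^+ 2 * (at0 * Q - bt0 * P)); first by rewrite expr2; sring.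
  by rewrite aQ e2; sring.
have m1 q : lin (e * P) (e * Q) q = e * u0 q by rewrite /u0 /lin mulrDr mulrA.
have m2 q : lin (e * at0) (e * bt0) q = e * lin at0 bt0 q by rewrite /lin mulrDr mulrA.
have m3 q : e * lin g0 dl q = lin g0 dl q by rewrite /lin mulrDr mulrA eg ed.
apply: filterS3 (filterI T0u Z0u) (filterI (filterI u0U u0e) ve) (filterI T1E Z1E) => q [a b] [[c c'] d] [f f'].
have mu : lin (e * P) (e * Q) q \is a GRing.unit by rewrite m1 (unitrMl _ c) eU.
have yE : (lin (e * P) (e * Q) q)^-1 = v q * e^-1 by rewrite m1 invrM.
have eVe : geven e^-1 := gevenV ee.
have e1 : e * e^-1 = 1 by rewrite divrr.
have v1 : u0 q * v q = 1 by rewrite /v divrr.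
have m3q := m3 q.
have T0E : T0 q = lin g0 dl q * v q by rewrite -a -mulrA v1 mulr1.
have Z0E : Z0 q = lin at0 bt0 q * v q by rewrite -b -mulrA v1 mulr1.
have le : geven (lin at0 bt0 q) by exact: lin_hom.
have lo : godd (lin g0 dl q) by exact: lin_hom.
split=> //.
  rewrite /splZ expr2 (invrM mu mu) yE m2 [LHS]thpD -/(Z0 q) f' T0E Z0E.
  congr (_ + th * _).
    move: (lin at0 bt0 q) (v q) le d e1 => x y xe ye e1.
    by transitivity (x * y * (e * e^-1)); [rewrite e1 mulr1|sring].
  rewrite -[in RHS]m3q -[in RHS]m3q.
  move: (lin g0 dl q) (v q) lo d e1 => x y xe ye e1.
  by transitivity (x * y * y * (e * e^-1) * (e * e^-1)); [rewrite e1 !mulr1|sring].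
rewrite /splT yE eE [LHS]thpD -/(T0 q) f T0E; congr (_ + th * _).
  rewrite -[in RHS]m3q.
  move: (lin g0 dl q) (v q) lo d e1 => x y xe ye e1.
  by transitivity (x * y * (e * e^-1)); [rewrite e1 mulr1|sring].
move: (v q) d e1 => y ye e1.
by transitivity (y * (e * e^-1)); [rewrite e1 mulr1|sring].
Unshelve. all: by end_near. Qed.

End SPLConverse.

(** * Local solutions of D^3 u = w u and flat coordinates *)

Section Existence.
Variables (K : numClosedFieldType) (H : holoCalc K) (N : nat).
Local Notation L := (grass K N.+1).
Local Notation th := (ggen K (ord0 : 'I_N.+1)).
Local Notation sh := (sh H).
Local Notation sdz := (sdz H).
Local Notation SD := (SD H).
Local Notation scgerm := (scgerm H).
Local Notation uinv := (uinv H).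
Implicit Types (p q : K) (F G Z T w u : K -> L).

(** Coefficientwise primitives are unrelated to each other; those of coefficients of the wrong
    parity or containing theta are replaced by 0, which makes [G] homogeneous and free of theta. *)
Lemma sdz_primitive b F p : sh F p -> (\forall q \near p, ghom b (F q)) ->
  (\forall q \near p, thfree (F q)) ->
  exists G, [/\ sh G p, \forall q \near p, ghom b (G q), \forall q \near p, thfree (G q) &
    \forall q \near p, sdz G q = F q].
Proof.
move=> hF hb hf.
have /choice[g hg] : forall A, exists g, holo H g p /\ \forall q \near p, hder H g q = F q A.
  by move=> A; apply: hc_primitive (hF A).
pose G q : L := [ffun A : {set 'I_N.+1} => if (odd #|A| == b) && (ord0 \notin A) then g A q else 0].
have GE A q : G q A = if (odd #|A| == b) && (ord0 \notin A) then g A q else 0 by rewrite ffunE.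
exists G; split.
- move=> A; case e: ((odd #|A| == b) && (ord0 \notin A)).
    by apply: hc_ext (hg A).1; near=> q; rewrite GE e.
  by apply: hc_ext (hc_cst H 0 p); near=> q; rewrite GE e.
- near=> q => A; rewrite GE; case: ifP => [/andP[/eqP]//|]; by rewrite eqxx.
- by near=> q => A h; rewrite GE h andbF.
- have h1 : \forall q \near p, forall A, hder H (g A) q = F q A.
    exact: (@filter_forall _ _ (fun A q => hder H (g A) q = F q A) (nbhs p) _ (fun A => (hg A).2)).
  apply: filterS3 h1 hb hf => q a c d; apply/ffunP => A; rewrite sdzE.
  case e: ((odd #|A| == b) && (ord0 \notin A)).
    by rewrite -a; apply: hc_near_der; near=> w; rewrite GE e.
  have -> : F q A = 0.
    move/negbT: e; rewrite negb_and negbK => /orP[nb|]; last exact: d.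
    by apply/eqP; apply: contraNT nb => /c ->.
  by rewrite -(hc_der_cst H 0 q); apply: hc_near_der; near=> w; rewrite GE e.
Unshelve. all: by end_near. Qed.

(** D (G_0 + theta F_0) = F_0 + theta G_0', so it suffices to integrate the theta component of
    [F]. *)
Lemma SD_primitive b F p : sh F p -> (\forall q \near p, ghom b (F q)) ->
  exists G, [/\ sh G p, \forall q \near p, ghom (~~ b) (G q) &
    \forall q \near p, SD G q = F q].
Proof.
move=> hF hb.
have f1 : \forall q \near p, thfree (thp1 (F q)) by near=> q; exact: thp1_free.
have b1 : \forall q \near p, ghom (~~ b) (thp1 (F q)) by apply: filterS hb => q; exact: thp1_hom.
have [G0 [hG0 G0b G0f G0E]] := sdz_primitive (sh_thp1 hF) b1 f1.
have hth q := sh_cst H th q.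
have hF0 := sh_thp0 hF.
exists (fun q => G0 q + th * thp0 (F q)); split.
- exact: (shD hG0 (shM (hth p) hF0)).
- apply: filterS2 G0b hb => q a c; apply: ghomD => //.
  by have := ghomM (@th_odd K N) (thp0_hom c).
- apply: filterS3 G0E G0f (filterI (sh_near hG0) (sh_near hF0)) => q a c [d e].
  have m := shM (hth q) e.
  apply: (etrans (SDD d m)); rewrite (SDM (hth q) e) SD_th mul1r.
  rewrite (_ : gsig th = - th); last exact/goddE/th_odd.
  rewrite /SuperDerivation.SD a (thp_free c).2 add0r (thp_free (@thp0_free _ _ _)).2 add0r.
  by rewrite mulNr mulrA (godd_sq (@th_odd K N)) mul0r oppr0 addr0 addrC -thpD.
Unshelve. all: by end_near. Qed.

(** Left multiplication in the Grassmann algebra is linear in coefficients, so this is a scalar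
    system indexed by pairs of an unknown and a monomial. *)
Lemma sh_ode (I : finType) (M : I -> I -> K -> L) (y0 : I -> L) p :
  (forall i j, sh (M i j) p) ->
  exists y : I -> K -> L, [/\ forall i, sh (y i) p, forall i, y i p = y0 i &
    \forall q \near p, forall i, sdz (y i) q = \sum_j M i j q * y j q].
Proof.
move=> hM.
pose A (s t : I * {set 'I_N.+1}) q := \sum_B gcoef K B t.2 s.2 * M s.1 t.1 q B.
have hA s t : holo H (A s t) p.
  by apply: hc_sum => B; apply: hc_mul; [exact: hc_cst|exact: hM].
have [y [y1 y2 y3]] := hc_ode (fun s => y0 s.1 s.2) hA.
exists (fun i q => [ffun B => y (i, B) q]); split.
- by move=> i B; apply: hc_ext (y1 (i, B)); near=> q; rewrite ffunE.
- by move=> i; apply/ffunP => B; rewrite ffunE y2.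
apply: filterS y3 => q h i; apply/ffunP => B; rewrite sdzE gsumE.
transitivity (hder H (y (i, B)) q).
  by apply: hc_near_der; near=> w; rewrite ffunE.
rewrite h (eq_bigr (fun t => A (i, B) (t.1, t.2) q * y (t.1, t.2) q)); last by case.
rewrite -(pair_bigA _ (fun j E => A (i, B) (j, E) q * y (j, E) q)) /=.
apply: eq_bigr => j _; rewrite gmulE exchange_big /=; apply: eq_bigr => E _.
rewrite /A /= mulr_suml; apply: eq_bigr => D _; rewrite -mulrA ffunE //.
Unshelve. all: by end_near. Qed.

Lemma SD_sig F q : sh F q -> SD (fun q => gsig (F q)) q = - gsig (SD F q).
Proof.
move=> h; rewrite /SuperDerivation.SD (sdz_sig h) thp1_sig gsigD gsigM.
rewrite (_ : gsig th = - th); last exact/goddE/th_odd.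
by rewrite mulNr opprD opprK.
Qed.

(** For u = y_0 + theta y_2 the equation reads y_0'' = w_1 y_0 - w_0 y_2 and y_2' = w_0 y_0, a first
    order system in y_0, y_1 = y_0', y_2. The initial value 1 of y_0 makes [u] invertible. *)
Lemma D3_solve w p : sh w p -> (\forall q \near p, godd (w q)) ->
  exists u, [/\ sh u p, \forall q \near p, geven (u q), u p \is a GRing.unit &
    \forall q \near p, SD (SD (SD u)) q = w q * u q].
Proof.
move=> hw wo.
pose w0 : K -> L := fun q => thp0 (w q); pose w1 : K -> L := fun q => thp1 (w q).
have hw0 : sh w0 p := sh_thp0 hw.
have hw1 : sh w1 p := sh_thp1 hw.
pose M (i j : 'I_3) : K -> L := match val i, val j with
  | 0%N, 1%N => fun=> 1 | 1%N, 0%N => w1 | 1%N, 2%N => fun q => - w0 q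
  | 2%N, 0%N => w0 | _, _ => fun=> 0 end.
have hM i j : sh (M i j) p.
  rewrite /M; case: i => [[|[|[|i]]] ?] //=; case: j => [[|[|[|j]]] ?] //=; try exact: sh_cst.
  exact: (shN hw0).
have [y [yh yp ye]] := sh_ode (fun i => if val i == 0%N then 1 else 0) hM.
(* The solution of the system may contain theta. Its coefficients do not, so the theta-free parts
   solve the same system. *)
pose y0 : K -> L := fun q => thp0 (y ord0 q).
pose y1 : K -> L := fun q => thp0 (y (inord 1) q).
pose y2 : K -> L := fun q => thp0 (y (inord 2) q).
have hy0 : sh y0 p := sh_thp0 (yh _); have hy1 : sh y1 p := sh_thp0 (yh _); have hy2 : sh y2 p := sh_thp0 (yh _).
have o3 (F : 'I_3 -> L) : \sum_j F j = F ord0 + F (inord 1) + F (inord 2).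
  rewrite !big_ord_recl big_ord0 addr0 addrA; congr (_ + F _ + F _); apply: val_inj; by rewrite /= inordK.
have eqs : \forall q \near p, [/\ sdz y0 q = y1 q, sdz y1 q = w1 q * y0 q - w0 q * y2 q & sdz y2 q = w0 q * y0 q].
  apply: filterS ye => q h.
  have f0 := (thp_free (@thp0_free _ _ (w q))).1; have f1 := (thp_free (@thp1_free _ _ (w q))).1.
  have hM' i j : M (inord i) (inord j) q = M (inord i) (inord j) q by [].
  have E := fun i => congr1 (@thp0 K N) (h i).
  split; [have := E ord0|have := E (inord 1)|have := E (inord 2)];
    rewrite o3 /M /= ?inordK // !mul0r ?add0r ?addr0 ?mul1r -sdz_thp0 => e;
    apply: (etrans e); rewrite ?mulNr ?thp0D ?thp0N ?thp0M ?f0 ?f1 //.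
pose u q := y0 q + th * y2 q.
have hth q := sh_cst H th q.
have hu : sh u p := shD hy0 (shM (hth p) hy2).
have tt (x : L) : th * (th * x) = 0 by rewrite mulrA (godd_sq (@th_odd K N)) mul0r.
have D3 : \forall q \near p, SD (SD (SD u)) q = w q * u q.
  have e1 : \forall q \near p, SD (SD u) q = sdz u q.
    by apply: filterS (sh_near hu) => q; exact: SD_sq.
  have e2 : \forall q \near p, sdz u q = y1 q + th * (w0 q * y0 q).
    apply: filterS2 eqs (filterI (sh_near hy0) (sh_near hy2)) => q [a b c] [d e].
    have m := shM (hth q) e.
    by rewrite (sdzD d m) (sdzM (hth q) e) sdz_cst mul0r add0r a c.
  have e3 := near_SD' H e1; have e4 := near_SD' H e2.
  have m := shM hw0 hy0.
  apply: filterS3 (filterI e3 e4) (filterI eqs wo) (filterI (sh_near hy1) (sh_near m)) => q [-> ->] [[a b c] wq] [d e].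
  have m1 := shM (hth q) e.
  apply: (etrans (SDD d m1)); rewrite (SDM (hth q) e) SD_th mul1r.
  rewrite (_ : gsig th = - th); last exact/goddE/th_odd.
  rewrite /SuperDerivation.SD b mulNr [th * (thp1 _ + _)]mulrDr tt addr0 (_ : thp1 (w0 q * y0 q) = 0); last first.
    by apply/thfreeP/thfreeM; exact: thp0_free.
  rewrite mulr0 oppr0 addr0 (_ : thp1 (y1 q) = 0); last exact/thfreeP/thp0_free.
  rewrite add0r /u [in RHS](thpD (w q)) -/(w0 q) -/(w1 q).
  have w0o : godd (w0 q) by exact: thp0_hom.
  have w1e : geven (w1 q) by exact: (thp1_hom wq).
  rewrite mulrDl !mulrDr -!mulrA [w1 q * (th * _)]mulrA (geven_comm th w1e) -!mulrA tt addr0.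
  rewrite [w0 q * (th * _)]mulrA (godd_anti w0o (@th_odd K N)) mulNr -mulrA mulrN.
  by rewrite addrC -!addrA; congr (_ + _); rewrite addrC.
(* [u] need not be even. D^3 anticommutes with [gsig] and [w] is odd, so [gsig u] solves the same
   equation, and the mean of the two solutions is even. *)
have hs : sh (fun q => gsig (u q)) p := sh_sig hu.
have D3s : \forall q \near p, SD (SD (SD (fun q => gsig (u q)))) q = w q * gsig (u q).
  have e1 : \forall q \near p, SD (fun q => gsig (u q)) q = - gsig (SD u q).
    by apply: filterS (sh_near hu) => q; exact: SD_sig.
  have hu1 := sh_SD hu; have hu2 := sh_SD hu1.
  have e2 : \forall q \near p, SD (fun q => - gsig (SD u q)) q = gsig (SD (SD u) q).
    apply: filterS (sh_near hu1) => q h.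
    by apply: (etrans (SDN (sh_sig h))); rewrite (SD_sig h) opprK.
  have e3 : \forall q \near p, SD (fun q => gsig (SD (SD u) q)) q = - gsig (SD (SD (SD u)) q).
    by apply: filterS (sh_near hu2) => q h; rewrite (SD_sig h).
  apply: filterS3 (filterI (near_SD' H (near_SD' H e1)) (near_SD' H e2)) (filterI D3 wo) e3 => q [a b] [c d] e.
  apply: (etrans a); apply: (etrans b); apply: (etrans e); rewrite c gsigM.
  by have /goddE -> := d; rewrite mulNr opprK.
have hsum := shD hu hs.
exists (fun q => 2^-1 *: (u q + gsig (u q))); split.
- exact: shZ.
- by near=> q; apply/gevenE; rewrite gsigZ gsigD gsigK addrC.
- rewrite gunitE gbodyZ gbodyD.
  have u1 : gbody (u p) = 1.
    rewrite gbodyD gbodyM (gbody_odd (@th_odd K N)) mul0r addr0 /y0 yp /=.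
    by rewrite (thp_free (@thfree1 K N)).1 gbody1.
  have -> : gbody (gsig (u p)) = gbody (u p) by rewrite /gbody gsigE cards0 expr0 mul1r.
  by rewrite u1 (_ : 2^-1 * (1 + 1) = 1 :> K) ?oner_neq0 //; field.
have hsu1 := sh_SD hu; have hsu2 := sh_SD hsu1; have hss1 := sh_SD hs; have hss2 := sh_SD hss1.
have e1 : \forall q \near p, SD (fun q => 2^-1 *: (u q + gsig (u q))) q = 2^-1 *: (SD u q + SD (fun q => gsig (u q)) q).
  apply: filterS3 (sh_near hu) (sh_near hs) (sh_near hsum) => q a b c.
  by apply: (etrans (SDZ _ c)); rewrite (SDD a b).
have e2 : \forall q \near p, SD (fun q => 2^-1 *: (SD u q + SD (fun q => gsig (u q)) q)) q = 2^-1 *: (SD (SD u) q + SD (SD (fun q => gsig (u q))) q).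
  apply: filterS3 (sh_near hsu1) (sh_near hss1) (sh_near (shD hsu1 hss1)) => q a b c.
  by apply: (etrans (SDZ _ c)); rewrite (SDD a b).
have e3 : \forall q \near p, SD (fun q => 2^-1 *: (SD (SD u) q + SD (SD (fun q => gsig (u q))) q)) q = 2^-1 *: (SD (SD (SD u)) q + SD (SD (SD (fun q => gsig (u q)))) q).
  apply: filterS3 (sh_near hsu2) (sh_near hss2) (sh_near (shD hsu2 hss2)) => q a b c.
  by apply: (etrans (SDZ _ c)); rewrite (SDD a b).
apply: filterS3 (filterI (near_SD' H (near_SD' H e1)) (near_SD' H e2)) (filterI D3 D3s) e3 => q [a b] [c d] e.
apply: (etrans a); apply: (etrans b); apply: (etrans e); rewrite c d.
by rewrite -mulrDr -scalerAr.
Unshelve. all: by end_near. Qed.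

(** Two primitives are taken, D T = 1 / u and D Z = T / u; the second equation is D Z = T D T. *)
Lemma flat_coordinates w p : sh w p -> (\forall q \near p, godd (w q)) ->
  exists Z T, scgerm Z T p /\ \forall q \near p, SD (SD (SD (uinv T))) q = w q * uinv T q.
Proof.
move=> hw wo; have [u [hu ue uu u3]] := D3_solve hw wo.
have hV := sh_inv hu uu; have uU := near_unit hu uu.
have Ve : \forall q \near p, geven (u q)^-1 by apply: filterS ue => q; exact: gevenV.
have [T [hT To TE]] := SD_primitive hV Ve.
have hm := shM hT hV.
have mo : \forall q \near p, godd (T q / u q) by apply: filterS2 To Ve => q; exact: godd_evenM.
have [Z [hZ Ze ZE]] := SD_primitive hm mo.
exists Z, T; split.
  split => //; last by rewrite (near_at TE) unitrV.
  by apply: filterS2 ZE TE => q a b; rewrite a b.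
have e : \forall q \near p, uinv T q = u q by apply: filterS TE => q a; rewrite /uinv a invrK.
apply: filterS3 (near_SD' H (near_SD' H (near_SD' H e))) u3 e => q a b c.
by apply: (etrans a); rewrite c; exact: b.
Qed.

End Existence.

(** * The inverse function theorem in dimension 1|1 *)

Section InverseFunction.
Variables (K : numClosedFieldType) (H : holoCalc K) (N : nat).
Local Notation L := (grass K N.+1).
Local Notation th := (ggen K (ord0 : 'I_N.+1)).
Local Notation sh := (sh H).
Local Notation sdz := (sdz H).
Local Notation SD := (SD H).
Local Notation sev := (sev H).
Local Notation pull := (pull H).
Local Notation scgerm := (scgerm H).
Implicit Types (p q : K) (F G Z T w f : K -> L).

(** A local change of coordinates, superconformal or not. The mixed derivatives are odd and have no
    body, so invertibility of the Jacobian concerns the two diagonal derivatives only. *)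
Record bigerm Z T p : Prop := BiGerm {
  bi_shZ : sh Z p;
  bi_shT : sh T p;
  bi_Ze : \forall q \near p, geven (Z q);
  bi_To : \forall q \near p, godd (T q);
  bi_dZ : gbody (sdz Z p) != 0;
  bi_dT : gbody (thp1 (T p)) != 0
}.

(** The generators of the base: the filtration counts these and leaves [theta] aside. *)
Let W : {set 'I_N.+1} := (~: [set ord0])%SET.
Lemma card_W : #|W| = N.
Proof. by rewrite cardsC1 card_ord. Qed.

Lemma WI_odd (A : {set 'I_N.+1}) : (#|A :&: W| < 1)%N -> A = finset.set0 \/ A = [set ord0]%SET.
Proof.
rewrite ltnS leqn0 cards_eq0 => /eqP h.
have hA : A \subset [set ord0]%SET.
  apply/fintype.subsetP => x xA; apply/negPn/negP => nx.
  have : x \in (A :&: W)%SET by rewrite inE xA inE.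
  by rewrite h inE.
by move: hA; rewrite subset1 => /orP[/eqP ->|/eqP ->]; [right|left].
Qed.

(** The only monomials without a generator of the base are 1 and theta; the coefficient of 1 is the
    body, and theta is odd. *)
Lemma gfilt_even (x : L) : geven x -> gbody x = 0 -> gfilt W 1 x.
Proof.
move=> hx x0 A /WI_odd[]->; first exact: x0.
by apply/eqP; apply/negPn/negP => /hx; rewrite cards1.
Qed.

Lemma gfilt_odd (t : L) : godd t -> gfilt W 1 (t - (gbody (thp1 t)) *: th).
Proof.
move=> ht A /WI_odd[]->.
  rewrite gaddE goppE gscaleE.
  have -> : th finset.set0 = 0 := gbody_odd (@th_odd K N).
  by have := gbody_odd ht; rewrite /gbody => ->; rewrite mulr0 subr0.
rewrite gaddE goppE gscaleE ffunE eqxx mulr1 /gbody thp1E inE.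
by rewrite finset.setU0 subrr.
Qed.

Lemma gfilt_thp0 m (x : L) : gfilt W m x -> gfilt W m (thp0 x).
Proof. by move=> h A hA; rewrite thp0E; case: ifP => // _; exact: h. Qed.
Lemma gfilt_thp1 m (x : L) : gfilt W m x -> gfilt W m (thp1 x).
Proof.
move=> h A hA; rewrite thp1E; case: ifP => // _; apply: h.
rewrite finset.setIUl (_ : [set ord0]%SET :&: W = finset.set0) ?finset.set0U //.
by apply/setP => i; rewrite !inE andbN.
Qed.

Lemma gfilt_sdz m F q : (\forall q' \near q, gfilt W m (F q')) -> gfilt W m (sdz F q).
Proof.
move=> h A hA; rewrite sdzE -(hc_der_cst H 0 q); apply: hc_near_der.
by apply: filterS h => q' h; exact: h.
Qed.
Lemma gfilt_sdzn m F q k : (\forall q' \near q, gfilt W m (F q')) -> \forall q' \near q, gfilt W m (sdzn H k F q').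
Proof.
move=> h; elim: k => [|k IH]; first by apply: filterS h => q'; rewrite sdzn0.
by apply: filterS (near_near IH) => q' h'; rewrite sdznS; exact: gfilt_sdz.
Qed.

(* Modulo higher terms in the generators of S, the pullback by (z, t) sends f to
   f_0(z_0) + h theta f_1(z_0). *)
Lemma gfilt_sev m (z t : L) F : geven z -> godd t ->
  (\forall q \near gbody z, gfilt W m (F q)) ->
  gfilt W m.+1 (sev z t F - (thp0 (F (gbody z)) + (gbody (thp1 t) *: th) * thp1 (F (gbody z)))).
Proof.
move=> ze to hF; rewrite sevE big_ord_recl expr0 mul1r tay0 /chi.
have Fz := near_at hF.
have e (a b c s : L) : a + b + s - (a + c) = (b - c) + s.
  by rewrite opprD -(addrA a b s) [a + (b + s)]addrC addrA addrK addrAC.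
rewrite e; apply: gfiltD; last first.
  apply: gfilt_sum => k _; rewrite lift0 exprS -mulrA -(add1n m).
  have nuf : gfilt W 1 (z - (gbody z)%:A).
    apply: gfilt_even; first by apply: ghomB => //; exact: geven_alg.
    by rewrite gbodyB gbody_alg subrr.
  refine (gfiltM nuf _); rewrite -[m]add0n; apply: gfiltM; first exact: gfilt0.
  have ht : gfilt W m (tay H k.+1 F (gbody z)) by apply/gfiltZ/(near_at (gfilt_sdzn _ hF)).
  apply: gfiltD; first exact: gfilt_thp0.
  by rewrite -[m]add0n; apply: gfiltM; [exact: gfilt0|exact: gfilt_thp1].
rewrite -mulrBl -(add1n m); apply: gfiltM; first exact: gfilt_odd.
exact: gfilt_thp1.
Qed.

Section Germ.
Variables (Z T : K -> L) (p : K).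
Hypothesis g : bigerm Z T p.
Let z0 := gbody (Z p).

Let shZ := bi_shZ g.
Let shT := bi_shT g.
Let Ze := bi_Ze g.
Let To := bi_To g.

(** Successive approximation along the filtration: [f1] reproduces [w] to leading order, the
    remainder [w'] has one order more, and order [N.+1] in [N] generators means 0. *)
Lemma pull_onto b m w : (m <= N.+1)%N -> sh w p -> (\forall q \near p, ghom b (w q)) ->
  (\forall q \near p, gfilt W (N.+1 - m) (w q)) ->
  exists f, [/\ sh f z0, \forall y \near z0, ghom b (f y) &
    \forall q \near p, pull Z T f q = w q].
Proof.
have hb : holo H (fun q => gbody (Z q)) p := holo_body shZ.
have db : hder H (fun q => gbody (Z q)) p != 0 by rewrite -gbody_sdz; exact: bi_dZ g.
have [gi [gi_h gi_p giK giK']] := hc_inverse hb db.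
rewrite -/z0 in gi_h gi_p giK'.
have hh : holo H (fun q => gbody (thp1 (T q))) p := holo_body (sh_thp1 shT).
have hh0 := bi_dT g.
have hhn : \forall q \near p, gbody (thp1 (T q)) != 0 := near_body_neq0 (sh_thp1 shT) hh0.
elim: m w => [|m IH] w hm hw wb wf.
  exists (fun=> 0); split; [exact: sh_cst|by near=> y; exact: ghom0|].
  apply: filterS2 wf To => q; rewrite subn0 => h to.
  have -> : w q = 0 by apply: (@gfilt_top _ _ W); rewrite card_W.
  by rewrite /pull sev_cst chi_free //; exact: thfree0.
(* The leading part of the pullback is inverted explicitly: composition with the inverse [gi] of the
   body of [Z], and division of the theta component by the body of dT/dtheta. *)
pose f1 y : L := thp0 (w (gi y)) + ((gbody (thp1 (T (gi y))))^-1 *: th) * thp1 (w (gi y)).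
have comp_sh F : sh F p -> sh (fun y => F (gi y)) z0.
  by move=> hF A; apply: (@hc_comp K H (fun q => F q A) gi z0 gi_h); rewrite gi_p; exact: hF.
have near_gi (P : K -> Prop) : (\forall q \near p, P q) -> \forall y \near z0, P (gi y).
  by move=> h; have := hc_cts gi_h; rewrite -gi_p in h; exact.
have f1h : sh f1 z0.
  have hinv := hc_inv hh hh0.
  have h1 : sh (fun q => thp0 (w q) + ((gbody (thp1 (T q)))^-1 %:A * th) * thp1 (w q)) p.
    apply: (shD (sh_thp0 hw) (shM (shM (sh_body hinv) (sh_cst H th p)) (sh_thp1 hw))).
  apply: sh_ext (comp_sh _ h1); near=> y.
  by rewrite /f1 -[_%:A * th]scalerAl mul1r.
have f1b : \forall y \near z0, ghom b (f1 y).
  apply: filterS (near_gi _ wb) => y h; apply: ghomD; first exact: thp0_hom.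
  by have := ghomM (@ghomZ _ _ _ (gbody (thp1 (T (gi y))))^-1 _ (@th_odd K N)) (thp1_hom h); rewrite addTb negbK.
have f1f : \forall y \near z0, gfilt W (N.+1 - m.+1) (f1 y).
  apply: filterS (near_gi _ wf) => y h; apply: gfiltD; first exact: gfilt_thp0.
  by rewrite -[X in gfilt W X]add0n; apply: gfiltM; [exact: gfilt0|exact: gfilt_thp1].
have hp1 := sh_pull shZ shT f1h.
pose w' q := w q - pull Z T f1 q.
have hw' : sh w' p := shB hw hp1.
have nb := near_body shZ.
have wb' : \forall q \near p, ghom b (w' q).
  apply: filterS3 wb (nb _ (near_near f1b)) (filterI Ze To) => q h1 h2 [h3 h4].
  by apply: ghomB => //; exact: sev_hom.
have wf' : \forall q \near p, gfilt W (N.+1 - m) (w' q).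
  apply: filterS3 (nb _ (near_near f1f)) (filterI giK hhn) (filterI Ze To) => q h1 [h2 h3] [h4 h5].
  have := gfilt_sev h4 h5 h1; rewrite -(subSn hm) subSS => h6.
  have e : thp0 (f1 (gbody (Z q))) + (gbody (thp1 (T q)) *: th) * thp1 (f1 (gbody (Z q))) = w q.
    have f0 := thfreeZ.
    rewrite /f1 h2 thp0D thp1D thp0M thp1M thp0Z thp1Z (thp_theta _ _).1 (thp_theta _ _).2.
    rewrite scaler0 mul0r addr0 (thp_free (@thp0_free _ _ _)).1 (thp_free (@thp0_free _ _ _)).2 add0r.
    rewrite (thp_free (@thp1_free _ _ _)).2 mulr0 addr0 -!scalerAl mul1r -scalerAr scalerA.
    by rewrite divff // scale1r -thpD.
  by move: h6; rewrite e /w' => /gfiltN; rewrite opprB.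
have [f2 [f2h f2b f2E]] := IH w' (ltnW hm) hw' wb' wf'.
exists (fun y => f1 y + f2 y); split.
- exact: shD.
- by apply: filterS2 f1b f2b => y; exact: ghomD.
- apply: filterS2 f2E (near_pullD T shZ f1h f2h) => q e1 e2.
  by rewrite /pull e2 -/(pull Z T f1 q) -/(pull Z T f2 q) e1 /w' addrC subrK.
Unshelve. all: by end_near. Qed.

(** [Z'] and [T'] are preimages of the coordinate functions z and theta under the pullback; the
    chain rule on bodies shows that they are again coordinates. *)
Lemma left_inverse_germ : exists Z' T', [/\ bigerm Z' T' z0, gbody (Z' z0) = p &
  \forall q \near p, pull Z T Z' q = q%:A /\ pull Z T T' q = th].
Proof.
have f0 (w : K -> L) : \forall q \near p, gfilt W (N.+1 - N.+1) (w q) by near=> q; rewrite subnn.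
have p1 : \forall q \near p, geven (q%:A : L) by near=> q; exact: geven_alg.
have p2 : \forall q \near p, godd th by near=> q; exact: th_odd.
have [Z' [hZ Ze' ZE]] := pull_onto (leqnn _) (@sh_id _ H N p) p1 (f0 _).
have [T' [hT To' TE]] := pull_onto (leqnn _) (sh_cst H th p) p2 (f0 _).
have nb := near_body shZ.
have bE : \forall q \near p, gbody (Z' (gbody (Z q))) = q.
  apply: filterS2 ZE To => q e to.
  by have := congr1 (@gbody _ _) e; rewrite /pull (sev_body H (Z q) to) gbody_alg.
exists Z', T'; split; [split => //|exact: near_at bE|exact: filterI ZE TE].
- have e : hder H ((fun y => gbody (Z' y)) \o (fun q => gbody (Z q))) p = 1.
    rewrite -(hc_der_id H p); exact: hc_near_der.
  move: e; rewrite (hc_der_comp (holo_body shZ) (holo_body hZ)) -gbody_sdz => e.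
  by apply: contraTneq isT => h; move: e; rewrite h mul0r => /eqP; rewrite eq_sym oner_eq0.
- have := chain_rule shZ shT Ze To (@geven1 _ _) (@ghom0 _ _ true) hT.
  rewrite (vf_near H 1 0 TE) /vf !mul0r !addr0 !mul1r (thp_theta _ _).2.
  move=> /(congr1 (@gbody _ _)); rewrite gbody1 gbodyD !gbodyM.
  rewrite (gbody_odd (thp1_hom (near_at Ze))) mul0r add0r (sev_body H (Z p) (near_at To)).
  by move=> e; apply: contraTneq isT => h; move: e; rewrite h mulr0 => /eqP; rewrite oner_eq0.
Unshelve. all: by end_near. Qed.

End Germ.

Lemma pull_comp' Z T Z' T' F p : bigerm Z T p -> bigerm Z' T' (gbody (Z p)) ->
  sh F (gbody (Z' (gbody (Z p)))) -> \forall q \near p,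
  pull Z T (pull Z' T' F) q = pull (pull Z T Z') (pull Z T T') F q.
Proof.
move=> g g' hF; have nb := near_body (bi_shZ g); have nb' := near_body (bi_shZ g').
have h1 : \forall q \near p, sh Z' (gbody (Z q)) by exact: nb (sh_near (bi_shZ g')).
have h1' : \forall q \near p, sh T' (gbody (Z q)) by exact: nb (sh_near (bi_shT g')).
have h2 : \forall q \near p, \forall w \near gbody (Z q), geven (Z' w).
  by exact: nb (near_near (bi_Ze g')).
have h2' : \forall q \near p, \forall w \near gbody (Z q), godd (T' w).
  by exact: nb (near_near (bi_To g')).
have h3 : \forall q \near p, sh F (gbody (Z' (gbody (Z q)))).
  by exact: nb (nb' _ (sh_near hF)).
apply: filterS3 (filterI h1 h1') (filterI (bi_Ze g) (bi_To g)) (filterI h3 (filterI h2 h2')) => q [a b] [e f] [i [c d]].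
exact: (sev_comp e f a b c d i).
Qed.

(** A left inverse [Z2], [T2] of the left inverse is taken. Pulling back its defining equations by
    [(Z, T)] gives [Z2 = Z] and [T2 = T], so the left inverse is two-sided. *)
Lemma inverse_germ Z T p : bigerm Z T p -> exists Z' T',
  [/\ bigerm Z' T' (gbody (Z p)), gbody (Z' (gbody (Z p))) = p,
  \forall q \near p, pull Z T Z' q = q%:A /\ pull Z T T' q = th &
  \forall y \near gbody (Z p), pull Z' T' Z y = y%:A /\ pull Z' T' T y = th].
Proof.
move=> g; have [Z' [T' [g' ep e]]] := left_inverse_germ g.
exists Z', T'; split => //.
have [Z2 [T2 [g2 ep2 e2]]] := left_inverse_germ g'.
rewrite ep in g2 ep2.
have shE F : sh F p -> \forall q \near p, pull (pull Z T Z') (pull Z T T') F q = F q.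
  move=> hF; apply: filterS2 e (sh_near hF) => q [a b] c.
  by rewrite {1}/pull a b; exact: sev_refl.
have z2 : gbody (Z2 p) = gbody (Z p) by [].
have step F : sh F (gbody (Z p)) -> True by [].
have EZ : \forall q \near p, Z2 q = Z q.
  have h1 := pull_comp' g g'; rewrite ep in h1; have {}h1 := h1 _ (bi_shZ g2).
  have h3 := near_body (bi_shZ g) (near_near e2).
  apply: filterS3 (filterI h1 h3) (shE _ (bi_shZ g2)) (bi_To g) => q [a c] d to.
  have i : pull Z T (pull Z' T' Z2) q = pull Z T (fun y => y%:A) q.
    by apply: sev_near; apply: filterS c => y [].
  by move: (etrans (esym i) (etrans a d)); rewrite /pull sev_id.
have ET : \forall q \near p, T2 q = T q.
  have h1 := pull_comp' g g'; rewrite ep in h1; have {}h1 := h1 _ (bi_shT g2).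
  have h3 := near_body (bi_shZ g) (near_near e2).
  apply: filterS3 (filterI h1 h3) (shE _ (bi_shT g2)) (bi_To g) => q [a c] d to.
  have i : pull Z T (pull Z' T' T2) q = pull Z T (fun=> th) q.
    by apply: sev_near; apply: filterS c => y [].
  by move: (etrans (esym i) (etrans a d)); rewrite /pull (sev_th H (Z q) to).
have nb' := near_body (bi_shZ g'); rewrite ep in nb'.
apply: filterS3 e2 (nb' _ (near_near EZ)) (nb' _ (near_near ET)) => y [a b] c d.
by split; [apply: etrans a|apply: etrans b]; symmetry; exact: sev_near.
Qed.

(** d_z Z = D^2 Z = D (T J) = J^2 - T D J, which has the body of J^2. *)
Lemma sc_bigerm Z T p : scgerm Z T p -> bigerm Z T p.
Proof.
move=> [h1 h2 h3 h4 h5 h6].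
have J0 : gbody (SD T p) != 0 by rewrite -gunitE.
split => //.
  have e := near_SD H h5.
  have hJ := sh_SD h2.
  rewrite -(SD_sq h1) e (SDM h2 hJ) gbodyD !gbodyM.
  have -> : gsig (T p) = - T p by apply/goddE/(near_at h4).
  have -> : gbody (- T p) = 0 by apply: gbody_odd; apply: ghomN; exact: near_at h4.
  by rewrite mul0r addr0 mulf_neq0.
by move: J0; rewrite /SuperDerivation.SD gbodyD gbodyM (gbody_odd (@th_odd K N)) mul0r addr0.
Qed.

End InverseFunction.

(** * Superconformal coordinates for a non-integrable odd field *)

Section Coordinates.
Variables (K : numClosedFieldType) (H : holoCalc K) (N : nat).
Local Notation L := (grass K N.+1).
Local Notation th := (ggen K (ord0 : 'I_N.+1)).
Local Notation sh := (sh H).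
Local Notation sdz := (sdz H).
Local Notation SD := (SD H).
Local Notation sev := (sev H).
Local Notation pull := (pull H).
Local Notation vf := (vf H).
Local Notation scgerm := (scgerm H).
Local Notation bigerm := (bigerm H).
Implicit Types (p q : K) (F G Z T w f a b h : K -> L).

Lemma body_sdz_pull Z T Z' p : sh Z p -> (\forall q \near p, godd (T q)) -> sh Z' (gbody (Z p)) ->
  gbody (sdz (pull Z T Z') p) = gbody (sdz Z' (gbody (Z p))) * gbody (sdz Z p).
Proof.
move=> hZ To hZ'; rewrite !gbody_sdz -(hc_der_comp (holo_body hZ) (holo_body hZ')).
apply: hc_near_der; apply: filterS To => q to.
by rewrite /SconfMaps.pull (sev_body H (Z q) to).
Qed.

Lemma body_thp1_pull Z T T' p : sh Z p -> sh T p -> (\forall q \near p, geven (Z q)) ->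
  (\forall q \near p, godd (T q)) -> sh T' (gbody (Z p)) ->
  gbody (thp1 (pull Z T T' p)) = gbody (thp1 (T p)) * gbody (thp1 (T' (gbody (Z p)))).
Proof.
move=> hZ hT Ze To hT'.
have := chain_rule hZ hT Ze To (@geven1 _ _) (@ghom0 _ _ true) hT'.
rewrite /Pullbacks.vf !mul0r !addr0 !mul1r => e; apply: (etrans (congr1 (@gbody _ _) e)).
rewrite gbodyD !gbodyM (gbody_odd (thp1_hom (near_at Ze))) mul0r add0r.
by rewrite (sev_body H (Z p) (near_at To)).
Qed.

Lemma bi_comp Z T Z' T' p : bigerm Z T p -> bigerm Z' T' (gbody (Z p)) ->
  bigerm (pull Z T Z') (pull Z T T') p.
Proof.
move=> [h1 h2 h3 h4 h5 h6] [h1' h2' h3' h4' h5' h6'].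
have nb := near_body h1.
split; try exact: sh_pull.
- have n3 : \forall q \near p, \forall w \near gbody (Z q), geven (Z' w) by exact: nb (near_near h3').
  by apply: filterS3 n3 h3 h4 => q a b c; exact: sev_hom.
- have n3 : \forall q \near p, \forall w \near gbody (Z q), godd (T' w) by exact: nb (near_near h4').
  by apply: filterS3 n3 h3 h4 => q a b c; exact: sev_hom.
- by rewrite (body_sdz_pull h1 h4 h1') mulf_neq0.
- by rewrite (body_thp1_pull h1 h2 h3 h4 h2') mulf_neq0.
Qed.

(** On bodies the chain rule makes each diagonal derivative a factor of 1. *)
Lemma bi_left_inverse Z T Z' T' p : sh Z p -> sh T p -> (\forall q \near p, geven (Z q)) ->
  (\forall q \near p, godd (T q)) -> sh Z' (gbody (Z p)) -> sh T' (gbody (Z p)) ->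
  (\forall q \near p, pull Z T Z' q = q%:A /\ pull Z T T' q = th) -> bigerm Z T p.
Proof.
move=> h1 h2 h3 h4 h1' h2' e.
have e1 : sdz (pull Z T Z') p = 1.
  by rewrite -(sdz_id H N p); apply: near_sdz; apply: filterS e => q [].
have e2 : thp1 (pull Z T T' p) = 1 by rewrite (near_at e).2 (thp_theta _ _).2.
split => //.
  have := body_sdz_pull h1 h4 h1'; rewrite e1 gbody1 => i.
  by apply: contraTneq isT => z; move/eqP: i; rewrite z mulr0 oner_eq0.
have := body_thp1_pull h1 h2 h3 h4 h2'; rewrite e2 gbody1 => i.
by apply: contraTneq isT => z; move/eqP: i; rewrite z mul0r oner_eq0.
Qed.

(* The odd vector field a d/dtheta + b d/dz is h times the pullback of
   D_theta by (Z, T). *)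
Record along a b Z T h p : Prop := Along {
  al_sh : sh h p;
  al_even : \forall q \near p, geven (h q);
  al_unit : h p \is a GRing.unit;
  al_Z : \forall q \near p, vf q (a q) (b q) Z = h q * T q;
  al_T : \forall q \near p, vf q (a q) (b q) T = h q
}.

(** Let E be the field and take T = b / a, with Z theta-free and Z' = T_1. Then E Z = a T T_1, and E
    T = a (T_1 + T T'), so T^2 = 0 gives E Z = (E T) T. The last hypothesis, non-integrability on
    bodies, makes T_1 invertible. *)
Lemma superconformal_coordinates a b p : sh a p -> sh b p ->
  (\forall q \near p, geven (a q)) -> (\forall q \near p, godd (b q)) ->
  gbody (a p) != 0 -> gbody (thp1 (b p)) != 0 ->
  exists Z T h, bigerm Z T p /\ along a b Z T h p.
Proof.
move=> ha hb ae bo a0 b1.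
have aU : a p \is a GRing.unit by rewrite gunitE.
have aUn := near_unit ha aU.
have Ve : \forall q \near p, geven (a q)^-1 by apply: filterS ae => q; exact: gevenV.
have hV := sh_inv ha aU.
pose T q := (a q)^-1 * b q.
have hT : sh T p := shM hV hb.
have To : \forall q \near p, godd (T q) by apply: filterS2 Ve bo => q; exact: geven_oddM.
have T1e : \forall q \near p, geven (thp1 (T q)) by apply: filterS To => q h; exact: (thp1_hom h).
have T1f : \forall q \near p, thfree (thp1 (T q)) by near=> q; exact: thp1_free.
have [Z [hZ Ze Zf dZ]] := sdz_primitive (sh_thp1 hT) T1e T1f.
have T10 : gbody (thp1 (T p)) != 0.
  rewrite /T thp1M gbodyD !gbodyM (gbody_odd (near_at bo)) mulr0 add0r.
  have /gevenE -> := near_at Ve.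
  by rewrite gbodyV // mulf_neq0 // invr_neq0.
exists Z, T, (fun q => vf q (a q) (b q) T); split.
  by split => //; rewrite (near_at dZ).
have To1 := near_sdz_hom H To.
split.
- exact: (shD (shM ha (sh_thp1 hT)) (shM hb (sh_sdz hT))).
- by apply: filterS3 ae bo (near_near To) => q h1 h2 h3; exact: (vf_hom h1 h2 h3).
- rewrite gunitE /Pullbacks.vf gbodyD !gbodyM (gbody_odd (near_at bo)) mul0r addr0.
  by rewrite mulf_neq0.
- apply: filterS3 (filterI dZ Zf) (filterI To bo) (filterI (filterI T1e To1) (filterI ae aUn)) => q [h1 h2] [h3 h4] [[h5 h6] [h7 h8]].
  rewrite /Pullbacks.vf h1 (thp_free h2).2 mulr0 add0r.
  have bE : b q = a q * T q by rewrite /T mulrA divrr // mul1r.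
  rewrite bE; move: (a q) (T q) (thp1 (T q)) (sdz T q) h3 h5 h6 h7 => x y z t yo ze to xe.
  by sring.
- by near=> q.
Unshelve. all: by end_near. Qed.

(** A superconformal change of coordinates multiplies the factor [h] by the pullback of D theta'.
    Through this, coordinates adapted to a generator may be changed to any superconformal ones. *)
Lemma along_pull a b A B h Z T p : sh a p -> sh b p ->
  (\forall q \near p, geven (a q)) -> (\forall q \near p, godd (b q)) ->
  bigerm A B p -> along a b A B h p -> scgerm Z T (gbody (A p)) ->
  along a b (pull A B Z) (pull A B T) (fun q => h q * pull A B (SD T) q) p.
Proof.
move=> ha hb ae bo [g1 g2 g3 g4 g5 g6] [h1 h2 h3 h4 h5] g.
have nb := near_body g1.
have hJ := sc_J_sh g.
have hpJ := sh_pull g1 g2 hJ.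
have n1 : \forall q \near p, scgerm Z T (gbody (A q)) by exact: nb (sc_near g).
have n2 := sh_near g1; have n3 := sh_near g2; have n4 := near_near g3; have n5 := near_near g4.
have key q F : sh A q -> sh B q -> (\forall q' \near q, geven (A q')) -> (\forall q' \near q, godd (B q')) ->
   geven (a q) -> godd (b q) -> vf q (a q) (b q) A = h q * B q -> vf q (a q) (b q) B = h q ->
   sh F (gbody (A q)) -> vf q (a q) (b q) (pull A B F) = h q * pull A B (SD F) q.
  move=> k1 k2 k3 k4 k5 k6 k7 k8 hF.
  apply: (etrans (chain_rule k1 k2 k3 k4 k5 k6 hF)).
  rewrite k7 k8 -mulrA -mulrDr; congr (_ * _).
  have hth := sh_cst H th (gbody (A q)).
  have e := sevD (B q) (sh_thp1 hF) (shM hth (sh_sdz hF)).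
  have e' := sevM (near_at k3) (near_at k4) hth (sh_sdz hF).
  rewrite (sev_th H (A q) (near_at k4)) in e'.
  by rewrite addrC /SconfMaps.pull; apply/esym/(etrans e); rewrite e'.
have key' : \forall q \near p, forall F, sh F (gbody (A q)) ->
    vf q (a q) (b q) (pull A B F) = h q * pull A B (SD F) q.
  apply: filterS3 (filterI (filterI n2 n3) (filterI n4 n5)) (filterI ae bo) (filterI h4 h5) => q [[k1 k2] [k3 k4]] [k5 k6] [k7 k8] F.
  exact: key.
split.
- exact: shM.
- have n6 : \forall q \near p, \forall w \near gbody (A q), geven (SD T w) by exact: nb (near_near (sc_J_even g)).
  apply: filterS3 h2 n6 (filterI g3 g4) => q k1 k2 [k3 k4].
  by apply: gevenM => //; exact: sev_hom.
- rewrite gunitE gbodyM /SconfMaps.pull (sev_body H (A p) (near_at g4)) mulf_neq0 // -gunitE //.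
  exact: (sc_unit g).
- apply: filterS3 key' n1 (filterI g3 g4) => q k1 k2 [k3 k4].
  rewrite (k1 _ (sc_shZ k2)) -mulrA; congr (_ * _).
  apply: etrans (sevM k3 k4 (sc_J_sh k2) (sc_shT k2)).
  apply: sev_near; apply: filterS2 (sc_conf k2) (sc_J_even k2) => w -> je.
  by rewrite (geven_comm _ je).
- by apply: filterS2 key' n1 => q k1 k2; rewrite (k1 _ (sc_shT k2)).
Qed.

End Coordinates.

Module GaugeGerms.

(** * Gauge transformations of matrix germs *)

Section MatrixGerms.
Variables (K : numClosedFieldType) (H : holoCalc K) (N : nat).
Local Notation L := (grass K N.+1).
Local Notation th := (ggen K (ord0 : 'I_N.+1)).
Local Notation sh := (sh H).
Local Notation sdz := (sdz H).
Local Notation SD := (SD H).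
Local Notation sev := (sev H).
Local Notation pull := (pull H).
Local Notation scgerm := (scgerm H).
Local Notation uinv := (uinv H).
Implicit Types (p q : K) (F G Z T : K -> L) (M g A : K -> 'M[L]_3).

Definition kmD M : K -> 'M[L]_3 := fun p =>
  \matrix_(i < 3, j < 3) ((-1) ^+ (i == 1%N :> nat) * SD (fun q => M q i j) p).
Definition msh M p := forall i j, sh (fun q => M q i j) p.
Definition mpull Z T M : K -> 'M[L]_3 := fun q =>
  \matrix_(i < 3, j < 3) pull Z T (fun w => M w i j) q.

Lemma kmDE M p i j : kmD M p i j = (-1) ^+ (i == 1%N :> nat) * SD (fun q => M q i j) p.
Proof. by rewrite mxE. Qed.

Lemma mpullE Z T M q i j : mpull Z T M q i j = pull Z T (fun w => M w i j) q.
Proof. by rewrite mxE. Qed.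

Lemma kmD_near M M' p : (\forall q \near p, M q = M' q) -> kmD M p = kmD M' p.
Proof.
move=> h; apply/matrixP => i j; rewrite !kmDE; congr (_ * _); apply: near_SD.
by apply: filterS h => q ->.
Qed.

Lemma mshP M p : msh M p -> \forall q \near p, msh M q.
Proof.
move=> h.
have h1 i : \forall q \near p, forall j, sh (fun q => M q i j) q.
  exact: (@filter_forall _ _ (fun j q => sh (fun q => M q i j) q) (nbhs p) _ (fun j => sh_near (h i j))).
exact: (@filter_forall _ _ (fun i q => forall j, sh (fun q => M q i j) q) (nbhs p) _ h1).
Qed.

Lemma sh_mulmx g M p : msh g p -> msh M p -> msh (fun q => g q *m M q) p.
Proof.
move=> h h' i j.
apply: sh_ext (sh_sum (index_enum 'I_3) xpredT (fun k => shM (h i k) (h' k j))).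
by near=> q; rewrite mxE.
Unshelve. all: by end_near. Qed.

Lemma sign_comm (b : bool) (x : L) : (-1) ^+ b * x = x * (-1) ^+ b.
Proof. by case: b; rewrite ?expr1 ?expr0 ?mulN1r ?mulrN1 ?mul1r ?mulr1. Qed.

(** Passing D through the entry (i, k) of an even matrix gives the product of the signs of rows i
    and k. The first is already in [kmD] of the product, the second in [kmD M], so no sign is
    left. *)
Lemma kmDM g M p : msh g p -> msh M p -> (forall i j, ghom (mxpar i j) (g p i j)) ->
  kmD (fun q => g q *m M q) p = kmD g p *m M p + g p *m kmD M p.
Proof.
move=> hg hM hh; apply/matrixP => i j; rewrite kmDE [RHS]mxE !mxE -big_split /=.
rewrite (_ : SD _ p = SD (fun q => \sum_k g q i k * M q k j) p); last first.
  by apply: near_SD; near=> q; rewrite mxE.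
rewrite (SD_sum (index_enum 'I_3) xpredT (fun k => shM (hg i k) (hM k j))) mulr_sumr.
apply: eq_bigr => k _; rewrite !kmDE (SDM (hg i k) (hM k j)) mulrDr !mulrA; congr (_ + _ * _).
have /ghomE -> := hh i k; rewrite /mxpar.
by case: (_ == _); case: (_ == _); rewrite /= ?expr1 ?expr0 ?scale1r ?scaleN1r ?mul1r ?mulr1 ?mulN1r ?mulrN1 ?opprK.
Unshelve. all: by end_near. Qed.

Lemma kmD1 p : kmD (fun=> 1%:M) p = 0.
Proof.
apply/matrixP => i j; rewrite kmDE SD_cst; first by rewrite mulr0 mxE.
by rewrite mxE; case: (_ == _); [exact: thfree1|exact: thfree0].
Qed.

Definition gaugeAt g A A' p := A p *m g p = g p *m A' p - kmD g p.

Lemma gauge_comp g g' A A' A'' p : msh g p -> msh g' p -> kin_G (g p) ->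
  gaugeAt g A A' p -> gaugeAt g' A' A'' p -> gaugeAt (fun q => g q *m g' q) A A'' p.
Proof.
move=> hg hg' gG e1 e2; rewrite /gaugeAt (kmDM hg hg' (kin_G_hom gG)).
move: e1 e2; rewrite /gaugeAt; move: (A p) (A' p) (A'' p) (g p) (g' p) (kmD g p) (kmD g' p).
move=> a a' a'' x x' d d' e1 e2.
by rewrite mulmxA e1 mulmxBl -(mulmxA x a') e2 mulmxBr mulmxA opprD addrA addrAC.
Qed.

Lemma sh_ginv3 g p : msh g p -> msh (fun q => ginv3 (g q)) p.
Proof.
move=> h; elim/ord3P; elim/ord3P;
  by [apply: sh_ext (h _ _); near=> q; rewrite kmx3E /= |
      apply: sh_ext (shN (h _ _)); near=> q; rewrite kmx3E /=].
Unshelve. all: by end_near. Qed.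

Lemma gauge_inv g A A' p : msh g p -> (\forall q \near p, kin_G (g q)) ->
  gaugeAt g A A' p -> gaugeAt (fun q => ginv3 (g q)) A' A p.
Proof.
move=> hg gG e; have [gi vg gv] := ginv3P (near_at gG).
have e1 : kmD (fun q => g q *m ginv3 (g q)) p = 0.
  rewrite -(kmD1 p); apply: kmD_near; apply: filterS gG => q /ginv3P[_ _ h]; exact: h.
rewrite (kmDM hg (sh_ginv3 hg) (kin_G_hom (near_at gG))) in e1.
rewrite /gaugeAt; apply: (can_inj (g := mulmx (ginv3 (g p))) (f := mulmx (g p))).
  by move=> X; rewrite mulmxA vg mul1mx.
rewrite mulmxBr !mulmxA gv mul1mx.
have -> : g p *m kmD (fun q => ginv3 (g q)) p = - (kmD g p *m ginv3 (g p)).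
  by apply/eqP; rewrite -addr_eq0 addrC e1.
have -> : g p *m A' p = A p *m g p + kmD g p by rewrite e subrK.
by rewrite mulmxDl -mulmxA gv mulmx1 opprK.
Qed.

Lemma scale_mulmx (x : L) (A B : 'M[L]_3) : geven x -> A *m (x *: B) = x *: (A *m B).
Proof.
move=> xe; apply/matrixP => i j; rewrite !mxE mulr_sumr; apply: eq_bigr => k _.
by rewrite !mxE mulrA -(geven_comm _ xe) -mulrA.
Qed.

Lemma sh_mpull Z T M p : scgerm Z T p -> msh M (gbody (Z p)) -> msh (mpull Z T M) p.
Proof.
move=> g h i j; apply: sh_ext (sh_pullg g (h i j)).
by near=> q; rewrite mxE.
Unshelve. all: by end_near. Qed.

Lemma mpull_M Z T M M' p : scgerm Z T p -> msh M (gbody (Z p)) -> msh M' (gbody (Z p)) ->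
  \forall q \near p, mpull Z T (fun w => M w *m M' w) q = mpull Z T M q *m mpull Z T M' q.
Proof.
move=> g h h'.
have hn : \forall q \near p, msh M (gbody (Z q)) by exact: (sc_body g (mshP h)).
have hn' : \forall q \near p, msh M' (gbody (Z q)) by exact: (sc_body g (mshP h')).
apply: filterS3 hn hn' (filterI (sc_Ze g) (sc_To g)) => q h1 h2 [ze to]; apply/matrixP => i j; rewrite !mxE.
transitivity (pull Z T (fun w => M w i o0 * M' w o0 j + M w i o1 * M' w o1 j + M w i o2 * M' w o2 j) q).
  by congr (pull _ _ _ q); apply/funext => w; rewrite mul3E.
have m0 := shM (h1 i o0) (h2 o0 j); have m1 := shM (h1 i o1) (h2 o1 j); have m2 := shM (h1 i o2) (h2 o2 j).
rewrite [RHS](_ : _ = (mpull Z T M q *m mpull Z T M' q) i j); last by rewrite mxE.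
rewrite mul3E !mxE.
apply: (etrans (sevD (T q) (shD m0 m1) m2)).
rewrite (sevD (T q) m0 m1) (sevM ze to (h1 i o0) (h2 o0 j)) (sevM ze to (h1 i o1) (h2 o1 j)).
by rewrite (sevM ze to (h1 i o2) (h2 o2 j)).
Qed.

Lemma mpull_ext Z T M M' p : scgerm Z T p -> (\forall w \near gbody (Z p), M w = M' w) ->
  \forall q \near p, mpull Z T M q = mpull Z T M' q.
Proof.
move=> g h; have h' := sc_body g (near_near h).
apply: filterS h' => q hq; apply/matrixP => i j; rewrite !mxE; apply: sev_near.
by apply: filterS hq => w ->.
Qed.

Lemma mpull_D Z T M p : scgerm Z T p -> msh M (gbody (Z p)) ->
  \forall q \near p, kmD (mpull Z T M) q = SD T q *: mpull Z T (kmD M) q.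
Proof.
move=> g h.
have hn : \forall q \near p, msh M (gbody (Z q)) by exact: (sc_body g (mshP h)).
apply: filterS3 hn (sc_near g) (filterI (sc_Ze g) (sc_To g)) => q h1 g1 [ze to]; apply/matrixP => i j.
rewrite kmDE [RHS]mxE (mpullE Z T (kmD M)).
rewrite (_ : SD _ q = SD (pull Z T (fun w => M w i j)) q); last first.
  by apply: near_SD; near=> q'; rewrite mxE.
rewrite (near_at (sc_chain g1 (h1 i j))) mulrA sign_comm -mulrA; congr (_ * _).
case ei: (i == 1%N :> nat); last first.
  rewrite expr0 mul1r; congr (pull _ _ _ q); apply/funext => w; by rewrite kmDE ei expr0 mul1r.
rewrite expr1.
have hD := sh_SD (h1 i j).
have hc := sh_cst H (-1 : L) (gbody (Z q)).
transitivity (pull Z T (fun w => -1 * SD (fun w => M w i j) w) q).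
  rewrite /SconfMaps.pull (sevM ze to hc hD) sev_cst chi_free //.
  by apply: thfreeN; exact: thfree1.
by congr (pull _ _ _ q); apply/funext => w; rewrite kmDE ei expr1.
Unshelve. all: by end_near. Qed.

(** Pullback multiplies D by D theta'; the gauge equation therefore persists once the connection
    matrices are multiplied by the same factor. *)
Lemma gauge_pull Z T g A A' p : scgerm Z T p -> msh g (gbody (Z p)) -> msh A (gbody (Z p)) ->
  msh A' (gbody (Z p)) -> (\forall w \near gbody (Z p), gaugeAt g A A' w) ->
  \forall q \near p, gaugeAt (mpull Z T g) (fun q => SD T q *: mpull Z T A q)
    (fun q => SD T q *: mpull Z T A' q) q.
Proof.
move=> sg hg hA hA' e.
have e1 : \forall w \near gbody (Z p), A w *m g w + kmD g w = g w *m A' w.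
  by apply: filterS e => w ->; rewrite subrK.
have hD : msh (kmD g) (gbody (Z p)).
  move=> i j; apply: sh_ext (shM (sh_cst H ((-1) ^+ (i == 1%N :> nat)) _) (sh_SD (hg i j))).
  by near=> w; rewrite kmDE.
have h1 := mpull_M sg hA hg; have h2 := mpull_M sg hg hA'; have h3 := mpull_D sg hg.
have h4 := mpull_ext sg e1.
have h5 : \forall q \near p, mpull Z T (fun w => A w *m g w + kmD g w) q =
    mpull Z T (fun w => A w *m g w) q + mpull Z T (kmD g) q.
  have hn : \forall q \near p, msh (fun w => A w *m g w) (gbody (Z q)).
    by exact: (sc_body sg (mshP (sh_mulmx hA hg))).
  have hn' : \forall q \near p, msh (kmD g) (gbody (Z q)) by exact: (sc_body sg (mshP hD)).
  apply: filterS2 hn hn' => q k1 k2; apply/matrixP => i j; rewrite !mxE.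
  rewrite (_ : (fun w => _ i j) = (fun w => (A w *m g w) i j + kmD g w i j)); last first.
    by apply/funext => w; rewrite mxE.
  exact: (sevD (T q) (k1 i j) (k2 i j)).
apply: filterS3 (filterI h1 h2) (filterI h3 h4) (filterI h5 (sc_J_even sg)) => q [a b] [c d] [f Je].
rewrite /gaugeAt c scale_mulmx // -b -scalemxAl -a -scalerBr; congr (_ *: _).
by rewrite -d f addrK.
Unshelve. all: by end_near. Qed.

Lemma kmD_Bm (t del beta u : K -> L) p : sh t p -> sh del p ->
  kmD (fun q => Bm (t q) (del q) (beta q) (u q)) p =
  kmx3 [:: [:: SD t p; - SD (fun q => del q * t q) p; SD beta p];
           [:: 0; 0; - SD del p]; [:: 0; 0; SD u p]].
Proof.
move=> ht hd; have f0 := @thfree0 K N; have f1 := @thfree1 K N.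
have e (F : K -> L) i j : (fun q => Bm (t q) (del q) (beta q) (u q) i j) = F ->
  kmD (fun q => Bm (t q) (del q) (beta q) (u q)) p i j = (-1) ^+ (i == 1%N :> nat) * SD F p.
  by move=> <-; exact: kmDE.
have E i j := funext (fun q => kmx3E [:: [:: t q; - (del q * t q); beta q];[:: 0; 1; del q]; [:: 0; 0; u q]] i j).
apply: mx3P; rewrite (e _ _ _ (E _ _)) kmx3E /= ?expr0 ?mul1r ?expr1 ?mulN1r //.
- exact: SDN (shM hd ht).
- by rewrite SD_cst ?oppr0.
- by rewrite SD_cst ?oppr0.
- by rewrite SD_cst.
- by rewrite SD_cst.
Qed.

Lemma scale_Om (x y : L) : x *: Om 1 0 0 (- y) = Om x 0 0 (- (x * y)).
Proof. by apply: mx3P; rewrite mxE !kmx3E /= ?oppr0 ?mulr0 ?mulrN ?mulr1. Qed.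

Lemma kin_B_Bm M p : kin_B (M p) ->
  M p = Bm (M p o0 o0) (M p o1 o2) (M p o0 o2) (M p o2 o2) /\
  [/\ [/\ geven (M p o0 o0), godd (M p o1 o2), geven (M p o0 o2) & geven (M p o2 o2)]
    & M p o0 o0 * M p o2 o2 = 1].
Proof.
move=> /kin_BP[t [del [beta [u [h tu ->]]]]].
by rewrite !kmx3E.
Qed.

(* The B-valued gauge transformation from D^3 - w to D^3 - w' induced by the
   change of coordinates. *)
Definition bJ T : K -> 'M[L]_3 := fun q =>
  Bm (SD T q) (- SD (uinv T) q) (SD (SD (uinv T)) q) (uinv T q).

Section BJ.
Variables (Z T : K -> L) (p : K).
Hypothesis sg : scgerm Z T p.
Let J := SD T.
Let u := uinv T.
Let shJ : sh J p := sc_J_sh sg.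
Let shu : sh u p := sc_u_sh sg.

Lemma bJ_par : \forall q \near p,
  [/\ geven (J q), godd (- SD u q), geven (SD (SD u) q) & geven (u q)].
Proof.
have ue := sc_u_even sg; have uo := near_SD_hom H ue; have u2 := near_SD_hom H uo.
by apply: filterS3 (sc_J_even sg) (filterI ue uo) u2 => q a [b c] d; split => //; exact: ghomN.
Qed.

Lemma bJ_Ju : \forall q \near p, J q * u q = 1.
Proof. by apply: filterS (sc_J_unit sg) => q; exact: divrr. Qed.

Lemma bJ_in : \forall q \near p, kin_B (bJ T q).
Proof. by apply: filterS2 bJ_par bJ_Ju => q a b; apply: Bm_in. Qed.

Lemma sh_bJ : msh (bJ T) p.
Proof.
have h0 := sh_cst H (0 : L) p; have h1 := sh_cst H (1 : L) p.
have hu1 := shN (sh_SD shu).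
elim/ord3P; elim/ord3P; rewrite /msh.
- by apply: sh_ext shJ; near=> q; rewrite kmx3E.
- by apply: sh_ext (shN (shM hu1 shJ)); near=> q; rewrite kmx3E.
- by apply: sh_ext (sh_SD (sh_SD shu)); near=> q; rewrite kmx3E.
- by apply: sh_ext h0; near=> q; rewrite kmx3E.
- by apply: sh_ext h1; near=> q; rewrite kmx3E.
- by apply: sh_ext hu1; near=> q; rewrite kmx3E.
- by apply: sh_ext h0; near=> q; rewrite kmx3E.
- by apply: sh_ext h0; near=> q; rewrite kmx3E.
- by apply: sh_ext shu; near=> q; rewrite kmx3E.
Unshelve. all: by end_near. Qed.

Lemma bJ_DJ : \forall q \near p, SD J q = - (J q ^+ 2 * SD u q).
Proof.
have h := near_SD' H (sc_uJ sg).
apply: filterS3 h (filterI bJ_par bJ_Ju) (filterI (sh_near shu) (sh_near shJ)) => q a [[b0 b1 b2 b3] c] [d e].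
have a' : SD (fun q => u q * J q) q = 0 by apply: (etrans a); apply: SD_cst; exact: thfree1.
have {}a' := etrans (esym (SDM d e)) a'.
rewrite (_ : gsig (u q) = u q) in a'; last exact/gevenE.
have uo : godd (SD u q) by rewrite -[SD u q]opprK; exact: ghomN.
have uJ : SD J q = - (J q * SD u q * J q).
  have := congr1 (fun z => J q * z) a'; rewrite /= mulr0 mulrDr !mulrA c mul1r => /eqP.
  by rewrite addrC addr_eq0 => /eqP.
rewrite uJ expr2; move: (J q) (SD u q) b0 uo => x y xe yo; sring.
Qed.

(** All entries but the upper right one hold by D J = - J^2 D u and the definition of [bJ]; the
    upper right one is the law relating [w] and [w']. *)
Lemma bJ_gauge w w' : (\forall q \near p, w q * u q = J q ^+ 2 * w' q + SD (SD (SD u)) q) ->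
  \forall q \near p, gaugeAt (bJ T) (fun q => Om 1 0 0 (- w q)) (fun q => J q *: Om 1 0 0 (- w' q)) q.
Proof.
move=> hw; have n : \forall q \near p, sh J q /\ sh u q by exact: filterI (sh_near shJ) (sh_near shu).
apply: filterS3 (filterI hw n) (filterI bJ_par bJ_Ju) bJ_DJ => q [e [k1 k2]] [[b0 b1 b2 b3] c] d.
rewrite /gaugeAt (kmD_Bm _ _ k1 (shN (sh_SD k2))).
rewrite scale_Om.
have k3 := shN (sh_SD k2).
apply/gauge_entries.
have uo : godd (SD u q) by rewrite -[SD u q]opprK; exact: ghomN.
rewrite (SDM k3 k1) (SDN (sh_SD k2)) d.
rewrite -/(J q) -/(u q) ?mul0r ?mulr0 ?addr0 ?add0r ?mul1r ?oppr0 ?mulr1 ?subr0 ?sub0r ?add0r.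
have sg1 : gsig (- SD u q) = SD u q by have /goddE -> := b1; rewrite opprK.
have uJ : u q * J q = 1 by rewrite (geven_comm _ b3).
split; [split|split|split] => //.
- by rewrite opprK expr2; move: (J q) (SD u q) b0 uo => x y xe yo; sring.
- rewrite sg1; move: (J q) (SD u q) (SD (SD u) q) b0 uo b2 => x y z xe yo ze; sring.
- by rewrite mulNr e opprD mulrN expr2 mulrA ?addr0.
- by rewrite ?addr0.
Qed.

(** Solved from the bottom up: the coefficients of f force the diagonal entries J, 1 and u, the
    entries of [b] then give del = - D u and beta = - D del, and the upper right entry is left as a
    condition on [w] and [w']. *)
Lemma bJ_unique M w w' : msh M p -> (\forall q \near p, kin_B (M q)) ->
  (\forall q \near p, gaugeAt M (fun q => Om 1 0 0 (- w q)) (fun q => J q *: Om 1 0 0 (- w' q)) q) ->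
  \forall q \near p, M q = bJ T q /\ w q * u q = J q ^+ 2 * w' q + SD (SD (SD u)) q.
Proof.
move=> hM MB hg.
pose t : K -> L := fun q => M q o0 o0; pose del : K -> L := fun q => M q o1 o2.
pose beta : K -> L := fun q => M q o0 o2; pose v : K -> L := fun q => M q o2 o2.
have ht : sh t p := hM _ _; have hd : sh del p := hM _ _.
have ME : \forall q \near p, M q = Bm (t q) (del q) (beta q) (v q).
  by apply: filterS MB => q /kin_B_Bm[].
have eqs : \forall q \near p, [/\ t q = J q, v q = u q, del q = - SD v q, beta q = - SD del q
   & w q * v q = J q ^+ 2 * w' q + SD beta q].
  have n : \forall q \near p, sh t q /\ sh del q by exact: filterI (sh_near ht) (sh_near hd).
  apply: filterS3 (filterI hg (near_near ME)) (filterI n MB) (filterI bJ_Ju (sc_J_unit sg)) => q [a b] [[c d] /kin_B_Bm[_ [[m0 m1 m2 m3] m4]]] [j ju].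
  move: a; rewrite /gaugeAt (kmD_near b) (kmD_Bm _ _ c d) (near_at b).
  rewrite scale_Om.
  move=> /gauge_entries[[_ _ e3] [e4 _ e6] [e7 e8]].
  rewrite !mul1r in e4 e6 e8; rewrite !mul0r !mulr0 ?oppr0 ?addr0 ?add0r ?subr0 ?sub0r in e3 e6 e8.
  have vu : v q = u q.
    by apply: (mulIr ju); rewrite -e7; apply/esym/mulVr.
  split => //.
  - by rewrite -e6 opprK.
  - move: e3; rewrite e4 mulNr => /(congr1 (fun z => - z)); rewrite opprK => ->.
    by rewrite opprD !opprK mulrN mulrA -expr2 opprK.
have sv : \forall q \near p, SD v q = SD u q by apply: near_SD' ; apply: filterS eqs => q [].
have dv : \forall q \near p, del q = - SD u q by apply: filterS2 eqs sv => q [_ _ -> _ _] ->.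
have sd : \forall q \near p, SD del q = - SD (SD u) q.
  apply: filterS2 (near_SD' H dv) (sh_near (sh_SD shu)) => q -> h; exact: SDN.
have bv : \forall q \near p, beta q = SD (SD u) q.
  by apply: filterS2 eqs sd => q [_ _ _ -> _] ->; rewrite opprK.
have sb := near_SD' H bv.
apply: filterS3 (filterI eqs ME) (filterI dv bv) sb => q [[a b _ _ e] c] [d f] i.
by rewrite c a b d f; split => //; rewrite -b e i.
Qed.

End BJ.

Lemma mpull_Bm Z T (t del beta u : K -> L) p : scgerm Z T p ->
  sh t (gbody (Z p)) -> sh del (gbody (Z p)) ->
  \forall q \near p, mpull Z T (fun w => Bm (t w) (del w) (beta w) (u w)) q =
    Bm (pull Z T t q) (pull Z T del q) (pull Z T beta q) (pull Z T u q).
Proof.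
move=> g ht hd.
have hm := pull_M g hd ht.
have hn := sc_body g (sh_near (shM hd ht)).
apply: filterS3 hm hn (filterI (sc_Ze g) (sc_To g)) => q e hs [ze to].
have f1 := @thfree1 K N; have f0 := @thfree0 K N.
have E i j : (fun w => Bm (t w) (del w) (beta w) (u w) i j) = _ :=
  funext (fun w => kmx3E [:: [:: t w; - (del w * t w); beta w];[:: 0; 1; del w]; [:: 0; 0; u w]] i j).
apply: mx3P; rewrite [LHS]mxE E kmx3E /= ?pull_cst //.
rewrite -e; have hc := sh_cst H (-1 : L) (gbody (Z q)).
transitivity (pull Z T (fun w => -1 * (del w * t w)) q).
  by congr (pull _ _ _ q); apply/funext => w; rewrite mulN1r.
by rewrite /SconfMaps.pull (sevM ze to hc hs) sev_cst chi_free ?mulN1r //; exact: thfreeN.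
Qed.

Lemma BmM_opp (J d s u J' e r v : L) :
  [/\ geven J, godd (- d), geven s & geven u] ->
  [/\ geven J', godd (- e), geven r & geven v] -> J' * v = 1 ->
  Bm J (- d) s u *m Bm J' (- e) r v = Bm (J * J') (- (d * v + e)) (s * v - d * J * e + J * r) (u * v).
Proof.
move=> h h' h1; rewrite BmM //; congr Bm; first by rewrite opprD mulNr addrC.
by rewrite !mulrN !mulNr opprK addrC [J * r - _]addrC addrA.
Qed.

Lemma congr_Bm (t del b u t' del' b' u' : L) : t = t' -> del = del' -> b = b' -> u = u' ->
  Bm t del b u = Bm t' del' b' u'.
Proof. by move=> -> -> -> ->. Qed.

(** Entry by entry this is the composition rule for D theta', u, D u and D^2 u. *)
Lemma bJ_comp Z T Z' T' p : scgerm Z T p -> scgerm Z' T' (gbody (Z p)) ->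
  \forall q \near p, bJ (pull Z T T') q = bJ T q *m mpull Z T (bJ T') q.
Proof.
move=> g g'.
have hJ := sc_J_sh g'; have hu := sc_u_sh g'; have hu1 := sh_SD hu.
have hb := mpull_Bm (SD (SD (uinv T'))) (uinv T') g hJ (shN hu1).
have hN : \forall q \near p, pull Z T (fun w => - SD (uinv T') w) q = - pull Z T (SD (uinv T')) q.
  have hn := sc_body g (sh_near hu1).
  apply: filterS3 (sc_Ze g) (sc_To g) hn => q ze to hs.
  have hc := sh_cst H (-1 : L) (gbody (Z q)).
  transitivity (pull Z T (fun w => -1 * SD (uinv T') w) q).
    by congr (pull _ _ _ q); apply/funext => w; rewrite mulN1r.
  by rewrite /SconfMaps.pull (sevM ze to hc hs) sev_cst chi_free ?mulN1r //; apply: thfreeN; exact: thfree1.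
have pb : \forall q \near p, [/\ geven (pull Z T (SD T') q), godd (- pull Z T (SD (uinv T')) q),
    geven (pull Z T (SD (SD (uinv T'))) q) & geven (pull Z T (uinv T') q)].
  have n1 := bJ_par g'.
  have h0 : \forall w \near gbody (Z p), geven (SD T' w) by apply: filterS n1 => w [].
  have h1 : \forall w \near gbody (Z p), godd (- SD (uinv T') w) by apply: filterS n1 => w [].
  have h2 : \forall w \near gbody (Z p), geven (SD (SD (uinv T')) w) by apply: filterS n1 => w [].
  have h3 : \forall w \near gbody (Z p), geven (uinv T' w) by apply: filterS n1 => w [].
  have k0 := pull_hom g h0; have k1 := pull_hom g h1; have k2 := pull_hom g h2; have k3 := pull_hom g h3.
  apply: filterS3 (filterI k0 k1) (filterI k2 k3) hN => q [a b] [c d] e.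
  by split => //; rewrite -e.
have ju : \forall q \near p, pull Z T (SD T') q * pull Z T (uinv T') q = 1.
  have m := pull_M g hJ hu; have m1 := pull_ext g (bJ_Ju g').
  apply: filterS2 m m1 => q <- ->; apply: pull_cst; exact: thfree1.
apply: filterS3 (filterI hb hN) (filterI pb (filterI (bJ_par g) ju)) (filterI (sc_comp_u g g') (filterI (sc_comp_Du g g') (filterI (sc_comp_D2u g g') (sc_compJ g g')))).
move=> q [b n] [c [d e]] [f [i [j k]]].
have b' := b; rewrite n in b'.
apply: etrans _ (esym (etrans (congr1 (mulmx (bJ T q)) b') (BmM_opp d c e))).
exact: (congr_Bm k (congr1 -%R i) j f).
Qed.

End MatrixGerms.

End GaugeGerms.
Export GaugeGerms.

(** * The normal form of an oper connection *)

Section NormalForm.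
Variables (K : numClosedFieldType) (H : holoCalc K) (N : nat).
Local Notation L := (grass K N.+1).
Local Notation sh := (sh H).
Local Notation SD := (SD H).
Local Notation msh := (msh H).
Local Notation gaugeAt := (gaugeAt H).
Implicit Types (p q : K) (a h c d : K -> L) (M : K -> 'M[L]_3).

Section Normalize.
Variables (a h c d : K -> L).
(** The solution of [gauge_entries] with left side [Om 1 0 0 (- w)]: the coefficients of f give the
    diagonal, the lower right corner gives [nf_del], position (2,3) gives [nf_beta], and the upper
    right corner gives [nf_w]. *)
Definition nf_u : K -> L := fun q => (a q)^-1.
Definition nf_del : K -> L := fun q => - SD nf_u q - nf_u q * h q.
Definition nf_beta : K -> L := fun q => - c q + nf_del q * h q - SD nf_del q.
Definition nf_w : K -> L := fun q =>
  - (a q * (a q * d q - nf_del q * a q * c q - nf_beta q * h q - SD nf_beta q)).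
Definition nf_B : K -> 'M[L]_3 := fun q => Bm (a q) (nf_del q) (nf_beta q) (nf_u q).

Variable p : K.
Hypotheses (ha : sh a p) (hh : sh h p) (hc : sh c p) (hd : sh d p).
Hypotheses (ae : \forall q \near p, geven (a q)) (ho : \forall q \near p, godd (h q)).
Hypotheses (ce : \forall q \near p, geven (c q)) (dO : \forall q \near p, godd (d q)).
Hypothesis au : a p \is a GRing.unit.

Let shu : sh nf_u p := sh_inv ha au.
Lemma sh_nf_del : sh nf_del p.
Proof. exact: (shB (shN (sh_SD shu)) (shM shu hh)). Qed.
Lemma sh_nf_beta : sh nf_beta p.
Proof. exact: (shB (shD (shN hc) (shM sh_nf_del hh)) (sh_SD sh_nf_del)). Qed.
Lemma sh_nf_w : sh nf_w p.
Proof.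
apply/shN/shM => //; apply: (shB (shB (shB (shM ha hd) _) _) (sh_SD sh_nf_beta)).
  exact: (shM (shM sh_nf_del ha) hc).
exact: (shM sh_nf_beta hh).
Qed.
Lemma nf_u_even : \forall q \near p, geven (nf_u q).
Proof. by apply: filterS ae => q; exact: gevenV. Qed.
Lemma nf_del_odd : \forall q \near p, godd (nf_del q).
Proof.
apply: filterS3 nf_u_even (near_SD_hom H nf_u_even) ho => q h1 h2 h3.
by apply: ghomB; [exact: ghomN|exact: geven_oddM].
Qed.
Lemma nf_beta_even : \forall q \near p, geven (nf_beta q).
Proof.
apply: filterS3 nf_del_odd (near_SD_hom H nf_del_odd) (filterI ho ce) => q h1 h2 [h3 h4].
by apply: ghomB => //; apply: ghomD; [exact: ghomN|exact: goddM].
Qed.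
Lemma nf_w_odd : \forall q \near p, godd (nf_w q).
Proof.
apply: filterS3 (filterI nf_del_odd ae) (filterI nf_beta_even (near_SD_hom H nf_beta_even)) (filterI ho (filterI ce dO)) => q [h1 h2] [h3 h4] [h5 [h6 h7]].
rewrite /nf_w; move: (a q) (d q) (nf_del q) (c q) (nf_beta q) (h q) (SD nf_beta q) h2 h7 h1 h6 h3 h5 h4.
move=> x y z t v r s h2 h7 h1 h6 h3 h5 h4.
apply/ghomN/geven_oddM => //; apply: ghomB => //; apply: ghomB; last exact: geven_oddM.
apply: ghomB; first exact: geven_oddM.
by apply: godd_evenM => //; exact: godd_evenM.
Qed.
Lemma nf_au : \forall q \near p, a q * nf_u q = 1.
Proof. by apply: filterS (near_unit ha au) => q; exact: divrr. Qed.
Lemma nf_B_in : \forall q \near p, kin_B (nf_B q).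
Proof.
apply: filterS3 (filterI ae nf_au) (filterI nf_del_odd nf_beta_even) nf_u_even => q [h1 h2] [h3 h4] h5.
by apply: Bm_in.
Qed.

Lemma sh_Bm (t del beta u : K -> L) : sh t p -> sh del p -> sh beta p -> sh u p ->
  msh (fun q => Bm (t q) (del q) (beta q) (u q)) p.
Proof.
move=> h1 h2 h3 h4; have k0 := sh_cst H (0 : L) p; have k1 := sh_cst H (1 : L) p.
elim/ord3P; elim/ord3P; rewrite /GaugeGerms.msh.
- by apply: sh_ext h1; near=> q; rewrite kmx3E.
- by apply: sh_ext (shN (shM h2 h1)); near=> q; rewrite kmx3E.
- by apply: sh_ext h3; near=> q; rewrite kmx3E.
- by apply: sh_ext k0; near=> q; rewrite kmx3E.
- by apply: sh_ext k1; near=> q; rewrite kmx3E.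
- by apply: sh_ext h2; near=> q; rewrite kmx3E.
- by apply: sh_ext k0; near=> q; rewrite kmx3E.
- by apply: sh_ext k0; near=> q; rewrite kmx3E.
- by apply: sh_ext h4; near=> q; rewrite kmx3E.
Unshelve. all: by end_near. Qed.

Lemma sh_nf_B : msh nf_B p.
Proof. exact: sh_Bm ha sh_nf_del sh_nf_beta shu. Qed.

Lemma D_inverse (t u : K -> L) : sh t p -> sh u p -> (\forall q \near p, geven (t q)) ->
  (\forall q \near p, geven (u q)) -> (\forall q \near p, t q * u q = 1) ->
  \forall q \near p, SD t q = - (t q * t q * SD u q).
Proof.
move=> ht hu te ue tu.
apply: filterS3 (near_SD' H tu) (filterI (filterI te ue) tu) (filterI (near_SD_hom H ue) (filterI (sh_near ht) (sh_near hu))) => q e1 [[e2 e3] e4] [uo [s1 s2]].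
have e5 : SD (fun q => t q * u q) q = 0 by apply: (etrans e1); apply: SD_cst; exact: thfree1.
have {}e5 := etrans (esym (SDM s1 s2)) e5.
rewrite (_ : gsig (t q) = t q) in e5; last exact/gevenE.
have := congr1 (fun z => z * t q) e5; rewrite /= mul0r mulrDl -!mulrA -(geven_comm _ e2) e4 mulr1 => /eqP.
rewrite addr_eq0 => /eqP ->; congr (- _); congr (_ * _).
by rewrite -(geven_comm _ e2).
Qed.

Lemma nf_gauge : \forall q \near p, gaugeAt nf_B (fun q => Om 1 0 0 (- nf_w q))
  (fun q => Om (a q) (h q) (c q) (d q)) q.
Proof.
have n1 := nf_au; have n2 := nf_u_even; have n3 := nf_del_odd; have n4 := nf_beta_even.
have Da := D_inverse ha shu ae n2 n1.
have uo := near_SD_hom H n2; have de := near_SD_hom H n3; have bo := near_SD_hom H n4.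
apply: filterS3 (filterI (filterI n1 n2) (filterI n3 n4)) (filterI (filterI Da uo) (filterI de bo)) (filterI (filterI (filterI ae ho) (filterI ce dO)) (filterI (sh_near ha) (sh_near sh_nf_del))).
move=> q [[au1 ue] [dlo be]] [[Daq duo] [ddle dbo]] [[[aeq hoq] [ceq doq]] [sa sdl]].
rewrite /GaugeGerms.gaugeAt (kmD_Bm _ _ sa sdl).
apply/gauge_entries.
rewrite (SDM sdl sa) (_ : gsig (nf_del q) = - nf_del q); last exact/goddE.
have bE : nf_beta q = - c q + nf_del q * h q - SD nf_del q by [].
have dE : nf_del q = - SD nf_u q - nf_u q * h q by [].
have wE : nf_w q = - (a q * (a q * d q - nf_del q * a q * c q - nf_beta q * h q - SD nf_beta q)) by [].
rewrite Daq wE !mul1r !mul0r ?mulr0 ?oppr0 ?add0r ?addr0 ?subr0 ?sub0r.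
have duE : SD nf_u q = - nf_del q - nf_u q * h q by rewrite dE opprD !opprK addrK.
rewrite duE.
move: (SD nf_beta q) (SD nf_del q) (nf_u q) (a q) (h q) (c q) (d q) au1 ue dlo be ddle dbo aeq hoq ceq doq bE.
move: (nf_del q) (nf_beta q) => del beta sb sd u t x y z tu ue dlo be sde sbo te xo ye zo bE.
have e0 s : t * (u * s) = s by rewrite mulrA tu mul1r.
have e1 : t * t * (- del - u * x) = - (t * (t * del)) - t * x.
  by rewrite mulrBr mulrN -!mulrA e0.
have ut : u * t = 1 by rewrite (geven_comm _ ue).
split; [split|split|split] => //.
- by rewrite e1; sring.
- by rewrite bE e1; sring.
- by move: (t * z - _ - _ - _) => s; rewrite opprK -mulrA -(geven_comm s ue) e0.
- by rewrite bE; sring.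
- by sring.
Qed.

End Normalize.

(** Conjugation by B cannot create entries below the subdiagonal and multiplies both subdiagonal
    entries by [u]. The remaining coefficients [h], [c], [d] are read off the gauge equation and
    have the parities of an odd element of [b]. *)
Lemma Jf_gauge J M p : msh M p -> (\forall q \near p, kin_B (M q)) -> geven (J p) -> J p \is a GRing.unit ->
  exists a h c d : L, [/\ geven a, a \is a GRing.unit, [/\ godd h, geven c & godd d] &
   Om a h c d *m M p = M p *m (J p *: kf_mx K N.+1) - kmD H M p].
Proof.
move=> hM MB Je Ju.
pose t : K -> L := fun q => M q o0 o0; pose del : K -> L := fun q => M q o1 o2.
pose beta : K -> L := fun q => M q o0 o2; pose u : K -> L := fun q => M q o2 o2.
have ht : sh t p := hM _ _; have hdel : sh del p := hM _ _; have hu : sh u p := hM _ _.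
have ME : \forall q \near p, M q = Bm (t q) (del q) (beta q) (u q) by apply: filterS MB => q /kin_B_Bm[].
have te : \forall q \near p, geven (t q) by apply: filterS MB => q /kin_B_Bm[_ [[]]].
have dlo : \forall q \near p, godd (del q) by apply: filterS MB => q /kin_B_Bm[_ [[]]].
have be : \forall q \near p, geven (beta q) by apply: filterS MB => q /kin_B_Bm[_ [[]]].
have ue : \forall q \near p, geven (u q) by apply: filterS MB => q /kin_B_Bm[_ [[]]].
have tu : \forall q \near p, t q * u q = 1 by apply: filterS MB => q /kin_B_Bm[_ []].
have Dt := near_at (D_inverse ht hu te ue tu).
have Du := near_at (near_SD_hom H ue); have Dd := near_at (near_SD_hom H dlo); have Db := near_at (near_SD_hom H be).
rewrite (kmD_near H ME) (kmD_Bm _ _ ht hdel) (near_at ME).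
rewrite (_ : J p *: kf_mx K N.+1 = Om (J p) 0 0 0); last first.
  by apply: mx3P; rewrite mxE !kmx3E /= ?oppr0 ?mulr0 ?mulrN ?mulr1.
rewrite (SDM hdel ht) (_ : gsig (del p) = - del p); last exact/goddE/(near_at dlo).
have tu0 := near_at tu; have te0 := near_at te; have d0 := near_at dlo; have b0 := near_at be; have u0 := near_at ue.
rewrite Dt.
have uU : u p \is a GRing.unit by apply/unitrP; exists (t p); rewrite tu0 (geven_comm _ u0).
pose h := J p * del p + t p * SD u p.
pose c := J p * beta p + t p * SD del p.
have ho : godd h by apply: ghomD; exact: geven_oddM.
have ce : geven c by apply: ghomD; exact: gevenM.
exists (u p * J p), h, c, (t p * (- SD beta p - h * beta p - c * del p)).
split.
- exact: gevenM.
- by rewrite (unitrMl _ Ju).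
- split => //; apply: geven_oddM => //; apply: ghomB; last exact: geven_oddM.
  by apply: ghomB; [exact: ghomN|exact: godd_evenM].
apply/gauge_entries; rewrite ?mulr0 ?add0r ?addr0 ?oppr0 ?sub0r ?subr0.
have e0 s : t p * (u p * s) = s by rewrite mulrA tu0 mul1r.
have hE : h = J p * del p + t p * SD u p by [].
have cE : c = J p * beta p + t p * SD del p by [].
clearbody h c.
move: (t p) (u p) (del p) (beta p) (J p) (SD u p) (SD del p) (SD beta p) te0 u0 d0 b0 Je Du Dd Db tu0 e0 hE cE.
move=> x y z s j y' z' s' xe ye zo se je y'o z'e s'o xy e0 hE cE.
have yx : y * x = 1 by rewrite (geven_comm _ ye).
have f0 v : y * (x * v) = v by rewrite mulrA yx mul1r.
split; [split|split|split] => //.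
- by rewrite hE; sring.
- by rewrite hE cE; sring.
- by rewrite -mulrA -(geven_comm _ ye) e0; sring.
- by rewrite -mulrA (geven_comm x je) f0.
- by transitivity (z * j * (y * x)); [sring|rewrite yx mulr1].
- by transitivity (z' * (x * y)); [rewrite cE; sring|rewrite xy mulr1 add0r].
- by transitivity (- (y' * (x * y))); [rewrite hE; sring|rewrite xy mulr1].
Qed.

End NormalForm.

(** What the arguments on connections and superopers require of the collection of all superconformal
    charts. [a_flat] expresses its maximality: every superconformal germ at a point of a chart is
    the transition to some smaller chart. *)
Record satl (K : numClosedFieldType) (H : holoCalc K) (N : nat) := SAtl {
  aX : topologicalType;
  aC : Type;
  adom : aC -> set aX;
  abd : aC -> aX -> K;
  aZ : aC -> aC -> K -> grass K N.+1;
  aT : aC -> aC -> K -> grass K N.+1;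
  a_homeo : forall c, [/\ open (adom c), set_inj (adom c) (abd c),
    (forall x, adom c x -> {for x, continuous (abd c)})
    & forall O : set aX, open O -> O `<=` adom c -> open (abd c @` O)];
  a_cover : forall x, exists c, adom c x;
  a_sc : forall c c' x, adom c x -> adom c' x -> scgerm H (aZ c c') (aT c c') (abd c x);
  a_body : forall c c' x, adom c x -> adom c' x -> gbody (aZ c c' (abd c x)) = abd c' x;
  a_id : forall c x, adom c x ->
    aZ c c (abd c x) = (abd c x)%:A /\ aT c c (abd c x) = ggen K ord0;
  a_comp : forall c c' c'' x, adom c x -> adom c' x -> adom c'' x ->
    aZ c c'' (abd c x) = pull H (aZ c c') (aT c c') (aZ c' c'') (abd c x) /\
    aT c c'' (abd c x) = pull H (aZ c c') (aT c c') (aT c' c'') (abd c x);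
  a_flat : forall c x Z T (W : set aX), adom c x -> open W -> W x -> scgerm H Z T (abd c x) ->
    exists c', [/\ adom c' x, adom c' `<=` W `&` adom c &
      forall y, adom c' y -> aZ c c' (abd c y) = Z (abd c y) /\ aT c c' (abd c y) = T (abd c y)]
}.

(** * Sections, connections and superopers on an atlas *)

Section Atlas.
Variables (K : numClosedFieldType) (H : holoCalc K) (N : nat) (A : satl H N).
Local Notation L := (grass K N.+1).
Local Notation th := (ggen K (ord0 : 'I_N.+1)).
Local Notation sh := (sh H).
Local Notation SD := (SD H).
Local Notation pull := (pull H).
Local Notation uinv := (uinv H).
Local Notation scgerm := (scgerm H).
Local Notation X := (aX A).
Local Notation chart := (aC A).
Local Notation dom := (@adom K H N A).
Local Notation bd := (@abd K H N A).
Local Notation Z := (@aZ K H N A).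
Local Notation T := (@aT K H N A).
Implicit Types (c : chart) (x y : X) (W : set X) (F : K -> L) (p : K).

Definition tpull c c' F := pull (Z c c') (T c c') F.
Definition D3u c c' : K -> L := SD (SD (SD (uinv (T c c')))).

Lemma dom_open c : open (dom c).
Proof. by have [] := a_homeo c. Qed.

Lemma near_pts W c x (Q : K -> Prop) : open W -> W x -> dom c x ->
  (forall y, W y -> dom c y -> Q (bd c y)) -> \forall q \near bd c x, Q q.
Proof.
move=> Wo Wx cx h; have [co _ _ im] := a_homeo c.
have o : open (bd c @` (W `&` dom c)) by apply: im; [exact: openI|move=> y []].
have : nbhs (bd c x) (bd c @` (W `&` dom c)) by apply: open_nbhs_nbhs; split => //; exists x.
by apply: filterS => q [y [Wy cy] <-]; exact: h.
Qed.

Lemma near_pts' c x (P : X -> Prop) (Q : K -> Prop) : dom c x -> (\forall y \near x, P y) ->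
  (forall y, P y -> dom c y -> Q (bd c y)) -> \forall q \near bd c x, Q q.
Proof.
move=> cx h0 h; have : nbhs x P by exact: h0.
rewrite nbhsE => -[W [Wo Wx] WP].
by apply: (near_pts Wo Wx cx) => y /WP Py cy; exact: h.
Qed.

Lemma near_X c x (Q : K -> Prop) : dom c x -> (\forall q \near bd c x, Q q) ->
  \forall y \near x, Q (bd c y).
Proof. by move=> cx h; have [_ _ ct _] := a_homeo c; exact: (ct x cx Q h). Qed.

Lemma tr_comp c c' c'' x : dom c x -> dom c' x -> dom c'' x ->
  \forall q \near bd c x, Z c c'' q = tpull c c' (Z c' c'') q /\ T c c'' q = tpull c c' (T c' c'') q.
Proof.
move=> h h' h''; have o := openI (dom_open c') (dom_open c'').
apply: (near_pts o (conj h' h'') h) => y [y' y''] cy; exact: a_comp.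
Qed.

Lemma tr_id c x : dom c x -> \forall q \near bd c x, Z c c q = q%:A /\ T c c q = th.
Proof.
by move=> h; apply: (near_pts (dom_open c) h h) => y _ cy; exact: a_id.
Qed.

Lemma tpull_id c x F : dom c x -> sh F (bd c x) -> \forall q \near bd c x, tpull c c F q = F q.
Proof.
move=> cx hF; apply: filterS2 (tr_id cx) (sh_near hF) => q [e1 e2] h.
by rewrite /tpull /SconfMaps.pull e1 e2; exact: sev_refl.
Qed.

Lemma tpull_comp c c' c'' x F : dom c x -> dom c' x -> dom c'' x -> sh F (bd c'' x) ->
  \forall q \near bd c x, tpull c c' (tpull c' c'' F) q = tpull c c'' F q.
Proof.
move=> h h' h'' hF.
have g := a_sc h h'; have g' := a_sc h' h''.
rewrite -(a_body h h') in g'; rewrite -(a_body h' h'') -(a_body h h') in hF.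
apply: filterS2 (pull_comp g g' hF) (tr_comp h h' h'') => q e [e1 e2].
apply: (etrans e); rewrite [RHS]/tpull [RHS]/SconfMaps.pull e1 e2; reflexivity.
Qed.

Lemma tpull_inj c c' x F : dom c x -> dom c' x -> sh F (bd c' x) ->
  (\forall q \near bd c x, tpull c c' F q = 0) -> \forall q \near bd c' x, F q = 0.
Proof.
move=> h h' hF e; have g' := a_sc h' h.
have e' : \forall q \near bd c' x, tpull c' c (tpull c c' F) q = tpull c' c (fun=> 0) q.
  by apply: (pull_ext g'); rewrite (a_body h' h).
apply: filterS3 (tpull_comp h' h h' hF) (tpull_id h' hF) e' => q a b d.
rewrite -b -a d; apply: pull_cst; exact: thfree0.
Qed.

Lemma tr_near_u c c' c'' x : dom c x -> dom c' x -> dom c'' x ->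
  \forall q \near bd c x, uinv (T c c'') q = uinv (T c c') q * tpull c c' (uinv (T c' c'')) q.
Proof.
move=> h h' h''; have g := a_sc h h'; have g' := a_sc h' h''.
rewrite -(a_body h h') in g'.
have e : \forall q \near bd c x, T c c'' q = tpull c c' (T c' c'') q.
  by apply: filterS (tr_comp h h' h'') => q [].
apply: filterS2 (near_SD' H e) (sc_comp_u g g') => q a b.
by apply: etrans b; rewrite /PullbackComp.uinv a.
Qed.

Lemma tr_near_J c c' c'' x : dom c x -> dom c' x -> dom c'' x ->
  \forall q \near bd c x, SD (T c c'') q = SD (T c c') q * tpull c c' (SD (T c' c'')) q.
Proof.
move=> h h' h''; have g := a_sc h h'; have g' := a_sc h' h''.
rewrite -(a_body h h') in g'.
have e : \forall q \near bd c x, T c c'' q = tpull c c' (T c' c'') q.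
  by apply: filterS (tr_comp h h' h'') => q [].
by apply: filterS2 (near_SD' H e) (sc_compJ g g') => q -> ->.
Qed.

Lemma bJ_near F F' (p : K) : (\forall q \near p, F q = F' q) -> \forall q \near p, bJ H F q = bJ H F' q.
Proof.
move=> e; have e1 := near_SD' H e.
have e2 : \forall q \near p, uinv F q = uinv F' q by apply: filterS e1 => q; rewrite /PullbackComp.uinv => ->.
have e3 := near_SD' H e2; have e4 := near_SD' H e3.
apply: filterS3 (filterI e1 e2) e3 e4 => q [a b] d f.
exact: (congr_Bm a (congr1 -%R d) f b).
Qed.

Lemma tr_bJ c c' c'' x : dom c x -> dom c' x -> dom c'' x ->
  \forall q \near bd c x, bJ H (T c c'') q = bJ H (T c c') q *m mpull H (Z c c') (T c c') (bJ H (T c' c'')) q.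
Proof.
move=> h h' h''; have g := a_sc h h'; have g' := a_sc h' h''.
rewrite -(a_body h h') in g'.
have e : \forall q \near bd c x, T c c'' q = tpull c c' (T c' c'') q.
  by apply: filterS (tr_comp h h' h'') => q [].
by apply: filterS2 (bJ_near e) (bJ_comp g g') => q -> ->.
Qed.

Lemma tr_D3 c c' c'' x : dom c x -> dom c' x -> dom c'' x ->
  \forall q \near bd c x, D3u c c'' q =
    SD (T c c') q ^+ 2 * tpull c c' (D3u c' c'') q + D3u c c' q * tpull c c' (uinv (T c' c'')) q.
Proof.
move=> h h' h''; have g := a_sc h h'; have g' := a_sc h' h''.
rewrite -(a_body h h') in g'.
have e : \forall q \near bd c x, T c c'' q = tpull c c' (T c' c'') q.
  by apply: filterS (tr_comp h h' h'') => q [].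
have e2 : \forall q \near bd c x, uinv (T c c'') q = uinv (tpull c c' (T c' c'')) q.
  by apply: filterS (near_SD' H e) => q; rewrite /PullbackComp.uinv => ->.
apply: filterS2 (near_SD' H (near_SD' H (near_SD' H e2))) (sc_comp_D3u g g') => q a b.
exact: (etrans a b).
Qed.

Lemma tr_idJ c x : dom c x -> \forall q \near bd c x,
  [/\ SD (T c c) q = 1, uinv (T c c) q = 1, D3u c c q = 0 & bJ H (T c c) q = 1%:M].
Proof.
move=> h.
have e : \forall q \near bd c x, T c c q = th by apply: filterS (tr_id h) => q [].
have e1 : \forall q \near bd c x, SD (T c c) q = 1.
  by apply: filterS (near_SD' H e) => q ->; exact: SD_th.
have e2 : \forall q \near bd c x, uinv (T c c) q = 1.
  by apply: filterS e1 => q a; rewrite /PullbackComp.uinv a invr1.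
have c1 q : SD (fun=> 1 : L) q = 0 by apply: SD_cst; exact: thfree1.
have c0 q : SD (fun=> 0 : L) q = 0 by apply: SD_cst; exact: thfree0.
have e3 : \forall q \near bd c x, SD (uinv (T c c)) q = 0.
  by apply: filterS (near_SD' H e2) => q a; exact: (etrans a (c1 q)).
have e4 : \forall q \near bd c x, SD (SD (uinv (T c c))) q = 0.
  by apply: filterS (near_SD' H e3) => q a; exact: (etrans a (c0 q)).
have e5 : \forall q \near bd c x, SD (SD (SD (uinv (T c c)))) q = 0.
  by apply: filterS (near_SD' H e4) => q a; exact: (etrans a (c0 q)).
apply: filterS3 (filterI e1 e2) (filterI e3 e4) e5 => q [a1 a2] [a3 a4] a5; split => //.
rewrite /bJ; apply: etrans (congr_Bm a1 (congr1 -%R a3) a4 a2) _.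
by apply: mx3P; rewrite kmx3E mxE /= ?oppr0 ?mul0r ?oppr0.
Qed.

(** The local form of membership of the transition in SPL_2, convenient because the cocycle rule
    [tr_D3] applies to it. *)
Definition flat c c' x := \forall q \near bd c x, D3u c c' q = 0.
Definition srel c c' := forall x, dom c x -> dom c' x -> flat c c' x.

Lemma sh_D3u c c' x : dom c x -> dom c' x -> sh (D3u c c') (bd c x).
Proof. by move=> h h'; apply/sh_SD/sh_SD/sh_SD; exact: sc_u_sh (a_sc h h'). Qed.

Lemma J_unit c c' x : dom c x -> dom c' x -> \forall q \near bd c x, SD (T c c') q \is a GRing.unit.
Proof. by move=> h h'; exact: sc_J_unit (a_sc h h'). Qed.

(** In the cocycle rule from [c] through [c'] back to [c] only the term with the square of D theta'
    survives. *)
Lemma flat_sym c c' x : dom c x -> dom c' x -> flat c c' x -> flat c' c x.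
Proof.
move=> h h' e; apply: (tpull_inj h h' (sh_D3u h' h)).
apply: filterS3 (filterI (tr_D3 h h' h) (tr_idJ h)) e (J_unit h h') => q [a [_ _ b _]] d U.
have U2 : SD (T c c') q ^+ 2 \is a GRing.unit by rewrite unitrX.
by apply: (mulrI U2); rewrite mulr0; move: a; rewrite b d mul0r addr0.
Qed.

Lemma flat_trans c c' c'' x : dom c x -> dom c' x -> dom c'' x ->
  flat c c' x -> flat c' c'' x -> flat c c'' x.
Proof.
move=> h h' h'' e e'.
have g := a_sc h h'.
have e2 : \forall q \near bd c x, tpull c c' (D3u c' c'') q = tpull c c' (fun=> 0) q.
  by apply: (pull_ext g); rewrite (a_body h h').
apply: filterS3 (tr_D3 h h' h'') e e2 => q a b d.
apply: (etrans a); rewrite b d mul0r addr0 /tpull pull_cst ?mulr0 //; exact: thfree0.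
Qed.

Lemma srel_sym c c' : srel c c' -> srel c' c.
Proof. by move=> h x h' hc; apply: flat_sym => //; exact: h. Qed.

Definition gsec (n : int) W (phi : chart -> K -> L) : Prop :=
  (forall c x, W x -> dom c x -> sh (phi c) (bd c x)) /\
  (forall c c' x, W x -> dom c x -> dom c' x ->
     phi c (bd c x) = tpull c c' (phi c') (bd c x) * SD (T c c') (bd c x) ^ (- n)).

Record gconn (om : chart -> K -> L) : Prop := GConn {
  gc_sh : forall c x, dom c x -> sh (om c) (bd c x);
  gc_odd : forall c x, dom c x -> godd (om c (bd c x));
  gc_law : forall c c' x, dom c x -> dom c' x ->
    om c (bd c x) * uinv (T c c') (bd c x) =
    SD (T c c') (bd c x) ^+ 2 * tpull c c' (om c') (bd c x) + D3u c c' (bd c x)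
}.

Lemma gc_law_near om c c' x : gconn om -> dom c x -> dom c' x ->
  \forall q \near bd c x, om c q * uinv (T c c') q =
    SD (T c c') q ^+ 2 * tpull c c' (om c') q + D3u c c' q.
Proof.
move=> G h h'; apply: (near_pts (dom_open c') h' h) => y cy' cy; exact: gc_law.
Qed.

(* The section of D equal to 1 in the chart k. *)
Lemma gsec_test k : gsec 1 (dom k) (fun c => uinv (T c k)).
Proof.
split=> [c x h h'|c c' x h h1 h2]; first exact: sc_u_sh (a_sc h' h).
rewrite (near_at (tr_near_u h1 h2 h)) exprN1 /PullbackComp.uinv.
exact: geven_comm (gevenV (near_at (sc_J_even (a_sc h1 h2)))).
Qed.

(** The test section is 1 in the chart [k], where the operator therefore returns [- om k].
    Transforming this value as a section of D^(-2) to the chart [c] gives the law. *)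
Lemma test_law om k c x : (forall c x, dom c x -> sh (om c) (bd c x)) -> dom c x -> dom k x ->
  gsec (- 2) (dom k) (fun c q => D3u c k q - om c q * uinv (T c k) q) ->
  om c (bd c x) * uinv (T c k) (bd c x) =
    SD (T c k) (bd c x) ^+ 2 * tpull c k (om k) (bd c x) + D3u c k (bd c x).
Proof.
move=> hom h hk [_ s]; have := s c k x hk h hk; rewrite opprK => e.
have g := a_sc h hk.
have e1 : \forall w \near gbody (Z c k (bd c x)), D3u k k w - om k w * uinv (T k k) w = -1 * om k w.
  rewrite (a_body h hk); apply: filterS (tr_idJ hk) => w [_ a b _].
  by rewrite a b mulr1 sub0r mulN1r.
have e2 := near_at (pull_ext g e1).
rewrite /tpull e2 in e.
have hk' : sh (om k) (gbody (Z c k (bd c x))) by rewrite (a_body h hk); exact: hom.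
have e3 := near_at (pull_M g (sh_cst H (-1 : L) _) hk').
have f1 : thfree (-1 : L) by apply: thfreeN; exact: thfree1.
rewrite e3 (@pull_cst K H N (Z c k) (T c k) (-1) (bd c x) f1) mulN1r in e.
have Je : geven (SD (T c k) (bd c x) ^+ 2) by apply: gevenX; exact: near_at (sc_J_even g).
move/eqP: e; rewrite subr_eq addrC -subr_eq => /eqP <-.
by rewrite mulNr opprK addrC (geven_comm _ Je).
Qed.

(** By [sc_law], D^3 of the field picks up the extra term D^3 u times the pulled back field, and the
    law for [om] contains the same term; the difference transforms with the factor (D theta')^2. *)
Lemma gconn_section om n W phi : gconn om -> open W -> n = 1 -> gsec n W phi ->
  gsec (- 2) W (fun c q => SD (SD (SD (phi c))) q - om c q * phi c q).
Proof.
move=> G Wo -> [s1 s2]; split=> [c x Wx h|c c' x Wx h h'].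
  apply: shB; first by apply/sh_SD/sh_SD/sh_SD; exact: s1.
  by apply: shM; [exact: gc_sh|exact: s1].
have g := a_sc h h'.
have hp : sh (phi c') (gbody (Z c c' (bd c x))) by rewrite (a_body h h'); exact: s1.
have ho : sh (om c') (gbody (Z c c' (bd c x))) by rewrite (a_body h h'); exact: gc_sh.
have e : \forall q \near bd c x, phi c q = (SD (T c c') q)^-1 * pull (Z c c') (T c c') (phi c') q.
  have e0 : \forall q \near bd c x, phi c q = tpull c c' (phi c') q * SD (T c c') q ^ (- 1).
    apply: (near_pts (openI Wo (dom_open c')) (conj Wx h') h).
    by move=> y [Wy cy'] cy; exact: (s2 c c' y Wy cy cy').
  apply: filterS2 (sc_u_even g) e0 => q a b; rewrite b exprN1; exact/esym/geven_comm.
have e3 := near_at (near_SD' H (near_SD' H (near_SD' H e))).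
rewrite e3 (near_at (sc_law g hp)) (near_at e).
have hD := sh_SD (sh_SD (sh_SD hp)).
have hm := shM ho hp.
have p1 := near_at (pull_M g ho hp).
have p2 : pull (Z c c') (T c c') (fun q => SD (SD (SD (phi c'))) q - om c' q * phi c' q) (bd c x) =
    pull (Z c c') (T c c') (SD (SD (SD (phi c')))) (bd c x) - pull (Z c c') (T c c') (om c') (bd c x) * pull (Z c c') (T c c') (phi c') (bd c x).
  have a1 := near_at (pull_D g hD (shN hm)).
  apply: (etrans a1); congr (_ + _); rewrite -p1.
  have f1 : thfree (-1 : L) by apply: thfreeN; exact: thfree1.
  have a2 := near_at (pull_M g (sh_cst H (-1 : L) _) hm).
  rewrite (@pull_cst K H N (Z c c') (T c c') (-1) (bd c x) f1) mulN1r in a2; rewrite -a2.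
  have fe : (fun w => - (om c' w * phi c' w)) = (fun w => -1 * (om c' w * phi c' w)).
    by apply/funext => w; rewrite mulN1r.
  exact: (congr1 (fun F => pull (Z c c') (T c c') F (bd c x)) fe).
rewrite /tpull p2 opprK.
have law := gc_law G h h'; rewrite /PullbackComp.uinv in law.
have Je := near_at (sc_J_even g).
move: law; rewrite /tpull /D3u; move: (pull _ _ (om c') _) (pull _ _ (phi c') _) (pull _ _ (SD _) _).
move: (SD (SD (SD _)) _) (SD _ _) Je (om c _) => s j je o a b d law.
have -> : o * (j^-1 * b) = j ^+ 2 * a * b + s * b by rewrite mulrA law mulrDl.
rewrite opprD addrACA subrr addr0 -exprnP -(geven_comm (d - a * b) (gevenX je : geven (j ^+ 2))).
by rewrite mulrBr mulrA.
Qed.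

End Atlas.

(** * Comparison of normal frames under a change of coordinates *)

Section Frames.
Variables (K : numClosedFieldType) (H : holoCalc K) (N : nat).
Local Notation L := (grass K N.+1).
Local Notation sh := (sh H).
Local Notation SD := (SD H).
Local Notation pull := (pull H).
Local Notation mpull := (mpull H).
Local Notation uinv := (uinv H).
Local Notation msh := (msh H).
Local Notation gaugeAt := (gaugeAt H).
Local Notation scgerm := (scgerm H).
Implicit Types (p q : K) (Z T F : K -> L) (M g : K -> 'M[L]_3).

Definition nfm (w : K -> L) : K -> 'M[L]_3 := fun q => Om 1 0 0 (- w q).

Lemma pull_N Z T F p : scgerm Z T p -> sh F (gbody (Z p)) ->
  \forall q \near p, pull Z T (fun w => - F w) q = - pull Z T F q.
Proof.
move=> g hF; have a := pull_M g (sh_cst H (-1 : L) _) hF.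
have fe : (fun w => - F w) = (fun w => -1 * F w) by apply/funext => w; rewrite mulN1r.
have f1 : thfree (-1 : L) by apply: thfreeN; exact: thfree1.
apply: filterS a => q e; rewrite fe; apply: (etrans e).
by rewrite (@pull_cst K H N Z T (-1) q f1) mulN1r.
Qed.

Lemma mpull_ginv3 Z T M p : scgerm Z T p -> msh M (gbody (Z p)) ->
  \forall q \near p, mpull Z T (fun w => ginv3 (M w)) q = ginv3 (mpull Z T M q).
Proof.
move=> g hM.
have n i j := pull_N g (hM i j).
have n2 : \forall q \near p, forall i j, pull Z T (fun w => - M w i j) q = - pull Z T (fun w => M w i j) q.
  have n1 i : \forall q \near p, forall j, pull Z T (fun w => - M w i j) q = - pull Z T (fun w => M w i j) q.
    exact: (@filter_forall _ _ (fun j q => pull Z T (fun w => - M w i j) q = - pull Z T (fun w => M w i j) q) (nbhs p) _ (n i)).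
  exact: (@filter_forall _ _ (fun i q => forall j, pull Z T (fun w => - M w i j) q = - pull Z T (fun w => M w i j) q) (nbhs p) _ n1).
apply: filterS n2 => q e.
have E i j := funext (fun w => kmx3E
  [:: [:: M w o2 o2; M w o1 o2; - M w o0 o2]; [:: - M w o2 o1; M w o1 o1; M w o0 o1];
      [:: - M w o2 o0; - M w o1 o0; M w o0 o0]] i j).
apply: mx3P; rewrite mpullE; apply: (etrans (congr1 (fun F => pull Z T F q) (E _ _)));
  rewrite [RHS]kmx3E /= ?mpullE //; exact: e.
Qed.

Lemma kin_B_mpull Z T M p : scgerm Z T p -> msh M (gbody (Z p)) ->
  (\forall w \near gbody (Z p), kin_B (M w)) -> \forall q \near p, kin_B (mpull Z T M q).
Proof.
move=> g hM MB.
pose t : K -> L := fun q => M q o0 o0; pose del : K -> L := fun q => M q o1 o2.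
pose beta : K -> L := fun q => M q o0 o2; pose u : K -> L := fun q => M q o2 o2.
have ht : sh t (gbody (Z p)) := hM _ _; have hd : sh del (gbody (Z p)) := hM _ _.
have hu : sh u (gbody (Z p)) := hM _ _.
have ME : \forall q \near gbody (Z p), M q = Bm (t q) (del q) (beta q) (u q) by apply: filterS MB => q /kin_B_Bm[].
have te : \forall q \near gbody (Z p), geven (t q) by apply: filterS MB => q /kin_B_Bm[_ [[]]].
have dlo : \forall q \near gbody (Z p), godd (del q) by apply: filterS MB => q /kin_B_Bm[_ [[]]].
have be : \forall q \near gbody (Z p), geven (beta q) by apply: filterS MB => q /kin_B_Bm[_ [[]]].
have ue : \forall q \near gbody (Z p), geven (u q) by apply: filterS MB => q /kin_B_Bm[_ [[]]].
have tu : \forall q \near gbody (Z p), t q * u q = 1 by apply: filterS MB => q /kin_B_Bm[_ []].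
have h1 := mpull_ext g ME; have h2 := mpull_Bm beta u g ht hd.
have h3 := pull_M g ht hu; have h4 := pull_ext g tu.
apply: filterS3 (filterI h1 h2) (filterI (filterI (pull_hom g te) (pull_hom g dlo)) (filterI (pull_hom g be) (pull_hom g ue))) (filterI h3 h4).
move=> q [a b] [[k1 k2] [k3 k4]] [k5 k6]; rewrite a b; apply: Bm_in => //.
by apply: (etrans (esym k5)); apply: (etrans k6); apply: pull_cst; exact: thfree1.
Qed.

Lemma mulmx_cancel (a b c P V : 'M[L]_3) : P *m V = 1%:M -> a *m (b *m (c *m P)) *m V = a *m b *m c.
Proof. by move=> PV; rewrite !mulmxA -(mulmxA _ P) PV mulmx1. Qed.

Lemma frame_law Z T p (h b A g B h' b' A' : K -> 'M[L]_3) (w w' : K -> L) : scgerm Z T p ->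
  let z0 := gbody (Z p) in
  [/\ msh h p, msh b p & msh g p] ->
  [/\ \forall q \near p, kin_G (h q), \forall q \near p, kin_B (b q),
      \forall q \near p, kin_G (g q) & \forall q \near p, kin_B (B q)] ->
  (\forall q \near p, gaugeAt (fun q => b q *m h q) (nfm w) A q) ->
  [/\ msh h' z0, msh b' z0, msh A' z0 & sh w' z0] ->
  (\forall q \near z0, kin_G (h' q)) -> (\forall q \near z0, kin_B (b' q)) ->
  (\forall q \near z0, gaugeAt (fun q => b' q *m h' q) (nfm w') A' q) ->
  (\forall q \near p, kin_G (mpull Z T h' q)) ->
  (\forall q \near p, gaugeAt g A (fun q => SD T q *: mpull Z T A' q) q) ->
  (\forall q \near p, h q *m g q = B q *m mpull Z T h' q) ->
  \forall q \near p, b q *m h q *m g q = bJ H T q *m mpull Z T (fun q => b' q *m h' q) q /\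
    w q * uinv T q = SD T q ^+ 2 * pull Z T w' q + SD (SD (SD (uinv T))) q.
Proof.
move=> sg z0 [hh hb hg] [hG bB gG BB] e [hh' hb' hA' hw'] hG' bB' e' pG eg hgB.
pose P := mpull Z T (fun q => b' q *m h' q).
have hbh := sh_mulmx hb hh; have hbh' := sh_mulmx hb' hh'.
have shP : msh P p := sh_mpull sg hbh'.
have PE : \forall q \near p, P q = mpull Z T b' q *m mpull Z T h' q := mpull_M sg hb' hh'.
have pB := kin_B_mpull sg hb' bB'.
have PG : \forall q \near p, kin_G (P q).
  by apply: filterS3 PE pB pG => q -> [k1 _] k2; exact: kin_GM.
have bhG : \forall q \near p, kin_G (b q *m h q).
  by apply: filterS2 bB hG => q [k1 _] k2; exact: kin_GM.
have shN : msh (nfm w') z0.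
  have k0 := sh_cst H (0 : L) z0; have k1 := sh_cst H (1 : L) z0.
  elim/ord3P; elim/ord3P; rewrite /GaugeGerms.msh;
   by [apply: sh_ext k0; near=> q; rewrite kmx3E | apply: sh_ext k1; near=> q; rewrite kmx3E
    | apply: sh_ext (shN hw'); near=> q; rewrite kmx3E | apply: sh_ext (shN k1); near=> q; rewrite kmx3E
    | apply: sh_ext (shN k0); near=> q; rewrite kmx3E].
have eP := gauge_pull sg hbh' shN hA' e'.
pose M q := b q *m h q *m g q *m ginv3 (P q).
have hbhg := sh_mulmx hbh hg.
have shM : msh M p := sh_mulmx hbhg (sh_ginv3 shP).
have ME : \forall q \near p, M q = b q *m B q *m ginv3 (mpull Z T b' q).
  apply: filterS3 (filterI PE pB) (filterI PG hgB) BB => q [k1 [k2 k2']] [k3 k4] k5.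
  have [_ _ k6] := ginv3P k3; have [_ k7 _] := ginv3P k2.
  have k8 : mpull Z T h' q = ginv3 (mpull Z T b' q) *m P q by rewrite k1 mulmxA k7 mul1mx.
  rewrite /M -(mulmxA (b q)) k4 k8; exact: mulmx_cancel.
have MB : \forall q \near p, kin_B (M q).
  apply: filterS3 ME (filterI bB BB) pB => q -> [k1 k2] k3.
  by apply: kin_BM; [exact: kin_BM|exact: kin_BV].
have pN : \forall q \near p, mpull Z T (nfm w') q = Om 1 0 0 (- pull Z T w' q).
  have h1 := pull_N sg hw'.
  apply: filterS h1 => q k1.
  have f0 := @thfree0 K N; have f1 := @thfree1 K N.
  have E i j := funext (fun v => kmx3E [:: [:: 0; 0; - w' v]; [:: - 1; 0; 0]; [:: 0; 1; - 0]] i j).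
  have c0 := @pull_cst K H N Z T 0 q f0; have c1 := @pull_cst K H N Z T 1 q f1.
  have cN := @pull_cst K H N Z T (-1) q (thfreeN f1); have cN0 := @pull_cst K H N Z T (-0) q (thfreeN f0).
  by apply: mx3P; rewrite mpullE; apply: (etrans (congr1 (fun F => pull Z T F q) (E _ _)));
    rewrite [RHS]kmx3E /=.
have gM : \forall q \near p, gaugeAt M (nfm w) (fun q => SD T q *: Om 1 0 0 (- pull Z T w' q)) q.
  apply: filterS3 (filterI (filterI e eg) (filterI eP pN)) (filterI (filterI bhG gG) (near_near PG)) (filterI (mshP hbh) (filterI (mshP hg) (mshP shP))).
  move=> q [[k1 k2] [k3 k4]] [[k5 k6] k7] [k8 [k9 k10]].
  have g1 := gauge_comp k8 k9 k5 k1 k2.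
  have g2 := gauge_inv k10 k7 k3.
  have := gauge_comp (sh_mulmx k8 k9) (sh_ginv3 k10) (kin_GM k5 k6) g1 g2.
  by rewrite /GaugeGerms.gaugeAt k4.
have hw : \forall q \near p, M q = bJ H T q /\ w q * uinv T q = SD T q ^+ 2 * pull Z T w' q + SD (SD (SD (uinv T))) q.
  exact: (bJ_unique sg shM MB gM).
apply: filterS2 hw PG => q [k1 k2] k3; split => //.
have [_ k4 _] := ginv3P k3.
by rewrite -k1 /M -/(P q) -(mulmxA (b q *m h q *m g q)) k4 mulmx1.
Unshelve. all: by end_near. Qed.

Lemma oper_frame p (h A A0 : K -> 'M[L]_3) : msh h p -> msh A0 p ->
  (\forall q \near p, kin_G (h q)) -> (\forall q \near p, gaugeAt h A A0 q) ->
  (\forall q \near p, exists (a : L) mu, [/\ geven a, a \is a GRing.unit, kin_b_odd mu & A q = a *: kf_mx K N.+1 + mu]) ->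
  let a q := A q o2 o1 in let hh q := A q o0 o0 in let c q := A q o0 o1 in let d q := A q o0 o2 in
  [/\ msh (nf_B H a hh c) p, \forall q \near p, kin_B (nf_B H a hh c q),
      sh (nf_w H a hh c d) p, \forall q \near p, godd (nf_w H a hh c d q) &
      \forall q \near p, gaugeAt (fun q => nf_B H a hh c q *m h q) (nfm (nf_w H a hh c d)) A0 q].
Proof.
move=> sh1 sA hG e form a hh c d.
have form' : \forall q \near p, [/\ A q = Om (a q) (hh q) (c q) (d q), geven (a q) /\ a q \is a GRing.unit,
    godd (hh q), geven (c q) & godd (d q)].
  apply: filterS form => q [a' [mu [ae au hmu AE]]].
  have [h' [c' [d' [ho ce do_ OE]]]] := OmE a' hmu.
  have AE' : A q = Om a' h' c' d' by rewrite AE.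
  by rewrite /a /hh /c /d AE' !kmx3E.
(* The oper condition provides [A] at each point without regularity; the gauge equation solved for
   [A] shows that it is holomorphic. *)
have shA : msh A p.
  have s1 : msh (kmD H h) p.
    move=> i j; apply: sh_ext (shM (sh_cst H ((-1) ^+ (i == 1%N :> nat)) _) (sh_SD (sh1 i j))).
    by near=> w; rewrite kmDE.
  have s2 : msh (fun q => h q *m A0 q - kmD H h q) p.
    move=> i j; apply: sh_ext (shB (sh_mulmx sh1 sA i j) (s1 i j)).
    by near=> w; rewrite mx3BE.
  have s3 := sh_mulmx s2 (sh_ginv3 sh1).
  move=> i j; apply: sh_ext (s3 i j).
  apply: filterS2 e hG => q k1 /ginv3P[_ _ k2].
  by rewrite -k1 -mulmxA k2 mulmx1.
have ha : sh a p := shA _ _; have hhh : sh hh p := shA _ _.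
have hc : sh c p := shA _ _; have hd : sh d p := shA _ _.
have ae : \forall q \near p, geven (a q) by apply: filterS form' => q [_ []].
have ho : \forall q \near p, godd (hh q) by apply: filterS form' => q [].
have ce : \forall q \near p, geven (c q) by apply: filterS form' => q [].
have dO : \forall q \near p, godd (d q) by apply: filterS form' => q [].
have au : a p \is a GRing.unit by have [_ []] := near_at form'.
have gg := nf_gauge ha hhh ae ho ce dO au.
have bB := nf_B_in ha ae ho ce au.
have sb := sh_nf_B ha hhh hc au.
split; [exact: sb|exact: bB|exact: (sh_nf_w ha hhh hc hd au)|exact: (nf_w_odd H ae ho ce dO)|].
apply: filterS3 (filterI gg e) (filterI bB (mshP sb)) (filterI (mshP sh1) form') => q [k1 k2] [[k3 _] k4] [k5 [k6 _ _ _ _]].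
apply: (gauge_comp k4 k5 k3 _ k2).
rewrite /GaugeGerms.gaugeAt k6; exact: k1.
Unshelve. all: by end_near. Qed.

End Frames.

(** * Superopers on an atlas and their potentials *)

Section Opers.
Variables (K : numClosedFieldType) (H : holoCalc K) (N : nat) (A : satl H N).
Local Notation L := (grass K N.+1).
Local Notation sh := (sh H).
Local Notation SD := (SD H).
Local Notation uinv := (uinv H).
Local Notation msh := (msh H).
Local Notation gaugeAt := (gaugeAt H).
Local Notation X := (aX A).
Local Notation chart := (aC A).
Local Notation dom := (@adom K H N A).
Local Notation bd := (@abd K H N A).
Local Notation Z := (@aZ K H N A).
Local Notation T := (@aT K H N A).
Local Notation mfield := (chart -> K -> 'M[L]_3).
Implicit Types (c : chart) (x y : X) (W : set X) (p q : K) (M : mfield).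

Definition mtpull c c' (m : K -> 'M[L]_3) := mpull H (Z c c') (T c c') m.
Definition gmsec (n : int) W M : Prop := forall i j, @gsec K H N A n W (fun c p => M c p i j).
Definition gon W (P : chart -> K -> Prop) : Prop := forall c x, W x -> dom c x -> P c (bd c x).
Definition gGfun W M : Prop := gmsec 0 W M /\ gon W (fun c p => kin_G (M c p)).
Definition gBfun W M : Prop := gmsec 0 W M /\ gon W (fun c p => kin_B (M c p)).
Definition ggauge W (g a a' : mfield) : Prop :=
  gon W (fun c p => a c p *m g c p = g c p *m a' c p - kmD H (g c) p).

(** Superopers over an abstract atlas, matching the records of the statement field by field. *)
Record gop := Gop {
  g_idx : Type;
  g_dom : g_idx -> set X;
  g_g : g_idx -> g_idx -> mfield;
  g_h : g_idx -> mfield;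
  g_A : g_idx -> mfield;
  g_open : forall k, open (g_dom k);
  g_cover : forall x, exists k, g_dom k x;
  g_gG : forall k l, gGfun (g_dom k `&` g_dom l) (g_g k l);
  g_cocycle : forall k l m,
    gon (g_dom k `&` g_dom l `&` g_dom m)
      (fun c p => g_g k l c p *m g_g l m c p = g_g k m c p);
  g_hG : forall k, gGfun (g_dom k) (g_h k);
  g_reduction : forall k l, exists2 b : mfield,
    gBfun (g_dom k `&` g_dom l) b
    & gon (g_dom k `&` g_dom l)
        (fun c p => g_h k c p *m g_g k l c p = b c p *m g_h l c p);
  g_Asection : forall k, gmsec (- 1) (g_dom k) (g_A k);
  g_conn : forall k l,
    ggauge (g_dom k `&` g_dom l) (g_g k l) (g_A k) (g_A l);
  g_oper : forall k W (b : mfield), open W -> W `<=` g_dom k -> gBfun W b ->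
    exists a0 : mfield,
      ggauge W (fun c p => b c p *m g_h k c p) a0 (g_A k) /\
      gon W (fun c p => exists (a : L) (mu : 'M[L]_3),
        [/\ geven a, a \is a GRing.unit, kin_b_odd mu
          & a0 c p = a *: kf_mx K N.+1 + mu])
}.

Definition giso (O O' : gop) : Prop :=
  exists phi : g_idx O -> g_idx O' -> mfield,
    [/\ forall k k', gGfun (g_dom k `&` g_dom k') (phi k k'),
        forall k k' l l',
          gon (g_dom k `&` g_dom k' `&` (g_dom l `&` g_dom l'))
            (fun c p => g_g k l c p *m phi l l' c p =
                        phi k k' c p *m g_g k' l' c p),
        forall k k', exists2 b : mfield, gBfun (g_dom k `&` g_dom k') b
          & gon (g_dom k `&` g_dom k')
              (fun c p => g_h k c p *m phi k k' c p = b c p *m g_h k' c p)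
      & forall k k',
          ggauge (g_dom k `&` g_dom k') (phi k k') (g_A k) (g_A k')].

Lemma gmsec_sh n W M c x : gmsec n W M -> W x -> dom c x -> msh (M c) (bd c x).
Proof. by move=> h Wx cx i j; exact: (h i j).1. Qed.

Lemma gmsec_near0 W M c c' x : open W -> gmsec 0 W M -> W x -> dom c x -> dom c' x ->
  \forall q \near bd c x, M c q = mtpull c c' (M c') q.
Proof.
move=> Wo h Wx cx cx'; apply: (near_pts (openI Wo (dom_open c')) (conj Wx cx') cx).
move=> y [Wy cy'] cy; apply/matrixP => i j; rewrite mpullE.
by apply: (etrans ((h i j).2 c c' y Wy cy cy')); exact: mulr1.
Qed.

Lemma gmsec_near1 W M c c' x : open W -> gmsec (- 1) W M -> W x -> dom c x -> dom c' x ->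
  \forall q \near bd c x, M c q = SD (T c c') q *: mtpull c c' (M c') q.
Proof.
move=> Wo h Wx cx cx'.
have e : \forall q \near bd c x, forall i j, M c q i j = tpull c c' (fun w => M c' w i j) q * SD (T c c') q.
  apply: (near_pts (openI Wo (dom_open c')) (conj Wx cx') cx) => y [Wy cy'] cy i j.
  by rewrite ((h i j).2 c c' y Wy cy cy') opprK.
apply: filterS2 e (sc_J_even (a_sc cx cx')) => q k1 k2; apply/matrixP => i j.
by rewrite k1 mxE mpullE; exact/esym/(geven_comm _ k2).
Qed.

Lemma gmsec0I W M : (forall c x, W x -> dom c x -> msh (M c) (bd c x)) ->
  (forall c c' x, W x -> dom c x -> dom c' x -> M c (bd c x) = mtpull c c' (M c') (bd c x)) ->
  gmsec 0 W M.
Proof.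
move=> h1 h2 i j; split => [c x Wx cx|c c' x Wx cx cx']; first exact: (h1 c x Wx cx i j).
by rewrite (h2 c c' x Wx cx cx') mpullE; apply/esym/mulr1.
Qed.

Lemma gon_near W (P : chart -> K -> Prop) c x : open W -> gon W P -> W x -> dom c x ->
  \forall q \near bd c x, P c q.
Proof. by move=> Wo h Wx cx; apply: (near_pts Wo Wx cx) => y Wy cy; exact: h. Qed.

Lemma gmsec0M W M M' : gmsec 0 W M -> gmsec 0 W M' -> open W ->
  gmsec 0 W (fun c p => M c p *m M' c p).
Proof.
move=> h h' Wo; apply: gmsec0I => [c x Wx cx|c c' x Wx cx cx'].
  exact: (sh_mulmx (gmsec_sh h Wx cx) (gmsec_sh h' Wx cx)).
have s := gmsec_sh h Wx cx'; have s' := gmsec_sh h' Wx cx'.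
rewrite -(a_body cx cx') in s s'.
rewrite /mtpull (near_at (mpull_M (a_sc cx cx') s s')).
by rewrite (near_at (gmsec_near0 Wo h Wx cx cx')) (near_at (gmsec_near0 Wo h' Wx cx cx')).
Qed.

Lemma gmsec0V W M : gmsec 0 W M -> open W -> gmsec 0 W (fun c p => ginv3 (M c p)).
Proof.
move=> h Wo; apply: gmsec0I => [c x Wx cx|c c' x Wx cx cx'].
  exact: (sh_ginv3 (gmsec_sh h Wx cx)).
have s := gmsec_sh h Wx cx'.
rewrite -(a_body cx cx') in s.
rewrite /mtpull (near_at (mpull_ginv3 (a_sc cx cx') s)).
by rewrite (near_at (gmsec_near0 Wo h Wx cx cx')).
Qed.

Lemma gmsec0W W W' M : W' `<=` W -> gmsec 0 W M -> gmsec 0 W' M.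
Proof.
move=> s h; apply: gmsec0I => [c x Wx cx|c c' x Wx cx cx'].
  by apply: (gmsec_sh h) => //; exact: s.
apply/matrixP => i j; rewrite mpullE ((h i j).2 c c' x (s _ Wx) cx cx'); exact: mulr1.
Qed.

Lemma gBfun1 W : gBfun W (fun _ _ => 1%:M).
Proof.
split; last first.
  move=> c x _ _; split; first exact: kin_G1.
  by move=> i j ij; rewrite mxE; case: eqP => // e; rewrite e ltnn in ij.
apply: gmsec0I => [c x _ _ i j|c c' x _ _ _]; first exact: sh_cst.
apply/matrixP => i j; rewrite mpullE.
have f : thfree ((1%:M : 'M[L]_3) i j) by rewrite mxE; case: (_ == _); [exact: thfree1|exact: thfree0].
by rewrite (@pull_cst K H N (Z c c') (T c c') _ (bd c x) f).
Qed.

Definition is_frame (h a : mfield) (b : mfield) (w : chart -> K -> L) W : Prop :=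
  forall c x, W x -> dom c x ->
  [/\ msh (b c) (bd c x), \forall q \near bd c x, kin_B (b c q),
      sh (w c) (bd c x), \forall q \near bd c x, godd (w c q) &
      \forall q \near bd c x, gaugeAt (fun q => b c q *m h c q) (nfm (w c)) (a c) q].

Lemma gop_frame (O : gop) (k : g_idx O) : exists bw : mfield * (chart -> K -> L),
  is_frame (g_h k) (g_A k) bw.1 bw.2 (g_dom k).
Proof.
have [a0 [e form]] := g_oper (@g_open O k) (@subset_refl _ _) (gBfun1 (g_dom k)).
pose a c q := a0 c q o2 o1; pose hh c q := a0 c q o0 o0.
pose cc c q := a0 c q o0 o1; pose d c q := a0 c q o0 o2.
exists (fun c => nf_B H (a c) (hh c) (cc c), fun c => nf_w H (a c) (hh c) (cc c) (d c)) => c x kx cx.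
have [hs hG] := g_hG k.
have e' : ggauge (g_dom k) (g_h k) a0 (g_A k).
  move=> c1 x1 k1 c1x; have := e c1 x1 k1 c1x; rewrite mul1mx => ->; congr (_ - _).
  by apply: kmD_near; near=> q; rewrite mul1mx.
exact: (oper_frame (gmsec_sh hs kx cx) (gmsec_sh (g_Asection k) kx cx) (gon_near (@g_open O k) hG kx cx)
  (gon_near (@g_open O k) e' kx cx) (gon_near (@g_open O k) form kx cx)).
Unshelve. all: by end_near. Qed.

Definition gframe (O : gop) (k : g_idx O) := projT1 (cid (gop_frame k)).
Definition fB (O : gop) (k : g_idx O) : mfield := (gframe k).1.
Definition fw (O : gop) (k : g_idx O) : chart -> K -> L := (gframe k).2.
Lemma frameP (O : gop) (k : g_idx O) : is_frame (g_h k) (g_A k) (fB k) (fw k) (g_dom k).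
Proof. exact: (projT2 (cid (gop_frame k))). Qed.

Definition gG (O : gop) (k : g_idx O) : mfield := fun c q => fB k c q *m g_h k c q.

(** Formulated for an isomorphism between two superopers; a transition function within one superoper
    is the case [O = O'], so that one computation covers gluing and invariance. *)
Lemma gop_law (O O' : gop) (k : g_idx O) (k' : g_idx O') (phi b : mfield) c c' x :
  gGfun (g_dom k `&` g_dom k') phi -> gBfun (g_dom k `&` g_dom k') b ->
  gon (g_dom k `&` g_dom k') (fun c p => g_h k c p *m phi c p = b c p *m g_h k' c p) ->
  ggauge (g_dom k `&` g_dom k') phi (g_A k) (g_A k') ->
  g_dom k x -> g_dom k' x -> dom c x -> dom c' x ->
  \forall q \near bd c x, gG k c q *m phi c q = bJ H (T c c') q *m mtpull c c' (gG k' c') q /\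
   fw k c q * uinv (T c c') q = SD (T c c') q ^+ 2 * tpull c c' (fw k' c') q + D3u c c' q.
Proof.
move=> [ps pG] [bs bB] red gau kx kx' cx cx'.
have Wo : open (g_dom k `&` g_dom k') by apply: openI; exact: g_open.
have Wx : (g_dom k `&` g_dom k') x by [].
have sg := a_sc cx cx'; have eb := a_body cx cx'.
have [f1 f2 f3 f4 f5] := frameP kx cx.
have [f1' f2' f3' f4' f5'] := frameP kx' cx'.
have [hs hG] := g_hG k; have [hs' hG'] := g_hG k'.
have m1 := gmsec_sh hs kx cx; have m1' := gmsec_sh hs' kx' cx'.
have m2 := gmsec_sh ps Wx cx.
have m3' := gmsec_sh (g_Asection k') kx' cx'.
have n1 := gon_near (@g_open O k) hG kx cx; have n1' := gon_near (@g_open O' k') hG' kx' cx'.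
have n2 := gon_near Wo pG Wx cx; have n3 := gon_near Wo bB Wx cx.
have n4 := gon_near Wo red Wx cx; have n5 := gon_near Wo gau Wx cx.
have n6 := gmsec_near0 (@g_open O' k') hs' kx' cx cx'.
have n7 := gmsec_near1 (@g_open O' k') (g_Asection k') kx' cx cx'.
have n8 := gon_near (@g_open O' k') hG' kx' cx.
rewrite -eb in f1' f2' f3' f5' m1' m3' n1'.
have q1 : \forall q \near bd c x, kin_G (mpull H (Z c c') (T c c') (g_h k' c') q).
  by apply: filterS2 n6 n8 => q k1 k2; rewrite -/(mtpull c c' (g_h k' c')) -k1.
have q2 : \forall q \near bd c x, gaugeAt (phi c) (g_A k c) (fun q => SD (T c c') q *: mpull H (Z c c') (T c c') (g_A k' c') q) q.
  by apply: filterS2 n5 n7 => q k1 k2; rewrite /GaugeGerms.gaugeAt -/(mtpull c c' (g_A k' c')) -k2.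
have q3 : \forall q \near bd c x, g_h k c q *m phi c q = b c q *m mpull H (Z c c') (T c c') (g_h k' c') q.
  by apply: filterS2 n4 n6 => q k1 k2; rewrite k1 -/(mtpull c c' (g_h k' c')) -k2.
exact: (frame_law sg (And3 m1 f1 m2) (And4 n1 f2 n2 n3) f5 (And4 m1' f1' m3' f3') n1' f2' f5' q1 q2 q3).
Qed.

Lemma gop_law_self (O : gop) (k l : g_idx O) c c' x :
  g_dom k x -> g_dom l x -> dom c x -> dom c' x ->
  \forall q \near bd c x, gG k c q *m g_g k l c q = bJ H (T c c') q *m mtpull c c' (gG l c') q /\
   fw k c q * uinv (T c c') q = SD (T c c') q ^+ 2 * tpull c c' (fw l c') q + D3u c c' q.
Proof.
move=> kx lx cx cx'; have [b bB red] := g_reduction k l.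
refine (gop_law (g_gG k l) bB red (@g_conn O k l) kx lx cx cx').
Qed.

Lemma law_same (O O' : gop) (k : g_idx O) (k' : g_idx O') (M : K -> 'M[L]_3) c x :
  g_dom k' x -> dom c x ->
  (\forall q \near bd c x, M q = bJ H (T c c) q *m mtpull c c (gG k' c) q /\
   fw k c q * uinv (T c c) q = SD (T c c) q ^+ 2 * tpull c c (fw k' c) q + D3u c c q) ->
  \forall q \near bd c x, M q = gG k' c q /\ fw k c q = fw k' c q.
Proof.
move=> kx' cx e.
have [f1 _ f3 _ _] := frameP kx' cx.
have [hs _] := g_hG k'.
have sG : msh (gG k' c) (bd c x) := sh_mulmx f1 (gmsec_sh hs kx' cx).
have n : \forall q \near bd c x, msh (gG k' c) q := mshP sG.
apply: filterS3 (filterI e (tr_idJ cx)) (filterI (tpull_id cx f3) (tr_id cx)) n => q [[k1 k2] [j1 j2 j3 j4]] [k3 [k4 k4']] k5.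
split.
  rewrite k1 j4 mul1mx; apply/matrixP => i j; rewrite mpullE /SconfMaps.pull k4 k4'.
  exact: (sev_refl (k5 i j)).
by move: k2; rewrite j1 j2 j3 k3 mulr1 expr1n mul1r addr0.
Qed.

Lemma frame_glue (O : gop) (k l : g_idx O) c x : g_dom k x -> g_dom l x -> dom c x ->
  \forall q \near bd c x, gG k c q *m g_g k l c q = gG l c q /\ fw k c q = fw l c q.
Proof. by move=> kx lx cx; apply: law_same (gop_law_self kx lx cx cx). Qed.

(** The potentials [fw k] agree on overlaps by [frame_glue], so any trivialization around the point
    may be chosen. The value 0 is taken outside the image of the chart. *)
Definition gom (O : gop) : chart -> K -> L := fun c q =>
  if pselect (exists x, dom c x /\ bd c x = q) is left ex
  then fw (projT1 (cid (@g_cover O (projT1 (cid ex))))) c q else 0.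

Lemma gomE (O : gop) (k : g_idx O) c x : g_dom k x -> dom c x -> gom O c (bd c x) = fw k c (bd c x).
Proof.
move=> kx cx; rewrite /gom; case: pselect => [ex|n]; last by exfalso; apply: n; exists x.
case: cid => y [cy e] /=; case: cid => l ly /=.
have [_ inj _ _] := a_homeo c.
have yx : y = x by apply: inj; rewrite ?inE.
rewrite yx in ly.
by have [_ ->] := near_at (frame_glue ly kx cx).
Qed.

Lemma gomE_near (O : gop) (k : g_idx O) c x : g_dom k x -> dom c x ->
  \forall q \near bd c x, gom O c q = fw k c q.
Proof. by move=> kx cx; apply: (near_pts (@g_open O k) kx cx) => y ky cy; exact: gomE. Qed.

Lemma gom_conn (O : gop) : gconn (gom O).
Proof.
split=> [c x cx|c x cx|c c' x cx cx']; have [k kx] := @g_cover O x.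
- have [_ _ h _ _] := frameP kx cx.
  by apply: sh_ext h; apply: filterS (gomE_near kx cx) => q ->.
- by rewrite (gomE kx cx); have [_ _ _ h _] := frameP kx cx; exact: near_at h.
rewrite (gomE kx cx); have [_ ->] := near_at (gop_law_self kx kx cx cx').
have h : \forall w \near gbody (Z c c' (bd c x)), fw k c' w = gom O c' w.
  by rewrite (a_body cx cx'); apply: filterS (gomE_near kx cx') => q ->.
have e := near_at (pull_ext (a_sc cx cx') h).
by rewrite /tpull e.
Qed.

Lemma giso_om (O O' : gop) : giso O O' -> forall c x, dom c x -> gom O c (bd c x) = gom O' c (bd c x).
Proof.
move=> [phi [pG _ red gau]] c x cx.
have [k kx] := @g_cover O x; have [k' kx'] := @g_cover O' x.
have [b bB rb] := red k k'.
have e := gop_law (pG k k') bB rb (gau k k') kx kx' cx cx.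
by rewrite (gomE kx cx) (gomE kx' cx); have [_ ->] := near_at (law_same kx' cx e).
Qed.

Lemma mulmx_inj_l (V P a b : 'M[L]_3) : V *m P = 1%:M -> P *m a = P *m b -> a = b.
Proof. by move=> VP e; rewrite -[a]mul1mx -[b]mul1mx -VP -!mulmxA e. Qed.

Lemma quotient_cancel (J m m' G G' V U : 'M[L]_3) : G = J *m m -> G' = J *m m' ->
  m *m V = 1%:M -> U *m G = 1%:M -> V *m m' = U *m G'.
Proof.
move=> e e' mV UG; rewrite e' -[m' in RHS]mul1mx -mV !mulmxA -(mulmxA U) -e UG mul1mx //.
Qed.

Lemma glue_alg (G Gl G' Gl' g g' f fl : 'M[L]_3) : G *m g = Gl -> G' *m g' = Gl' ->
  G *m f = G' -> Gl *m fl = Gl' -> G *m (g *m fl) = G *m (f *m g').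
Proof. by move=> a b c d; rewrite !mulmxA a c d b. Qed.

Lemma gG_in (O : gop) (k : g_idx O) c x : g_dom k x -> dom c x -> kin_G (gG k c (bd c x)).
Proof.
move=> kx cx; have [_ h _ _ _] := frameP kx cx; have [_ hG] := g_hG k.
by apply: kin_GM; [exact: (near_at h).1|exact: hG].
Qed.

Lemma sh_gG (O : gop) (k : g_idx O) c x : g_dom k x -> dom c x -> msh (gG k c) (bd c x).
Proof.
move=> kx cx; have [h _ _ _ _] := frameP kx cx; have [hs _] := g_hG k.
exact: (sh_mulmx h (gmsec_sh hs kx cx)).
Qed.

Lemma gg1 (O : gop) (k : g_idx O) c x : g_dom k x -> dom c x -> g_g k k c (bd c x) = 1%:M.
Proof.
move=> kx cx; have e := @g_cocycle O k k k c x (conj (conj kx kx) kx) cx.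
have [_ gG'] := g_gG k k; have [_ v _] := ginv3P (gG' c x (conj kx kx) cx).
by rewrite -[LHS]mul1mx -v -mulmxA e.
Qed.

Lemma gG_tr (O : gop) (k : g_idx O) c c' x : g_dom k x -> dom c x -> dom c' x ->
  gG k c (bd c x) = bJ H (T c c') (bd c x) *m mtpull c c' (gG k c') (bd c x).
Proof.
move=> kx cx cx'; have [<- _] := near_at (gop_law_self kx kx cx cx').
by rewrite (gg1 kx cx) mulmx1.
Qed.

(** Both superopers are brought to the same normal form by [gG], so [(gG k)^-1 gG k'] intertwines
    the connections. It is a function on the surface because a change of chart multiplies both
    frames on the left by the same [bJ]. *)
Lemma om_giso (O O' : gop) : (forall c x, dom c x -> gom O c (bd c x) = gom O' c (bd c x)) -> giso O O'.
Proof.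
move=> eom.
pose phi (k : g_idx O) (k' : g_idx O') : mfield := fun c q => ginv3 (gG k c q) *m gG k' c q.
have Wo (k : g_idx O) (k' : g_idx O') : open (g_dom k `&` g_dom k') by apply: openI; exact: g_open.
have phis k k' : gmsec 0 (g_dom k `&` g_dom k') (phi k k').
  apply: gmsec0I => [c x [kx kx'] cx|c c' x [kx kx'] cx cx'].
    exact: (sh_mulmx (sh_ginv3 (sh_gG kx cx)) (sh_gG kx' cx)).
  have sg := a_sc cx cx'.
  have s1 := sh_gG kx cx'; have s2 := sh_gG kx' cx'; rewrite -(a_body cx cx') in s1 s2.
  have e1 := near_at (mpull_M sg (sh_ginv3 s1) s2).
  have e2 := near_at (mpull_ginv3 sg s1).
  rewrite /mtpull; apply/esym/(etrans e1); rewrite e2 /phi.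
  have b1 := near_at (bJ_in sg); have [_ v _] := ginv3P b1.1.
  have t1 := gG_tr kx cx cx'; have t2 := gG_tr kx' cx cx'.
  have [i1 i2 i3] := ginv3P (gG_in kx cx).
  have P1 : mtpull c c' (gG k c') (bd c x) = ginv3 (bJ H (T c c') (bd c x)) *m gG k c (bd c x).
    by rewrite t1 mulmxA v mul1mx.
  have P2 : mtpull c c' (gG k' c') (bd c x) = ginv3 (bJ H (T c c') (bd c x)) *m gG k' c (bd c x).
    by rewrite t2 mulmxA v mul1mx.
  have PG : kin_G (mtpull c c' (gG k c') (bd c x)).
    by rewrite P1; apply: kin_GM (gG_in kx cx); have [] := ginv3P b1.1.
  have [_ j2 j3] := ginv3P PG.
  exact: (quotient_cancel t1 t2 j3 i2).
have phiG k k' : gGfun (g_dom k `&` g_dom k') (phi k k').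
  split; first exact: phis.
  move=> c x [kx kx'] cx; apply: kin_GM (gG_in kx' cx).
  by have [] := ginv3P (gG_in kx cx).
have key k k' c x : g_dom k x -> g_dom k' x -> dom c x -> gG k c (bd c x) *m phi k k' c (bd c x) = gG k' c (bd c x).
  move=> kx kx' cx; have [_ _ i3] := ginv3P (gG_in kx cx).
  by rewrite /phi mulmxA i3 mul1mx.
exists phi; split => //.
- move=> k k' l l' c x [[kx kx'] [lx lx']] cx.
  have [_ i2 _] := ginv3P (gG_in kx cx).
  apply: (mulmx_inj_l i2).
  have [e1 _] := near_at (frame_glue kx lx cx).
  have [e2 _] := near_at (frame_glue kx' lx' cx).
  exact: (glue_alg e1 e2 (key k k' c x kx kx' cx) (key l l' c x lx lx' cx)).
(* This matrix is the quotient of the two B-valued factors [fB k] and [fB k']. *)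
- move=> k k'; exists (fun c q => g_h k c q *m phi k k' c q *m ginv3 (g_h k' c q)).
    split.
      apply: gmsec0M => //; last first.
        by apply: gmsec0V => //; apply: gmsec0W (g_hG k').1 => x [].
      apply: gmsec0M => //; by apply: gmsec0W (g_hG k).1 => x [].
    move=> c x [kx kx'] cx.
    have [_ h1 _ _ _] := frameP kx cx; have [_ h2 _ _ _] := frameP kx' cx.
    have h3 := (g_hG k).2 c x kx cx; have h4 := (g_hG k').2 c x kx' cx.
    have [_ v1 _] := ginv3P (near_at h1).1; have [_ _ v4] := ginv3P h4.
    have e : g_h k c (bd c x) *m phi k k' c (bd c x) = ginv3 (fB k c (bd c x)) *m gG k' c (bd c x).
      rewrite -(key k k' c x kx kx' cx) /gG -(mulmxA (fB k c _)).
      by rewrite (mulmxA (ginv3 (fB k c (bd c x)))) v1 mul1mx.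
    rewrite e /gG (mulmxA _ (fB k' c (bd c x))) -(mulmxA _ (g_h k' c (bd c x))) v4 mulmx1.
    by apply: kin_BM (near_at h2); apply: kin_BV; exact: near_at h1.
  move=> c x [kx kx'] cx; have [_ v _] := ginv3P ((g_hG k').2 c x kx' cx).
  by rewrite -[RHS]mulmxA v mulmx1.
move=> k k' c x [kx kx'] cx.
have [_ _ _ _ h1] := frameP kx cx; have [_ _ _ _ h2] := frameP kx' cx.
have nG : \forall q \near bd c x, kin_G (gG k c q).
  by apply: (near_pts (@g_open O k) kx cx) => y ky cy; exact: gG_in.
have s1 := sh_gG kx cx; have s2 := sh_gG kx' cx.
have g1 := gauge_inv s1 nG (near_at h1).
have ew : fw k c (bd c x) = fw k' c (bd c x) by rewrite -(gomE kx cx) -(gomE kx' cx) eom.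
have [i1 _ _] := ginv3P (near_at nG).
apply: (gauge_comp (sh_ginv3 s1) s2 i1 g1).
by have := near_at h2; rewrite /GaugeGerms.gaugeAt /nfm ew.
Qed.

End Opers.

(** * The superoper of a superprojective atlas *)

Section AtlasOper.
Variables (K : numClosedFieldType) (H : holoCalc K) (N : nat) (A : satl H N).
Local Notation L := (grass K N.+1).
Local Notation sh := (sh H).
Local Notation SD := (SD H).
Local Notation uinv := (uinv H).
Local Notation msh := (msh H).
Local Notation gaugeAt := (gaugeAt H).
Local Notation X := (aX A).
Local Notation chart := (aC A).
Local Notation dom := (@adom K H N A).
Local Notation bd := (@abd K H N A).
Local Notation Z := (@aZ K H N A).
Local Notation T := (@aT K H N A).
Local Notation D3u := (@D3u K H N A).
Local Notation mfield := (chart -> K -> 'M[L]_3).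
Implicit Types (c k l : chart) (x y : X) (W : set X) (p q : K).

Lemma gaugeAt_congr (g a a1 a' : K -> 'M[L]_3) p : a p = a1 p -> gaugeAt g a a' p -> gaugeAt g a1 a' p.
Proof. by rewrite /GaugeGerms.gaugeAt => <-. Qed.

Lemma kf_Om : kf_mx K N.+1 = Om 1 0 0 (- 0).
Proof. by apply: mx3P; rewrite !kmx3E /= ?oppr0. Qed.

(** The gauge transformation which, in the coordinates of [c], takes the connection D + f of the
    chart [k] to normal form. In the chart [k] itself it is 1, and there [atG k l] is [bJ] of the
    change of coordinates from [k] to [l]. *)
Definition atB k : mfield := fun c => bJ H (T c k).
Definition atA k : mfield := fun c q => SD (T c k) q *: kf_mx K N.+1.
Definition atG k l : mfield := fun c q => ginv3 (atB k c q) *m atB l c q.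

Lemma atB_in k c x : dom k x -> dom c x -> \forall q \near bd c x, kin_B (atB k c q).
Proof. by move=> kx cx; exact: bJ_in (a_sc cx kx). Qed.
Lemma sh_atB k c x : dom k x -> dom c x -> msh (atB k c) (bd c x).
Proof. by move=> kx cx; exact: sh_bJ (a_sc cx kx). Qed.

Lemma atG_in k l c x : dom k x -> dom l x -> dom c x -> \forall q \near bd c x, kin_B (atG k l c q).
Proof.
move=> kx lx cx; apply: filterS2 (atB_in kx cx) (atB_in lx cx) => q h1 h2.
by apply: kin_BM h2; exact: kin_BV.
Qed.

Lemma atG_sec k l : gmsec (A := A) 0 (dom k `&` dom l) (atG k l).
Proof.
apply: gmsec0I => [c x [kx lx] cx|c c' x [kx lx] cx cx'].
  exact: (sh_mulmx (sh_ginv3 (sh_atB kx cx)) (sh_atB lx cx)).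
have sg := a_sc cx cx'.
have s1 := sh_atB kx cx'; have s2 := sh_atB lx cx'; rewrite -(a_body cx cx') in s1 s2.
have e1 := near_at (mpull_M sg (sh_ginv3 s1) s2).
have e2 := near_at (mpull_ginv3 sg s1).
have n1 : \forall w \near gbody (Z c c' (bd c x)), kin_B (atB k c' w) by rewrite (a_body cx cx'); exact: atB_in.
have pB := near_at (kin_B_mpull sg s1 n1).
have [_ _ v1] := ginv3P pB.1.
have [_ v2 _] := ginv3P (near_at (atB_in kx cx)).1.
have t1 := near_at (tr_bJ cx cx' kx); have t2 := near_at (tr_bJ cx cx' lx).
rewrite /mtpull; apply/esym/(etrans e1); rewrite e2.
exact: (quotient_cancel t1 t2 v1 v2).
Qed.

Lemma atG_B k l : gBfun (A := A) (dom k `&` dom l) (atG k l).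
Proof. by split; [exact: atG_sec|move=> c x [kx lx] cx; exact: near_at (atG_in kx lx cx)]. Qed.

Lemma atA_sec k : gmsec (A := A) (- 1) (dom k) (atA k).
Proof.
move=> i j; have f : thfree (kf_mx K N.+1 i j).
  have f0 := @thfree0 K N; have f1 := @thfree1 K N.
  by move: i j; elim/ord3P; elim/ord3P; rewrite kmx3E //=; exact: thfreeN.
have E c : (fun q => atA k c q i j) = (fun q => SD (T c k) q * kf_mx K N.+1 i j).
  by apply/funext => q; rewrite mxE.
split=> [c x kx cx|c c' x kx cx cx'].
  rewrite E; exact: (shM (sc_J_sh (a_sc cx kx)) (sh_cst H _ _)).
have sg := a_sc cx cx'.
have s1 : sh (SD (T c' k)) (gbody (Z c c' (bd c x))) by rewrite (a_body cx cx'); exact: sc_J_sh (a_sc cx' kx).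
rewrite [LHS]mxE (near_at (tr_near_J cx cx' kx)) E /tpull (near_at (pull_M sg s1 (sh_cst H _ _))).
rewrite (@pull_cst K H N (Z c c') (T c c') _ (bd c x) f) opprK -mulrA.
exact: (geven_comm _ (near_at (sc_J_even sg))).
Qed.

(** The two sides are the potentials, seen in [c], of the connections D + f of [k] and of [l]. They
    agree by the cocycle rule when the transition between [k] and [l] is in SPL_2. *)
Lemma flat_w k l c x : dom k x -> dom l x -> dom c x -> flat k l x ->
  D3u c k (bd c x) * SD (T c k) (bd c x) = D3u c l (bd c x) * SD (T c l) (bd c x).
Proof.
move=> kx lx cx fl; have sg := a_sc cx kx; have sg' := a_sc kx lx.
have n0 : \forall w \near gbody (Z c k (bd c x)), D3u k l w = 0 by rewrite (a_body cx kx).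
have e0 := near_at (pull_ext sg n0).
have f0 := @pull_cst K H N (Z c k) (T c k) 0 (bd c x) (@thfree0 K N).
have D := near_at (tr_D3 cx kx lx).
have D3 := near_at (tr_near_J cx kx lx).
rewrite -(a_body cx kx) in sg'.
have n1 : \forall w \near gbody (Z c k (bd c x)), uinv (T k l) w * SD (T k l) w = 1 := sc_uJ sg'.
have e1 := near_at (pull_ext sg n1).
have e2 := near_at (pull_M sg (sc_u_sh sg') (sc_J_sh sg')).
have f1 := @pull_cst K H N (Z c k) (T c k) 1 (bd c x) (@thfree1 K N).
have uJ : tpull c k (uinv (T k l)) (bd c x) * tpull c k (SD (T k l)) (bd c x) = 1.
  by apply: (etrans (esym e2)); apply: (etrans e1).
have Je := near_at (sc_J_even sg).
have z0 : tpull c k (D3u k l) (bd c x) = 0 by apply: (etrans e0).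
rewrite D D3 z0 mulr0 add0r; move: uJ Je.
move: (tpull c k (uinv _) _) (tpull c k (SD _) _) (SD (T c k) (bd c x)) => a b j ab je.
by rewrite -mulrA [a * (j * b)]mulrA -(geven_comm a je) -(mulrA j) ab mulr1.
Qed.

(** The potential solves w u = D^3 u, the law with zero potential in the chart [k]. *)
Lemma atB_gauge k c x : dom k x -> dom c x -> \forall q \near bd c x,
  gaugeAt (atB k c) (fun q => Om 1 0 0 (- (D3u c k q * SD (T c k) q))) (atA k c) q.
Proof.
move=> kx cx; have sg := a_sc cx kx.
pose w q := D3u c k q * SD (T c k) q.
have e : \forall q \near bd c x, w q * uinv (T c k) q = SD (T c k) q ^+ 2 * 0 + SD (SD (SD (uinv (T c k)))) q.
  apply: filterS (bJ_Ju sg) => q h; rewrite mulr0 add0r /w -mulrA h mulr1 //.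
have := bJ_gauge sg (w := w) (w' := fun=> 0) e.
by apply: filterS => q; rewrite /GaugeGerms.gaugeAt /atA kf_Om.
Qed.

Definition cover_ok (S : chart -> Prop) : Prop :=
  (forall x, exists2 c, S c & dom c x) /\ (forall c c', S c -> S c' -> srel c c').

Section Build.
Variables (S : chart -> Prop) (ok : cover_ok S).
Let idx := {k | S k}.
Let sd (k : idx) : set X := dom (sval k).

Lemma at_open (k : idx) : open (sd k). Proof. exact: dom_open. Qed.
Lemma at_cover x : exists k : idx, sd k x.
Proof. by have [c Sc cx] := ok.1 x; exists (exist _ c Sc). Qed.
Lemma at_gG (k l : idx) : gGfun (A := A) (sd k `&` sd l) (atG (sval k) (sval l)).
Proof. by have [h1 h2] := atG_B (sval k) (sval l); split => // c x xk cx; have [] := h2 c x xk cx. Qed.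
Lemma at_cocycle (k l m : idx) : gon (A := A) (sd k `&` sd l `&` sd m)
  (fun c p => atG (sval k) (sval l) c p *m atG (sval l) (sval m) c p = atG (sval k) (sval m) c p).
Proof.
move=> c x [[kx lx] mx] cx; have [_ _ v] := ginv3P (near_at (atB_in lx cx)).1.
have := mulmx_cancel 1%:M (ginv3 (atB (sval k) c (bd c x))) 1%:M v.
by rewrite !mul1mx mulmx1 /atG => h; rewrite mulmxA h.
Qed.
Lemma at_hG (k : idx) : gGfun (A := A) (sd k) (fun _ _ => 1%:M).
Proof. by have [h1 h2] := @gBfun1 K H N A (sd k); split => // c x xk cx; have [] := h2 c x xk cx. Qed.
Lemma at_reduction (k l : idx) : exists2 b : mfield, gBfun (A := A) (sd k `&` sd l) b
    & gon (A := A) (sd k `&` sd l) (fun c p => 1%:M *m atG (sval k) (sval l) c p = b c p *m 1%:M).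
Proof. by exists (atG (sval k) (sval l)); [exact: atG_B|move=> c x _ _; rewrite mul1mx mulmx1]. Qed.
Lemma at_conn (k l : idx) : ggauge (A := A) (sd k `&` sd l) (atG (sval k) (sval l)) (atA (sval k)) (atA (sval l)).
Proof.
move=> c x [kx lx] cx.
have g1 := near_at (atB_gauge kx cx); have g2 := near_at (atB_gauge lx cx).
have w := flat_w kx lx cx (ok.2 _ _ (svalP k) (svalP l) x kx lx).
have BG : \forall q \near bd c x, kin_G (atB (sval k) c q) by apply: filterS (atB_in kx cx) => q [].
have g3 := gauge_inv (sh_atB kx cx) BG g1.
have [i1 _ _] := ginv3P (near_at BG).
apply: (gauge_comp (sh_ginv3 (sh_atB kx cx)) (sh_atB lx cx) i1 g3).
exact: (gaugeAt_congr (congr1 (fun w => Om 1 0 0 (- w)) (esym w)) g2).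
Qed.
Lemma at_oper (k : idx) W (b : mfield) : open W -> W `<=` sd k -> gBfun (A := A) W b ->
    exists a0 : mfield,
      ggauge (A := A) W (fun c p => b c p *m 1%:M) a0 (atA (sval k)) /\
      gon (A := A) W (fun c p => exists (a : L) (mu : 'M[L]_3),
        [/\ geven a, a \is a GRing.unit, kin_b_odd mu
          & a0 c p = a *: kf_mx K N.+1 + mu]).
Proof.
move=> Wo Wk [bs bB].
pose P c p (m : 'M[L]_3) := m *m b c p = b c p *m atA (sval k) c p - kmD H (b c) p /\
  exists (a : L) (mu : 'M[L]_3), [/\ geven a, a \is a GRing.unit, kin_b_odd mu & m = a *: kf_mx K N.+1 + mu].
(* The matrix is needed only at points, where [Jf_gauge] provides it, so it is chosen point by
   point. *)
pose a0 c p : 'M[L]_3 := if pselect (exists m, P c p m) is left ex then projT1 (cid ex) else 0.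
have aP c x : W x -> dom c x -> P c (bd c x) (a0 c (bd c x)).
  move=> Wx cx; have kx := Wk x Wx; have sg := a_sc cx kx.
  rewrite /a0; case: pselect => [ex|n]; first by case: cid.
  exfalso; apply: n.
  have [a [h [cc [d [ae au [ho ce do_] e]]]]] := Jf_gauge (gmsec_sh bs Wx cx) (gon_near Wo bB Wx cx)
    (near_at (sc_J_even sg)) (sc_unit sg).
  have [m mu E] := Om_form a ho ce do_.
  by exists (Om a h cc d); split => //; exists a, m.
exists a0; split => c x Wx cx; have [h1 h2] := aP c x Wx cx => //.
rewrite mulmx1 h1; congr (_ - _); apply: kmD_near; near=> q; by rewrite mulmx1.
Unshelve. all: by end_near. Qed.

Definition gop_of : gop A := Gop at_open at_cover at_gG at_cocycle at_hG at_reduction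
  (fun k : idx => atA_sec (sval k)) at_conn at_oper.

End Build.

(** In the chart [k] the isomorphism is a B-valued gauge transformation between two normal forms of
    potential 0; the law of [bJ_unique] then reads D^3 u = 0. *)
Lemma gop_of_reflect (S S' : chart -> Prop) (ok : cover_ok S) (ok' : cover_ok S') :
  giso (gop_of ok) (gop_of ok') -> forall k k', S k -> S' k' -> srel k k'.
Proof.
move=> [phi [pG _ red gau]] k k' Sk Sk' x kx kx'.
pose i : g_idx (gop_of ok) := exist _ k Sk; pose i' : g_idx (gop_of ok') := exist _ k' Sk'.
have [ps _] := pG i i'; have [b [_ bB] rb] := red i i'; have ga := gau i i'.
have Wo : open (dom k `&` dom k') by apply: openI; exact: dom_open.
have Wx : (dom k `&` dom k') x by [].
have n1 : \forall q \near bd k x, kin_B (phi i i' k q).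
  apply: (near_pts Wo Wx kx) => y Wy ky; have := rb k y Wy ky; rewrite /= mul1mx mulmx1 => ->.
  exact: bB.
have n2 := gon_near Wo ga Wx kx.
have n3 : \forall q \near bd k x, gaugeAt (phi i i' k) (fun=> Om 1 0 0 (- 0)) (fun q => SD (T k k') q *: Om 1 0 0 (- 0)) q.
  apply: filterS2 n2 (tr_idJ kx) => q h [j1 _ _ _]; move: h.
  by rewrite /GaugeGerms.gaugeAt /= /atA -kf_Om j1 scale1r.
have u := bJ_unique (a_sc kx kx') (w := fun=> 0) (w' := fun=> 0) (gmsec_sh ps Wx kx) n1 n3.
by apply: filterS u => q [_]; rewrite mul0r mulr0 add0r => e; exact: (esym e).
Qed.

End AtlasOper.

(** * Superconformal charts *)

Module BodyGerms.

Section Germs.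
Variables (K : numClosedFieldType) (H : holoCalc K) (N : nat).
Local Notation L := (grass K N.+1).
Local Notation th := (ggen K (ord0 : 'I_N.+1)).
Local Notation sh := (sh H).
Local Notation SD := (SD H).
Local Notation pull := (pull H).
Local Notation vf := (vf H).
Definition kmap : Type := ((K -> L) * (K -> L))%type.
Implicit Types (p q : K) (m : kmap).

Definition kid : kmap := (fun q => q%:A, fun=> th).
(* kcmp m m' is the expression of m' after m. *)
Definition kcmp m m' : kmap := (pull m.1 m.2 m'.1, pull m.1 m.2 m'.2).
Definition meqv q m m' := m.1 q = m'.1 q /\ m.2 q = m'.2 q.
Definition meq p m m' := \forall q \near p, meqv q m m'.
Definition bg m p := bigerm H m.1 m.2 p.
Definition bdy m p := gbody (m.1 p).

Lemma meq_sym p m m' : meq p m m' -> meq p m' m.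
Proof. by apply: filterS => q [e1 e2]; split. Qed.
Lemma meq_trans p m m' m'' : meq p m m' -> meq p m' m'' -> meq p m m''.
Proof. by apply: filterS2 => q [e1 e2] [e3 e4]; split; [exact: etrans e1 e3|exact: etrans e2 e4]. Qed.
Lemma meq_l p m m1 m' : meq p m m1 -> meq p (kcmp m m') (kcmp m1 m').
Proof. by apply: filterS => q [e1 e2]; rewrite /meqv /kcmp /SconfMaps.pull /= e1 e2. Qed.
Lemma meq_r p m m' m1 : bg m p -> meq (bdy m p) m' m1 -> meq p (kcmp m m') (kcmp m m1).
Proof.
move=> g e.
have h : \forall q \near p, \forall w \near gbody (m.1 q), meqv w m' m1 by exact: (near_body (bi_shZ g) (near_near e)).
apply: filterS h => q h; split; apply: sev_near; by apply: filterS h => w [].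
Qed.
Lemma meqA p m m' m'' : bg m p -> bg m' (bdy m p) -> sh m''.1 (bdy m' (bdy m p)) -> sh m''.2 (bdy m' (bdy m p)) ->
  meq p (kcmp (kcmp m m') m'') (kcmp m (kcmp m' m'')).
Proof.
move=> g g' h1 h2; apply: filterS2 (pull_comp' g g' h1) (pull_comp' g g' h2) => q e1 e2.
by split; symmetry.
Qed.
Lemma meq_idl p m : sh m.1 p -> sh m.2 p -> meq p (kcmp kid m) m.
Proof. by move=> h1 h2; apply: filterS2 (pull_id h1) (pull_id h2) => q. Qed.
Lemma meq_idr p m : bg m p -> meq p (kcmp m kid) m.
Proof.
move=> g; apply: filterS (bi_To g) => q to; split; first exact: sev_id.
exact: (sev_th H (m.1 q) to).
Qed.
Lemma bg_cmp p m m' : bg m p -> bg m' (bdy m p) -> bg (kcmp m m') p.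
Proof. exact: bi_comp. Qed.
Lemma bdy_cmp p m m' : bg m p -> bdy (kcmp m m') p = bdy m' (bdy m p).
Proof. by move=> g; apply: (sev_body H (m.1 p) (near_at (bi_To g))). Qed.
Lemma bg_near p m : bg m p -> \forall q \near p, bg m q.
Proof.
move=> [h1 h2 h3 h4 h5 h6].
have n5 := near_body_neq0 (sh_sdz h1) h5; have n6 := near_body_neq0 (sh_thp1 h2) h6.
apply: filterS3 (filterI (sh_near h1) (sh_near h2)) (filterI (near_near h3) (near_near h4)) (filterI n5 n6).
by move=> q [a b] [c d] [e f].
Qed.

(* The odd vector field e = (e.1, e.2) is h times the pullback of e' by m. *)
Definition carries (e : kmap) m (h : K -> L) (e' : kmap) p :=
  [/\ sh h p, geven (h p), h p \is a GRing.unit &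
  vf p (e.1 p) (e.2 p) m.1 = h p * pull m.1 m.2 e'.2 p /\
  vf p (e.1 p) (e.2 p) m.2 = h p * pull m.1 m.2 e'.1 p].

Lemma vf_pull (e : kmap) m h (e' : kmap) F p : geven (e.1 p) -> godd (e.2 p) -> bg m p ->
  carries e m h e' p -> sh e'.1 (bdy m p) -> sh e'.2 (bdy m p) -> sh F (bdy m p) ->
  vf p (e.1 p) (e.2 p) (pull m.1 m.2 F) =
  h p * pull m.1 m.2 (fun w => vf w (e'.1 w) (e'.2 w) F) p.
Proof.
move=> a1 a2 [h1 h2 h3 h4 _ _] [_ _ _ [e1 e2]] s1 s2 hF.
apply: (etrans (chain_rule h1 h2 h3 h4 a1 a2 hF)).
have k1 := sh_thp1 hF; have k2 := sh_sdz hF.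
have d := sevD (m.2 p) (shM s1 k1) (shM s2 k2).
have m1 := sevM (near_at h3) (near_at h4) s1 k1.
have m2 := sevM (near_at h3) (near_at h4) s2 k2.
rewrite e1 e2 /SconfMaps.pull /Pullbacks.vf; apply/esym/(etrans (congr1 (fun z => h p * z) d)); rewrite m1 m2.
by rewrite mulrDr !mulrA addrC.
Qed.

Definition kD : kmap := (fun=> 1, fun=> th).
Lemma vf_kD F w : vf w (kD.1 w) (kD.2 w) F = SD F w.
Proof. by rewrite /Pullbacks.vf mul1r. Qed.

Lemma carries_comp (e e' e'' : kmap) m m' h h' p : geven (e.1 p) -> godd (e.2 p) -> bg m p ->
  bg m' (bdy m p) -> sh e'.1 (bdy m p) -> sh e'.2 (bdy m p) ->
  sh e''.1 (bdy m' (bdy m p)) -> sh e''.2 (bdy m' (bdy m p)) ->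
  carries e m h e' p -> (\forall w \near bdy m p, carries e' m' h' e'' w) ->
  carries e (kcmp m m') (fun q => h q * pull m.1 m.2 h' q) e'' p.
Proof.
move=> a1 a2 g g' s1 s2 s1' s2' c c'.
have [h'1 h'2 h'3 h'4] : [/\ sh h' (bdy m p), \forall w \near bdy m p, geven (h' w), h' (bdy m p) \is a GRing.unit &
   \forall w \near bdy m p, vf w (e'.1 w) (e'.2 w) m'.1 = h' w * pull m'.1 m'.2 e''.2 w /\
     vf w (e'.1 w) (e'.2 w) m'.2 = h' w * pull m'.1 m'.2 e''.1 w].
  by split; [have [] := near_at c'|apply: filterS c' => w []|have [] := near_at c'|apply: filterS c' => w []].
case: (c) => c1 c2 c3 _.
have [[b1 b2 b3 b4 _ _] [b1' b2' b3' b4' _ _]] := (g, g').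
have pc F F' : sh F' (bdy m' (bdy m p)) -> sh F (bdy m p) ->
    (\forall w \near bdy m p, vf w (e'.1 w) (e'.2 w) F = h' w * pull m'.1 m'.2 F' w) ->
    vf p (e.1 p) (e.2 p) (pull m.1 m.2 F) = h p * pull m.1 m.2 h' p * pull (kcmp m m').1 (kcmp m m').2 F' p.
  move=> sF' sF eF; rewrite (vf_pull a1 a2 g c s1 s2 sF) -mulrA; congr (_ * _).
  have k := sh_pull b1' b2' sF'.
  rewrite -(near_at (pull_comp' g g' sF')).
  apply: etrans (sevM (near_at b3) (near_at b4) h'1 k).
  exact: sev_near.
split.
- by apply: shM => //; exact: sh_pull.
- by apply: gevenM => //; exact: (sev_hom (near_at b3) (near_at b4) h'2).
- rewrite gunitE gbodyM /SconfMaps.pull (sev_body H (m.1 p) (near_at b4)) mulf_neq0 // -gunitE //.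
- split; apply: pc => //; by apply: filterS h'4 => w [].
Qed.

(** The generator is a multiple of the pullback of D_theta both by [m0] and by [m0] followed by [m].
    Comparison shows that D z' - theta' D theta' for [m] becomes 0 after pullback by [m0], and the
    germ [m0'], with [m0] after it the identity, brings this back. *)
Lemma scgerm_along (e : kmap) (m0 m1 m : kmap) h0 h1 p :
  (\forall q \near p, geven (e.1 q)) -> (\forall q \near p, godd (e.2 q)) ->
  bg m0 p -> bg m (bdy m0 p) ->
  (\forall q \near p, carries e m0 h0 kD q) -> (\forall q \near p, carries e m1 h1 kD q) ->
  meq p (kcmp m0 m) m1 -> (exists2 m0', bg m0' (bdy m0 p) & bdy m0' (bdy m0 p) = p /\ meq (bdy m0 p) (kcmp m0' m0) kid) ->
  scgerm H m.1 m.2 (bdy m0 p).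
Proof.
move=> ae bo g g' c0 c1 em [m0' g0' [eb ei]].
have [b1 b2 b3 b4 _ _] := g; have [b1' b2' b3' b4' _ _] := g'.
have nb := near_body b1.
have E : \forall q \near p, pull m0.1 m0.2 (fun w => SD m.1 w - m.2 w * SD m.2 w) q = 0 /\ pull m0.1 m0.2 (SD m.2) q \is a GRing.unit.
  have n1 : \forall q \near p, bg m (gbody (m0.1 q)) by exact: nb (bg_near g').
  apply: filterS3 (filterI (filterI ae bo) (filterI (bg_near g) n1)) (filterI c0 c1) (near_near em) => q [[k1 k2] [k3 k4]] [k5 k6] k7.
  have [s1 s2 s3 s4 _ _] := k4; have [t1 t2 t3 t4 _ _] := k3.
  have hth : sh kD.2 (bdy m0 q) := sh_cst H th _; have h1' : sh kD.1 (bdy m0 q) := sh_cst H (1 : L) _.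
  have v F : sh F (bdy m0 q) -> vf q (e.1 q) (e.2 q) (pull m0.1 m0.2 F) = h0 q * pull m0.1 m0.2 (SD F) q.
    move=> hF; apply: (etrans (vf_pull k1 k2 k3 k5 h1' hth hF)); congr (_ * _).
    by apply: sev_near; near=> w; exact: vf_kD.
  case: (k5) => u1 u2 u3 _; case: (k6) => r1 r2 r3 [r4 r5].
  have w1 : vf q (e.1 q) (e.2 q) (pull m0.1 m0.2 m.1) = vf q (e.1 q) (e.2 q) m1.1.
    by apply: vf_near; apply: filterS k7 => w [].
  have w2 : vf q (e.1 q) (e.2 q) (pull m0.1 m0.2 m.2) = vf q (e.1 q) (e.2 q) m1.2.
    by apply: vf_near; apply: filterS k7 => w [].
  have to1 : godd (m1.2 q).
    have [_ <-] := near_at k7; have h := near_near s4.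
    exact: (sev_hom (near_at t3) (near_at t4) s4).
  have p1 : pull m1.1 m1.2 kD.2 q = m1.2 q := sev_th H (m1.1 q) to1.
  have p2 : pull m1.1 m1.2 kD.1 q = 1 := @pull_cst K H N m1.1 m1.2 1 q (@thfree1 K N).
  rewrite p1 in r4; rewrite p2 mulr1 in r5.
  have E1 : h0 q * pull m0.1 m0.2 (SD m.1) q = h1 q * m1.2 q by rewrite -(v _ s1) w1.
  have E2 : h0 q * pull m0.1 m0.2 (SD m.2) q = h1 q by rewrite -(v _ s2) w2.
  have j1 := sh_SD s1; have j2 := sh_SD s2.
  have mm := sevM (near_at t3) (near_at t4) s2 j2.
  have hN := shM s2 j2; have hc := sh_cst H (-1 : L) (bdy m0 q).
  have mN := sevM (near_at t3) (near_at t4) hc hN.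
  have dd := sevD (m0.2 q) j1 (shM hc hN).
  have f1 : thfree (-1 : L) by apply: thfreeN; exact: thfree1.
  have cN := @pull_cst K H N m0.1 m0.2 (-1) q f1.
  have ph : geven (pull m0.1 m0.2 (SD m.2) q).
    exact: (sev_hom (near_at t3) (near_at t4) (near_SD_hom H s4)).
  split.
    apply: (mulrI u3); rewrite mulr0.
    have -> : (fun w => SD m.1 w - m.2 w * SD m.2 w) = (fun w => SD m.1 w + -1 * (m.2 w * SD m.2 w)).
      by apply/funext => w; rewrite mulN1r.
    have -> : pull m0.1 m0.2 (fun w => SD m.1 w + -1 * (m.2 w * SD m.2 w)) q =
      pull m0.1 m0.2 (SD m.1) q - pull m0.1 m0.2 m.2 q * pull m0.1 m0.2 (SD m.2) q.
      apply: (etrans dd); congr (_ + _); apply: (etrans mN).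
      by rewrite -/(pull m0.1 m0.2 (fun=> -1) q) cN mulN1r mm.
    have [_ e2] := near_at k7.
    rewrite mulrBr E1 (_ : pull m0.1 m0.2 m.2 q = m1.2 q) // -(geven_comm (m1.2 q) ph) mulrA E2 subrr //.
  by move: r3; rewrite -E2 (geven_comm _ u2) (unitrMl _ u3).
have back (F : K -> L) : sh F (bdy m0 p) -> (\forall q \near p, pull m0.1 m0.2 F q = 0) -> \forall w \near bdy m0 p, F w = 0.
  move=> hF hz.
  have g0 : bg m0 (bdy m0' (bdy m0 p)) by rewrite eb.
  have hF' : sh F (bdy m0 (bdy m0' (bdy m0 p))) by rewrite eb.
  have pc := pull_comp' g0' g0 hF'.
  have hz' : \forall q \near bdy m0' (bdy m0 p), pull m0.1 m0.2 F q = 0 by rewrite eb.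
  have hz2 := near_body (bi_shZ g0') (near_near hz').
  apply: filterS3 (filterI pc hz2) (filterI ei (bi_To g0')) (pull_id hF) => w [k1 k2] [[k3 k3'] k4] k5.
  have z : pull m0'.1 m0'.2 (pull m0.1 m0.2 F) w = 0.
    apply: (etrans (sev_near H (m0'.2 w) k2)); exact: (@pull_cst K H N m0'.1 m0'.2 0 w (@thfree0 K N)).
  have e' : pull (kcmp m0' m0).1 (kcmp m0' m0).2 F w = pull kid.1 kid.2 F w by rewrite /SconfMaps.pull k3 k3'.
  by rewrite -k5; apply/esym; rewrite -{1}z; exact: (etrans k1 e').
split => //.
  have hs : sh (fun w => SD m.1 w - m.2 w * SD m.2 w) (bdy m0 p) := shB (sh_SD b1') (shM b2' (sh_SD b2')).
  have E0 : \forall q \near p, pull m0.1 m0.2 (fun w => SD m.1 w - m.2 w * SD m.2 w) q = 0 by apply: filterS E => q [].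
  by apply: filterS (back _ hs E0) => w /eqP; rewrite subr_eq0 => /eqP.
have [_] := near_at E; rewrite !gunitE /SconfMaps.pull (sev_body H (m0.1 p) (near_at b4)) //.
Unshelve. all: by end_near. Qed.

End Germs.

End BodyGerms.
Export BodyGerms.

Definition homeo_on (K : numClosedFieldType) (X : topologicalType) (U : set X) (f : X -> K) : Prop :=
  [/\ open U, set_inj U f, (forall x, U x -> {for x, continuous f})
    & forall O : set X, open O -> O `<=` U -> open (f @` O)].

Section Charts.
Variables (K : numClosedFieldType) (H : holoCalc K) (N : nat).
Local Notation kmap := (kmap K N).
Local Notation sh := (sh H).
Local Notation bg := (bg H).
Local Notation bdy := (@bdy K N).
Local Notation kcmp := (kcmp H).
Local Notation carries := (carries H).
Local Notation kid := (kid K N).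
Local Notation kD := (kD K N).

Definition msm (m : kmap) (p : K) := [/\ sh m.1 p, sh m.2 p, geven (m.1 p) & godd (m.2 p)].

(** Data apart from its properties, so that candidate charts can be assembled before they are shown
    to be charts. *)
Record chart_data (X : topologicalType) (I : Type) := ChartData {
  cd_dom : set X;
  cd_bd : X -> K;
  cd_to : I -> kmap;
  cd_from : I -> kmap
}.

Record chart_ok (X : topologicalType) (I : Type) (dom : I -> set X) (crd : I -> X -> K)
    (tr : I -> I -> kmap) (gen : I -> kmap) (c : chart_data X I) : Prop := ChartOk {
  co_homeo : homeo_on (cd_dom c) (cd_bd c);
  co_to_ok : forall i x, dom i x -> cd_dom c x -> msm (cd_to c i) (crd i x);
  co_from_ok : forall i x, dom i x -> cd_dom c x -> msm (cd_from c i) (cd_bd c x);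
  co_to_body : forall i x, dom i x -> cd_dom c x -> bdy (cd_to c i) (crd i x) = cd_bd c x;
  co_from_body : forall i x, dom i x -> cd_dom c x -> bdy (cd_from c i) (cd_bd c x) = crd i x;
  co_glue : forall i j x, dom i x -> dom j x -> cd_dom c x ->
    meqv (crd i x) (kcmp (tr i j) (cd_to c j)) (cd_to c i);
  co_toK : forall i x, dom i x -> cd_dom c x ->
    meqv (crd i x) (kcmp (cd_to c i) (cd_from c i)) kid;
  co_fromK : forall i x, dom i x -> cd_dom c x ->
    meqv (cd_bd c x) (kcmp (cd_from c i) (cd_to c i)) kid;
  co_conf : forall i, exists h, forall x, dom i x -> cd_dom c x ->
    carries (gen i) (cd_to c i) h kD (crd i x)
}.

(** A super Riemann surface over an abstract field. [k_ok] and [k_mk] say that the data indexed by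
    [kS] are exactly the admissible charts, so a locally constructed chart is an element of [kS]. *)
Record ksrs := KSrs {
  kX : topologicalType;
  kI : Type;
  kdom : kI -> set kX;
  kcrd : kI -> kX -> K;
  ktr : kI -> kI -> kmap;
  kgen : kI -> kmap;
  k_cover : forall x, exists i, kdom i x;
  k_homeo : forall i, homeo_on (kdom i) (kcrd i);
  k_tr_ok : forall i j x, kdom i x -> kdom j x -> msm (ktr i j) (kcrd i x);
  k_body : forall i j x, kdom i x -> kdom j x -> bdy (ktr i j) (kcrd i x) = kcrd j x;
  k_id : forall i x, kdom i x -> meqv (kcrd i x) (ktr i i) kid;
  k_comp : forall i j k x, kdom i x -> kdom j x -> kdom k x ->
    meqv (kcrd i x) (kcmp (ktr i j) (ktr j k)) (ktr i k);
  k_gen : forall i x, kdom i x ->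
    [/\ sh (kgen i).1 (kcrd i x), sh (kgen i).2 (kcrd i x),
        geven ((kgen i).1 (kcrd i x)) & godd ((kgen i).2 (kcrd i x))];
  k_gen1 : forall i x, kdom i x -> gbody ((kgen i).1 (kcrd i x)) != 0;
  k_gen2 : forall i x, kdom i x -> gbody (thp1 ((kgen i).2 (kcrd i x))) != 0;
  k_glue : forall i j, exists h, forall x, kdom i x -> kdom j x ->
    carries (kgen i) (ktr i j) h (kgen j) (kcrd i x);
  kS : Type;
  kdata : kS -> chart_data kX kI;
  k_ok : forall c, chart_ok kdom kcrd ktr kgen (kdata c);
  k_mk : forall d, chart_ok kdom kcrd ktr kgen d -> exists c, kdata c = d
}.

Section Atlas.
Variable S : ksrs.
Local Notation X := (kX S).
Local Notation idx := (kI S).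
Local Notation dom := (@kdom S).
Local Notation crd := (@kcrd S).
Local Notation tr := (@ktr S).
Local Notation gen := (@kgen S).
Local Notation sdom c := (cd_dom (kdata c)).
Local Notation sbd c := (cd_bd (kdata c)).
Local Notation sto c := (cd_to (kdata c)).
Local Notation sfrom c := (cd_from (kdata c)).
Implicit Types (i j k : idx) (x y : X) (c : kS S) (W : set X) (p q : K).

Lemma homeo_pts W (U : set X) (f : X -> K) x (Q : K -> Prop) : homeo_on U f -> open W -> W x -> U x ->
  (forall y, W y -> U y -> Q (f y)) -> \forall q \near f x, Q q.
Proof.
move=> [co _ _ im] Wo Wx cx h.
have o : open (f @` (W `&` U)) by apply: im; [exact: openI|move=> y []].
have : nbhs (f x) (f @` (W `&` U)) by apply: open_nbhs_nbhs; split => //; exists x.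
by apply: filterS => q [y [Wy cy] <-]; exact: h.
Qed.

Lemma dopen i : open (dom i). Proof. by have [] := k_homeo i. Qed.

Lemma msm_bg (m m' : kmap) p : (\forall q \near p, msm m q) -> (sh m'.1 (bdy m p) /\ sh m'.2 (bdy m p)) ->
  meq p (kcmp m m') kid -> bg m p.
Proof.
move=> n [h1 h2] e; have [a1 a2 _ _] := near_at n.
by apply: (bi_left_inverse a1 a2 _ _ h1 h2 e); apply: filterS n => q [].
Qed.

Lemma meq_tr_id i x : dom i x -> meq (crd i x) (tr i i) kid.
Proof. by move=> h; apply: (homeo_pts (k_homeo i) (dopen i) h h) => y hy _; exact: k_id. Qed.
Lemma meq_tr_comp i j k x : dom i x -> dom j x -> dom k x ->
  meq (crd i x) (kcmp (tr i j) (tr j k)) (tr i k).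
Proof.
move=> hi hj hk; apply: (homeo_pts (k_homeo i) (openI (dopen j) (dopen k)) (conj hj hk) hi).
by move=> y [yj yk] yi; exact: k_comp.
Qed.
Lemma bg_tr i j x : dom i x -> dom j x -> bg (tr i j) (crd i x).
Proof.
move=> hi hj; apply: (@msm_bg _ (tr j i)).
- by apply: (homeo_pts (k_homeo i) (dopen j) hj hi) => y yj yi; exact: k_tr_ok.
- by rewrite (k_body hi hj); have [] := k_tr_ok hj hi.
exact: meq_trans (meq_tr_comp hi hj hi) (meq_tr_id hi).
Qed.

Section Ok.
Variable d : chart_data X idx.
Hypothesis ok : chart_ok dom crd tr gen d.
Lemma co_open : open (cd_dom d). Proof. by have [] := co_homeo ok. Qed.
Lemma meq_toK i x : dom i x -> cd_dom d x -> meq (crd i x) (kcmp (cd_to d i) (cd_from d i)) kid.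
Proof. by move=> hi hd; apply: (homeo_pts (k_homeo i) co_open hd hi) => y yd yi; exact: (co_toK ok yi yd). Qed.
Lemma meq_fromK i x : dom i x -> cd_dom d x -> meq (cd_bd d x) (kcmp (cd_from d i) (cd_to d i)) kid.
Proof. by move=> hi hd; apply: (homeo_pts (co_homeo ok) (dopen i) hi hd) => y yi yd; exact: (co_fromK ok yi yd). Qed.
Lemma meq_glue i j x : dom i x -> dom j x -> cd_dom d x ->
  meq (crd i x) (kcmp (tr i j) (cd_to d j)) (cd_to d i).
Proof.
move=> hi hj hd; apply: (homeo_pts (k_homeo i) (openI (dopen j) co_open) (conj hj hd) hi).
by move=> y [yj yd] yi; exact: (co_glue ok yi yj yd).
Qed.
Lemma bg_to i x : dom i x -> cd_dom d x -> bg (cd_to d i) (crd i x).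
Proof.
move=> hi hd; apply: (@msm_bg _ (cd_from d i)); last exact: meq_toK.
- by apply: (homeo_pts (k_homeo i) co_open hd hi) => y yd yi; exact: (co_to_ok ok yi yd).
- by rewrite (co_to_body ok hi hd); have [] := co_from_ok ok hi hd.
Qed.
Lemma bg_from i x : dom i x -> cd_dom d x -> bg (cd_from d i) (cd_bd d x).
Proof.
move=> hi hd; apply: (@msm_bg _ (cd_to d i)); last exact: meq_fromK.
- by apply: (homeo_pts (co_homeo ok) (dopen i) hi hd) => y yi yd; exact: (co_from_ok ok yi yd).
- by rewrite (co_from_body ok hi hd); have [] := co_to_ok ok hi hd.
Qed.
End Ok.

Definition ctr c c' i : kmap := kcmp (sfrom c i) (sto c' i).

(** The map from [c] to the i-th coordinates followed by [tr i j] is the map to the j-th ones, since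
    both invert [sto c j]. *)
Lemma meq_ctr_indep c c' i j x : dom i x -> dom j x -> sdom c x -> sdom c' x ->
  meq (sbd c x) (ctr c c' i) (ctr c c' j).
Proof.
move=> hi hj h h'; have ok := k_ok c; have ok' := k_ok c'.
have gfi := bg_from ok hi h; have gfj := bg_from ok hj h.
have bfi := co_from_body ok hi h; have bfj := co_from_body ok hj h.
have gtr : bg (tr i j) (bdy (sfrom c i) (sbd c x)) by rewrite bfi; exact: bg_tr.
have btr : bdy (tr i j) (bdy (sfrom c i) (sbd c x)) = crd j x by rewrite bfi; exact: k_body.
have [to1 to2 _ _] := co_to_ok ok hj h; have [to1' to2' _ _] := co_to_ok ok' hj h'.
have [fr1 fr2 _ _] := co_from_ok ok hj h.
(* from_i followed by tr_ij is from_j *)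
have e : meq (sbd c x) (kcmp (sfrom c i) (tr i j)) (sfrom c j).
  have g1 : bg (kcmp (sfrom c i) (tr i j)) (sbd c x) by exact: bg_cmp.
  have b1 : bdy (kcmp (sfrom c i) (tr i j)) (sbd c x) = crd j x by rewrite bdy_cmp.
  have s1 : meq (sbd c x) (kcmp (kcmp (sfrom c i) (tr i j)) (sto c j)) kid.
    have a := meqA gfi gtr; rewrite btr in a; have {}a := a _ to1 to2.
    apply: (meq_trans a); apply: meq_trans (meq_fromK ok hi h).
    by apply: (meq_r gfi); rewrite bfi; exact: (meq_glue ok hi hj h).
  have gto : bg (sto c j) (bdy (kcmp (sfrom c i) (tr i j)) (sbd c x)) by rewrite b1; exact: bg_to.
  have a := meqA g1 gto; rewrite b1 (co_to_body ok hj h) in a; have {}a := a _ fr1 fr2.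
  have s2 : meq (sbd c x) (kcmp (kcmp (sfrom c i) (tr i j)) (kcmp (sto c j) (sfrom c j))) (kcmp (sfrom c i) (tr i j)).
    apply: meq_trans (meq_idr g1); apply: (meq_r g1); rewrite b1; exact: (meq_toK ok hj h).
  apply: (meq_trans (meq_sym s2)); apply: (meq_trans (meq_sym a)).
  apply: (meq_trans (meq_l H (sfrom c j) s1)); exact: meq_idl.
have a := meqA gfi gtr; rewrite btr in a; have {}a := a _ to1' to2'.
have s : meq (sbd c x) (kcmp (sfrom c i) (kcmp (tr i j) (sto c' j))) (ctr c c' i).
  by apply: (meq_r gfi); rewrite bfi; exact: (meq_glue ok' hi hj h').
apply: (meq_trans (meq_sym s)); apply: (meq_trans (meq_sym a)); exact: meq_l.
Qed.

Lemma bg_ctr c c' i x : dom i x -> sdom c x -> sdom c' x ->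
  bg (ctr c c' i) (sbd c x) /\ bdy (ctr c c' i) (sbd c x) = sbd c' x.
Proof.
move=> hi h h'; have ok := k_ok c; have ok' := k_ok c'.
have gf := bg_from ok hi h; have bf := co_from_body ok hi h.
split; first by apply: (bg_cmp gf); rewrite bf; exact: (bg_to ok' hi h').
by rewrite bdy_cmp // bf; exact: (co_to_body ok' hi h').
Qed.

Lemma to_ctr c c' i x : dom i x -> sdom c x -> sdom c' x ->
  meq (crd i x) (kcmp (sto c i) (ctr c c' i)) (sto c' i).
Proof.
move=> hi h h'; have ok := k_ok c; have ok' := k_ok c'.
have gt := bg_to ok hi h; have bt := co_to_body ok hi h.
have gf : bg (sfrom c i) (bdy (sto c i) (crd i x)) by rewrite bt; exact: bg_from.
have [to1 to2 _ _] := co_to_ok ok' hi h'.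
have a := meqA gt gf; rewrite bt (co_from_body ok hi h) in a; have {}a := a _ to1 to2.
apply: (meq_trans (meq_sym a)); apply: (meq_trans (meq_l H (sto c' i) (meq_toK ok hi h))).
exact: meq_idl.
Qed.

Lemma ctr_comp c c' c'' i x : dom i x -> sdom c x -> sdom c' x -> sdom c'' x ->
  meq (sbd c x) (kcmp (ctr c c' i) (ctr c' c'' i)) (ctr c c'' i).
Proof.
move=> hi h h' h''; have ok := k_ok c; have ok' := k_ok c'.
have gf := bg_from ok hi h; have bf := co_from_body ok hi h.
have gt : bg (sto c' i) (bdy (sfrom c i) (sbd c x)) by rewrite bf; exact: (bg_to ok').
have [g2 _] := bg_ctr hi h' h''.
have a := meqA gf gt; rewrite bf (co_to_body ok' hi h') in a.
have {}a := a _ (bi_shZ g2) (bi_shT g2).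
apply: (meq_trans a); apply: (meq_r gf); rewrite bf; exact: to_ctr.
Qed.

Lemma gen_near i x : dom i x -> (\forall q \near crd i x, geven ((gen i).1 q)) /\
  (\forall q \near crd i x, godd ((gen i).2 q)).
Proof.
by move=> hi; split; apply: (homeo_pts (k_homeo i) (dopen i) hi hi) => y yi _; have [] := k_gen yi.
Qed.

Lemma sc_ctr c c' i x : dom i x -> sdom c x -> sdom c' x ->
  scgerm H (ctr c c' i).1 (ctr c c' i).2 (sbd c x).
Proof.
move=> hi h h'; have ok := k_ok c; have ok' := k_ok c'.
have gt := bg_to ok hi h; have bt := co_to_body ok hi h.
have [h0 c0] := co_conf ok i; have [h1 c1] := co_conf ok' i.
have n0 : \forall q \near crd i x, carries (gen i) (sto c i) h0 kD q.
  by apply: (homeo_pts (k_homeo i) (co_open ok) h hi) => y yd yi; exact: c0.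
have n1 : \forall q \near crd i x, carries (gen i) (sto c' i) h1 kD q.
  by apply: (homeo_pts (k_homeo i) (co_open ok') h' hi) => y yd yi; exact: c1.
have [ae bo] := gen_near hi; have [gc bc] := bg_ctr hi h h'.
rewrite -bt in gc *.
apply: (scgerm_along ae bo gt gc n0 n1 (to_ctr hi h h')).
by rewrite bt; exists (sfrom c i); [exact: bg_from|split; [exact: (co_from_body ok hi h)|exact: (meq_fromK ok hi h)]].
Qed.

(** An invertible germ adapted to the generator is a chart on a small open set. Its expressions in
    the other coordinates are composites with [tr], and uniqueness of inverses reduces the axioms to
    the chart [i]. *)
Lemma mk_chart i x (m : kmap) h W : dom i x -> open W -> W x -> bg m (crd i x) ->
  (\forall q \near crd i x, carries (gen i) m h kD q) ->
  exists c, [/\ sdom c x, sdom c `<=` W `&` dom i & forall y, sdom c y -> meq (crd i y) (sto c i) m].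
Proof.
move=> hi Wo Wx g ca; have [m1 [m2 [g' eb e1 e2]]] := inverse_germ g.
pose m' : kmap := (m1, m2).
have [co inj ct im] := k_homeo i.
(* All germ identities that the axioms of a chart will use, at once; the domain is cut out by their
   conjunction. *)
have n1 : \forall q \near crd i x, [/\ bg m q, carries (gen i) m h kD q, meq q (kcmp m m') kid &
    [/\ bg m' (bdy m q), meq (bdy m q) (kcmp m' m) kid & bdy m' (bdy m q) = q]].
  have nb := near_body (bi_shZ g).
  have k1 : \forall q \near crd i x, bg m' (bdy m q) by exact: (nb _ (bg_near (m := m') g')).
  have k2 : \forall q \near crd i x, meq (bdy m q) (kcmp m' m) kid by exact: (nb _ (near_near e2)).
  have k3 : \forall q \near crd i x, meq q (kcmp m m') kid by exact: near_near e1.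
  apply: filterS3 (filterI (bg_near g) ca) k3 (filterI k1 k2) => q [a b] d [f f']; split => //; split => //.
  have [d1 _] := near_at d; have := bdy_cmp m' a; rewrite /BodyGerms.bdy d1 /= gbody_alg => <- //.
have n2 := ct x hi _ n1.
have : nbhs x [set y | [/\ bg m (crd i y), carries (gen i) m h kD (crd i y), meq (crd i y) (kcmp m m') kid &
    [/\ bg m' (bdy m (crd i y)), meq (bdy m (crd i y)) (kcmp m' m) kid & bdy m' (bdy m (crd i y)) = crd i y]]] by exact: n2.
rewrite nbhsE => -[U1 [Oo Ox] OP].
pose U := (U1 `&` W) `&` dom i.
have Uo : open U by apply: openI => //; exact: openI.
have UP y : U y -> [/\ bg m (crd i y), carries (gen i) m h kD (crd i y), meq (crd i y) (kcmp m m') kid &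
    [/\ bg m' (bdy m (crd i y)), meq (bdy m (crd i y)) (kcmp m' m) kid & bdy m' (bdy m (crd i y)) = crd i y]].
  by move=> [[/OP]].
clear n1 n2.
pose d : chart_data X idx := ChartData U (fun y => bdy m (crd i y)) (fun j => kcmp (tr j i) m) (fun j => kcmp m' (tr i j)).
have hom : homeo_on U (cd_bd d).
  split => //.
  - move=> y z; rewrite !inE /= => Uy Uz e.
    have [_ _ _ [_ _ ey]] := UP y Uy; have [_ _ _ [_ _ ez]] := UP z Uz.
    by apply: inj; rewrite ?inE; [exact: Uy.2|exact: Uz.2|rewrite -ey -ez e].
  - move=> y Uy; have [[s1 _ _ _ _ _] _ _ _] := UP y Uy.
    exact: (@continuous_comp _ _ _ (crd i) (fun q => gbody (m.1 q)) y (ct y Uy.2) (hc_cts (holo_body s1))).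
  (* Openness of the image: near an image point, [w] is the image of the point whose i-th coordinate
     is the body of [m'] at [w]. *)
  move=> O' O'o O'U; rewrite openE => _ [y O'y <-].
  have [_ _ _ [gm' em eby]] := UP y (O'U y O'y).
  have o : open (crd i @` O') by apply: im => // z /O'U [].
  have n3 : \forall q \near bdy m' (bdy m (crd i y)), (crd i @` O') q.
    by rewrite eby; apply: open_nbhs_nbhs; split => //; exists y.
  have n4 := near_body (bi_shZ gm') n3.
  apply: filterS3 n4 em (bi_To gm') => w [z O'z ez] [k1 _] k2; exists z => //.
  have := congr1 (@gbody _ _) k1; rewrite /= gbody_alg => <-.
  by rewrite /SconfMaps.pull (sev_body H (m'.1 w) k2) /BodyGerms.bdy ez.
have bgt j y : dom j y -> U y -> bg (kcmp (tr j i) m) (crd j y).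
  move=> yj Uy; apply: (bg_cmp (bg_tr yj Uy.2)).
  by rewrite (k_body yj Uy.2); have [] := UP y Uy.
have bgf j y : dom j y -> U y -> bg (kcmp m' (tr i j)) (bdy m (crd i y)).
  move=> yj Uy; have [_ _ _ [a _ b]] := UP y Uy; apply: (bg_cmp a).
  by rewrite b; exact: (bg_tr Uy.2 yj).
have ok : chart_ok dom crd tr gen d.
  split => //=.
  - by move=> j y yj Uy; have [a1 a2 a3 a4 _ _] := bgt j y yj Uy; split => //; [exact: near_at a3|exact: near_at a4].
  - by move=> j y yj Uy; have [a1 a2 a3 a4 _ _] := bgf j y yj Uy; split => //; [exact: near_at a3|exact: near_at a4].
  - by move=> j y yj Uy; rewrite (bdy_cmp m (bg_tr yj Uy.2)) (k_body yj Uy.2).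
  - move=> j y yj Uy; have [_ _ _ [a _ b]] := UP y Uy.
    by rewrite (bdy_cmp (tr i j) a) b (k_body Uy.2 yj).
  - move=> j k y yj yk Uy; have yi := Uy.2; have [gm _ _ _] := UP y Uy.
    have gji := bg_tr yj yk.
    have gki : bg (tr k i) (bdy (tr j k) (crd j y)) by rewrite (k_body yj yk); exact: bg_tr.
    have a := meqA gji gki; rewrite (k_body yj yk) (k_body yk yi) in a.
    have {}a := a _ (bi_shZ gm) (bi_shT gm).
    exact: near_at (meq_trans (meq_sym a) (meq_l H (m) (meq_tr_comp yj yk yi))).
  - move=> j y yj Uy; have yi := Uy.2; have [gm _ e3 [gm' e4 e5]] := UP y Uy.
    have gji := bg_tr yj yi; have gij := bg_tr yi yj.
    have gm1 : bg m (bdy (tr j i) (crd j y)) by rewrite (k_body yj yi).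
    have gf := bgf j y yj Uy.
    have a := meqA gji gm1; rewrite (k_body yj yi) in a; have {}a := a _ (bi_shZ gf) (bi_shT gf).
    have a2 := meqA gm gm'; rewrite e5 in a2; have {}a2 := a2 _ (bi_shZ gij) (bi_shT gij).
    have s1 : meq (crd i y) (kcmp m (kcmp m' (tr i j))) (tr i j).
      apply: (meq_trans (meq_sym a2)); apply: (meq_trans (meq_l H (tr i j) e3)).
      exact: (meq_idl (bi_shZ gij) (bi_shT gij)).
    apply: (near_at (meq_trans a (meq_trans _ (meq_trans (meq_tr_comp yj yi yj) (meq_tr_id yj))))).
    by apply: (meq_r gji); rewrite (k_body yj yi).
  - move=> j y yj Uy; have yi := Uy.2; have [gm _ e3 [gm' e4 e5]] := UP y Uy.
    have gij : bg (tr i j) (bdy m' (bdy m (crd i y))) by rewrite e5; exact: bg_tr.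
    have gij0 := bg_tr yi yj.
    have gt := bgt j y yj Uy; have gji := bg_tr yj yi.
    have a := meqA gm' gij; rewrite e5 (k_body yi yj) in a; have {}a := a _ (bi_shZ gt) (bi_shT gt).
    have gji' : bg (tr j i) (bdy (tr i j) (crd i y)) by rewrite (k_body yi yj).
    have a2 := meqA gij0 gji'; rewrite (k_body yi yj) (k_body yj yi) in a2; have {}a2 := a2 _ (bi_shZ gm) (bi_shT gm).
    apply: (near_at (meq_trans a (meq_trans _ e4))); apply: (meq_r gm'); rewrite e5.
    apply: (meq_trans (meq_sym a2)).
    apply: (meq_trans (meq_l H (m) (meq_trans (meq_tr_comp yi yj yi) (meq_tr_id yi)))).
    exact: (meq_idl (bi_shZ gm) (bi_shT gm)).
  move=> j; have [hj cj] := k_glue j i; exists (fun q => hj q * pull H (tr j i).1 (tr j i).2 h q) => y yj Uy.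
  have yi := Uy.2; have [gm cm _ _] := UP y Uy.
  have [g1 g2 g3 g4] := k_gen yj; have [g1' g2' _ _] := k_gen yi.
  rewrite -(k_body yj yi) in g1' g2'.
  have gm1 : bg m (bdy (tr j i) (crd j y)) by rewrite (k_body yj yi).
  have ca' : \forall w \near bdy (tr j i) (crd j y), carries (gen i) m h kD w.
    rewrite (k_body yj yi).
    by apply: (homeo_pts (k_homeo i) Uo Uy yi) => z Uz zi; have [] := UP z Uz.
  have s1 : sh kD.1 (bdy m (bdy (tr j i) (crd j y))) := sh_cst H 1 _.
  have s2 : sh kD.2 (bdy m (bdy (tr j i) (crd j y))) := sh_cst H _ _.
  exact: (carries_comp g3 g4 (bg_tr yj yi) gm1 g1' g2' s1 s2 (cj y yj yi) ca').
have [c cE] := k_mk ok; exists c; rewrite cE; split.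
- by [].
- by move=> y [[_ yW] yi].
move=> y Uy; have [gy _ _ _] := UP y Uy.
apply: (meq_trans (meq_l H (m) (meq_tr_id Uy.2))).
exact: (meq_idl (bi_shZ gy) (bi_shT gy)).
Qed.

(** The new chart is the germ [(Z, T)] after the chart [c], expressed in the i-th coordinates;
    [along_pull] shows that it is superconformal. *)
Lemma trans_flat c i x (Z T : K -> grass K N.+1) W : dom i x -> sdom c x -> open W -> W x ->
  scgerm H Z T (sbd c x) ->
  exists c', [/\ sdom c' x, sdom c' `<=` (W `&` sdom c) `&` dom i &
    forall y, sdom c' y -> meq (sbd c y) (ctr c c' i) (Z, T)].
Proof.
move=> hi h Wo Wx sg; have ok := k_ok c; have [h0 c0] := co_conf ok i.
have gt := bg_to ok hi h; have bt := co_to_body ok hi h.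
have n0 : \forall q \near crd i x, carries (gen i) (sto c i) h0 kD q.
  by apply: (homeo_pts (k_homeo i) (co_open ok) h hi) => y yd yi; exact: c0.
have [ae bo] := gen_near hi; have [ga gb _ _] := k_gen hi.
have gm : bg (Z, T) (bdy (sto c i) (crd i x)) by rewrite bt; exact: sc_bigerm.
have sg' : scgerm H Z T (gbody ((sto c i).1 (crd i x))) by move: bt; rewrite /BodyGerms.bdy => ->.
have al : along H (gen i).1 (gen i).2 (sto c i).1 (sto c i).2 h0 (crd i x).
  split.
  - by have [] := near_at n0.
  - by apply: filterS n0 => q [].
  - by have [] := near_at n0.
  - apply: filterS2 n0 (bi_To gt) => q [_ _ _ [e _]] to.
    by apply: (etrans e); congr (_ * _); exact: (sev_th H ((sto c i).1 q) to).
  - apply: filterS n0 => q [_ _ _ [_ e]]; apply: (etrans e).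
    by rewrite (@pull_cst K H N (sto c i).1 (sto c i).2 1 q (@thfree1 K N)) mulr1.
have [a1 a2 a3 a4 a5] := along_pull ga gb ae bo gt al sg'.
have gc : bg (kcmp (sto c i) (Z, T)) (crd i x) by exact: bg_cmp.
pose h1 q := h0 q * pull H (sto c i).1 (sto c i).2 (SD H T) q.
have cc : \forall q \near crd i x, carries (gen i) (kcmp (sto c i) (Z, T)) h1 kD q.
  apply: filterS3 (filterI (sh_near a1) a2) (filterI (near_unit a1 a3) (bi_To gc)) (filterI a4 a5) => q [k1 k2] [k3 k4] [k5 k6].
  split => //; split; first by apply: (etrans k5); congr (_ * _); apply/esym/(sev_th H ((kcmp (sto c i) (Z, T)).1 q) k4).
  by apply: (etrans k6); rewrite (@pull_cst K H N (kcmp (sto c i) (Z, T)).1 (kcmp (sto c i) (Z, T)).2 1 q (@thfree1 K N)) mulr1.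
have [_ _ ct _] := co_homeo ok.
have : nbhs x [set y | scgerm H Z T (sbd c y)] by exact: (ct x h _ (sc_near sg)).
rewrite nbhsE => -[V1 [Vo Vx] VP].
have Wo' : open ((W `&` sdom c) `&` V1) by apply: openI => //; apply: openI => //; exact: co_open.
have [c' [hc' sub em]] := mk_chart hi Wo' (conj (conj Wx h) Vx) gc cc; exists c'; split => //.
  by move=> y /sub[[[]]].
move=> y /[dup] /em {}em /sub[[[yW yc] /VP sgy] yi].
have gf := bg_from ok yi yc; have bf := co_from_body ok yi yc.
have e1 : meq (sbd c y) (ctr c c' i) (kcmp (sfrom c i) (kcmp (sto c i) (Z, T))).
  by apply: (meq_r gf); rewrite bf.
apply: (meq_trans e1).
have gto : bg (sto c i) (bdy (sfrom c i) (sbd c y)) by rewrite bf; exact: bg_to.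
have a := meqA gf gto; rewrite bf (co_to_body ok yi yc) in a; have gm' := sc_bigerm sgy.
have {}a := a (Z, T) (bi_shZ gm') (bi_shT gm').
apply: (meq_trans (meq_sym a)); apply: (meq_trans (meq_l H (Z, T) (meq_fromK ok yi yc))).
exact: (meq_idl (m := (Z, T)) (bi_shZ gm') (bi_shT gm')).
Qed.

Lemma chart_cover x : exists c, sdom c x.
Proof.
have [i hi] := k_cover x; have [ga gb _ _] := k_gen hi; have [ae bo] := gen_near hi.
have [Z [T [h [g al]]]] := superconformal_coordinates ga gb ae bo (k_gen1 hi) (k_gen2 hi).
have cc : \forall q \near crd i x, carries (gen i) (Z, T) h kD q.
  have [a1 a2 a3 a4 a5] := al.
  apply: filterS3 (filterI (sh_near a1) a2) (filterI (near_unit a1 a3) (bi_To g)) (filterI a4 a5) => q [k1 k2] [k3 k4] [k5 k6].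
  split => //; split; first by apply: (etrans k5); congr (_ * _); apply/esym/(sev_th H (Z q) k4).
  by apply: (etrans k6); rewrite (@pull_cst K H N Z T 1 q (@thfree1 K N)) mulr1.
have [c [hc _ _]] := mk_chart (m := (Z, T)) hi openT I g cc; by exists c.
Qed.

(* The transition from c to c' at a point, through any chart of the atlas
   around that point. *)
Definition ctrans c c' : kmap :=
  let pick q := if pselect (exists x, sdom c x /\ sbd c x = q) is left ex
    then Some (projT1 (cid (k_cover (projT1 (cid ex))))) else None in
  (fun q => if pick q is Some i then (ctr c c' i).1 q else 0,
   fun q => if pick q is Some i then (ctr c c' i).2 q else 0).

Lemma ctransE c c' i x : dom i x -> sdom c x -> sdom c' x -> meqv (sbd c x) (ctrans c c') (ctr c c' i).
Proof.
move=> hi h h'; rewrite /meqv /ctrans /=.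
case: pselect => [ex|n]; last by exfalso; apply: n; exists x.
case: cid => y [cy e] /=; case: cid => j jy /=.
have [_ inj _ _] := co_homeo (k_ok c).
have yx : y = x by apply: inj; rewrite ?inE.
rewrite yx in jy; exact: near_at (meq_ctr_indep jy hi h h').
Qed.

Lemma ctrans_near c c' i x : dom i x -> sdom c x -> sdom c' x -> meq (sbd c x) (ctrans c c') (ctr c c' i).
Proof.
move=> hi h h'.
apply: (homeo_pts (co_homeo (k_ok c)) (openI (dopen i) (co_open (k_ok c'))) (conj hi h') h).
by move=> y [yi y'] cy; exact: ctransE.
Qed.

Lemma satl_sc c c' x : sdom c x -> sdom c' x -> scgerm H (ctrans c c').1 (ctrans c c').2 (sbd c x).
Proof.
move=> h h'; have [i hi] := k_cover x; have e := ctrans_near hi h h'.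
by apply: sc_ext (sc_ctr hi h h'); apply: filterS e => q [].
Qed.

Lemma satl_body c c' x : sdom c x -> sdom c' x -> bdy (ctrans c c') (sbd c x) = sbd c' x.
Proof.
move=> h h'; have [i hi] := k_cover x; have [e _] := ctransE hi h h'.
by rewrite /BodyGerms.bdy e; have [_] := bg_ctr hi h h'.
Qed.

Lemma satl_id c x : sdom c x -> meqv (sbd c x) (ctrans c c) kid.
Proof.
move=> h; have [i hi] := k_cover x; have [e1 e2] := ctransE hi h h.
have [e3 e4] := co_fromK (k_ok c) hi h.
by split; [exact: etrans e1 e3|exact: etrans e2 e4].
Qed.

Lemma satl_comp c c' c'' x : sdom c x -> sdom c' x -> sdom c'' x ->
  meqv (sbd c x) (ctrans c c'') (kcmp (ctrans c c') (ctrans c' c'')).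
Proof.
move=> h h' h''; have [i hi] := k_cover x.
have e1 := ctrans_near hi h h''; have e2 := ctrans_near hi h h'; have e3 := ctrans_near hi h' h''.
have [g b] := bg_ctr hi h h'.
have s1 : meq (sbd c x) (kcmp (ctr c c' i) (ctrans c' c'')) (kcmp (ctr c c' i) (ctr c' c'' i)).
  by apply: (meq_r g); rewrite b.
have s2 := meq_trans (meq_l H (ctrans c' c'') e2) (meq_trans s1 (ctr_comp hi h h' h'')).
exact: near_at (meq_trans e1 (meq_sym s2)).
Qed.

Lemma satl_flat c x (Z T : K -> grass K N.+1) W : sdom c x -> open W -> W x -> scgerm H Z T (sbd c x) ->
  exists c', [/\ sdom c' x, sdom c' `<=` W `&` sdom c & forall y, sdom c' y ->
    (ctrans c c').1 (sbd c y) = Z (sbd c y) /\ (ctrans c c').2 (sbd c y) = T (sbd c y)].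
Proof.
move=> h Wo Wx sg; have [i hi] := k_cover x; have [c' [h' sub e]] := trans_flat hi h Wo Wx sg.
exists c'; split => // [y /sub[]//|y cy].
have [[_ yc] yi] := sub y cy.
exact: near_at (meq_trans (ctrans_near yi yc cy) (e y cy)).
Qed.

Definition ksatl : satl H N := SAtl (fun c => co_homeo (k_ok c)) chart_cover satl_sc satl_body satl_id
  satl_comp satl_flat.

End Atlas.
End Charts.

(** * Superprojective atlases from connections *)

Section Flat.
Variables (K : numClosedFieldType) (H : holoCalc K) (N : nat) (A : satl H N).
Local Notation SD := (SD H).
Local Notation uinv := (uinv H).
Local Notation chart := (aC A).
Local Notation dom := (@adom K H N A).
Local Notation bd := (@abd K H N A).
Local Notation Z := (@aZ K H N A).
Local Notation T := (@aT K H N A).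
Local Notation D3u := (@D3u K H N A).

Definition vanishing (om : chart -> K -> grass K N.+1) (c : chart) : Prop :=
  forall x, dom c x -> om c (bd c x) = 0.

Lemma vanishing_near om c x : vanishing om c -> dom c x -> \forall q \near bd c x, om c q = 0.
Proof. by move=> h cx; apply: (near_pts (dom_open c) cx cx) => y _; exact: h. Qed.

Lemma J2_inj (j a : grass K N.+1) : j \is a GRing.unit -> j ^+ 2 * a = 0 -> a = 0.
Proof.
move=> ju e; have j2 : j ^+ 2 \is a GRing.unit by rewrite unitrX.
by apply: (mulrI j2); rewrite e mulr0.
Qed.

Lemma tpull0 c c' x (F : K -> grass K N.+1) : dom c x -> dom c' x -> (\forall q \near bd c' x, F q = 0) ->
  \forall q \near bd c x, tpull c c' F q = 0.
Proof.
move=> h h' e; rewrite -(a_body h h') in e.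
apply: filterS (pull_ext (a_sc h h') e) => q k; apply: (etrans k).
exact: (@pull_cst K H N (Z c c') (T c c') 0 q (@thfree0 K N)).
Qed.

Lemma law_vanish om c c' x : gconn om -> dom c x -> dom c' x ->
  (\forall q \near bd c x, om c q * uinv (T c c') q = D3u c c' q) ->
  \forall q \near bd c' x, om c' q = 0.
Proof.
move=> G h h' e; apply: (tpull_inj h h' (gc_sh G h')).
apply: filterS3 (gc_law_near G h h') e (J_unit h h') => q k1 k2 k3.
by apply: (J2_inj k3); move/eqP: k1; rewrite k2 -subr_eq subrr eq_sym => /eqP.
Qed.

Lemma flat_cover om : gconn om -> cover_ok (vanishing om).
Proof.
move=> G; split=> [x|c c' vc vc' x h h'].
  have [c cx] := a_cover x.
  have oo : \forall q \near bd c x, godd (om c q).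
    by apply: (near_pts (dom_open c) cx cx) => y _ cy; exact: gc_odd.
  have [Z1 [T1 [sg e]]] := flat_coordinates (gc_sh G cx) oo.
  have : nbhs x [set y | \forall q \near bd c y, SD (SD (SD (uinv T1))) q = om c q * uinv T1 q].
    by have := near_X cx (near_near e); exact.
  rewrite nbhsE => -[W [Wo Wx] WP].
  have [c' [c'x sub tr]] := a_flat cx Wo Wx sg; exists c' => // y c'y.
  have [Wy cy] := sub y c'y.
  have eT : \forall q \near bd c y, T c c' q = T1 q.
    by apply: (near_pts (dom_open c') c'y cy) => z c'z _; have [] := tr z c'z.
  have eu : \forall q \near bd c y, uinv (T c c') q = uinv T1 q.
    by apply: filterS (near_SD' H eT) => q; rewrite /PullbackComp.uinv => ->.
  apply: (near_at (law_vanish G cy c'y _)).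
  apply: filterS3 (WP y Wy) eu (near_SD' H (near_SD' H (near_SD' H eu))) => q k1 k2 k3.
  by rewrite k2; apply/esym/(etrans k3).
apply: filterS3 (gc_law_near G h h') (vanishing_near vc h) (tpull0 h h' (vanishing_near vc' h')) => q k1 k2 k3.
by move: k1; rewrite k2 k3 mul0r mulr0 add0r => e; exact: (esym e).
Qed.

(** Around a point a chart [c2] with [om' = 0] is taken. Being SPL_2-related to charts with
    [om = 0], it also has [om = 0]; the law then expresses both potentials in [c] as D^3 u / u for
    the transition to [c2]. *)
Lemma vanishing_inj om om' : gconn om -> gconn om' ->
  (forall c c', vanishing om c -> vanishing om' c' -> srel c c') ->
  forall c x, dom c x -> om c (bd c x) = om' c (bd c x).
Proof.
move=> G G' h c x cx.
have [c1 v1 c1x] := (flat_cover G).1 x; have [c2 v2 c2x] := (flat_cover G').1 x.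
have om2 : \forall q \near bd c2 x, om c2 q = 0.
  apply: (law_vanish G c1x c2x).
  by apply: filterS2 (h c1 c2 v1 v2 x c1x c2x) (vanishing_near v1 c1x) => q -> ->; rewrite mul0r.
have l1 := gc_law G cx c2x; have l2 := gc_law G' cx c2x.
have z1 := near_at (tpull0 cx c2x om2); have z2 := near_at (tpull0 cx c2x (vanishing_near v2 c2x)).
rewrite z1 mulr0 add0r in l1; rewrite z2 mulr0 add0r in l2.
have uU : uinv (T c c2) (bd c x) \is a GRing.unit by rewrite unitrV; exact: near_at (J_unit cx c2x).
by apply: (mulIr uU); rewrite l1 l2.
Qed.

(** Relatedness is local, so a chart of [S2] around the point links a chart of [S1] with one of
    [S3]. *)
Lemma cover_trans (S1 S2 S3 : chart -> Prop) : cover_ok (fun c => S1 c \/ S2 c) -> cover_ok S2 ->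
  cover_ok (fun c => S2 c \/ S3 c) -> cover_ok S1 -> cover_ok S3 -> cover_ok (fun c => S1 c \/ S3 c).
Proof.
move=> [_ h12] [c2 _] [_ h23] [c1 h1] [_ h3]; split=> [x|c c'].
  by have [c Sc cx] := c1 x; exists c => //; left.
have cross a b : S1 a -> S3 b -> srel a b.
  move=> Sa Sb x ax bx; have [e Se ex] := c2 x.
  by apply: (flat_trans ax ex bx); [apply: h12 => //; [left|right]|apply: h23 => //; [left|right]].
move=> [a|a] [b|b]; [exact: h1|exact: cross|exact/srel_sym/cross|exact: h3].
Qed.

End Flat.

(** * From the abstract atlas back to the original transition maps *)

Section Bridge.
Variables (K : numClosedFieldType) (H : holoCalc K) (N : nat) (S : ksrs H N).
Local Notation L := (grass K N.+1).
Local Notation sh := (sh H).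
Local Notation SD := (SD H).
Local Notation pull := (pull H).
Local Notation dom := (@kdom K H N S).
Local Notation A := (ksatl S).
Local Notation sdom c := (cd_dom (kdata c)).
Local Notation sbd c := (cd_bd (kdata c)).

Lemma ctr_pull c c' i x (F : K -> L) : dom i x -> sdom c x -> sdom c' x ->
  tpull (A := A) c c' F (sbd c x) = pull (ctr c c' i).1 (ctr c c' i).2 F (sbd c x) /\
  SD (aT (s := A) c c') (sbd c x) = SD (ctr c c' i).2 (sbd c x).
Proof.
move=> hi h h'; have [e1 e2] := ctransE hi h h'; split.
  by rewrite /tpull /SconfMaps.pull [aZ _ _ _]e1 [aT _ _ _]e2.
by apply: near_SD; apply: filterS (ctrans_near hi h h') => q [].
Qed.

Definition ksec (n : int) (W : set (kX S)) (phi : kS S -> K -> L) : Prop :=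
  (forall c x, W x -> sdom c x -> sh (phi c) (sbd c x)) /\
  (forall c c' i x, W x -> sdom c x -> sdom c' x -> dom i x ->
     phi c (sbd c x) = pull (ctr c c' i).1 (ctr c c' i).2 (phi c') (sbd c x)
        * SD (ctr c c' i).2 (sbd c x) ^ (- n)).

Lemma ksecE n W phi : ksec n W phi <-> gsec (A := A) n W phi.
Proof.
split=> -[h1 h2]; (split; first exact: h1).
- move=> c c' x Wx cx c'x; have [i hi] := k_cover x.
  have [e1 e2] := ctr_pull (phi c') hi cx c'x.
  by apply: (etrans (h2 c c' i x Wx cx c'x hi)); rewrite [tpull _ _ _ _]e1 [SD (aT _ _) _]e2.
- move=> c c' i x Wx cx c'x hi.
  have [e1 e2] := ctr_pull (phi c') hi cx c'x.
  by apply: (etrans (h2 c c' x Wx cx c'x)); rewrite [tpull _ _ _ _]e1 [SD (aT _ _) _]e2.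
Qed.

Definition klden (c d : grass K N) : K -> L := fun p => thlift c * p%:A + thlift d.
Definition ksplZ (a b c d gam del : grass K N) : K -> L := fun p =>
  (thlift a * p%:A + thlift b) / klden c d p
  + ggen K ord0 * ((thlift gam * p%:A + thlift del) / klden c d p ^+ 2).
Definition ksplT (c d gam del : grass K N) : K -> L := fun p =>
  (thlift gam * p%:A + thlift del) / klden c d p
  + ggen K ord0 * ((1 + thlift (2^-1 *: (del * gam))) / klden c d p).

Definition kspl (c c' : kS S) : Prop := forall x, sdom c x -> sdom c' x ->
  exists a b c0 d gam del : grass K N,
  [/\ [/\ geven a, geven b, geven c0 & geven d], godd gam /\ godd del, a * d - b * c0 = 1 &
    \forall y \near x, sdom c y -> sdom c' y ->
      klden c0 d (sbd c y) \is a GRing.unit /\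
      forall i, dom i y -> meqv (sbd c y) (ctr c c' i) (ksplZ a b c0 d gam del, ksplT c0 d gam del)].

Lemma ksplTE c d gam del p : ksplT c d gam del p = splT (thlift c) (thlift d) (thlift gam) (thlift del) p.
Proof. by rewrite /ksplT thliftZ thliftM. Qed.

(** Both directions use the characterization of SPL_2 by D^3 u = 0. It yields parameters free of
    theta in the larger algebra, which come from the base by [thlift_surj]. *)
Lemma ksplE c c' : kspl c c' <-> srel (A := A) c c'.
Proof.
split=> h x cx c'x.
  have [a [b [c0 [d [gam [del [[ae be ce de] [go dlo] D n]]]]]]] := h x cx c'x.
  have nT : \forall q \near sbd c x, lin (thlift c0) (thlift d) q \is a GRing.unit /\
      aT (s := A) c c' q = splT (thlift c0) (thlift d) (thlift gam) (thlift del) q.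
    have n' : \forall y \near x, sdom c' y /\ (sdom c y -> sdom c' y ->
        klden c0 d (sbd c y) \is a GRing.unit /\
        forall i, dom i y -> meqv (sbd c y) (ctr c c' i) (ksplZ a b c0 d gam del, ksplT c0 d gam del)).
      apply: filterI => //; apply: open_nbhs_nbhs; split => //; exact: co_open (k_ok c').
    apply: (@near_pts' _ _ _ A c x _ _ cx n') => y [c'y hy] cy.
    have [u1 u2] := hy cy c'y; split; first exact: u1.
    have [i yi] := k_cover y; have [_ e] := u2 i yi; have [_ e'] := ctransE yi cy c'y.
    by apply: (etrans e'); apply: (etrans e); exact: ksplTE.
  have sg := @a_sc _ _ _ A c c' x cx c'x.
  apply: (@spl_D3u K H N _ (thlift c0) (thlift d) (thlift gam) (thlift del)).
  - by split; apply/thlift_hom.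
  - by split; exact: thlift_free.
  - by have [] := near_at nT.
  - exact: (sc_shT sg).
  - by apply: filterS nT => q [].
have sg := @a_sc _ _ _ A c c' x cx c'x.
have [a [b [c0 [d [gam [del [[[ae be ce de] [go dlo]] [[af bf cf df] [gf dlf]] D n]]]]]]] := D3u_spl sg (h x cx c'x).
have [a1 aE] := thlift_surj af; have [b1 bE] := thlift_surj bf; have [c1 cE] := thlift_surj cf.
have [d1 dE] := thlift_surj df; have [g1 gE] := thlift_surj gf; have [dl1 dlE] := thlift_surj dlf.
subst a b c0 d gam del.
exists a1, b1, c1, d1, g1, dl1; split.
- by split; apply/thlift_hom.
- by split; apply/thlift_hom.
- apply: thlift_inj; rewrite thlift1 -D thliftD thliftM -!thliftM; congr (_ + _).
  by rewrite -scaleN1r thliftZ scaleN1r.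
have n' := @near_X _ _ _ A c x _ cx n.
apply: filterS n' => y [u1 u2 u3] cy c'y; split; first exact: u1.
move=> i yi; have [e1 e2] := ctransE yi cy c'y; split.
  by apply: (etrans (esym e1)); exact: u2.
by apply: (etrans (esym e2)); apply: (etrans u3); apply/esym/ksplTE.
Qed.

End Bridge.

Import complex.

(** * Specialization to complex superfunctions *)

Section Calculus.
Variable R : realType.
Local Notation C := (Cx R).

(** Unlike [der] it is not locked: the abstract derivations and pullbacks then unfold to those of
    the statement. *)
Definition cxder (f : C -> C) : C -> C := derive1 (f : C -> C^o).
Lemma cxderE f : cxder f = der f. Proof. exact: esym (derE f). Qed.

Lemma cx_hder (f : C -> C) p : holo_at f p -> holo_at (cxder f) p.
Proof. by rewrite cxderE; exact: holo_der. Qed.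
Lemma cx_near (f g : C -> C) p : (\forall q \near p, f q = g q) -> cxder f p = cxder g p.
Proof. by rewrite !cxderE; exact: near_der. Qed.
Lemma cx_derD (f g : C -> C) p : holo_at f p -> holo_at g p ->
  cxder (fun q => f q + g q) p = cxder f p + cxder g p.
Proof. by rewrite !cxderE; exact: derD. Qed.
Lemma cx_derM (f g : C -> C) p : holo_at f p -> holo_at g p ->
  cxder (fun q => f q * g q) p = cxder f p * g p + f p * cxder g p.
Proof. by rewrite !cxderE; exact: derM. Qed.
Lemma cx_cst (k p : C) : cxder (fun=> k) p = 0.
Proof. by rewrite cxderE; exact: der_cst. Qed.
Lemma cx_id (p : C) : cxder (fun q => q) p = 1.
Proof. by rewrite cxderE; exact: der_id. Qed.
Lemma cx_comp (f g : C -> C) p : holo_at g p -> holo_at f (g p) ->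
  cxder (f \o g) p = cxder f (g p) * cxder g p.
Proof. by rewrite !cxderE; exact: der_comp. Qed.
Lemma cx_const (f : C -> C) p : holo_at f p -> (\forall q \near p, cxder f q = 0) ->
  \forall q \near p, f q = f p.
Proof. by rewrite cxderE; exact: holo_const. Qed.
Lemma cx_primitive (f : C -> C) p : holo_at f p ->
  exists F, holo_at F p /\ \forall q \near p, cxder F q = f q.
Proof. by move=> /holo_primitive[F [h e]]; exists F; rewrite cxderE. Qed.
Lemma cx_inverse (f : C -> C) p : holo_at f p -> cxder f p != 0 ->
  exists g, [/\ holo_at g (f p), g (f p) = p, \forall q \near p, g (f q) = q &
    \forall w \near f p, f (g w) = w].
Proof. by rewrite cxderE; exact: holo_inverse. Qed.
Lemma cx_ode (I : finType) (A : I -> I -> C -> C) (y0 : I -> C) p :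
  (forall i j, holo_at (A i j) p) ->
  exists y : I -> C -> C, [/\ forall i, holo_at (y i) p, forall i, y i p = y0 i &
    \forall q \near p, forall i, cxder (y i) q = \sum_j A i j q * y j q].
Proof.
move=> hA; have [y [h1 h2 h3]] := linear_ode y0 hA; exists y; split => //.
by apply: filterS h3 => q h i; rewrite cxderE.
Qed.

Definition cxCalc : holoCalc C := @HoloCalc C (@holo_at R) cxder (@holo_ext R) (@holo_cst R) (@holo_id R)
  (@holoD R) (@holoM R) (@holoV R) (@holo_comp R) (@holo_near R) (@holo_cts R) cx_hder cx_near
  cx_derD cx_derM cx_cst cx_id cx_comp cx_const cx_primitive (@holo_factor R) cx_inverse cx_ode.

End Calculus.

(** If the body of d b / dtheta vanished, the square of the field would have zero body, hence be
    proportional to the field with factor 0. *)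
Lemma nonint_body (K : numClosedFieldType) (H : holoCalc K) (N : nat) (a b : K -> grass K N.+1) p :
  geven (a p) -> godd (b p) -> gbody (a p) != 0 ->
  ~ (exists c : K, gbody (vf H p (a p) (b p) a) = c * gbody (a p) /\
                   gbody (vf H p (a p) (b p) b) = c * gbody (b p)) ->
  gbody (thp1 (b p)) != 0.
Proof.
move=> ae bo a0 n; apply/eqP => b1; apply: n; exists 0; rewrite !mul0r.
rewrite /vf !gbodyD !gbodyM (gbody_odd bo) b1 !mul0r !addr0 mulr0; split => //.
by rewrite (gbody_odd (thp1_hom ae)) mulr0.
Qed.

Section Instance.
Variables (R : realType) (N : nat) (Sg : srs R N).
Local Notation C := (Cx R).
Local Notation H := (cxCalc R).
Local Notation L := (gL R N).
Local Notation X := (sc_space Sg).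
Local Notation idx := (sc_idx Sg).

Definition kmap_of (T : smap R N) : kmap C N := (smz T, smth T).
Definition vf_of (E : svf R N) : kmap C N := (vfth E, vfz E).

Definition sg_tr (i j : idx) := kmap_of (sc_tr i j).
Definition sg_gen (i : idx) := vf_of (srs_gen i).
Definition sg_data (c : schart Sg) : chart_data C N X idx :=
  @ChartData C N X idx (ch_dom c) (ch_bd c) (fun i => kmap_of (ch_to c i)) (fun i => kmap_of (ch_from c i)).

Lemma smap_ok_msm (U : set X) (f : X -> C) (T : smap R N) x : smap_ok (f @` U) T -> U x ->
  msm H (kmap_of T) (f x).
Proof.
move=> [h1 [h2 h3]] Ux; have Vx : (f @` U) (f x) by exists x.
by split; [move=> B; exact: h1|move=> B; exact: h2|have [] := h3 _ Vx|have [] := h3 _ Vx].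
Qed.

Lemma msm_smap_ok (U : set X) (f : X -> C) (T : smap R N) : (forall x, U x -> msm H (kmap_of T) (f x)) ->
  smap_ok (f @` U) T.
Proof.
move=> h; split; last split.
- by move=> _ B [x Ux <-]; have [s _ _ _] := h x Ux; exact: s.
- by move=> _ B [x Ux <-]; have [_ s _ _] := h x Ux; exact: s.
- by move=> _ [x Ux <-]; have [_ _ s1 s2] := h x Ux.
Qed.

Lemma same_line_carries (U : set X) (f : X -> C) (T : smap R N) (E E' : svf R N) :
  vf_same_line (f @` U) T E E' ->
  exists h, forall x, U x -> carries H (vf_of E) (kmap_of T) h (vf_of E') (f x).
Proof.
move=> [h [[h1 h2] h3]]; exists h => x Ux; have Vx : (f @` U) (f x) by exists x.
have [a b] := h2 _ Vx.
by split; [move=> B; exact: h1|exact: a|exact: b|exact: h3].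
Qed.

Lemma carries_same_line (U : set X) (f : X -> C) (T : smap R N) (E E' : svf R N) h :
  (forall x, U x -> carries H (vf_of E) (kmap_of T) h (vf_of E') (f x)) ->
  vf_same_line (f @` U) T E E'.
Proof.
move=> c; exists h; split.
  split; first by move=> _ B [x Ux <-]; have [s _ _ _] := c x Ux; exact: s.
  by move=> _ [x Ux <-]; have [_ s1 s2 _] := c x Ux.
by move=> _ [x Ux <-]; have [_ _ _ s] := c x Ux.
Qed.

Lemma sg_gen1 i x : sc_dom i x -> gbody ((sg_gen i).1 (sc_crd i x)) != 0.
Proof.
move=> ix; have [_ [_ h]] := srs_gen_odd i.
have [ae bo] := h _ (ex_intro2 _ _ x ix erefl).
case: (srs_gen_nonzero ix) => // b0; exfalso; move: b0; by rewrite (gbody_odd bo) eqxx.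
Qed.

Lemma sg_gen2 i x : sc_dom i x -> gbody (thp1 ((sg_gen i).2 (sc_crd i x))) != 0.
Proof.
move=> ix; have [_ [_ h]] := srs_gen_odd i.
have Vx : (sc_crd i @` sc_dom (s := Sg) i) (sc_crd i x) by exists x.
have [ae bo] := h _ Vx.
have [co inj ct im] := sc_homeo (s := Sg) i.
have Vo : open (sc_crd i @` sc_dom (s := Sg) i) by exact: im.
(* Non-integrability is used for the generator itself, that is, for its multiple by 1. *)
have sE : vfscale (fun=> 1) (srs_gen i) = srs_gen i.
  rewrite /vfscale; case: (srs_gen i) => a b /=; congr SVF; apply/funext => p; exact: mul1r.
apply: (nonint_body (H := H) ae bo (sg_gen1 ix)).
have := @srs_nonint R N Sg i _ (fun=> 1) Vo (@subset_refl _ _); rewrite sE => ni.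
apply: (ni _ _ _ _ Vx).
- by move=> p B _; exact: holo_cst.
- by move=> p _; exact: geven1.
- by move=> _ [y iy <-]; exact: srs_gen_nonzero.
Qed.

Lemma sg_ok (c : schart Sg) : chart_ok H (sc_dom (s := Sg)) (sc_crd (s := Sg)) sg_tr sg_gen (sg_data c).
Proof.
split.
- exact: (ch_homeo c).
- by move=> i x ix cx; exact: (smap_ok_msm (ch_to_ok c i) (conj ix cx)).
- by move=> i x ix cx; exact: (smap_ok_msm (ch_from_ok c i) (conj ix cx)).
- by move=> i x ix cx; exact: (ch_to_body ix cx).
- by move=> i x ix cx; exact: (ch_from_body ix cx).
- by move=> i j x ix jx cx; exact: (ch_to_glue ix jx cx).
- by move=> i x ix cx; exact: (ch_toK ix cx).
- by move=> i x ix cx; exact: (ch_fromK ix cx).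
- move=> i; have [h hc] := same_line_carries (ch_superconformal c i); exists h => x ix cx.
  exact: (hc x (conj ix cx)).
Qed.

Definition smap_of (m : kmap C N) : smap R N := SMap m.1 m.2.

Lemma sg_mk (d : chart_data C N X idx) :
  chart_ok H (sc_dom (s := Sg)) (sc_crd (s := Sg)) sg_tr sg_gen d -> exists c, sg_data c = d.
Proof.
case: d => D bd to from [h1 h2 h3 h4 h5 h6 h7 h8 h9].
have kk (m : kmap C N) : kmap_of (smap_of m) = m by case: m.
have p2 i : smap_ok (sc_crd i @` (sc_dom (s := Sg) i `&` D)) (smap_of (to i)).
  by apply: msm_smap_ok => x [ix cx]; rewrite kk; exact: h2.
have p3 i : smap_ok (bd @` (sc_dom (s := Sg) i `&` D)) (smap_of (from i)).
  by apply: msm_smap_ok => x [ix cx]; rewrite kk; exact: h3.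
have p9 i : vf_same_line (sc_crd i @` (sc_dom (s := Sg) i `&` D)) (smap_of (to i)) (srs_gen i) (Defs.vfD R N).
  have [h hc] := h9 i; apply: (@carries_same_line _ _ _ _ _ h) => x [ix cx]; rewrite kk; exact: hc.
exists (@SChart R N Sg D bd (fun i => smap_of (to i)) (fun i => smap_of (from i)) h1 p2 p3 h4 h5 h6 h7 h8 p9).
rewrite /sg_data /=; congr ChartData; apply/funext => i; exact: kk.
Qed.

Lemma sg_gen_ok i x : sc_dom i x ->
  [/\ sh H (sg_gen i).1 (sc_crd i x), sh H (sg_gen i).2 (sc_crd i x),
      geven ((sg_gen i).1 (sc_crd i x)) & godd ((sg_gen i).2 (sc_crd i x))].
Proof.
move=> ix; have [h1 [h2 h]] := srs_gen_odd i.
have Vx : (sc_crd i @` sc_dom (s := Sg) i) (sc_crd i x) by exists x.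
by have [ae bo] := h _ Vx; split => // B; [exact: h1|exact: h2].
Qed.

Lemma sg_glue i j : exists h, forall x, sc_dom i x -> sc_dom j x ->
  carries H (sg_gen i) (sg_tr i j) h (sg_gen j) (sc_crd i x).
Proof.
have [h hc] := same_line_carries (srs_gen_glue i j); exists h => x ix jx; exact: (hc x (conj ix jx)).
Qed.

Definition sg_ksrs : ksrs H N := @KSrs C H N X idx (sc_dom (s := Sg)) (sc_crd (s := Sg)) sg_tr sg_gen
  (@sc_cover R N Sg) (@sc_homeo R N Sg) (fun i j x ix jx => smap_ok_msm (sc_tr_ok i j) (conj ix jx))
  (@sc_tr_body R N Sg) (@sc_tr_id R N Sg) (@sc_tr_comp R N Sg) sg_gen_ok sg_gen1 sg_gen2 sg_glue
  (schart Sg) sg_data sg_ok sg_mk.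

Definition sgA : satl H N := ksatl sg_ksrs.

Lemma Dsection_gsec n (W : set X) (phi : sfield Sg) : Dsection n W phi <-> gsec (A := sgA) n W phi.
Proof.
apply: iff_trans (ksecE (S := sg_ksrs) n W phi); split=> -[h1 h2]; split.
- by move=> c x Wx cx B; apply: h1; exists x.
- exact: h2.
- by move=> c _ B [x [Wx cx] <-]; exact: h1.
- exact: h2.
Qed.

Lemma spl_srel (c c' : schart Sg) : spl_related c c' <-> srel (A := sgA) c c'.
Proof.
apply: iff_trans (ksplE (S := sg_ksrs) c c'); split=> h x cx cx'.
  have [[a b c0 d gam del e o D] n] := h x cx cx'.
  by exists a, b, c0, d, gam, del; split => //; exact: n.
have [a [b [c0 [d [gam [del [e o D n]]]]]]] := h x cx cx'.
by exists (Spl e o D); exact: n.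
Qed.

End Instance.

(** * The bijections *)

Section Classes.

(** The map on classes goes through chosen representatives, and equal images as predicates are
    related by reflexivity. So reflecting the relation suffices for injectivity. *)
Lemma classes_inj (T T' : Type) (r : T -> T -> Prop) (r' : T' -> T' -> Prop) (f : T -> T') :
  (forall t, r' t t) -> (forall t t', r t t' -> r t = r t') ->
  (forall t t', r' (f t) (f t') -> r t t') ->
  exists F : classes r -> classes r', injective F.
Proof.
move=> refl req refle; pose rep (P : classes r) : T := projT1 (cid (proj2_sig P)).
have repE P : sval P = r (rep P) by exact: projT2 (cid (proj2_sig P)).
pose F P : classes r' := exist _ (r' (f (rep P))) (ex_intro _ (f (rep P)) erefl).
exists F => P Q e.
have e1 : r' (f (rep P)) = r' (f (rep Q)) by exact: (congr1 (fun u => sval u) e).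
have e2 : r' (f (rep P)) (f (rep Q)) by rewrite e1.
have e3 : sval P = sval Q by rewrite !repE; exact: (req _ _ (refle _ _ e2)).
clear e e1 e2; case: P Q e3 => [P p] [Q q] /= e3; subst Q; congr exist; exact: Prop_irrelevance.
Qed.

(** The points whose backward chain under [f] and [g] starts at a point outside the image of [g]. *)
Inductive orbit_class (T U : Type) (f : T -> U) (g : U -> T) : T -> Prop :=
| orbit_base a : (forall b, g b <> a) -> orbit_class f g a
| orbit_step a : orbit_class f g a -> orbit_class f g (g (f a)).

(** The bijection is [f] on these orbits and the inverse of [g] elsewhere. *)
Lemma cantor_bernstein (T U : Type) (f : T -> U) (g : U -> T) : injective f -> injective g ->
  exists F : T -> U, bijective F.
Proof.
move=> fI gI; pose orb := orbit_class f g.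
have pre a : ~ orb a -> exists b, g b = a.
  move=> na; apply: contrapT => n; apply: na; apply: orbit_base => b e; apply: n; by exists b.
pose F a := if pselect (orb a) is right n then projT1 (cid (pre a n)) else f a.
have F1 a : orb a -> F a = f a by rewrite /F; case: pselect.
have F2 a : ~ orb a -> g (F a) = a.
  by rewrite /F; case: pselect => // n _; exact: projT2 (cid (pre a n)).
have FI : injective F.
  move=> a b e; case: (pselect (orb a)) => oa; case: (pselect (orb b)) => ob.
  - by apply: fI; rewrite -(F1 a oa) -(F1 b ob).
  - exfalso; apply: (ob); rewrite -(F2 b ob) -e (F1 a oa); exact: orbit_step.
  - exfalso; apply: (oa); rewrite -(F2 a oa) e (F1 b ob); exact: orbit_step.
  - by rewrite -(F2 a oa) -(F2 b ob) e.
have FS u : exists a, F a = u.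
  case: (pselect (orb (g u))) => o; last by exists (g u); apply: gI; exact: F2.
  have [a oa e] : exists2 a, orb a & g u = g (f a).
    move: o; move E : (g u) => v o; case: o E => [a n e|a oa e]; last by exists a.
    by case: (n u).
  by exists a; rewrite (F1 a oa); exact: (esym (gI _ _ e)).
pose G u := projT1 (cid (FS u)); have GK u : F (G u) = u by exact: projT2 (cid (FS u)).
by exists F; exists G => [a|u]; [apply: FI; exact: GK|exact: GK].
Qed.

End Classes.

Lemma gsec_ext (K : numClosedFieldType) (H : holoCalc K) (N : nat) (A : satl H N) (n : int)
  (W : set (aX A)) (phi psi : aC A -> K -> grass K N.+1) : open W -> gsec n W phi ->
  (forall c x, W x -> adom c x -> sh H (psi c) (abd c x)) ->
  (forall c x, W x -> adom c x -> phi c (abd c x) = psi c (abd c x)) -> gsec n W psi.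
Proof.
move=> Wo [_ s] h e; split => // c c' x Wx cx c'x.
have e' : \forall w \near gbody (aZ c c' (abd c x)), phi c' w = psi c' w.
  by rewrite (a_body cx c'x); apply: (near_pts Wo Wx c'x) => y Wy cy; exact: e.
rewrite -(e c x Wx cx) (s c c' x Wx cx c'x) /tpull.
by rewrite (near_at (pull_ext (a_sc cx c'x) e')).
Qed.

(** For connections and for superopers equivalence amounts to equality of potentials on charts,
    which gives the properties of an equivalence relation at once. *)
Lemma rel_of_invariant (T I X V : Type) (r : T -> T -> Prop) (om : T -> I -> X -> V)
  (D : I -> X -> Prop) :
  (forall t t', r t t' <-> forall i x, D i x -> om t i x = om t' i x) ->
  (forall t, r t t) /\ (forall t t', r t t' -> r t = r t').
Proof.
move=> h; split=> [t|t t' /h e]; first exact/h.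
apply/funext => u; apply/propext; split=> /h k; apply/h => i x ix.
  by rewrite -(k i x ix) (e i x ix).
by rewrite (e i x ix); exact: k.
Qed.

Section Equivalence.
Variables (R : realType) (N : nat) (Sg : srs R N).
Local Notation C := (Cx R).
Local Notation H := (cxCalc R).
Local Notation L := (gL R N).
Local Notation A := (sgA Sg).
Local Notation X := (sc_space Sg).
Local Notation chart := (schart Sg).

Lemma mDsectionE n (W : set X) (M : mfield Sg) : mDsection n W M <-> gmsec (A := A) n W M.
Proof.
by split=> h i j; [exact: (proj1 (Dsection_gsec _ _ _) (h i j))|exact: (proj2 (Dsection_gsec _ _ _) (h i j))].
Qed.

Lemma GfunE (W : set X) (g : mfield Sg) : Gfun W g <-> gGfun (A := A) W g.
Proof.
by split=> -[a b]; (split; last exact: b); [exact: (proj1 (mDsectionE _ _ _) a)|exact: (proj2 (mDsectionE _ _ _) a)].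
Qed.

Lemma BfunE (W : set X) (g : mfield Sg) : Bfun W g <-> gBfun (A := A) W g.
Proof.
by split=> -[a b]; (split; last exact: b); [exact: (proj1 (mDsectionE _ _ _) a)|exact: (proj2 (mDsectionE _ _ _) a)].
Qed.

Lemma exBfunE (W : set X) (Q : mfield Sg -> chart -> C -> Prop) :
  (exists2 b, Bfun W b & on_open W (Q b)) <-> (exists2 b, gBfun (A := A) W b & gon (A := A) W (Q b)).
Proof. by split=> -[b h k]; exists b => //; [exact: (proj1 (BfunE _ _) h)|exact: (proj2 (BfunE _ _) h)]. Qed.

Section ToGop.
Variable O : superoper Sg.
Local Notation od := (@op_dom R N Sg O).
Local Notation oh := (@op_h R N Sg O).
Local Notation og := (@op_g R N Sg O).

Lemma to_gG k l : gGfun (A := A) (od k `&` od l) (og k l).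
Proof. exact: (proj1 (GfunE _ _) (@op_gG R N Sg O k l)). Qed.
Lemma to_hG k : gGfun (A := A) (od k) (oh k).
Proof. exact: (proj1 (GfunE _ _) (@op_hG R N Sg O k)). Qed.
Lemma to_red k l : exists2 b : mfield Sg, gBfun (A := A) (od k `&` od l) b
  & gon (A := A) (od k `&` od l) (fun c p => oh k c p *m og k l c p = b c p *m oh l c p).
Proof. exact: (proj1 (exBfunE _ (fun b c p => oh k c p *m og k l c p = b c p *m oh l c p)) (@op_reduction R N Sg O k l)). Qed.
Lemma to_A k : gmsec (A := A) (- 1) (od k) (@op_A R N Sg O k).
Proof. exact: (proj1 (mDsectionE _ _ _) (@op_Asection R N Sg O k)). Qed.
Lemma to_oper k (W : set X) (b : mfield Sg) : open W -> W `<=` od k -> gBfun (A := A) W b ->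
  exists a0 : mfield Sg,
      ggauge (A := A) W (fun c p => b c p *m oh k c p) a0 (@op_A R N Sg O k) /\
      gon (A := A) W (fun c p => exists (a : L) (mu : 'M[L]_3),
        [/\ geven a, a \is a GRing.unit, kin_b_odd mu
          & a0 c p = a *: kf_mx C N.+1 + mu]).
Proof. by move=> Wo Wk h; exact: (@op_oper R N Sg O k W b Wo Wk (proj2 (BfunE _ _) h)). Qed.

Definition to_gop : gop A := @Gop C H N A (op_idx O) od og oh (@op_A R N Sg O) (@op_open R N Sg O)
  (@op_cover R N Sg O) to_gG (@op_cocycle R N Sg O) to_hG to_red to_A (@op_conn R N Sg O) to_oper.
End ToGop.

Section OfGop.
Variable G : gop A.
Local Notation od := (@g_dom C H N A G).
Local Notation oh := (@g_h C H N A G).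
Local Notation og := (@g_g C H N A G).

Lemma of_gG k l : Gfun (Sg := Sg) (od k `&` od l) (og k l).
Proof. exact: (proj2 (GfunE _ _) (@g_gG C H N A G k l)). Qed.
Lemma of_hG k : Gfun (Sg := Sg) (od k) (oh k).
Proof. exact: (proj2 (GfunE _ _) (@g_hG C H N A G k)). Qed.
Lemma of_red k l : exists2 b : mfield Sg, Bfun (od k `&` od l) b
  & on_open (Sg := Sg) (od k `&` od l) (fun c p => oh k c p *m og k l c p = b c p *m oh l c p).
Proof. exact: (proj2 (exBfunE _ (fun b c p => oh k c p *m og k l c p = b c p *m oh l c p)) (@g_reduction C H N A G k l)). Qed.
Lemma of_A k : mDsection (Sg := Sg) (- 1) (od k) (@g_A C H N A G k).
Proof. exact: (proj2 (mDsectionE _ _ _) (@g_Asection C H N A G k)). Qed.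
Lemma of_oper k (W : set X) (b : mfield Sg) : open W -> W `<=` od k -> Bfun W b ->
    exists a0 : mfield Sg,
      gauge W (fun c p => b c p *m oh k c p) a0 (@g_A C H N A G k) /\
      on_open W (fun c p => exists (a : L) (mu : 'M[L]_3),
        [/\ geven a, a \is a GRing.unit, in_b_odd mu
          & a0 c p = a *: f_mx R N + mu]).
Proof. by move=> Wo Wk h; exact: (@g_oper C H N A G k W b Wo Wk (proj1 (BfunE _ _) h)). Qed.

Definition of_gop : superoper Sg := @Superoper R N Sg (g_idx G) od og oh (@g_A C H N A G)
  (@g_open C H N A G) (@g_cover C H N A G) of_gG (@g_cocycle C H N A G) of_hG of_red of_A
  (@g_conn C H N A G) of_oper.
End OfGop.

Lemma to_gop_iso (O O' : superoper Sg) : oper_iso O O' <-> giso (to_gop O) (to_gop O').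
Proof.
split=> -[phi [a b c d]]; exists phi; split; try exact: b; try exact: d.
- by move=> k k'; exact: (proj1 (GfunE _ _) (a k k')).
- by move=> k k'; exact: (proj1 (exBfunE _ (fun b c p => op_h k c p *m phi k k' c p = b c p *m op_h k' c p)) (c k k')).
- by move=> k k'; exact: (proj2 (GfunE _ _) (a k k')).
- by move=> k k'; exact: (proj2 (exBfunE _ (fun b c p => op_h k c p *m phi k k' c p = b c p *m op_h k' c p)) (c k k')).
Qed.

Lemma of_gop_iso (G G' : gop A) : oper_iso (of_gop G) (of_gop G') -> giso G G'.
Proof.
move=> [phi [a b c d]]; exists phi; split; try exact: b; try exact: d.
- by move=> k k'; exact: (proj1 (GfunE _ _) (a k k')).
- by move=> k k'; exact: (proj1 (exBfunE _ (fun b c p => g_h k c p *m phi k k' c p = b c p *m g_h k' c p)) (c k k')).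
Qed.

Definition oper_om (O : superoper Sg) : chart -> C -> L := gom (to_gop O).

Lemma oper_isoE (O O' : superoper Sg) : oper_iso O O' <->
  forall (c : chart) (x : X), ch_dom c x -> oper_om O c (ch_bd c x) = oper_om O' c (ch_bd c x).
Proof.
apply: (iff_trans (to_gop_iso O O')); split=> [h c x cx|h]; first exact: (giso_om h cx).
by apply: om_giso => c x cx; exact: h.
Qed.

Local Notation D3u := (@D3u C H N A).
Local Notation T := (@aT C H N A).
Definition test_field (k : chart) : sfield Sg := fun c => uinv H (T c k).

Lemma chart_open (c : chart) : open (ch_dom c). Proof. by have [] := ch_homeo c. Qed.

Lemma test_field_section k : Dsection 1 (ch_dom k) (test_field k).
Proof. exact: (proj2 (Dsection_gsec _ _ _) (gsec_test (A := A) k)). Qed.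

(** The section equal to 1 in the chart [c] recovers the potential from the value of the
    operator. *)
Lemma test_cancel (c : chart) (x : X) (a b : L) : ch_dom c x ->
  D3u c c (ch_bd c x) - a * uinv H (T c c) (ch_bd c x) =
  D3u c c (ch_bd c x) - b * uinv H (T c c) (ch_bd c x) -> a = b.
Proof.
move=> cx; have [_ u _ _] := near_at (tr_idJ (A := A) (c := c) cx).
by move=> /addrI/oppr_inj; rewrite u !mulr1.
Qed.

Definition conn_om (P : spconn Sg) : chart -> C -> L := fun c => projT1 (cid (@spc_form R N Sg P c)).

Lemma conn_omP (P : spconn Sg) c : [/\ sholo (ch_bd c @` ch_dom c) (conn_om P c),
  forall x, ch_dom c x -> godd (conn_om P c (ch_bd c x))
  & forall (W : set X) (phi : sfield Sg), open W -> Dsection 1 W phi ->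
    forall x, W x -> ch_dom c x -> spc_op P W phi c (ch_bd c x) =
      Dth (Dth (Dth (phi c))) (ch_bd c x) - conn_om P c (ch_bd c x) * phi c (ch_bd c x)].
Proof. exact: projT2 (cid (@spc_form R N Sg P c)). Qed.

Lemma conn_om_sh (P : spconn Sg) c x : ch_dom c x -> sh H (conn_om P c) (ch_bd c x).
Proof. by move=> cx B; have [s _ _] := conn_omP P c; apply: s; exists x. Qed.

Lemma conn_om_conn (P : spconn Sg) : gconn (A := A) (conn_om P).
Proof.
split.
- by move=> c x cx; exact: conn_om_sh.
- by move=> c x cx; have [_ o _] := conn_omP P c; exact: o.
- move=> c k x cx kx; apply: (test_law (A := A) (om := conn_om P)) => //.
    by move=> c0 y cy; exact: conn_om_sh.
  have s := @spc_section R N Sg P (ch_dom k) (test_field k) (chart_open k) (test_field_section k).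
  apply: (gsec_ext (A := A) (chart_open k) (proj1 (Dsection_gsec _ _ _) s)) => c0 y ky cy.
    apply: shB; first exact: (sh_D3u cy ky).
    by apply: shM; [exact: (conn_om_sh P cy)|exact: sc_u_sh (a_sc (s := A) cy ky)].
  by have [_ _ f] := conn_omP P c0; exact: (f _ _ (chart_open k) (test_field_section k) y ky cy).
Qed.

Section OfConn.
Variables (om : chart -> C -> L) (G : gconn (A := A) om).
Definition conn_op (W : set X) (phi : sfield Sg) : sfield Sg :=
  fun c q => Dth (Dth (Dth (phi c))) q - om c q * phi c q.

Lemma conn_op_section (W : set X) (phi : sfield Sg) : open W -> Dsection 1 W phi -> Dsection (- 2) W (conn_op W phi).
Proof.
move=> Wo s; apply: (proj2 (Dsection_gsec _ _ _)).
exact: (gconn_section G Wo erefl (proj1 (Dsection_gsec _ _ _) s)).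
Qed.

Lemma conn_op_form (c : chart) : exists om : C -> L,
    [/\ sholo (ch_bd c @` ch_dom c) om,
        forall x, ch_dom c x -> godd (om (ch_bd c x))
      & forall (W : set X) (phi : sfield Sg), open W -> Dsection 1 W phi ->
          forall x, W x -> ch_dom c x ->
          conn_op W phi c (ch_bd c x) =
            Dth (Dth (Dth (phi c))) (ch_bd c x) - om (ch_bd c x) * phi c (ch_bd c x)].
Proof.
exists (om c); split => //; first by move=> _ B [x cx <-]; exact: (gc_sh G (c := c) cx).
by move=> x cx; exact: (gc_odd G (c := c) cx).
Qed.

Definition of_conn : spconn Sg := SPConn conn_op_section conn_op_form.

Lemma of_conn_om (c : chart) (x : X) : ch_dom c x -> conn_om of_conn c (ch_bd c x) = om c (ch_bd c x).
Proof.
move=> cx; have [_ _ f] := conn_omP of_conn c; apply: (test_cancel cx).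
exact: (esym (f _ _ (chart_open c) (test_field_section c) x cx cx)).
Qed.
End OfConn.

Lemma spconn_equivE (P Q : spconn Sg) : spconn_equiv P Q <->
  forall (c : chart) (x : X), ch_dom c x -> conn_om P c (ch_bd c x) = conn_om Q c (ch_bd c x).
Proof.
split=> [h c x cx|h W phi Wo s c x Wx cx]; have [_ _ f] := conn_omP P c; have [_ _ f'] := conn_omP Q c.
  have s := test_field_section c; have o := chart_open c; apply: (test_cancel cx).
  exact: (etrans (esym (f _ _ o s x cx cx)) (etrans (h _ _ o s c x cx cx) (f' _ _ o s x cx cx))).
by rewrite (f W phi Wo s x Wx cx) (f' W phi Wo s x Wx cx) (h c x cx).
Qed.

Lemma spl_coverE (S : set chart) : spl_covering S <-> cover_ok (A := A) S.
Proof.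
by split=> -[h1 h2]; (split; first exact: h1) => c c' Sc Sc';
   [exact: (proj1 (spl_srel _ _) (h2 c c' Sc Sc'))|exact: (proj2 (spl_srel _ _) (h2 c c' Sc Sc'))].
Qed.

Definition atlas_ok (t : spatlas Sg) := proj1 (spl_coverE _) (spa_ok t).

Lemma spatlas_refl (t : spatlas Sg) : spatlas_equiv t t.
Proof. by rewrite /spatlas_equiv setUid; exact: spa_ok. Qed.

Lemma spatlas_trans (s t u : spatlas Sg) : spatlas_equiv s t -> spatlas_equiv t u -> spatlas_equiv s u.
Proof.
move=> st tu; apply: (proj2 (spl_coverE _)).
exact: (cover_trans (proj1 (spl_coverE _) st) (atlas_ok t) (proj1 (spl_coverE _) tu) (atlas_ok s) (atlas_ok u)).
Qed.

Lemma spatlas_class (s t : spatlas Sg) : spatlas_equiv s t -> spatlas_equiv s = spatlas_equiv t.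
Proof.
move=> st; have ts : spatlas_equiv t s by rewrite /spatlas_equiv setUC.
by apply/funext => u; apply/propext; split; exact: spatlas_trans.
Qed.

Definition oper_of_atlas (t : spatlas Sg) : superoper Sg := of_gop (gop_of (atlas_ok t)).

Lemma oper_of_atlas_reflect (t t' : spatlas Sg) :
  oper_iso (oper_of_atlas t) (oper_of_atlas t') -> spatlas_equiv t t'.
Proof.
move=> /of_gop_iso h; have x := gop_of_reflect h; have [c1 r1] := atlas_ok t; have [c2 r2] := atlas_ok t'.
apply: (proj2 (spl_coverE _)); split=> [y|c c' [a|a] [b|b]].
- by have [c Sc cy] := c1 y; exists c => //; left.
- exact: r1.
- exact: x.
- apply: srel_sym; exact: x.
- exact: r2.
Qed.

Definition conn_of_oper (O : superoper Sg) : spconn Sg := of_conn (gom_conn (to_gop O)).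

Lemma conn_of_oper_reflect (O O' : superoper Sg) :
  spconn_equiv (conn_of_oper O) (conn_of_oper O') -> oper_iso O O'.
Proof.
move=> /spconn_equivE h; apply/oper_isoE => c x cx.
exact: (etrans (esym (of_conn_om (gom_conn (to_gop O)) cx)) (etrans (h c x cx) (of_conn_om (gom_conn (to_gop O')) cx))).
Qed.

Definition atlas_of_conn (P : spconn Sg) : spatlas Sg :=
  SPAtlas (proj2 (spl_coverE _) (flat_cover (conn_om_conn P))).

Lemma atlas_of_conn_reflect (P Q : spconn Sg) :
  spatlas_equiv (atlas_of_conn P) (atlas_of_conn Q) -> spconn_equiv P Q.
Proof.
move=> /(proj1 (spl_coverE _)) [_ h]; apply/spconn_equivE => c x cx.
apply: (vanishing_inj (conn_om_conn P) (conn_om_conn Q) _ cx) => c1 c2 v1 v2.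
by apply: h; [left|right].
Qed.

End Equivalence.

Theorem theorem2p3 (R : realType) (N : nat) (Sg : srs R N) :
  (exists F : superprojective_structure Sg -> superprojective_connection Sg,
     bijective F) /\
  (exists F : superprojective_connection Sg -> superoper_class Sg,
     bijective F) /\
  (exists F : superprojective_structure Sg -> superoper_class Sg,
     bijective F).
Proof.
have [oR oC] := rel_of_invariant (om := fun O c x => oper_om O c (ch_bd c x)) (@oper_isoE R N Sg).
have [cR cC] := rel_of_invariant (om := fun P c x => conn_om P c (ch_bd c x)) (@spconn_equivE R N Sg).
have [f fI] := classes_inj oR (@spatlas_class R N Sg) (@oper_of_atlas_reflect R N Sg).
have [g gI] := classes_inj cR oC (@conn_of_oper_reflect R N Sg).
have [h hI] := classes_inj (@spatlas_refl R N Sg) cC (@atlas_of_conn_reflect R N Sg).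
split; last split.
- exact: (cantor_bernstein (inj_comp gI fI) hI).
- exact: (cantor_bernstein (inj_comp fI hI) gI).
- exact: (cantor_bernstein fI (inj_comp hI gI)).
Qed.
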